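(* Let $p\in(n,\infty)$, let $S\subset\mathbb{R}^n$ be closed, and let $\mu$ be a positive regular Borel measure on $\mathbb{R}^n$ with $\operatorname{supp}\mu=\partial S$ satisfying $\mu(Q(x,kr))\le C_\mu k^n\mu(Q(x,r))$ for all $x\in S$, $0<r\le1$, $1\le k\le1/r$, and $C'_\mu\le\mu(Q(x,1))\le C''_\mu$ for all $x\in S$, where $C_\mu,C'_\mu,C''_\mu>0$. Assume that $\operatorname{int}(S)=\emptyset$ and that $S$ satisfies the ball condition with constant $\beta_S$. Then, for every $f\in C(S)$, $$\|f\|_{W^1_p(\mathbb{R}^n)|_S}\sim\|f\|_{L_p(\mu)}+\left(\iint_{\|x-y\|<1}\frac{|f(x)-f(y)|^p}{\|x-y\|^{p-n}\mu(Q(x,\|x-y\|))^2}\,d\mu(x)\,d\mu(y)\right)^{1/p}$$ with constants of equivalence depending only on $n,p,C_\mu,C'_\mu,C''_\mu$ and $\beta_S$.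
   Context: Ball condition: a closed set $A$ satisfies the ball condition if there is a constant $\beta_A>0$ such that for each Euclidean ball $B$ of diameter at most $1$ whose center lies in $A$ there exists a ball $B'\subset B\setminus A$ with $\operatorname{diam}B\le\beta_A\operatorname{diam}B'$. Here $\|x\|=\max_i|x_i|$ and $Q(x,r)=\{y:\|y-x\|\le r\}$. $W^1_p(\mathbb{R}^n)$ is the Sobolev space with norm $\|F\|_{L_p}+\|\nabla F\|_{L_p}$; as $p>n$, its elements are identified with their continuous representatives. $W^1_p(\mathbb{R}^n)|_S$ consists of all $f:S\to\mathbb{R}$ with $f=F|_S$ for some continuous $F\in W^1_p(\mathbb{R}^n)$, and $\|f\|_{W^1_p(\mathbb{R}^n)|_S}$ is the infimum of $\|F\|_{W^1_p(\mathbb{R}^n)}$ over all such $F$ ($+\infty$ if there is none). $C(S)$ is the set of continuous functions on $S$. $A\sim B$ means $A/C\le B\le CA$ (in $[0,\infty]$) for a constant $C\ge1$. The integrand is understood to be $0$ on the diagonal $x=y$. *)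

(* Defs.v *)
From HB Require Import structures.
From mathcomp Require Import all_boot all_order all_algebra.
From mathcomp Require Import lra.
From mathcomp Require Import all_classical all_reals all_analysis.
From mathcomp Require Import measurable_realfun.

Set Implicit Arguments.
Unset Strict Implicit.
Unset Printing Implicit Defensive.

Import Order.TTheory GRing.Theory Num.Def Num.Theory.
Import numFieldNormedType.Exports.

Local Open Scope classical_set_scope.
Local Open Scope ring_scope.

Notation borel_rV R n := (g_sigma_algebraType (@open 'rV[R]_n)).

Section borel.
Context {R : realType}.

Lemma measurable_coord_rV n (j : 'I_n) :
  measurable_fun setT (fun x : borel_rV R n => x ord0 j : R).
Proof.
apply: (@measurability _ _ _ _ setT _ _ (RGenOpens.measurableE R)) => _ [_ [a [b ->]] <-].
rewrite setTI; apply: sub_sigma_algebra.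
by apply: open_comp; [move=> x _; exact: coord_continuous|exact: interval_open].
Qed.

Lemma measurable_fun_rV d (T : measurableType d) n (f : T -> borel_rV R n) :
  (forall j, measurable_fun setT (fun t => f t ord0 j : R)) ->
  measurable_fun setT f.
Proof.
move=> mf; apply: (@measurability _ _ _ _ setT f _ erefl) => _ [U oU <-].
rewrite setTI.
pose c (q : 'rV[rat]_n) : 'rV[R]_n := map_mx ratr q.
pose J := [set qk : 'rV[rat]_n * nat | ball (c qk.1) qk.2.+1%:R^-1 `<=` U].
have -> : f @^-1` U = \bigcup_(qk in J)
    f @^-1` ball (c qk.1) (qk.2.+1%:R^-1 : R).
  apply/seteqP; split=> [t Uft|t [qk Jqk] ft]; last exact: Jqk.
  have /nbhs_ballP[e /= e0 eU] : nbhs (f t : 'rV[R]_n) U.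
    by move: oU; rewrite openE; apply.
  have [k ke] : exists k : nat, k.+1%:R^-1 < e / 2 :> R.
    have e20 : 0 < e / 2 by rewrite divr_gt0.
    have [k _ /(_ k (leqnn k))] := near_infty_natSinv_lt (PosNum e20).
    by exists k.
  have /choice[q qf] : forall j : 'I_n, exists q : rat,
      `|(f t : 'rV[R]_n) ord0 j - ratr q| < k.+1%:R^-1.
    move=> j; set z := _ ord0 j.
    have k0 : 0 < k.+1%:R^-1 :> R by rewrite invr_gt0.
    move: (k.+1%:R^-1 : R) k0 => e' e'0.
    have /rat_in_itvoo[q] : z - e' < z + e' by lra.
    rewrite in_itv/= => /andP[? ?]; exists q.
    by rewrite ltr_distlC; apply/andP; split; lra.
  have ctk : ball (c (\row_j q j)) (k.+1%:R^-1 : R) (f t).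
    split; first by rewrite invr_gt0.
    by move=> i j; rewrite (ord1 i) /c !mxE /ball/= distrC; exact: qf.
  exists (\row_j q j, k) => //= y yb; apply: eU.
  rewrite (splitr e); apply: (@ball_triangle _ _ (c (\row_j q j))).
    by apply: ball_sym; apply: le_ball ctk; exact: ltW.
  by apply: le_ball yb; exact: ltW.
rewrite bigcup_mkcond; apply: countable_bigcupT_measurable => [|[q k]].
  exact: countableP.
case: ifPn => // _ /=.
have -> : f @^-1` ball (c q) (k.+1%:R^-1 : R) =
    \bigcap_(j in [set: 'I_n]) (setT `&` (fun t => f t ord0 j : R) @^-1`
      ball (c q ord0 j) (k.+1%:R^-1)).
  rewrite eqEsubset; split=> [t [_ h] j _|t h]; first by split; [|exact: h].
  split; first by rewrite invr_gt0.
  move=> i j; rewrite (ord1 i); exact: (h j I).2.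
apply: fin_bigcap_measurable => // j _; apply: mf => //.
exact: measurable_ball.
Qed.

Definition cons_rV n (z : borel_rV R n * measurableTypeR R) : borel_rV R n.+1 :=
  row_mx z.2%:M z.1.

Lemma measurable_cons_rV n : measurable_fun setT (@cons_rV n).
Proof.
apply: measurable_fun_rV => j.
case: (@split_ordP 1 n j) => i ->.
  apply: (eq_measurable_fun snd) => [z _|]; last exact: measurable_snd.
  by rewrite /cons_rV (row_mxEl _ _ ord0 i) (ord1 i) !mxE.
apply: (eq_measurable_fun (fun z : borel_rV R n * measurableTypeR R => (z.1 : 'rV_n) ord0 i)) => [z _|].
  exact/esym/(row_mxEr (z.2%:M : 'M[R]_1) z.1).
apply: (measurableT_comp (@measurable_coord_rV n i)); exact: measurable_fst.
Qed.

Section pushforward_cons.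
Context n (m : {measure set (borel_rV R n) -> \bar R}).
Local Open Scope ereal_scope.

Definition lebesgue_cons : set (borel_rV R n.+1) -> \bar R :=
  pushforward (m \x @lebesgue_measure R) (@cons_rV n).

Let lebesgue_cons0 : lebesgue_cons set0 = 0.
Proof. by rewrite /lebesgue_cons /pushforward preimage_set0 measure0. Qed.

Let lebesgue_cons_ge0 A : 0 <= lebesgue_cons A.
Proof. exact: (measure_ge0 (m \x lebesgue_measure)). Qed.

Let lebesgue_cons_sigma_additive : semi_sigma_additive lebesgue_cons.
Proof.
move=> F mF tF mUF; rewrite /lebesgue_cons /pushforward preimage_bigcup.
have mcF A : measurable A -> measurable (@cons_rV n @^-1` A).
  by move=> mA; rewrite -[X in measurable X]setTI; exact: measurable_cons_rV.
apply: measure_semi_sigma_additive.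
- by move=> k; exact: mcF.
- apply/trivIsetP => /= i j _ _ ij; rewrite -preimage_setI.
  by move/trivIsetP : tF => /(_ _ _ _ _ ij) ->//; rewrite preimage_set0.
- by rewrite -preimage_bigcup; exact: mcF.
Qed.

HB.instance Definition _ := isMeasure.Build _ _ _ lebesgue_cons
  lebesgue_cons0 lebesgue_cons_ge0 lebesgue_cons_sigma_additive.

End pushforward_cons.

Fixpoint lebesgue_rV n : {measure set (borel_rV R n) -> \bar R} :=
  if n is n'.+1 then lebesgue_cons (lebesgue_rV n') else \d_((0 : 'rV[R]_0) : borel_rV R 0).

Lemma lebesgue_rV_box n (a b : 'rV[R]_n) : (forall i, a ord0 i <= b ord0 i) ->
  lebesgue_rV n [set x : 'rV[R]_n | forall i, a ord0 i <= x ord0 i <= b ord0 i]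
  = (\prod_i (b ord0 i - a ord0 i))%:E.
Proof.
elim: n a b => [|n IH] a b ab.
  by rewrite big_ord0 /= diracE mem_set//= => -[].
rewrite /= /lebesgue_cons /pushforward.
pose t (v : 'rV[R]_n.+1) : 'rV[R]_n := \row_i v ord0 (lift ord0 i).
have consE0 z : @cons_rV n z ord0 ord0 = z.2.
  transitivity (row_mx (z.2%:M : 'M[R]_1) z.1 ord0 (lshift n (ord0 : 'I_1))).
    by congr (_ _ _); exact: val_inj.
  by rewrite row_mxEl mxE eqxx.
have consES z i : @cons_rV n z ord0 (lift ord0 i) = (z.1 : 'rV[R]_n) ord0 i.
  transitivity (row_mx (z.2%:M : 'M[R]_1) z.1 ord0 (rshift 1 i)).
    by congr (_ _ _); exact: val_inj.
  by rewrite row_mxEr.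
rewrite (_ : _ @^-1` _ = [set x : 'rV[R]_n | forall i,
    t a ord0 i <= x ord0 i <= t b ord0 i] `*` `[a ord0 ord0, b ord0 ord0]%classic).
  rewrite product_measure1E//; last first.
    rewrite (_ : mkset _ = \bigcap_(i in [set: 'I_n]) (setT `&`
        (fun x : borel_rV R n => x ord0 i) @^-1` `[t a ord0 i, t b ord0 i]%classic)).
      apply: fin_bigcap_measurable => // i _.
      by apply: measurable_coord_rV => //; exact: measurable_itv.
    rewrite eqEsubset; split=> [x h i _|x h i]; first by split; [|rewrite /= in_itv/=].
    by have [_] := h i Logic.I; rewrite /= in_itv.
  rewrite IH; last by move=> i; rewrite !mxE.
  rewrite [X in (_ * X)%E](lebesgue_measure_itv `[a ord0 ord0, b ord0 ord0]).
  rewrite /= lte_fin big_ord_recl.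
  under eq_bigr do rewrite !mxE.
  have := ab ord0; rewrite le_eqVlt => /predU1P[->|->].
    by rewrite ltxx subrr mule0 mul0r.
  by rewrite -EFinD -EFinM mulrC.
rewrite eqEsubset; split=> [z h|z [h1 h2] i].
  split; last by move: (h ord0); rewrite consE0 /= in_itv.
  by move=> i; move: (h (lift ord0 i)); rewrite consES !mxE.
case: (unliftP ord0 i) => [j|] ->; last by move: h2; rewrite consE0 /= in_itv.
by move: (h1 j); rewrite consES !mxE.
Qed.

End borel.

Section geometry.
Context {R : realType} (n : nat).
Implicit Types (x c : 'rV[R]_n) (r : R) (A : set 'rV[R]_n).

Definition enorm x : R := Num.sqrt (\sum_i x ord0 i ^+ 2).

Definition eball c r : set 'rV[R]_n := [set y | enorm (y - c) < r].

(* The library norm [`|_|] on ['rV[R]_n] is the maximum norm. *)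
Definition cube c r : set 'rV[R]_n := [set y | `|y - c| <= r].

Definition boundary A : set 'rV[R]_n := closure A `\` A°.

(* [2 * r] is the diameter of a ball of radius [r]. *)
Definition ball_condition (beta : R) A := 0 < beta /\
  forall c r, A c -> 0 < r -> 2 * r <= 1 ->
  exists c' r', [/\ 0 < r', eball c' r' `<=` eball c r `\` A &
                    2 * r <= beta * (2 * r')].

End geometry.

Section regular_measures.
Context {R : realType} (n : nat) (mu : {measure set (borel_rV R n) -> \bar R}).
Local Open Scope ereal_scope.

Definition outer_regular (A : set 'rV[R]_n) :=
  mu A = ereal_inf [set mu U | U in [set U : set 'rV[R]_n | open U /\ A `<=` U]].

Definition inner_regular (A : set 'rV[R]_n) :=
  mu A = ereal_sup [set mu K | K in [set K : set 'rV[R]_n | compact K /\ K `<=` A]].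

Definition regular_measure := forall A : set (borel_rV R n), measurable A ->
  outer_regular A /\ inner_regular A.

Definition msupport : set 'rV[R]_n :=
  [set x | forall U : set 'rV[R]_n, open U -> U x -> 0 < mu U].

End regular_measures.

Section sobolev.
Context {R : realType} (n : nat).
Implicit Types (f F phi : 'rV[R]_n -> R) (G : 'rV[R]_n -> 'rV[R]_n).

Definition partial (i : 'I_n) phi : 'rV[R]_n -> R := 'D_(delta_mx ord0 i) phi.

Definition smooth phi := forall s : seq 'I_n,
  continuous (foldr partial phi s) /\
  forall i x, derivable (foldr partial phi s) x (delta_mx ord0 i).

Definition test_function phi := smooth phi /\
  exists2 K : set 'rV[R]_n, compact K & forall x, ~ K x -> phi x = 0.

Local Notation leb := (lebesgue_rV n : {measure set (borel_rV R n) -> \bar R}).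

Definition weak_gradient F G := forall (i : 'I_n) phi, test_function phi ->
  (\int[leb]_x (F x * partial i phi x)%:E =
   - \int[leb]_x (G x ord0 i * phi x)%:E)%E.

Definition norm_Lp (p : R) f : \bar R := 'N[leb]_p%:E [EFin \o f].

(* [F] is the continuous representative of an element of W^1_p, and [G] is its
   weak gradient, which [F] determines almost everywhere. *)
Definition sobolev_W1 (p : R) F G :=
  [/\ continuous F, (norm_Lp p F < +oo)%E,
      forall i, measurable_fun [set: borel_rV R n] (fun x => G x ord0 i),
      weak_gradient F G & (norm_Lp p (@enorm R n \o G) < +oo)%E].

(* The value is +oo when no [F] extends [f], the infimum being over set0. *)
Definition trace_norm (p : R) (S : set 'rV[R]_n) f : \bar R :=
  ereal_inf [set N | exists F G, [/\ sobolev_W1 p F G,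
    forall x, S x -> F x = f x &
    N = (norm_Lp p F + norm_Lp p (@enorm R n \o G))%E]].

End sobolev.

Section besov.
Context {R : realType} (n : nat) (p : R).
Context (mu : {measure set (borel_rV R n) -> \bar R}).
Implicit Types (S : set 'rV[R]_n) (f : 'rV[R]_n -> R).
Local Open Scope ereal_scope.

Definition besov_kernel f (x y : 'rV[R]_n) : \bar R :=
  if (0 < `|x - y| < 1)%R then
    (`|f x - f y| `^ p / `|x - y| `^ (p - n%:R))%R%:E /
    mu (cube x `|x - y|%R) ^+ 2
  else 0.

(* Only the values of [f] on [S] are meaningful, so the integrals are over [S];
   they agree with the integrals over the whole space when [mu] is supported
   in [S]. *)
Definition besov_norm S f : \bar R :=
  'N[mu]_p%:E [EFin \o (f \_ S)] +
  (\int[mu]_(y in S) \int[mu]_(x in S) besov_kernel f x y) `^ p^-1.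

End besov.

(* Main.v *)
(** Restriction: the ball condition makes S porous, so dist(., S)^(-a) is
    integrable on cubes for a small a > 0, and Morrey's inequality holds with
    |grad F|^p weighted by dist(., S)^g for some 0 < g < p - n.  Multiplying by
    the measure kernel and integrating, the weight turns the sum over dyadic
    scales into a convergent geometric series at every point off S.

    Extension: F(x) = (int_S f w) / (1 + int_S w) off S and F = f on S, where
    w(x, y) = chi(|x - y|^2) / |x - y|^(2N) with N large.  The weight is so
    concentrated near the points of S closest to x that, by two applications
    of Jensen's inequality, |grad F(x)|^p is bounded by a double integral of
    |f(y) - f(z)|^p whose x-integral is the Besov kernel.  Smoothing w to
    chi(|x - y|^2) / (e + |x - y|^2)^N and letting e -> 0 gives the weak
    gradient across S, which is a null set.  As F vanishes in a hole of S close
    to every point of its support, Morrey's inequality bounds the L_p norm of F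
    by that of its gradient. *)
Require Import Defs.
From HB Require Import structures.
From mathcomp Require Import all_boot all_order all_algebra.
From mathcomp Require Import lra ring.
From mathcomp Require Import all_classical all_reals all_analysis.
From mathcomp Require Import measurable_realfun.

Set Implicit Arguments.
Unset Strict Implicit.
Unset Printing Implicit Defensive.

Import Order.TTheory GRing.Theory Num.Def Num.Theory.
Import numFieldNormedType.Exports.

Local Open Scope classical_set_scope.
Local Open Scope ring_scope.

(** Without the weight the restriction bound would lose a logarithm: Morrey's inequality is used at
    every dyadic radius r, so |grad F(z)|^p is counted once for each r above a multiple of dist(z,
    S), and the number of such radii is unbounded near S. A factor (dist(z, S) / r)^g makes the
    count finite. Morrey's inequality is proved straight from the weak gradient: the difference of
    two tensor-product mollifiers is a sum of partial derivatives of explicit test functions, so F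
    is never smoothed. The 1 in the denominator of the extension makes F die out where the weights
    do, without a partition of unity; its price is that f itself, and not only its differences,
    enters the gradient, hence the L_p(mu) term. N must be large enough for the decay t^(-2N) of the
    weight to absorb two measures of cubes, each growing like t^n, and a power t^p: this is
    [2 * n + P <= 2 * N], with P an integer above p. All constants are fixed before S, mu and f,
    which is why the main estimates carry explicit ones. *)

Section integral.
Local Open Scope ereal_scope.
Context d (T : measurableType d) (R : realType).
Variable mu : {measure set T -> \bar R}.

(** The integral of a nonnegative function is a supremum over the simple functions below it, so
    monotonicity holds without measurability. This shortens most comparisons below. *)
Lemma ge0_le_integral_nm (D : set T) (f g : T -> \bar R) :
  (forall x, D x -> 0 <= f x) -> (forall x, D x -> f x <= g x) ->
  \int[mu]_(x in D) f x <= \int[mu]_(x in D) g x.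
Proof.
move=> f0 fg.
have g0 x : D x -> 0 <= g x by move=> Dx; apply: le_trans (fg _ Dx); exact: f0.
rewrite !ge0_integralE//; apply: le_ereal_sup => _ [h hf <-]; exists h => // x.
apply: le_trans (hf x) _; apply: lee_restrict => //.
Qed.

(** Hölder's inequality for [g * k^(1/p)] and [k^(1/q)] with q conjugate to p; raising it to the
    power p leaves the mass of k to the power [p / q = p - 1]. A mass bound M instead of mass one
    lets it serve for kernels that are not normalised. *)
Lemma weighted_jensen (p : R) (M : R) (D : set T) (g k : T -> R) : (1 < p)%R ->
  measurable D -> measurable_fun D g -> measurable_fun D k ->
  (forall x, D x -> (0 <= g x)%R) -> (forall x, D x -> (0 <= k x)%R) ->
  (0 <= M)%R -> \int[mu]_(x in D) (k x)%:E <= M%:E ->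
  (\int[mu]_(x in D) (g x * k x)%:E) `^ p <=
  (M `^ (p - 1))%:E * \int[mu]_(x in D) (g x `^ p * k x)%:E.
Proof.
move=> p1 mD mg mk g0 k0 M0 kM.
have p0 : (0 < p)%R by lra.
pose q := (p / (p - 1))%R.
have q0 : (0 < q)%R by apply: divr_gt0; lra.
have pq : (p^-1 + q^-1 = 1)%R by rewrite /q invf_div; field; lra.
pose f1 := ((fun x => g x * k x `^ p^-1)%R \_ D).
pose f2 := ((fun x => k x `^ q^-1)%R \_ D).
have mf1 : measurable_fun setT f1.
  apply/(measurable_restrictT _ _).1 => //; apply: measurable_funM => //.
  by apply: (@measurableT_comp _ _ _ _ _ _ (fun y : R => powR y _)); [exact: measurable_powR|].
have mf2 : measurable_fun setT f2.
  apply/(measurable_restrictT _ _).1 => //.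
  by apply: (@measurableT_comp _ _ _ _ _ _ (fun y : R => powR y _)); [exact: measurable_powR|].
have f10 x : (0 <= f1 x)%R.
  rewrite /f1 patchE; case: ifPn => // /set_mem Dx.
  by rewrite mulr_ge0// ?g0// powR_ge0.
have f20 x : (0 <= f2 x)%R.
  by rewrite /f2 patchE; case: ifPn => // /set_mem Dx; rewrite powR_ge0.
have := hoelder mu mf1 mf2 p0 q0 pq.
rewrite Lnorm1 unlock.
have -> : \int[mu]_x `|(EFin \o (f1 \* f2)%R) x| = \int[mu]_(x in D) (g x * k x)%:E.
  rewrite [RHS]integral_mkcond; apply: eq_integral => x _ /=.
  rewrite ger0_norm ?mulr_ge0// /f1 /f2 !patchE; case: ifPn => [/set_mem Dx|_].
    rewrite -mulrA -powRD ?pq; last by rewrite oner_eq0.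
    by rewrite powRr1// k0.
  by rewrite mul0r.
have -> : \int[mu]_x `|(EFin \o f1) x| `^ p = \int[mu]_(x in D) (g x `^ p * k x)%:E.
  rewrite [RHS]integral_mkcond; apply: eq_integral => x _ /=.
  rewrite ger0_norm// /f1 !patchE; case: ifPn => [/set_mem Dx|_].
    rewrite powRM ?g0 ?powR_ge0// -powRrM mulVf ?gt_eqF// powRr1//; exact: k0.
  by rewrite powR0// gt_eqF.
have -> : \int[mu]_x `|(EFin \o f2) x| `^ q = \int[mu]_(x in D) (k x)%:E.
  rewrite [RHS]integral_mkcond; apply: eq_integral => x _ /=.
  rewrite ger0_norm// /f2 !patchE; case: ifPn => [/set_mem Dx|_].
    rewrite -powRrM mulVf ?gt_eqF// powRr1//; exact: k0.
  by rewrite powR0// gt_eqF.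
have I0 : 0 <= \int[mu]_(x in D) (g x `^ p * k x)%:E.
  by apply: integral_ge0 => x Dx; rewrite lee_fin mulr_ge0 ?powR_ge0 ?k0.
have K0 : 0 <= \int[mu]_(x in D) (k x)%:E.
  by apply: integral_ge0 => x Dx; rewrite lee_fin k0.
have G0 : 0 <= \int[mu]_(x in D) (g x * k x)%:E.
  by apply: integral_ge0 => x Dx; rewrite lee_fin mulr_ge0 ?k0 ?g0.
move=> H.
have {}H : \int[mu]_(x in D) (g x * k x)%:E <=
   (\int[mu]_(x in D) (g x `^ p * k x)%:E) `^ p^-1 * (M%:E `^ q^-1).
  apply: le_trans H _; apply: lee_pmul; rewrite ?poweR_ge0//.
  apply: gt0_ler_poweR => //; rewrite ?ltW ?invr_gt0//= ?in_itv/= ?andbT ?lee_fin//.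
    by rewrite ?leey ?K0.
  by rewrite ?leey ?lee_fin ?M0.
have : (\int[mu]_(x in D) (g x * k x)%:E) `^ p <= ((\int[mu]_(x in D) (g x `^ p * k x)%:E) `^ p^-1 * (M%:E `^ q^-1)) `^ p.
  apply: gt0_ler_poweR => //; rewrite ?ltW//= ?in_itv/= ?andbT ?lee_fin?leey ?G0 ?mule_ge0 ?poweR_ge0//.
  by rewrite lee_fin powR_ge0.
rewrite poweRM ?poweR_ge0// -!poweRrM mulVf ?gt_eqF// poweRe1//.
rewrite muleC poweR_EFin; suff -> : (q^-1 * p = p - 1)%R by [].
by rewrite /q invf_div; field; lra.
Qed.
Lemma integrable_indic_lty (A : set T) : measurable A -> mu A < +oo ->
  mu.-integrable setT (fun x => (\1_A x)%:E).
Proof.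
move=> mA Aoo; apply/integrableP; split; first exact/measurable_EFinP.
rewrite (eq_integral (fun x => (\1_A x)%:E)); last first.
  by move=> x _ /=; rewrite ger0_norm.
by rewrite integral_indic// setIT.
Qed.
End integral.

Section sigma_finite_pack.
Context d2 (T2 : measurableType d2) (R : realType).
Variables (m : {measure set T2 -> \bar R}) (sm : sigma_finite setT m).
Let m' : set T2 -> \bar R := m.
HB.instance Definition _ := Measure.on m'.
HB.instance Definition _ := @Measure_isSigmaFinite.Build d2 T2 R m' sm.
(** Sigma-finiteness of [mu] will be a consequence of hypotheses on it; this turns such a proof into
    the structure that the Fubini-Tonelli lemmas expect. *)
Definition sfm : {sigma_finite_measure set T2 -> \bar R} := m'.
End sigma_finite_pack.

Section tonelli.
Local Open Scope ereal_scope.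
Context d1 d2 (T1 : measurableType d1) (T2 : measurableType d2) (R : realType).
Variables (m1 : {measure set T1 -> \bar R}) (s1 : sigma_finite setT m1).
Variables (m2 : {measure set T2 -> \bar R}) (s2 : sigma_finite setT m2).
Variable f : T1 * T2 -> \bar R.
Hypothesis mf : measurable_fun setT f.
Hypothesis f0 : forall z, 0 <= f z.

Lemma tonelli_swap : \int[m1]_x \int[m2]_y f (x, y) = \int[m2]_y \int[m1]_x f (x, y).
Proof. exact: (@fubini_tonelli _ _ _ _ _ (sfm s1) (sfm s2) f mf f0). Qed.

Lemma measurable_integral_snd : measurable_fun setT (fun x => \int[m2]_y f (x, y)).
Proof. exact: (@measurable_fun_fubini_tonelli_F _ _ _ _ _ (sfm s2) f mf f0). Qed.

Lemma measurable_xsection_measure A : measurable A ->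
  measurable_fun setT (fun x : T1 => m2 (xsection A x)).
Proof. exact: (@measurable_fun_xsection _ _ _ _ _ (sfm s2) A). Qed.
End tonelli.

(** * Row vectors, boxes and their Borel sets *)

Section rV.
Context {R : realType} (n : nat).
Implicit Types (x y c v : 'rV[R]_n) (r : R).

Lemma rV_norm_le x r : 0 <= r -> (`|x| <= r) <-> forall i, `|x ord0 i| <= r.
Proof.
move=> r0; rewrite [`|x|]/normr /= mx_normrE; split.
  by move/bigmax_leP => [_ h] i; exact: (h (ord0, i) isT).
by move=> h; apply/bigmax_leP; split=> // -[i j] _ /=; rewrite (ord1 i).
Qed.

Lemma rV_coord_le x i : `|x ord0 i| <= `|x|.
Proof. by move/(rV_norm_le x (normr_ge0 x)): (lexx `|x|); apply. Qed.

Lemma continuous_rV (f : 'rV[R]_n -> R) :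
  (forall x e, 0 < e -> exists2 r, 0 < r & forall y, `|x - y| < r -> `|f x - f y| < e) ->
  continuous f.
Proof.
move=> h x A /nbhs_ballP[e /= e0 eA]; have [r r0 hr] := h x e e0.
have H y : ball x r y -> A (f y).
  by rewrite mx_norm_ball /ball_ /= => /hr xy; apply: eA; rewrite /ball /=.
by have [_] := @nbhs_ballP R 'rV[R]_n x (f @^-1` A); apply; exists r.
Qed.

Definition box (a b : 'rV[R]_n) : set 'rV[R]_n :=
  [set x | forall i, a ord0 i <= x ord0 i <= b ord0 i].

Lemma cube_box c r : 0 <= r -> cube c r = box (c - const_mx r) (c + const_mx r).
Proof.
move=> r0; apply/seteqP; split => x /=; rewrite /cube /box /=.
  by move/(rV_norm_le _ r0) => h i; have := h i; rewrite !mxE ler_distl.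
by move=> h; apply/(rV_norm_le _ r0) => i; have := h i; rewrite !mxE ler_distl.
Qed.

Lemma rV_borel_open (U : set 'rV[R]_n) : open U -> measurable (U : set (borel_rV R n)).
Proof. by move=> oU; exact: sub_sigma_algebra. Qed.

Lemma rV_borel_closed (U : set 'rV[R]_n) : closed U -> measurable (U : set (borel_rV R n)).
Proof.
by move=> cU; rewrite -[U]setCK; apply: measurableC; apply: rV_borel_open; exact: closed_openC.
Qed.

Lemma measurable_box (a b : 'rV[R]_n) : measurable (box a b : set (borel_rV R n)).
Proof.
rewrite (_ : box a b = \bigcap_(i in [set: 'I_n]) (setT `&`
    (fun x : borel_rV R n => x ord0 i) @^-1` `[a ord0 i, b ord0 i]%classic)).
  apply: fin_bigcap_measurable => // i _.
  by apply: measurable_coord_rV => //; exact: measurable_itv.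
rewrite eqEsubset; split=> [x h i _|x h i]; first by split; [|rewrite /= in_itv/=].
by have [_] := h i Logic.I; rewrite /= in_itv.
Qed.

Lemma cube_lt0 c r : r < 0 -> cube c r = set0.
Proof.
move=> r0; apply/seteqP; split => // x; rewrite /cube /= => h.
by have := le_lt_trans h r0; rewrite ltNge normr_ge0.
Qed.

Lemma measurable_cube c r : measurable (cube c r : set (borel_rV R n)).
Proof.
have [r0|r0] := leP 0 r; first by rewrite cube_box//; exact: measurable_box.
by rewrite cube_lt0.
Qed.

Lemma leb_cube c r : 0 <= r -> lebesgue_rV n (cube c r) = ((2 * r) ^+ n)%:E.
Proof.
move=> r0; rewrite cube_box// lebesgue_rV_box; last first.
  by move=> i; rewrite !mxE; lra.
under eq_bigr do rewrite !mxE.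
rewrite (eq_bigr (fun=> 2 * r)); last by move=> i _; ring.
by rewrite prodr_const card_ord.
Qed.

(** A family indexed by a countable type of which every open set is a union; it carries all the
    covering arguments below. *)
Definition rat_cube (qk : 'rV[rat]_n * nat) : set 'rV[R]_n :=
  cube (map_mx ratr qk.1) qk.2.+1%:R^-1.

Lemma rat_cube_sub (U : set 'rV[R]_n) x : open U -> U x ->
  exists2 qk, rat_cube qk x & rat_cube qk `<=` U.
Proof.
move=> oU Ux.
have /nbhs_ballP[e /= e0 eU] : nbhs x U by move: oU; rewrite openE; apply.
have e20 : 0 < e / 2 by rewrite divr_gt0.
have [k ke] : exists k : nat, k.+1%:R^-1 < e / 2 :> R.
  have [k _ /(_ k (leqnn k))] := near_infty_natSinv_lt (PosNum e20).
  by exists k.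
have /choice[q qf] : forall j : 'I_n, exists q : rat,
    `|x ord0 j - ratr q| < k.+1%:R^-1.
  move=> j; set z := _ ord0 j.
  have k0 : 0 < k.+1%:R^-1 :> R by rewrite invr_gt0.
  move: (k.+1%:R^-1 : R) k0 => e' e'0.
  have /rat_in_itvoo[q] : z - e' < z + e' by lra.
  rewrite in_itv/= => /andP[? ?]; exists q.
  by rewrite ltr_distlC; apply/andP; split; lra.
have k0 : 0 <= k.+1%:R^-1 :> R by rewrite invr_ge0.
have xq : rat_cube (\row_j q j, k) x.
  by apply/(rV_norm_le _ k0) => i; rewrite !mxE; exact/ltW.
exists (\row_j q j, k) => // y yq; apply: eU.
rewrite mx_norm_ball /ball_ /=.
rewrite (_ : x - y = (x - map_mx ratr (\row_j q j)) - (y - map_mx ratr (\row_j q j))).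
  by rewrite (le_lt_trans (ler_normB _ _))// (splitr e) ltr_leD//
    ?(le_lt_trans xq)// (le_trans yq)// ltW.
by rewrite opprB addrA subrK.
Qed.

Lemma open_rat_cubes (U : set 'rV[R]_n) : open U ->
  U = \bigcup_(qk in [set qk | rat_cube qk `<=` U]) rat_cube qk.
Proof.
move=> oU; apply/seteqP; split=> [x Ux|x [qk /= qU xq]]; last exact: qU.
by have [qk xq qU] := rat_cube_sub oU Ux; exists qk.
Qed.

(** Boxes are stable under intersection and have an explicit Lebesgue measure, which is what the
    uniqueness theorem for measures works with. They generate because an open set is a countable
    union of rational cubes. *)
Lemma borel_rV_boxes : (@measurable _ (borel_rV R n)) =
  <<s [set A : set 'rV[R]_n | exists a b, A = box a b] >>.
Proof.
apply/seteqP; split; last first.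
  apply: smallest_sub; first exact: sigma_algebra_measurable.
  by move=> _ [a [b ->]]; exact: measurable_box.
apply: smallest_sub; first exact: smallest_sigma_algebra.
move=> U oU; rewrite (open_rat_cubes oU) bigcup_mkcond.
pose T := g_sigma_algebraType [set A : set 'rV[R]_n | exists a b, A = box a b].
change (measurable (\bigcup_i (if i \in [set qk | rat_cube qk `<=` U]
     then rat_cube i else set0) : set T)).
apply: countable_bigcupT_measurable => [|qk]; first exact: countableP.
case: ifPn => // _; apply: sub_sigma_algebra => /=.
by rewrite /rat_cube cube_box ?invr_ge0//; do 2 eexists; reflexivity.
Qed.

Lemma boxI (a b a' b' : 'rV[R]_n) : box a b `&` box a' b' =
  box (\row_i Num.max (a ord0 i) (a' ord0 i)) (\row_i Num.min (b ord0 i) (b' ord0 i)).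
Proof.
apply/seteqP; split => [x [/= h h'] i|x /= h].
  rewrite !mxE ge_max le_min.
  by case/andP: (h i) => -> ->; case/andP: (h' i) => -> ->.
by split => i; have := h i; rewrite !mxE ge_max le_min => /andP[/andP[? ?]/andP[? ?]];
  apply/andP.
Qed.

Lemma bigcup_cube0 : \bigcup_k cube (0 : 'rV[R]_n) k%:R = setT.
Proof.
apply/seteqP; split => // x _; exists (Num.bound `|x|) => //.
by rewrite /cube /= subr0 ltW// archi_boundP.
Qed.

End rV.

(** * Translation invariance and integrals of derivatives *)

Section lebesgue_translation.
Context {R : realType} (n : nat).
Implicit Types (x y c v : 'rV[R]_n) (r : R).
Local Notation leb := (lebesgue_rV n : {measure set (borel_rV R n) -> \bar R}).

Lemma continuous_measurable_rV (f : 'rV[R]_n -> R) : continuous f ->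
  measurable_fun setT (f : borel_rV R n -> R).
Proof.
move=> cf; apply: (@measurability _ _ _ _ setT _ _ (RGenOpens.measurableE R)) => _ [_ [a [b ->]] <-].
by rewrite setTI; apply: rV_borel_open; apply: open_comp; [move=> x _; exact: cf|exact: interval_open].
Qed.

Definition translate v : borel_rV R n -> borel_rV R n := fun x => (x : 'rV[R]_n) + v.

Lemma measurable_translate v : measurable_fun setT (translate v).
Proof.
apply: measurable_fun_rV => j.
apply: (eq_measurable_fun (fun t : borel_rV R n => (t : 'rV[R]_n) ord0 j + v ord0 j)) => [z _|].
  by rewrite /translate !mxE.
by apply: measurable_funD => //; exact: measurable_coord_rV.
Qed.

HB.instance Definition _ v :=
  isMeasurableFun.Build _ _ (borel_rV R n) (borel_rV R n) (translate v) (measurable_translate v).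

(** The two measures agree on boxes, a generating pi-system, and are finite on cubes that exhaust
    the space. *)
Lemma leb_translate v (A : set (borel_rV R n)) : measurable A ->
  leb A = pushforward leb (translate v) A.
Proof.
pose m2 : {measure set (borel_rV R n) -> \bar R} := pushforward leb (translate v).
apply: (@measure_unique _ _ (borel_rV R n) _ (fun k : nat => cube (0 : 'rV[R]_n) k%:R) (@borel_rV_boxes R n) _ _ _ leb (m2 (measurable_translate v))) => //=.
- by move=> _ _ [a [b ->]] [a' [b' ->]]; rewrite boxI; do 2 eexists; reflexivity.
- by move=> i; rewrite cube_box//; do 2 eexists; reflexivity.
- exact: bigcup_cube0.
- move=> _ [a [b ->]]; rewrite /pushforward.
  have -> : translate v @^-1` box a b = box (a - v) (b - v).
    apply/seteqP; split => x /= h i; have := h i; rewrite /translate !mxE.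
      by move=> /andP[? ?]; apply/andP; split; lra.
    by move=> /andP[? ?]; apply/andP; split; lra.
  (* [lebesgue_rV_box] wants ordered corners; with a reversed pair of corners the box and its
     translate are both empty. *)
  have [ab|] := pselect (forall i, a ord0 i <= b ord0 i).
    rewrite !lebesgue_rV_box//; last by move=> i; rewrite !mxE lerD2r.
    by congr (_%:E); apply: eq_bigr => i _; rewrite !mxE; ring.
  move=> /existsNP[i /negP]; rewrite -ltNge => ba.
  have -> : box a b = set0.
    apply/seteqP; split => // x /(_ i) /andP[h1 h2].
    by have := lt_le_trans ba (le_trans h1 h2); rewrite ltxx.
  have -> : box (a - v) (b - v) = set0.
    apply/seteqP; split => // x /(_ i); rewrite !mxE => /andP[h1 h2].
    by have := le_trans h1 h2; rewrite lerD2r leNgt ba.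
  by rewrite !measure0.
- by move=> k; rewrite leb_cube// ltry.
Qed.

Lemma integral_translate v (f : borel_rV R n -> \bar R) : measurable_fun setT f ->
  (\int[leb]_x f (translate v x) = \int[leb]_x f x)%E.
Proof.
move=> mf; pose pm v : {measure set (borel_rV R n) -> \bar R} :=
  measure_function_pushforward__canonical__measure_function_Measure leb (measurable_translate v).
rewrite [LHS]integralE [RHS]integralE; congr (_ - _)%E.
- rewrite [RHS](@eq_measure_integral _ _ _ setT (pm v)); last first.
    by move=> A mA _; exact: leb_translate.
  rewrite (ge0_integral_pushforward (measurable_translate v))//; [by rewrite preimage_setT; apply: eq_integral => x _; rewrite /= ?funeposE ?funenegE|exact: measurable_funepos].
- rewrite [RHS](@eq_measure_integral _ _ _ setT (pm v)); last first.
    by move=> A mA _; exact: leb_translate.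
  rewrite (ge0_integral_pushforward (measurable_translate v))//; [by rewrite preimage_setT; apply: eq_integral => x _; rewrite /= ?funeposE ?funenegE|exact: measurable_funeneg].
Qed.

Lemma sigma_finite_leb : sigma_finite setT leb.
Proof.
exists (fun k => cube (0 : 'rV[R]_n) k%:R); first by rewrite bigcup_cube0.
by move=> k; split; [exact: measurable_cube|rewrite leb_cube// ltry].
Qed.

Lemma is_derive_line (f : 'rV[R]_n -> R) x v (t d : R) :
  is_derive (x + t *: v) v f d -> is_derive t 1 (fun s => f (x + s *: v)) d.
Proof.
case=> ex val.
have E : (fun h : R => h^-1 *: (((fun s => f (x + s *: v)) \o shift t) (h *: (1 : R)) - f (x + t *: v))) =
  (fun h : R => h^-1 *: ((f \o shift (x + t *: v)) (h *: v) - f (x + t *: v))).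
  by apply/funext => h /=; rewrite scaler1 scalerDl addrCA addrA addrC addrA.
by split; rewrite /derivable /derive ?E.
Qed.

Lemma mvt_line (f df : 'rV[R]_n -> R) x v (t M : R) : 0 <= t ->
  (forall y, is_derive y v f (df y)) ->
  (forall y, (exists2 s, 0 <= s <= t & y = x + s *: v) -> `|df y| <= M) ->
  `|f (x + t *: v) - f x| <= M * t.
Proof.
move=> t0 fdf dfM.
pose g s := f (x + s *: v).
have gd (s : R) : is_derive s (1 : R) g (df (x + s *: v)) by apply: is_derive_line.
have [|s s_ E] := @MVT_segment _ g (fun s => df (x + s *: v)) 0 t t0 (fun s _ => gd s).
  by apply: derivable_within_continuous => s _; have [] := gd s.
rewrite -[X in _ - f X]addr0 -(scale0r v) -/(g t) -/(g 0) E normrM subr0 (ger0_norm t0).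
apply: ler_wpM2r => //; apply: dfM; exists s => //; move: s_; rewrite in_itv.
Qed.

Lemma derive_cvg_seq (f : 'rV[R]_n -> R) x v (d : R) (u : R^nat) :
  is_derive x v f d -> (forall k, u k != 0) -> u @ \oo --> (0 : R) ->
  (u k)^-1 * (f (x + u k *: v) - f x) @[k --> \oo] --> d.
Proof.
move=> [ex <-] u0 ucv.
have := ex; rewrite /derivable => /cvg_ex[/= l hl].
have -> : 'D_v f x = l by apply/cvg_lim.
have U : u @ \oo --> (0 : R)^'.
  move=> A; rewrite /dnbhs /within /= => hA.
  by have := ucv _ hA; rewrite /nbhs /=; apply: filterS => k /= h; apply: h; exact: u0.
have := cvg_comp _ _ U hl; apply: cvg_trans; apply: near_eq_cvg; near=> k => /=.
by rewrite (addrC x).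
Unshelve. all: by end_near. Qed.

Lemma cube_closed c r : closed (cube c r).
Proof.
rewrite (_ : cube c r = (fun x => `|x - c|) @^-1` [set y | y <= r])//.
apply: closed_comp; last exact: closed_le.
move=> x _; apply: continuous_comp; last exact: norm_continuous.
by apply: continuousB; [exact: id|exact: cst_continuous].
Qed.

Lemma cube_compact c r : compact (cube c r).
Proof.
apply: bounded_closed_compact; last exact: cube_closed.
exists (`|c| + r); split; first by rewrite num_real.
move=> M hM x; rewrite /cube /= => h; apply: le_trans (ltW hM).
by rewrite -[x](subrK c) (le_trans (ler_normD _ _))// addrC lerD2l.
Qed.

Lemma continuous_bounded_cube (f : 'rV[R]_n -> R) c r : continuous f ->
  exists2 M, 0 <= M & forall x, cube c r x -> `|f x| <= M.
Proof.
move=> cf; have := @compact_bounded R _ _ (continuous_compact (continuous_subspaceT cf) (@cube_compact c r)).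
move=> [M [_ h]]; exists (`|M| + 1); first by rewrite addr_ge0.
move=> x cx; apply: (h (`|M| + 1)) => /=; first by rewrite (le_lt_trans (ler_norm _))// ltrDl.
by exists x.
Qed.

Lemma leb_cube_lty c r : (leb (cube c r) < +oo)%E.
Proof.
have [r0|r0] := leP 0 r; first by rewrite leb_cube// ltry.
by rewrite cube_lt0// measure0 ltry.
Qed.

Lemma integrable_bounded_cube (f : borel_rV R n -> R) c r M :
  measurable_fun setT f -> (forall x, `|f x| <= M) -> (forall x, ~ cube c r x -> f x = 0) ->
  leb.-integrable setT (EFin \o f).
Proof.
move=> mf fM f0.
apply: (@le_integrable _ _ R leb setT measurableT (EFin \o f) (fun x : borel_rV R n => M%:E * (\1_(cube c r : set (borel_rV R n)) x)%:E)%E).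
- exact/measurable_EFinP.
- move=> x _ /=; rewrite lee_fin; have [cx|cx] := pselect (cube c r x).
    by rewrite indicE mem_set// mulr1 (le_trans (fM x))// ler_norm.
  by rewrite f0// normr0.
- apply: integrableZl => //; apply: integrable_indic_lty => //; first exact: measurable_cube.
  exact: leb_cube_lty.
Qed.

(** The difference quotients have integral zero by translation invariance. They are bounded by [K]
    by the mean value theorem and, the steps being at most 1, vanish off one cube of radius [M + 1],
    so dominated convergence applies. As their limit, [df] is measurable. *)
Lemma integral_derive_compact (i : 'I_n) (f df : 'rV[R]_n -> R) (M K : R) :
  continuous f -> (forall x, is_derive x (delta_mx ord0 i) f (df x)) ->
  (forall x, `|df x| <= K) -> (forall x, M < `|x| -> f x = 0) ->
  [/\ measurable_fun setT (df : borel_rV R n -> R),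
   leb.-integrable setT (EFin \o (df : borel_rV R n -> R)) & (\int[leb]_x (df x)%:E = 0)%E].
Proof.
move=> cf fdf dfK f0; pose e : 'rV[R]_n := delta_mx ord0 i.
have e1 : `|e| <= 1.
  apply/(rV_norm_le _ ler01) => j; rewrite mxE eqxx /=.
  by case: (j == i); rewrite ?normr1 ?normr0.
pose u k : R := k.+1%:R^-1.
have u0 k : 0 < u k by rewrite invr_gt0.
have ucv : u @ \oo --> (0 : R) by exact: cvg_harmonic.
pose D k x := (u k)^-1 * (f (x + u k *: e) - f x).
have mf : measurable_fun setT (f : borel_rV R n -> R) by exact: continuous_measurable_rV.
have mft k : measurable_fun setT ((fun x => f (x + u k *: e)) : borel_rV R n -> R).
  exact: (measurableT_comp mf (measurable_translate (u k *: e))).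
have mD k : measurable_fun setT (D k : borel_rV R n -> R).
  by apply: measurable_funM => //; apply: measurable_funB.
have Dcv x : D k x @[k --> \oo] --> df x.
  by apply: derive_cvg_seq => // k; rewrite gt_eqF.
have mdf : measurable_fun setT (df : borel_rV R n -> R).
  by apply: (@measurable_fun_cvg _ _ _ _ (D : nat -> borel_rV R n -> R)) => // x _; exact: Dcv.
have K0 : 0 <= K by apply: le_trans (dfK 0).
have DK k x : `|D k x| <= K.
  rewrite /D normrM normfV (gtr0_norm (u0 k)) mulrC ler_pdivrMr//.
  by apply: mvt_line => //; exact: ltW.
have D0 k x : ~ cube 0 (M + 1) x -> D k x = 0.
  rewrite /cube /= subr0 => /negP; rewrite -ltNge => Mx.
  rewrite /D !f0 ?subrr ?mulr0//; first by rewrite (lt_trans _ Mx)// ltrDl.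
  have : `|x| <= `|x + u k *: e| + `|u k *: e|.
    by rewrite -{1}[x](addrK (u k *: e)) (le_trans (ler_normB _ _)).
  have : `|u k *: e| <= 1.
    rewrite normrZ (gtr0_norm (u0 k)) -[leRHS]mulr1 ler_pM ?(ltW (u0 k))//.
    by rewrite /u invf_le1 ?ler1n// ltr0n.
  by lra.
have f0' x : ~ cube 0 (M + 1) x -> f x = 0.
  by rewrite /cube /= subr0 => /negP; rewrite -ltNge => Mx; apply: f0; lra.
have df0 x : ~ cube 0 (M + 1) x -> df x = 0.
  move=> Mx; have := Dcv x; rewrite (_ : (fun k => D k x) = cst 0); last first.
    by apply/funext => k; rewrite D0.
  by move/cvg_lim => <- //; rewrite lim_cst.
have If : leb.-integrable setT (EFin \o (f : borel_rV R n -> R)).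
  have [B B0 fB] := continuous_bounded_cube 0 (M + 1) cf.
  apply: (integrable_bounded_cube (M := B) mf _ f0') => x.
  have [/fB//|/f0' ->] := pselect (cube 0 (M + 1) x); by rewrite normr0.
have Ift k : leb.-integrable setT (EFin \o ((fun x => f (x + u k *: e)) : borel_rV R n -> R)).
  apply/integrableP; split; first exact/measurable_EFinP.
  have /integrableP[_] := If; rewrite -(integral_translate (u k *: e))//.
  by apply: measurableT_comp => //; exact/measurable_EFinP.
have ID k : (\int[leb]_x (D k x)%:E = 0)%E.
  rewrite /D; under eq_integral do rewrite EFinM EFinB.
  rewrite integralZl//; last exact: (integrableB measurableT (Ift k) If).
  rewrite (integralB measurableT (Ift k) If) (_ : \int[leb]_x _ = \int[leb]_x (f x)%:E)%E; last first.
    rewrite -(integral_translate (u k *: e) (f := EFin \o f))//; exact/measurable_EFinP.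
  by rewrite subee ?mule0//; exact: integrable_fin_num.
have [] := @dominated_convergence _ _ _ leb setT measurableT
   (fun k x => (D k x)%:E) (EFin \o df) (fun x : borel_rV R n => (K%:E * (\1_(cube 0 (M + 1) : set (borel_rV R n)) x)%:E)%E).
- by move=> k; exact/measurable_EFinP.
- exact/measurable_EFinP.
- by apply: aeW => x _; apply: cvg_EFin; [near=> k|exact: Dcv].
- apply: integrableZl => //; apply: integrable_indic_lty => //; first exact: measurable_cube.
  exact: leb_cube_lty.
- apply: aeW => x k _; rewrite lee_fin; have [cx|cx] := pselect (cube 0 (M + 1) x).
    by rewrite indicE mem_set// mulr1.
  by rewrite D0// normr0 mulr_ge0.
move=> Idf _; rewrite (_ : [sequence _]_n = cst 0%E); last first.
  by apply/funext => k /=; exact: ID.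
move=> /cvg_lim h; split => //; rewrite -h// lim_cst//.
Unshelve. all: by end_near. Qed.

End lebesgue_translation.

(** * Rules for directional derivatives *)

Section derive_rules.
Context {R : realType} {V : normedModType R}.
Implicit Types (f g : V -> R) (x v : V).

Lemma isd_mul f g x v (df dg : R) : is_derive x v f df -> is_derive x v g dg ->
  is_derive x v (fun y => f y * g y) (df * g x + f x * dg).
Proof.
move=> hf hg; have := is_deriveM hf hg; rewrite (_ : f * g = fun y => f y * g y)//.
by move=> h; apply: is_derive_eq h _; rewrite /GRing.scale /=; ring.
Qed.

Lemma isd_add f g x v (df dg : R) : is_derive x v f df -> is_derive x v g dg ->
  is_derive x v (fun y => f y + g y) (df + dg).
Proof. by move=> hf hg; have := is_deriveD hf hg; rewrite (_ : f + g = fun y => f y + g y). Qed.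

Lemma isd_opp f x v (df : R) : is_derive x v f df -> is_derive x v (fun y => - f y) (- df).
Proof. by move=> hf; have := is_deriveN hf; rewrite (_ : - f = fun y => - f y). Qed.

Lemma isd_exp f n x v (df : R) : is_derive x v f df ->
  is_derive x v (fun y => f y ^+ n) (n%:R * f x ^+ n.-1 * df).
Proof.
by move=> hf; have := is_deriveX n hf; rewrite (_ : f ^+ n = fun y => f y ^+ n)// exprfctE.
Qed.

Lemma is_derive_line0 f x v (d : R) :
  is_derive x v f d <-> is_derive (0 : R) (1 : R) (fun s : R => f (x + s *: v)) d.
Proof.
have E : (fun h : R => h^-1 *: (((fun s => f (x + s *: v)) \o shift (0 : R)) (h *: (1 : R)) - f (x + 0 *: v))) =
  (fun h : R => h^-1 *: ((f \o shift x) (h *: v) - f x)).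
  apply/funext => h /=; rewrite scaler1 addr0 scale0r addr0. by rewrite (addrC x).
by split => -[ex val]; split; move: ex val; rewrite /derivable /derive ?E.
Qed.

(** Restriction to the line through [x] along [v] reduces this to the one-variable chain rule, so a
    single directional derivative of [g] is enough. *)
Lemma isd_comp (f : R -> R) g x v (a b : R) : is_derive (g x) (1 : R) f a ->
  is_derive x v g b -> is_derive x v (fun y => f (g y)) (a * b).
Proof.
move=> hf /is_derive_line0 hg; apply/is_derive_line0.
by apply: (is_derive1_comp _ hg); rewrite scale0r addr0.
Qed.

Lemma isd_inv f x v (df : R) : f x != 0 -> is_derive x v f df ->
  is_derive x v (fun y => (f y)^-1) (- df / f x ^+ 2).
Proof.
move=> f0 hf; have : is_derive x v (fun y => (f y)^-1) (- (f x) ^- 2 * df).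
  apply: isd_comp hf; apply: is_derive_eq; [exact: is_deriveV|].
  by rewrite /GRing.scale /= mulr1.
by move=> h; apply: is_derive_eq h _; rewrite mulrC mulrN mulNr.
Qed.

End derive_rules.

(** * A smooth step function *)

Section smooth_step.
Context {R : realType}.
Implicit Types (p : {poly R}) (m : nat) (x : R).

(** The standard bump exp(-1/(1 - x^2)) times a rational function: a class closed under
    differentiation, so that all derivatives of the bump are treated at once. *)
Definition bumpf p m x : R :=
  if `|x| < 1 then p.[x] / (1 - x ^+ 2) ^+ m * expR (- (1 - x ^+ 2)^-1) else 0.

(** Numerator of the derivative over the denominator (1 - x^2)^(m+2); its three terms come from the
    polynomial, the denominator and the exponential. *)
Definition bumpd p m : {poly R} :=
  p^`() * (1%:P - 'X^2) ^+ 2 + (p * 'X * (1%:P - 'X^2)) *+ (2 * m) - (p * 'X) *+ 2.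

Lemma expR_inv_le m (u : R) : 0 < u -> expR (- u^-1) <= m.+1`!%:R * u ^+ m.+1.
Proof.
move=> u0; rewrite expRN invf_ple ?posrE ?expR_gt0 ?mulr_gt0 ?exprn_gt0 ?ltr0n ?fact_gt0//.
rewrite invfM -exprVn mulrC.
have : 0 <= u^-1 by rewrite invr_ge0 ltW.
by move/(@expR_ge1Dxn R _ m); lra.
Qed.

Lemma sq_lt1 x : `|x| < 1 -> 0 < 1 - x ^+ 2.
Proof. by rewrite -(real_normK (num_real x)) => h; rewrite subr_gt0 exprn_ilt1. Qed.

(** The exponential beats every power of 1 - x^2. The two powers kept make the function vanish to
    second order at 1 and -1, which gives derivative zero there. *)
Lemma bumpf_bound p m : exists2 C, 0 <= C & forall x, `|bumpf p m x| <= C * (1 - x ^+ 2) ^+ 2.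
Proof.
have [M Mp] : exists M, forall x, `|x| <= 1 -> `|p.[x]| <= M.
  exists (\sum_(i < size p) `|p`_i|) => x x1.
  rewrite horner_coef (le_trans (ler_norm_sum _ _ _))//; apply: ler_sum => i _.
  by rewrite normrM normrX ler_piMr// exprn_ile1.
exists (`|M| * m.+2`!%:R); first by rewrite mulr_ge0.
move=> x; rewrite /bumpf; case: ifPn => x1; last first.
  by rewrite normr0 mulr_ge0 ?sqr_ge0// mulr_ge0.
have u0 := sq_lt1 x1.
rewrite normrM normrM (ger0_norm (expR_ge0 _)) normfV (@ger0_norm _ ((1 - x ^+ 2) ^+ m)) ?exprn_ge0 ?(ltW u0)//.
rewrite -!mulrA; apply: ler_pM => //.
- by rewrite mulr_ge0 ?expR_ge0 ?invr_ge0 ?exprn_ge0 ?(ltW u0).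
- by apply: le_trans (Mp _ (ltW x1)) (ler_norm _).
rewrite mulrC ler_pdivrMr ?exprn_gt0//; have := expR_inv_le m.+1 u0.
by move=> /le_trans; apply; rewrite -mulrA -exprD addnC addn2.
Qed.

Lemma bumpf_derive p m x : is_derive x 1 (bumpf p m) (bumpf (bumpd p m) (m + 2) x).
Proof.
have [x1|x1|x1] := ltgtP `|x| 1.
- have u0 := sq_lt1 x1.
  pose f y := p.[y] * ((1 - y ^+ 2) ^+ m)^-1 * expR (- (1 - y ^+ 2)^-1).
  have : is_derive x 1 f (bumpf (bumpd p m) (m + 2) x).
    have D1 : is_derive x 1 (fun y : R => 1 - y ^+ 2) (0 + - (2 * x ^+ 1 * 1)).
      exact: (isd_add (is_derive_cst _ _ _) (isd_opp (isd_exp 2 (is_derive_id _ _)))).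
    have u0m : (1 - x ^+ 2) ^+ m != 0 by rewrite gt_eqF// exprn_gt0.
    have u0' : 1 - x ^+ 2 != 0 by rewrite gt_eqF.
    have D3 := isd_inv (f := fun y : R => (1 - y ^+ 2) ^+ m) u0m (isd_exp m D1).
    have D6 := isd_comp (is_derive_expR _) (isd_opp (isd_inv (f := fun y : R => 1 - y ^+ 2) u0' D1)).
    have D8 := isd_mul (isd_mul (is_derive_poly p x) D3) D6.
    apply: is_derive_eq D8 _.
    rewrite /bumpf x1 /bumpd !(hornerD, hornerN, hornerM, horner_exp, hornerX, hornerXn, hornerC, hornerMn).
    move: (expR _) (p^`().[x]) (p.[x]) => E d' q {D1 D3 D6 f}.
    rewrite expr1; move: u0 u0' {u0m}; set u := 1 - x ^+ 2 => u0 u0'.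
    case: m => [|k]; first by rewrite !expr0 muln0 mulr0n add0n; field.
    rewrite succnK addn2 !exprS -[_ *+ (2 * k.+1)]mulr_natl -[_ *+ 2]mulr_natl natrM.
    have : u ^+ k != 0 by rewrite gt_eqF// exprn_gt0.
    move: (u ^+ k) => U U0; field; exact/andP.
  move=> h; apply: (near_eq_is_derive _ h).
  near=> y; rewrite /f /bumpf ifT//.
  near: y; apply: (@cvgr_lt _ _ _ _ (fun y : R => `|y|) `|x|) => //; exact: norm_continuous.
- rewrite {2}/bumpf ifF; last by apply/negbTE; rewrite -leNgt ltW.
  apply: (near_eq_is_derive _ (is_derive_cst (0 : R) x (1 : R))).
  near=> y; rewrite /bumpf ifF//; apply/negbTE; rewrite -leNgt ltW//.
  near: y; apply: (@cvgr_gt _ _ _ _ (fun y : R => `|y|) `|x|) => //; exact: norm_continuous.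
(* At |x| = 1 the value is 0, and |1 - (h + x)^2| <= 3 |h| bounds the difference quotient by 9 C
   |h|. Hence the threshold e / (9 C + 1), with the 1 to keep the denominator positive. *)
- rewrite {2}/bumpf x1 ltxx.
  have [C C0 bC] := bumpf_bound p m.
  have cv : (fun h : R => h^-1 *: ((bumpf p m \o shift x) (h *: (1 : R)) - bumpf p m x)) @ 0^' --> (0 : R).
    apply/cvgrPdist_le => e e0; near=> h.
    have h0 : h != 0 by near: h; exact: nbhs_dnbhs_neq.
    rewrite sub0r normrN /= scaler1 /bumpf x1 ltxx subr0 -/(bumpf p m (h + x)).
    rewrite normrZ normfV mulrC ler_pdivrMr ?normr_gt0// (le_trans (bC _))//.
    have h1 : `|h| <= 1 by near: h; apply: dnbhs0_le.
    have h2 : `|h| <= e / (9 * C + 1).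
      by near: h; apply: dnbhs0_le; rewrite divr_gt0// ltr_wpDl// mulr_ge0.
    have : `|1 - (h + x) ^+ 2| <= 3 * `|h|.
      have -> : 1 - (h + x) ^+ 2 = - h * (h + 2 * x).
        have : x ^+ 2 = 1 by rewrite -(real_normK (num_real x)) x1 expr1n.
        by rewrite sqrrD => ->; ring.
      rewrite normrM normrN mulrC ler_wpM2r// (le_trans (ler_normD _ _))// normrM x1.
      by rewrite ger0_norm//; lra.
    rewrite -(real_normK (num_real (1 - (h + x) ^+ 2))).
    move: (`|1 - _|) (normr_ge0 (1 - (h + x) ^+ 2)) => D D0 Dh.
    have : D ^+ 2 <= (3 * `|h|) ^+ 2 by rewrite lerXn2r// nnegrE mulr_ge0.
    move=> /(ler_wpM2l C0)/le_trans; apply.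
    have : `|h| * (9 * C + 1) <= e by rewrite -ler_pdivlMr// ltr_wpDl// mulr_ge0.
    move: (normr_ge0 h) => h3 h4.
    have : `|h| * 9 * C <= e by lra.
    by move/(ler_wpM2r h3); apply: le_trans; rewrite le_eqVlt; apply/orP; left; apply/eqP; ring.
  split; first by apply/cvg_ex; exists 0.
  by apply/cvg_lim.
Unshelve. all: by end_near. Qed.

Fixpoint bumps m : {poly R} * nat :=
  if m is k.+1 then (bumpd (bumps k).1 (bumps k).2, ((bumps k).2 + 2)%N) else (1%:P, 0%N).

Lemma le_of_derive_ge0 (f df : R -> R) : (forall x, is_derive x 1 f (df x)) ->
  (forall x, 0 <= df x) -> forall x y, x <= y -> f x <= f y.
Proof.
move=> fdf df0 x y xy.
have [|c _ E] := @MVT_segment _ f df x y xy (fun s _ => fdf s).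
  by apply: derivable_within_continuous => s _; have [] := fdf s.
by rewrite -subr_ge0 E mulr_ge0// subr_ge0.
Qed.

Lemma is_derive_continuous (f df : R -> R) : (forall x, is_derive x 1 f (df x)) -> continuous f.
Proof.
by move=> fdf x; apply: differentiable_continuous; apply/derivable1_diffP; have [] := fdf x.
Qed.

Local Notation lebR := (@lebesgue_measure R).

(** [D 0] is the normalised primitive of the bump and [D k] its k-th derivative; the whole sequence
    is kept because test functions must have all derivatives. The bounds on [D 1] control the height
    of the mollifiers built from it and keep their integral positive. *)
Lemma smooth_step_exists : exists D : nat -> R -> R,
  [/\ forall k x, is_derive x 1 (D k) (D k.+1 x),
      (forall x, x <= -1 -> D 0 x = 0) /\ (forall x, 1 <= x -> D 0 x = 1),
      forall x, 0 <= D 0 x <= 1,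
      (forall x, 0 <= D 1%N x) /\ (exists M, forall x, D 1%N x <= M) &
      exists2 m, 0 < m & forall x, `|x| <= 2^-1 -> m <= D 1%N x].
Proof.
pose B k := bumpf (bumps k).1 (bumps k).2.
have dB k x : is_derive x 1 (B k) (B k.+1 x) by exact: bumpf_derive.
have B0 x : 0 <= B 0 x.
  rewrite /B /bumpf; case: ifPn => // _.
  by rewrite hornerC expr0 divr1 mul1r expR_ge0.
have B1 x : B 0 x <= 1.
  rewrite /B /bumpf; case: ifPn => // x1.
  rewrite hornerC expr0 divr1 mul1r -[leRHS]expR0 ler_expR oppr_le0 invr_ge0 ltW//.
  exact: sq_lt1.
have Bout x : 1 <= `|x| -> B 0 x = 0 by rewrite /B /bumpf leNgt => /negbTE ->.
pose m0 := expR (- 2) : R.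
have m00 : 0 < m0 by exact: expR_gt0.
have Bm x : `|x| <= 2^-1 -> m0 <= B 0 x.
  move=> x2; rewrite /B /bumpf ifT ?hornerC ?expr0 ?divr1 ?mul1r; last by rewrite (le_lt_trans x2)//; lra.
  rewrite ler_expR lerN2 invf_ple ?posrE//; last by apply: sq_lt1; lra.
  rewrite lerBrDr -lerBrDl (_ : 1 - 2^-1 = 2^-1); last by field.
  rewrite -(real_normK (num_real x)) (@le_trans _ _ (2^-1 ^+ 2))//.
    by rewrite lerXn2r// nnegrE invr_ge0.
  by rewrite exprVn; lra.
have cB : continuous (B 0) by apply: is_derive_continuous; exact: dB.
have mB : measurable_fun setT (B 0) by exact: continuous_measurable_fun.
have iB : lebR.-integrable setT (EFin \o B 0).
  apply: (@le_integrable _ _ R lebR setT measurableT (EFin \o B 0) (fun x : measurableTypeR R => (\1_(`[-1, 1]%classic : set (measurableTypeR R)) x)%:E)).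
  - exact/measurable_EFinP.
  - move=> x _ /=; rewrite lee_fin ger0_norm ?B0// indicE ger0_norm//.
    have [x1|x1] := leP `|x| 1; last by rewrite Bout ?(ltW x1).
    by rewrite mem_set ?B1//= in_itv/= -ler_norml.
  - apply: integrable_indic_lty; first exact: measurable_itv.
    by rewrite /= lebesgue_measure_itv /= lte_fin; case: ifP => _; rewrite ltry.
pose H0 x : R := \int[lebR]_(t in `]-oo, x]) B 0 t.
have dH0 x : is_derive x 1 H0 (B 0 x).
  have := @continuous_FTC1 R (B 0) -oo%O x (x + 1) _ _ _ (cB x).
  rewrite ltrDl ltr01 => /(_ isT).
  case.
  - exact: integrableS iB.
  - by rewrite ltNyr.
  - by move=> dv <-; rewrite derive1E; split.
have H0l x : x <= -1 -> H0 x = 0.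
  move=> x1; rewrite /H0 (@eq_Rintegral _ _ _ _ _ (fun=> 0)); last first.
    move=> t; rewrite inE /= in_itv/= => tx; apply: Bout.
    by rewrite ler0_norm; lra.
  by rewrite /Rintegral integral0.
have H0nd : forall x y, x <= y -> H0 x <= H0 y by apply: le_of_derive_ge0 dH0 B0.
have H0r x : 1 <= x -> H0 x = H0 1.
  move=> x1; have [|c c_ E] := @MVT_segment _ H0 (B 0) 1 x x1 (fun s _ => dH0 s).
    by apply: derivable_within_continuous => s _; have [] := dH0 s.
  apply/eqP; rewrite -subr_eq0 E Bout ?mul0r// ger0_norm; move: c_; rewrite in_itv/=; lra.
have H0p : 0 < H0 1.
  have h1 : - 2^-1 <= 2^-1 :> R by lra.
  have [|c c_ E] := @MVT_segment _ H0 (B 0) _ _ h1 (fun s _ => dH0 s).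
    by apply: derivable_within_continuous => s _; have [] := dH0 s.
  have h2 : H0 (2^-1) <= H0 1 by apply: H0nd; lra.
  have h3 : H0 (-1) <= H0 (- 2^-1) by apply: H0nd; lra.
  have h4 : m0 <= B 0 c by apply: Bm; move: c_; rewrite ler_norml in_itv /= => /andP[? ?]; apply/andP; split; lra.
  have h5 := H0l _ (lexx (-1)).
  have : m0 * (2^-1 - (- 2^-1)) <= H0 2^-1 - H0 (- 2^-1) by rewrite E ler_wpM2r//; lra.
  by rewrite (_ : 2^-1 - _ = 1); [lra|field].
pose Z := (H0 1)^-1.
have Z0 : 0 < Z by rewrite invr_gt0.
pose D k x := Z * (if k is l.+1 then B l x else H0 x).
have H0z x : 0 <= H0 x.
  have [x1|x1] := leP x (-1); first by rewrite H0l.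
  by rewrite -(H0l _ (lexx (-1))); apply: H0nd; exact: ltW.
exists D; split.
- move=> k x; rewrite (_ : D k.+1 x = 0 * (if k is l.+1 then B l x else H0 x) + Z * B k x).
    apply: (isd_mul (is_derive_cst Z x 1)).
    by case: k => [|k]; [exact: dH0|exact: dB].
  by rewrite mul0r add0r.
- split=> x x1; rewrite /D; first by rewrite H0l// mulr0.
  by rewrite H0r// mulVf// gt_eqF.
- move=> x; rewrite /D mulr_ge0 ?(ltW Z0)//= mulrC ler_pdivrMr// mul1r.
  by have [x1|x1] := leP 1 x; [rewrite H0r|apply: H0nd; exact: ltW].
- split; first by move=> x; rewrite /D mulr_ge0 ?(ltW Z0).
  by exists Z => x; rewrite /D -[leRHS]mulr1 ler_wpM2l// ltW.
- exists (Z * m0); first exact: mulr_gt0.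
  by move=> x x2; rewrite /D ler_wpM2l ?Bm// ltW.
Qed.

End smooth_step.

(** * Tensor-product test functions and classical weak gradients *)

Section product_functions.
Context {R : realType} (n : nat).
Implicit Types (x y c : 'rV[R]_n) (r t : R).
Local Notation leb := (lebesgue_rV n : {measure set (borel_rV R n) -> \bar R}).

Section prodf.
Variable a : 'I_n -> nat -> R -> R.
Hypothesis da : forall j k t, is_derive t 1 (a j k) (a j k.+1 t).

(** As [a j k] is the k-th derivative of the j-th factor, a partial derivative only raises one value
    of the multi-index [k]; smoothness is then immediate. *)
Definition prodf (k : 'I_n -> nat) x : R := \prod_j a j (k j) (x ord0 j).

Lemma is_derive_coord (i : 'I_n) x : is_derive x (delta_mx ord0 i) (fun y => y ord0 i) 1.
Proof.
apply/is_derive_line0.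
rewrite (_ : (fun s => _) = (fun s => x ord0 i + s)); last first.
  by apply/funext => s; rewrite !mxE !eqxx mulr1.
have := isd_add (is_derive_cst (x ord0 i) (0 : R) (1 : R)) (is_derive_id (0 : R) (1 : R)).
by rewrite add0r.
Qed.

Lemma prodf_derive k (i : 'I_n) x :
  is_derive x (delta_mx ord0 i) (prodf k) (prodf (fun j => (k j + (j == i))%N) x).
Proof.
have E y : prodf k y = a i (k i) (y ord0 i) * \prod_(j | j != i) a j (k j) (y ord0 j).
  by rewrite /prodf (bigD1 i).
rewrite [X in is_derive _ _ _ X](_ : _ =
   a i (k i).+1 (x ord0 i) * 1 * \prod_(j | j != i) a j (k j) (x ord0 j)); last first.
  rewrite /prodf (bigD1 i)//= eqxx addn1 mulr1; congr (_ * _).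
  by apply: eq_bigr => j /negbTE ->; rewrite addn0.
apply/is_derive_line0.
rewrite (_ : (fun s => _) = (fun s => a i (k i) ((x + s *: delta_mx ord0 i) ord0 i) *
   \prod_(j | j != i) a j (k j) (x ord0 j))); last first.
  apply/funext => s; rewrite E; congr (_ * _); apply: eq_bigr => j /negbTE ji.
  by rewrite !mxE ji ?andbF /= ?mulr0 ?addr0.
have /is_derive_line0 D := isd_comp (da i (k i) _) (is_derive_coord i x).
have := isd_mul D (is_derive_cst (\prod_(j | j != i) a j (k j) (x ord0 j)) (0 : R) (1 : R)).
by rewrite mulr0 addr0.
Qed.

Lemma prodf_continuous k : continuous (prodf k).
Proof.
have ca j m : continuous (a j m) by apply: is_derive_continuous; exact: da.
suff h s : continuous (fun x : 'rV[R]_n => \prod_(j <- s) a j (k j) (x ord0 j)) by exact: h.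
elim: s => [|j s IH].
  by rewrite (_ : (fun=> _) = cst 1); [exact: cst_continuous|apply/funext => x; rewrite big_nil].
rewrite (_ : (fun=> _) = (fun x => a j (k j) (x ord0 j) * \prod_(j <- s) a j (k j) (x ord0 j))); last first.
  by apply/funext => x; rewrite big_cons.
move=> x; apply: continuousM; last exact: IH.
apply: (@continuous_comp _ _ _ (fun y : 'rV[R]_n => y ord0 j) (a j (k j))).
  exact: coord_continuous.
exact: ca.
Qed.

Lemma partial_prodf k (i : 'I_n) : partial i (prodf k) = prodf (fun j => (k j + (j == i))%N).
Proof. by apply/funext => x; have [_ <-] := prodf_derive k i x. Qed.

Lemma prodf_smooth k : smooth (prodf k).
Proof.
move=> s; have [k' ->] : exists k', foldr (@partial R n) (prodf k) s = prodf k'.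
  elim: s => [|i s [k' IH]]; first by exists k.
  by exists (fun j => (k' j + (j == i))%N); rewrite /= IH partial_prodf.
by split; [exact: prodf_continuous|move=> i x; have [] := prodf_derive k' i x].
Qed.

Lemma prodf_out k c r : 0 <= r ->
  (forall j u, r < `|u - c ord0 j| -> a j (k j) u = 0) ->
  forall x, ~ cube c r x -> prodf k x = 0.
Proof.
move=> r0 ha x; rewrite /cube /= => /negP; rewrite -ltNge => rx.
have [j rj] : exists j, r < `|x ord0 j - c ord0 j|.
  apply: contrapT => /forallNP h.
  move: rx; rewrite ltNge => /negP; apply; apply/(rV_norm_le _ r0) => i.
  by rewrite !mxE leNgt; apply/negP/h.
by rewrite /prodf (bigD1 j)//= ha// mul0r.
Qed.

Lemma prodf_test k c r : 0 <= r ->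
  (forall j u, r < `|u - c ord0 j| -> a j (k j) u = 0) -> test_function (prodf k).
Proof.
move=> r0 ha; split; first exact: prodf_smooth.
by exists (cube c r); [exact: cube_compact|exact: prodf_out].
Qed.

End prodf.

Lemma test_function_derive (phi : 'rV[R]_n -> R) i x : test_function phi ->
  is_derive x (delta_mx ord0 i) phi (partial i phi x).
Proof. by move=> [/(_ [::])[_ h] _]; split => //; exact: h. Qed.

Lemma test_function_continuous (phi : 'rV[R]_n -> R) : test_function phi -> continuous phi.
Proof. by move=> [/(_ [::])[h _] _]. Qed.

Lemma test_function_partial_continuous (phi : 'rV[R]_n -> R) i : test_function phi ->
  continuous (partial i phi).
Proof. by move=> [/(_ [:: i])[h _] _]. Qed.

Lemma test_function_out (phi : 'rV[R]_n -> R) : test_function phi ->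
  exists2 M, 0 <= M & forall x, M < `|x| -> phi x = 0 /\ forall i, partial i phi x = 0.
Proof.
move=> tphi; have [_ [K cK K0]] := tphi.
have [M [_ hM]] := compact_bounded cK.
have out x : `|M| + 1 < `|x| -> phi x = 0.
  move=> Mx; apply: K0 => Kx; have := hM (`|M| + 1).
  rewrite (le_lt_trans (ler_norm M)) ?ltrDl// => /(_ isT x Kx) /=.
  by rewrite leNgt Mx.
exists (`|M| + 1); first by rewrite addr_ge0.
move=> x Mx; split; first exact: out.
move=> i; have h := test_function_derive i x tphi.
have : is_derive x (delta_mx ord0 i) phi 0.
  apply: (near_eq_is_derive _ (is_derive_cst (0 : R) x (delta_mx ord0 i))).
  near=> y; rewrite out//; near: y.
  apply: (@cvgr_gt _ _ _ _ (fun y : 'rV[R]_n => `|y|) `|x|) => //; exact: norm_continuous.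
by move=> [_ E0]; case: h => _ E; rewrite -E0 -E.
Unshelve. all: by end_near. Qed.

Lemma integrable_compact_support (f : 'rV[R]_n -> R) M : continuous f ->
  (forall x, M < `|x| -> f x = 0) -> leb.-integrable setT (EFin \o (f : borel_rV R n -> R)).
Proof.
move=> cf f0; have f0' x : ~ cube 0 M x -> f x = 0.
  by rewrite /cube /= subr0 => /negP; rewrite -ltNge => /f0.
have [B B0 fB] := continuous_bounded_cube 0 M cf.
apply: (integrable_bounded_cube (M := B) _ _ f0') => [|x].
  exact: continuous_measurable_rV.
by have [/fB//|/f0' ->] := pselect (cube 0 M x); rewrite normr0.
Qed.

(** Integration by parts: the i-th derivative of the compactly supported product [F * phi] has
    integral zero by [integral_derive_compact]. *)
Lemma classical_weak_gradient (F Gi : 'rV[R]_n -> R) i phi : continuous F ->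
  (forall x, is_derive x (delta_mx ord0 i) F (Gi x)) ->
  (forall M : R, exists C : R, forall x, `|x| <= M -> `|Gi x| <= C) ->
  test_function phi ->
  (\int[leb]_x (F x * partial i phi x)%:E = - \int[leb]_x (Gi x * phi x)%:E)%E.
Proof.
move=> cF dF bG tphi.
have [M M0 out] := test_function_out tphi.
have cphi := test_function_continuous tphi.
have cdphi := test_function_partial_continuous (i := i) tphi.
have dphi x := test_function_derive i x tphi.
pose psi x := F x * phi x.
pose dpsi x := Gi x * phi x + F x * partial i phi x.
have [C GC] := bG M.
have [B1 B10 phiB] := continuous_bounded_cube 0 M cphi.
have [B2 B20 dphiB] := continuous_bounded_cube 0 M cdphi.
have [B3 B30 FB] := continuous_bounded_cube 0 M cF.
have cubeM x : `|x| <= M -> cube 0 M x by rewrite /cube /= subr0.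
have [] := @integral_derive_compact R n i psi dpsi M (C * B1 + B3 * B2).
- by move=> x; apply: continuousM; [exact: cF|exact: cphi].
- by move=> x; exact: isd_mul.
- move=> x; have [xM|Mx] := leP `|x| M.
    rewrite (le_trans (ler_normD _ _))// !normrM lerD// ler_pM//.
    + exact: GC.
    + exact/phiB/cubeM.
    + exact/FB/cubeM.
    + exact/dphiB/cubeM.
  have [p0 dp0] := out _ Mx; rewrite /dpsi p0 dp0 !mulr0 addr0 normr0.
  have C0 : 0 <= C by apply: le_trans (GC 0 _); rewrite ?normr0.
  by rewrite addr_ge0// mulr_ge0.
- by move=> x /out[p0 _]; rewrite /psi p0 mulr0.
move=> mdpsi Idpsi I0.
have IF : leb.-integrable setT (EFin \o ((fun x => F x * partial i phi x) : borel_rV R n -> R)).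
  apply: (@integrable_compact_support _ M).
    by move=> x; apply: continuousM; [exact: cF|exact: cdphi].
  by move=> x /out[_ ->]; rewrite mulr0.
rewrite [X in (- X)%E](_ : _ = \int[leb]_x ((EFin \o (dpsi : borel_rV R n -> R)) \-
    (EFin \o ((fun x => (F x * partial i phi x)%R) : borel_rV R n -> R))) x)%E; last first.
  by apply: eq_integral => x _ /=; rewrite /dpsi -EFinB addrK.
by rewrite (integralB measurableT Idpsi IF) I0 sub0e oppeK.
Qed.

End product_functions.

(** The factors of [u] are replaced by those of [v] one at a time from the left; the i-th
    replacement leaves a product with one factor [u i - v i]. *)
Lemma telescope_prod (R : realType) (n : nat) (u v : 'I_n -> R) :
  \prod_j u j - \prod_j v j =
  \sum_(i < n) \prod_(j < n) (if (j < i)%N then v j else if (i < j)%N then u j else u j - v j).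
Proof.
pose P (k : nat) := \prod_(j < n) (if (j < k)%N then v j else u j).
transitivity (\sum_(i < n) (P i - P i.+1)).
  transitivity (P 0%N - P n).
    by rewrite /P; congr (_ - _); apply: eq_bigr => j _; rewrite ?ltn_ord.
  rewrite -(big_mkord xpredT (fun i => P i - P i.+1)).
  rewrite (eq_bigr (fun i => - (P i.+1 - P i))); last by move=> i _; rewrite opprB.
  by rewrite sumrN telescope_sumr// opprB.
apply: eq_bigr => i _.
rewrite /P (bigD1 i)//= ltnn [in X in _ - X](bigD1 i)//= ltnSn [RHS](bigD1 i)//= !ltnn.
rewrite mulrBl; congr (_ * _ - _ * _); apply: eq_bigr => j ji.
  case: ltngtP => // /val_inj E; by rewrite E eqxx in ji.
by rewrite ltnS; case: ltngtP => // /val_inj E; rewrite E eqxx in ji.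
Qed.

Lemma sume_const (R : realType) (n : nat) (x : \bar R) : (0 <= x)%E ->
  (\sum_(i < n) x = n%:R%:E * x)%E.
Proof.
move=> x0; elim: n => [|n IH]; first by rewrite big_ord0 mul0e.
by rewrite big_ord_recr/= IH -natr1 EFinD ge0_muleDl ?lee_fin// mul1e.
Qed.

(** * Comparison of mollified averages through the weak gradient *)

Section morrey.
Context {R : realType} (n : nat).
Implicit Types (x y c z : 'rV[R]_n) (r t rho s : R) (F : 'rV[R]_n -> R) (G : 'rV[R]_n -> 'rV[R]_n).
Local Notation leb := (lebesgue_rV n : {measure set (borel_rV R n) -> \bar R}).

Lemma enorm_ge0 x : 0 <= enorm x.
Proof. exact: sqrtr_ge0. Qed.

Lemma coord_le_enorm x i : `|x ord0 i| <= enorm x.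
Proof.
rewrite -sqrtr_sqr ler_sqrt; last by apply: sumr_ge0 => j _; exact: sqr_ge0.
by rewrite (bigD1 i)//= lerDl; apply: sumr_ge0 => j _; exact: sqr_ge0.
Qed.

Lemma measurable_enorm (G : 'rV[R]_n -> 'rV[R]_n) :
  (forall i, measurable_fun setT ((fun x => G x ord0 i) : borel_rV R n -> R)) ->
  measurable_fun setT ((fun x => enorm (G x)) : borel_rV R n -> R).
Proof.
move=> mG; apply: (@measurableT_comp _ _ _ _ _ _ (@Num.sqrt R)).
  by apply: continuous_measurable_fun; exact: sqrt_continuous.
by apply: measurable_sum => i; apply: measurable_funX.
Qed.

Lemma weak_pairing_le F G i (phi : 'rV[R]_n -> R) (B : R) c rho :
  (forall i, measurable_fun setT ((fun x => G x ord0 i) : borel_rV R n -> R)) ->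
  weak_gradient F G -> test_function phi -> 0 <= B ->
  (forall x, `|phi x| <= B) -> (forall x, ~ cube c rho x -> phi x = 0) ->
  (`| \int[leb]_x (F x * partial i phi x)%:E | <=
   B%:E * \int[leb]_(x in cube c rho) (enorm (G x))%:E)%E.
Proof.
move=> mG wG tphi B0 phiB phi0; rewrite wG// abseN.
have mphi : measurable_fun setT (phi : borel_rV R n -> R).
  by apply: continuous_measurable_rV; exact: test_function_continuous.
apply: le_trans (le_abse_integral _ _ _) _ => //.
  by apply/measurable_EFinP; apply: measurable_funM.
rewrite -ge0_integralZl_EFin//; last 3 first.
- exact: measurable_cube.
- by move=> x _; rewrite lee_fin enorm_ge0.
- by apply/measurable_EFinP; apply: measurable_funTS; exact: measurable_enorm.
rewrite [leRHS]integral_mkcond; apply: ge0_le_integral_nm => // x _ /=.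
rewrite patchE; case: ifPn => [|/negP]; rewrite ?inE => cx.
  by rewrite -EFinM lee_fin normrM mulrC ler_pM// coord_le_enorm.
by rewrite phi0 ?mulr0 ?normr0// => h; apply: cx; rewrite inE.
Qed.

Variables (D : nat -> R -> R) (M m : R).
Hypothesis dD : forall k (u : R), is_derive u (1 : R) (D k) (D k.+1 u).
Hypothesis Dl : forall u, u <= -1 -> D 0 u = 0.
Hypothesis Dr : forall u, 1 <= u -> D 0 u = 1.
Hypothesis D01 : forall u, 0 <= D 0 u <= 1.
Hypothesis D1_ge0 : forall u, 0 <= D 1%N u.
Hypothesis D1_le : forall u, D 1%N u <= M.
Hypothesis m0 : 0 < m.
Hypothesis D1_gt : forall u, `|u| <= 2^-1 -> m <= D 1%N u.

Let M0 : 0 <= M. Proof. exact: le_trans (D1_le 0). Qed.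

Lemma D1_out u : 1 < `|u| -> D 1%N u = 0.
Proof.
move=> u1; have [C ncC] : exists C : R, \near u, cst C u = D 0 u.
  have [u0|u0] := leP 0 u.
    exists 1; near=> v; rewrite Dr//; apply: ltW; near: v.
    by apply: (@cvgr_gt _ _ _ _ (fun v : R => v) u); [exact: cvg_id|rewrite -(ger0_norm u0)].
  exists 0; near=> v; rewrite Dl//; apply: ltW; near: v.
  apply: (@cvgr_lt _ _ _ _ (fun v : R => v) u); first exact: cvg_id.
  by move: u1; rewrite ltr0_norm//; lra.
have [_ E] := dD 0 u.
by have [_ E'] := near_eq_is_derive ncC (is_derive_cst C u (1 : R)); rewrite -E -E'.
Unshelve. all: by end_near. Qed.

(** The power of [r] keeps [sc c r k.+1] the derivative of [sc c r k]. Thus [sc c r 1] is a bump of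
    width [r] at [c] and [sc c r 0] is its primitive, a step from 0 to 1. *)
Definition sc (c r : R) (k : nat) (u : R) : R := r^-1 ^+ k * D k ((u - c) / r).

Lemma sc_derive (c : R) r k (u : R) : is_derive u (1 : R) (sc c r k) (sc c r k.+1 u).
Proof.
have d1 : is_derive u 1 (fun v : R => (v - c) / r) r^-1.
  have := isd_mul (isd_add (is_derive_id u (1 : R)) (is_derive_cst (- c) u (1 : R))) (is_derive_cst r^-1 u (1 : R)).
  by move=> h; apply: is_derive_eq h _; rewrite /cst /=; ring.
have := isd_mul (is_derive_cst (r^-1 ^+ k) u (1 : R)) (isd_comp (dD k _) d1).
by move=> h; apply: is_derive_eq h _; rewrite /cst /sc /= exprS; ring.
Qed.

Definition phi x r : 'rV[R]_n -> R := prodf (fun j => sc (x ord0 j) r) (fun=> 1%N).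

(** Factors of the i-th term in the telescoped difference [phi x r - phi y t]. In coordinate i the
    primitives are used: both steps are 0 far to the left and 1 far to the right, so their
    difference has compact support, and the term is the i-th partial derivative of a test
    function. *)
Definition theta_fam (i : 'I_n) x r y t (j : 'I_n) : nat -> R -> R :=
  if (j < i)%N then sc (y ord0 j) t else
  if (i < j)%N then sc (x ord0 j) r else
  (fun k u => sc (x ord0 j) r k u - sc (y ord0 j) t k u).

Definition theta i x r y t := prodf (theta_fam i x r y t) (fun j => nat_of_bool (j != i)).

Lemma theta_fam_derive i x r y t j k u :
  is_derive u (1 : R) (theta_fam i x r y t j k) (theta_fam i x r y t j k.+1 u).
Proof.
rewrite /theta_fam; case: ifP => _; first exact: sc_derive.
case: ifP => _; first exact: sc_derive.
by apply: (isd_add (sc_derive _ _ _ _)); apply: isd_opp; exact: sc_derive.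
Qed.

Lemma phi_diff x r y t z :
  phi x r z - phi y t z = \sum_i partial i (theta i x r y t) z.
Proof.
rewrite /phi /prodf telescope_prod; apply: eq_bigr => i _.
rewrite /theta (partial_prodf (theta_fam_derive i x r y t)) /prodf.
apply: eq_bigr => j _; rewrite (_ : ((j != i) + (j == i) = 1)%N); last by case: (j == i).
by rewrite /theta_fam; case: ifP => // _; case: ifP.
Qed.

Lemma sc1_out (c : R) r u : 0 < r -> r < `|u - c| -> sc c r 1 u = 0.
Proof.
move=> r0 h; rewrite /sc D1_out ?mulr0// normrM normfV (gtr0_norm r0).
by rewrite ltr_pdivlMr// mul1r.
Qed.

Lemma sc1_bound (c : R) r s u : 0 < s -> s <= r -> 0 <= sc c r 1 u <= M / s.
Proof.
move=> s0 sr; have r0 := lt_le_trans s0 sr.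
rewrite /sc expr1 mulr_ge0 ?invr_ge0 ?(ltW r0)//= mulrC ler_pM ?invr_ge0 ?(ltW r0)//.
by rewrite lef_pV2.
Qed.

Section theta.
Variables (x y c : 'rV[R]_n) (r t rho s : R).
Hypotheses (s0 : 0 < s) (sr : s <= r) (st : s <= t).
Hypotheses (xr : `|x - c| + r <= rho) (yt : `|y - c| + t <= rho).

Let r0 : 0 < r. Proof. exact: lt_le_trans sr. Qed.
Let t0 : 0 < t. Proof. exact: lt_le_trans st. Qed.
Let rho0 : 0 <= rho. Proof. by apply: le_trans xr; rewrite addr_ge0// ltW. Qed.

Let coord_out (w : 'rV[R]_n) (q : R) j u : `|w - c| + q <= rho ->
  rho < `|u - c ord0 j| -> q < `|u - w ord0 j|.
Proof.
move=> h1 h2; have := rV_coord_le (w - c) j; rewrite !mxE => h3.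
have : `|u - c ord0 j| <= `|u - w ord0 j| + `|w ord0 j - c ord0 j|.
  by rewrite (le_trans _ (ler_normD _ _))// addrA subrK.
lra.
Qed.

Lemma theta_fam_out i j u : rho < `|u - c ord0 j| ->
  theta_fam i x r y t j (nat_of_bool (j != i)) u = 0.
Proof.
move=> h; have hx := coord_out xr h; have hy := coord_out yt h.
rewrite /theta_fam; case: ltngtP => [ji|ij|/val_inj E].
- by rewrite (_ : j != i) ?sc1_out//; apply: contraTneq ji => ->; rewrite ltnn.
- by rewrite (_ : j != i) ?sc1_out//; apply: contraTneq ij => ->; rewrite ltnn.
subst j; rewrite eqxx /= /sc !expr0 !mul1r.
have := rV_coord_le (x - c) i; have := rV_coord_le (y - c) i.
rewrite !mxE !ler_norml => /andP[h1 h2] /andP[h3 h4].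
have x1 : x ord0 i - c ord0 i + r <= rho by apply: le_trans xr; rewrite lerD2r.
have x2 : r - rho <= x ord0 i - c ord0 i by apply: le_trans h3; rewrite lerBlDl lerBrDr addrC.
have y1 : y ord0 i - c ord0 i + t <= rho by apply: le_trans yt; rewrite lerD2r.
have y2 : t - rho <= y ord0 i - c ord0 i by apply: le_trans h1; rewrite lerBlDl lerBrDr addrC.
have [cu|uc] := leP (c ord0 i) u.
  move: h; rewrite ger0_norm ?subr_ge0// => h.
  have -> : D 0 ((u - x ord0 i) / r) = 1 by apply: Dr; rewrite ler_pdivlMr// mul1r; lra.
  have -> : D 0 ((u - y ord0 i) / t) = 1 by apply: Dr; rewrite ler_pdivlMr// mul1r; lra.
  by rewrite subrr.
move: h; rewrite ltr0_norm ?subr_lt0// => h.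
have -> : D 0 ((u - x ord0 i) / r) = 0 by apply: Dl; rewrite ler_pdivrMr// mulN1r; lra.
have -> : D 0 ((u - y ord0 i) / t) = 0 by apply: Dl; rewrite ler_pdivrMr// mulN1r; lra.
by rewrite subrr.
Qed.

Lemma theta_out i z : ~ cube c rho z -> theta i x r y t z = 0.
Proof. by apply: prodf_out => // j u; exact: theta_fam_out. Qed.

Lemma theta_test i : test_function (theta i x r y t).
Proof.
apply: (@prodf_test _ _ _ (theta_fam_derive i x r y t) _ c rho) => // j u.
exact: theta_fam_out.
Qed.

(** The i-th factor is a difference of two values in [0, 1]; the other n - 1 factors are bumps of
    height at most [M / s]. *)
Lemma theta_bound i z : `|theta i x r y t z| <= (M / s) ^+ n.-1.
Proof.
rewrite /theta /prodf normr_prod (bigD1 i)//=.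
rewrite [leRHS](_ : _ = 1 * \prod_(j < n | j != i) (M / s)); last first.
  by rewrite mul1r prodr_const cardC1 card_ord.
apply: ler_pM => //; first by apply: prodr_ge0.
  rewrite /theta_fam ltnn eqxx /= /sc !expr0 !mul1r ler_norml.
  have := D01 ((z ord0 i - x ord0 i) / r); have := D01 ((z ord0 i - y ord0 i) / t).
  by move=> /andP[? ?] /andP[? ?]; apply/andP; split; lra.
apply: ler_prod => j ji; rewrite normr_ge0 /= ji.
rewrite /theta_fam; case: ltngtP => [_|_|/val_inj E]; last by rewrite E eqxx in ji.
  by have /andP[? ?] := sc1_bound (y ord0 j) (z ord0 j) s0 st; rewrite ger0_norm.
by have /andP[? ?] := sc1_bound (x ord0 j) (z ord0 j) s0 sr; rewrite ger0_norm.
Qed.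

End theta.

Lemma phi_continuous x r : continuous (phi x r).
Proof. by apply: prodf_continuous => j k u; exact: sc_derive. Qed.

Lemma phi_out x r z : 0 < r -> ~ cube x r z -> phi x r z = 0.
Proof.
move=> r0; apply: (prodf_out (c := x) (ltW r0)) => j u h; exact: sc1_out.
Qed.

Lemma phi_ge0 x r z : 0 < r -> 0 <= phi x r z.
Proof.
by move=> r0; apply: prodr_ge0 => j _; have /andP[] := sc1_bound (x ord0 j) (z ord0 j) r0 (lexx r).
Qed.

Lemma phi_le x r z : 0 < r -> phi x r z <= (M / r) ^+ n.
Proof.
move=> r0; rewrite [leRHS](_ : _ = \prod_(j < n) (M / r)); last first.
  by rewrite prodr_const card_ord.
by apply: ler_prod => j _; exact: sc1_bound.
Qed.

Lemma out_cube_norm x r z : `|x| + r < `|z| -> ~ cube x r z.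
Proof.
move=> h; rewrite /cube /= => h2.
have : `|z| <= `|z - x| + `|x| by rewrite -{1}[z](subrK x) ler_normD.
by lra.
Qed.

Definition avg (F : 'rV[R]_n -> R) x r : R := (\int[leb]_z (F z * phi x r z))%R.

Lemma avg_integrable F x r : continuous F -> 0 < r ->
  leb.-integrable setT (EFin \o ((fun z => F z * phi x r z) : borel_rV R n -> R)).
Proof.
move=> cF r0; apply: (@integrable_compact_support _ _ _ (`|x| + r)).
  by move=> z; apply: continuousM; [exact: cF|exact: phi_continuous].
by move=> z /out_cube_norm/(phi_out r0) ->; rewrite mulr0.
Qed.

(** By [phi_diff] the difference of the averages is a sum of n pairings of [F] with a partial
    derivative of a test function supported in [cube c rho]. The weak gradient moves each derivative
    onto [G]. *)
Lemma avg_diff F G x y c r t rho s : continuous F ->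
  (forall i, measurable_fun setT ((fun x => G x ord0 i) : borel_rV R n -> R)) ->
  weak_gradient F G -> 0 < s -> s <= r -> s <= t ->
  `|x - c| + r <= rho -> `|y - c| + t <= rho ->
  (`|avg F x r - avg F y t|%:E <=
   (n%:R * (M / s) ^+ n.-1)%:E * \int[leb]_(x in cube c rho) (enorm (G x))%:E)%E.
Proof.
move=> cF mG wG s0 sr st xr yt.
have r0 := lt_le_trans s0 sr; have t0 := lt_le_trans s0 st.
have Ix := avg_integrable x cF r0; have Iy := avg_integrable y cF t0.
have tth i := theta_test s0 sr st xr yt i.
have IT i : leb.-integrable setT (fun z : borel_rV R n => (F z * partial i (theta i x r y t) z)%:E).
  have [M1 M10 out] := test_function_out (tth i).
  apply: (@integrable_compact_support _ _ (fun z => F z * partial i (theta i x r y t) z) M1).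
    by move=> z; apply: continuousM; [exact: cF|exact: test_function_partial_continuous].
  by move=> z /out[_ ->]; rewrite mulr0.
have E : ((avg F x r - avg F y t)%:E =
   \sum_(i < n) \int[leb]_z (F z * partial i (theta i x r y t) z)%:E)%E.
  rewrite /avg -RintegralB// /Rintegral fineK; last first.
    by apply: integrable_fin_num => //; have := integrableB measurableT Ix Iy.
  rewrite -integral_sum//; apply: eq_integral => z _.
  by rewrite sumEFin -mulr_sumr -phi_diff mulrBr.
rewrite -abse_EFin E (le_trans (lee_abs_sum _ _ _))//.
have B0 : 0 <= (M / s) ^+ n.-1 by rewrite exprn_ge0// divr_ge0// ltW.
apply: (@le_trans _ _ (\sum_(i < n) ((M / s) ^+ n.-1)%:E * \int[leb]_(x in cube c rho) (enorm (G x))%:E)%E).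
  apply: lee_sum => i _; apply: weak_pairing_le => //.
  - by move=> z; exact: (theta_bound _ _ s0 sr st).
  - by move=> z; exact: (theta_out s0 sr st xr yt).
rewrite sume_const ?EFinM ?muleA// mule_ge0//; apply: integral_ge0 => z _.
by rewrite lee_fin enorm_ge0.
Qed.

Lemma avg1_integrable x r : 0 < r ->
  leb.-integrable setT (EFin \o ((fun z => 1 * phi x r z) : borel_rV R n -> R)).
Proof. by move=> r0; apply: (@avg_integrable (fun=> 1)) => //; exact: cst_continuous. Qed.

(** The common integral of all the mollifiers; its value is never computed, only its positivity
    matters. *)
Definition cphi : R := avg (fun=> 1) 0 1.

(** [avg_diff] for the constant function 1, whose weak gradient is 0. *)
Lemma cphiE x r : 0 < r -> avg (fun=> 1) x r = cphi.
Proof.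
move=> r0; apply/eqP; rewrite -subr_eq0 -normr_le0 -lee_fin.
have s0 : 0 < Num.min r 1 by rewrite lt_min r0 ltr01.
have wG : weak_gradient (fun=> 1 : R) (fun=> 0 : 'rV[R]_n).
  move=> i f tf; rewrite (@classical_weak_gradient R n (fun=> 1) (fun=> 0) i f)//.
  - by congr (- _)%E; apply: eq_integral => z _; rewrite mxE.
  - exact: cst_continuous.
  - by move=> B; exists 0 => z _; rewrite normr0.
have := @avg_diff (fun=> 1) (fun=> 0) x 0 0 r 1 (Num.max (`|x| + r) 1) _ (@cst_continuous _ _ _) _ wG s0.
rewrite ge_min lexx ge_min lexx orbT !subr0 normr0 add0r !le_max !lexx orbT.
move=> /(_ _ isT isT isT isT) /le_trans; apply.
  by move=> i; rewrite (_ : (fun=> _) = cst 0)//; apply/funext => z; rewrite mxE.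
rewrite integral0_eq ?mule0// => z _.
by rewrite /enorm big1 ?sqrtr0// => i _; rewrite mxE expr0n.
Qed.

(** The mollifier is at least [m ^+ n] on the cube of radius 1/2, which has volume 1. *)
Lemma cphi_gt0 : 0 < cphi.
Proof.
have i1 := avg1_integrable 0 ltr01.
rewrite (lt_le_trans (exprn_gt0 n m0))// -lee_fin /cphi /avg /Rintegral fineK; last exact: integrable_fin_num.
apply: (@le_trans _ _ (\int[leb]_(x in cube 0 2^-1) (m ^+ n)%:E)%E).
  by rewrite integral_cst ?leb_cube//; [rewrite mulfV// expr1n mule1|exact: measurable_cube].
rewrite [leLHS]integral_mkcond; apply: ge0_le_integral_nm => z _.
  by rewrite patchE; case: ifPn => // _; rewrite lee_fin exprn_ge0// ltW.
rewrite patchE; case: ifPn => [|_]; last by rewrite lee_fin mul1r phi_ge0.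
rewrite inE /cube /= subr0 lee_fin mul1r => z2.
rewrite [leLHS](_ : _ = \prod_(j < n) m); last by rewrite prodr_const card_ord.
apply: ler_prod => j _; rewrite (ltW m0) /= /sc invr1 expr1n mul1r mxE subr0 mulr1.
by apply: D1_gt; apply: le_trans z2; exact: rV_coord_le.
Qed.

Lemma avg_cvg F x (e : R) : continuous F -> 0 < e ->
  exists2 r0, 0 < r0 & forall r, 0 < r -> r <= r0 -> `|avg F x r - cphi * F x| <= e.
Proof.
move=> cF e0.
have e'0 : 0 < e / cphi by rewrite divr_gt0// cphi_gt0.
have /cvgrPdist_le/(_ _ e'0)/nbhs_ballP[r1 /= r10 hr1] := cF x.
exists (r1 / 2); first by rewrite divr_gt0.
move=> r r0 rr1; rewrite -(cphiE x r0) mulrC -RintegralZl//; last exact: avg1_integrable.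
have IF := avg_integrable x cF r0.
have I1 : leb.-integrable setT (EFin \o ((fun z => F x * (1 * phi x r z)) : borel_rV R n -> R)).
  have := integrableZl measurableT (F x) (avg1_integrable x r0).
  by apply: eq_integrable => // z _ /=; rewrite -EFinM.
rewrite /avg -RintegralB//.
have IB := integrableB measurableT IF I1.
rewrite (le_trans (le_normr_Rintegral _ _))//.
rewrite -[leRHS](mulfVK (lt0r_neq0 cphi_gt0)) -[X in _ <= _ / _ * X](cphiE x r0) /avg -RintegralZl//; last exact: avg1_integrable.
apply: le_Rintegral => //.
- by apply: integrable_norm => //; exact: IB.
- have := integrableZl measurableT (e / cphi) (avg1_integrable x r0).
  by apply: eq_integrable => // z _ /=; rewrite -EFinM.
move=> z _; rewrite !mul1r -mulrBl normrM (ger0_norm (phi_ge0 _ _ r0)).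
have [cz|/(phi_out r0) ->] := pselect (cube x r z); last by rewrite !mulr0.
apply: ler_wpM2r; first exact: phi_ge0.
rewrite distrC; apply: hr1; rewrite mx_norm_ball /ball_ /= distrC (le_lt_trans cz)//.
by rewrite (le_lt_trans rr1)//; lra.
Qed.

Lemma avg_le F x r : continuous F -> 0 < r ->
  (`|avg F x r|%:E <= ((M / r) ^+ n)%:E * \int[leb]_(z in cube x r) `|F z|%:E)%E.
Proof.
move=> cF r0; have IF := avg_integrable x cF r0.
rewrite -abse_EFin /avg /Rintegral fineK; last exact: integrable_fin_num.
apply: le_trans (le_abse_integral _ _ _) _ => //.
  by have /integrableP[] := IF.
have mF : measurable_fun setT ((fun z => `|F z|) : borel_rV R n -> R).
  by apply: continuous_measurable_rV => z; apply: continuous_comp; [exact: cF|exact: norm_continuous].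
rewrite -ge0_integralZl_EFin//; last 3 first.
- exact: measurable_cube.
- by apply/measurable_EFinP; apply: measurable_funTS; exact: mF.
- by rewrite exprn_ge0// divr_ge0// ltW.
rewrite [leRHS]integral_mkcond; apply: ge0_le_integral_nm => // z _ /=.
rewrite patchE; case: ifPn => [|/negP]; rewrite ?inE => cx.
  by rewrite -EFinM lee_fin normrM mulrC ler_wpM2r// ger0_norm ?phi_ge0// phi_le.
by rewrite phi_out ?mulr0 ?normr0.
Qed.

End morrey.

Section powR_facts.
Context {R : realType}.
Implicit Types x y p : R.

Lemma powR_add_le x y p : 0 < p -> 0 <= x -> 0 <= y ->
  (x + y) `^ p <= 2 `^ p * (x `^ p + y `^ p).
Proof.
move=> p0 x0 y0; wlog xy : x y x0 y0 / x <= y.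
  by move=> h; have [/h|/ltW/h] := leP x y; [|rewrite addrC [x `^ p + _]addrC]; apply.
apply: (@le_trans _ _ ((2 * y) `^ p)).
  by rewrite ge0_ler_powR ?nnegrE ?(ltW p0)//; lra.
by rewrite powRM// ler_wpM2l ?powR_ge0// lerDr powR_ge0.
Qed.

Lemma poweR_root_le (A : \bar R) (B p : R) : 0 < p -> (0 <= A)%E -> 0 <= B ->
  (A `^ p <= B%:E)%E -> (A <= (B `^ p^-1)%:E)%E.
Proof.
move=> p0 A0 B0 AB.
have : ((A `^ p) `^ p^-1 <= (B%:E) `^ p^-1)%E.
  apply: gt0_ler_poweR => //; rewrite ?invr_ge0 ?(ltW p0)// in_itv /= ?leey ?poweR_ge0 ?lee_fin ?B0//.
by rewrite -poweRrM mulfV ?gt_eqF// poweRe1.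
Qed.

Lemma powR_root_le (A B p : R) : 0 < p -> 0 <= A -> 0 <= B -> A <= B `^ p^-1 -> A `^ p <= B.
Proof.
move=> p0 A0 B0 AB; rewrite -[leRHS](powRr1 B0) -(mulVf (lt0r_neq0 p0)) powRrM.
by rewrite ge0_ler_powR ?nnegrE ?powR_ge0// ltW.
Qed.
End powR_facts.

(** * Morrey's inequality with a distance weight *)

Section weighted_morrey.
Context {R : realType} (n : nat).
Implicit Types (x y c z : 'rV[R]_n) (r t rho s : R) (F : 'rV[R]_n -> R) (G : 'rV[R]_n -> 'rV[R]_n).
Local Notation leb := (lebesgue_rV n : {measure set (borel_rV R n) -> \bar R}).

Lemma cube_sub x y r s : `|x - y| + r <= s -> cube x r `<=` cube y s.
Proof.
move=> h z; rewrite /cube /= => hz; apply: le_trans h.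
have -> : z - y = (z - x) + (x - y) by rewrite addrA subrK.
by rewrite (le_trans (ler_normD _ _))// addrC lerD2l.
Qed.

Variables (p a Cd rho0 : R).
Hypotheses (n0 : (0 < n)%N) (np : n%:R < p) (a0 : 0 < a) (Cd0 : 0 < Cd).
Hypothesis ap : a * (p - 1) < p - n%:R.

Let p1 : 1 < p. Proof. by apply: le_lt_trans np; rewrite ler1n. Qed.
Let p0 : 0 < p. Proof. exact: lt_trans p1. Qed.

(** Isolates what porosity will provide for [d = dist S]. The rate rho^(n-a) is the one dictated by
    scaling when [d] behaves like a length. *)
Definition weight_ok (d : 'rV[R]_n -> R) :=
  [/\ measurable_fun setT (d : borel_rV R n -> R), forall x, 0 <= d x,
   leb [set x | d x = 0] = 0%E &
   forall c rho, 0 < rho -> rho <= rho0 ->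
    (\int[leb]_(z in cube c rho) (d z `^ (- a))%:E <= (Cd * rho `^ (n%:R - a))%:E)%E].

(** [g] is the power of [d] that Hölder's inequality leaves after integrating d^(-a), and
    [kap = 1 - (n + g) / p] is the resulting Hölder exponent of F, with n + g in place of the
    classical n. *)
Let g := a * (p - 1).
Let kap := (p - n%:R - g) / p.
Let kap0 : 0 < kap. Proof. by rewrite divr_gt0// subr_gt0. Qed.

Definition wenergy (d : 'rV[R]_n -> R) G c rho : \bar R :=
  (\int[leb]_(z in cube c rho) (enorm (G z) `^ p * d z `^ g)%:E)%E.

(** Split |G| as (|G| d^a) d^(-a) and apply [weighted_jensen] with kernel d^(-a): the remaining
    power of [d] is [a * p - a = g]. *)
Lemma cube_hoelder d G c rho (J : R) : weight_ok d ->
  (forall i, measurable_fun setT ((fun x => G x ord0 i) : borel_rV R n -> R)) ->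
  0 < rho -> rho <= rho0 -> 0 <= J -> (wenergy d G c rho <= J%:E)%E ->
  (\int[leb]_(z in cube c rho) (enorm (G z))%:E <=
   (((Cd * rho `^ (n%:R - a)) `^ (p - 1) * J) `^ p^-1)%:E)%E.
Proof.
move=> [md d0 dn dint] mG r0 rr0 J0 EJ.
have mg := measurable_enorm mG.
have mcube := @measurable_cube R n c rho.
have mN : measurable ([set x | d x = 0] : set (borel_rV R n)).
  by rewrite -[X in measurable X]setTI; have := md measurableT [set 0] (measurable_set1 _).
have mda : measurable_fun setT ((fun z => d z `^ a) : borel_rV R n -> R).
  by apply: (@measurableT_comp _ _ _ _ _ _ (fun y : R => powR y _)); [exact: measurable_powR|].
have mdna : measurable_fun setT ((fun z => d z `^ (- a)) : borel_rV R n -> R).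
  by apply: (@measurableT_comp _ _ _ _ _ _ (fun y : R => powR y _)); [exact: measurable_powR|].
(* Where [d z = 0] the real power d^(-a) is 0 by convention, so the splitting fails there; that set
   is null and is removed from both integrals. *)
have E0 : (\int[leb]_(z in cube c rho) (enorm (G z))%:E <=
    \int[leb]_(z in cube c rho) ((enorm (G z) * d z `^ a) * d z `^ (- a))%:E)%E.
  rewrite (ge0_negligible_integral mN mcube)//; last 2 first.
  - by apply/measurable_EFinP; exact: measurable_funTS.
  - by move=> z _; rewrite lee_fin enorm_ge0.
  rewrite [leRHS](ge0_negligible_integral mN mcube)//; last 2 first.
  - apply/measurable_EFinP; apply: measurable_funTS; apply: measurable_funM => //.
    exact: measurable_funM.
  - by move=> z _; rewrite lee_fin !mulr_ge0 ?enorm_ge0 ?powR_ge0.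
  apply: ge0_le_integral_nm => z; first by rewrite lee_fin enorm_ge0.
  move=> [_ /= /eqP dz]; rewrite lee_fin -mulrA -powRD; last by rewrite dz implybT.
  by rewrite subrr powRr0 mulr1.
apply: (le_trans E0); apply: poweR_root_le => //.
- by apply: integral_ge0 => z _; rewrite lee_fin !mulr_ge0 ?enorm_ge0 ?powR_ge0.
- by rewrite mulr_ge0// powR_ge0.
have M0 : 0 <= Cd * rho `^ (n%:R - a) by rewrite mulr_ge0 ?powR_ge0// ltW.
apply: (le_trans (weighted_jensen p1 mcube _ _ _ _ M0 (dint _ _ r0 rr0))).
- by apply: measurable_funTS; apply: measurable_funM.
- exact: measurable_funTS.
- by move=> z _; rewrite mulr_ge0 ?enorm_ge0 ?powR_ge0.
- by move=> z _; exact: powR_ge0.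
rewrite EFinM lee_wpmul2l ?lee_fin ?powR_ge0//; apply: le_trans EJ.
rewrite /wenergy le_eqVlt; apply/orP; left; apply/eqP; apply: eq_integral => z _; congr (_%:E).
rewrite powRM ?enorm_ge0 ?powR_ge0// -mulrA; congr (_ * _).
rewrite -powRrM -powRD; first by congr (_ `^ _); rewrite /g; ring.
have g0 : 0 < g by rewrite /g mulr_gt0// subr_gt0.
have -> : a * p - a = g by rewrite /g; ring.
by rewrite gt_eqF.
Qed.

Section morrey_steps.
Variables (D : nat -> R -> R) (M m : R).
Hypothesis dD : forall k (u : R), is_derive u (1 : R) (D k) (D k.+1 u).
Hypothesis Dl : forall u : R, u <= -1 -> D 0 u = 0.
Hypothesis Dr : forall u : R, 1 <= u -> D 0 u = 1.
Hypothesis D01 : forall u : R, 0 <= D 0 u <= 1.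
Hypothesis D1_ge0 : forall u : R, 0 <= D 1%N u.
Hypothesis D1_le : forall u : R, D 1%N u <= M.
Hypothesis m0 : 0 < m.
Hypothesis D1_gt : forall u : R, `|u| <= 2^-1 -> m <= D 1%N u.

Let M0 : 0 <= M. Proof. exact: le_trans (D1_le 0). Qed.
Local Notation avg := (avg (n := n) D).
Local Notation cphi := (cphi n D).

Let C1 := n%:R * (2 * M) ^+ n.-1 * Cd `^ ((p - 1) / p).
Let C1_ge0 : 0 <= C1.
Proof. by rewrite /C1 !mulr_ge0 ?powR_ge0// exprn_ge0// mulr_ge0. Qed.

Variables (d : 'rV[R]_n -> R) (F : 'rV[R]_n -> R) (G : 'rV[R]_n -> 'rV[R]_n).
Hypotheses (wd : weight_ok d) (cF : continuous F) (wG : weak_gradient F G).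
Hypothesis mG : forall i, measurable_fun setT ((fun x => G x ord0 i) : borel_rV R n -> R).

Lemma avg_step (J : R) x y c r t rho : 0 < rho -> rho <= rho0 -> rho / 2 <= r -> rho / 2 <= t ->
  `|x - c| + r <= rho -> `|y - c| + t <= rho ->
  0 <= J -> (wenergy d G c rho <= J%:E)%E ->
  `|avg F x r - avg F y t| <= C1 * rho `^ kap * J `^ p^-1.
Proof.
move=> r0 rr0 hr ht hx hy J0 hJ; have s0 : 0 < rho / 2 by rewrite divr_gt0.
have := @avg_diff R n D M dD Dl Dr D01 D1_ge0 D1_le F G x y c r t rho _ cF mG wG s0 hr ht hx hy.
rewrite -lee_fin => /le_trans; apply.
apply: (@le_trans _ _ ((n%:R * (M / (rho / 2)) ^+ n.-1)%:E * (((Cd * rho `^ (n%:R - a)) `^ (p - 1) * J) `^ p^-1)%:E)%E).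
  apply: lee_wpmul2l; last exact: (cube_hoelder wd).
  rewrite lee_fin mulr_ge0// exprn_ge0// divr_ge0//; exact: ltW.
rewrite -EFinM lee_fin powRM ?powR_ge0// powRM ?powR_ge0 ?(ltW Cd0)//.
rewrite le_eqVlt; apply/orP; left; apply/eqP.
rewrite powRM ?powR_ge0// -!powRrM.
have -> : M / (rho / 2) = (2 * M) * rho^-1 by field; rewrite gt_eqF.
rewrite exprMn -(powR_inv1 (ltW r0)) -[(rho `^ _) ^+ _]powR_mulrn ?powR_ge0// -powRrM.
(* The exponent -(n - 1) comes from the height of the test functions, (n - a)(p - 1)/p from the mass
   of the weight; they add up to [kap]. *)
have -> : rho `^ kap = rho `^ (-1 * n.-1%:R) * rho `^ ((n%:R - a) * ((p - 1) * p^-1)).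
  rewrite -powRD; last by rewrite (gt_eqF r0) implybT.
  congr (_ `^ _); rewrite /kap /g -subn1 natrB//; by field; rewrite gt_eqF.
by rewrite /C1; ring.
Qed.

Let K := (1 - 2 `^ (- kap))^-1.
Let h2 : 2 `^ (- kap) < 1 :> R.
Proof.
rewrite powRN invf_lt1 ?powR_gt0//.
have := @gt0_ltr_powR R kap kap0 1 2; rewrite !nnegrE powR1 => -> //; lra.
Qed.
Let K0 : 0 < K. Proof. by rewrite invr_gt0 subr_gt0. Qed.

(** Each halving of the radius costs a term of a geometric series of ratio 2^(-kap). Writing the
    partial sum as a difference of powers of the two radii makes the induction step an identity. *)
Lemma avg_telescope (J : R) x r k : 0 < r -> r <= rho0 -> 0 <= J -> (wenergy d G x r <= J%:E)%E ->
  `|avg F x r - avg F x (r / 2 ^+ k)| <= C1 * J `^ p^-1 * K * (r `^ kap - (r / 2 ^+ k) `^ kap).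
Proof.
move=> r0 rr0 J0 hJ; elim: k => [|k IH]; first by rewrite expr0 divr1 !subrr normr0 mulr0.
set q := r / 2 ^+ k in IH *.
have q0 : 0 < q by rewrite divr_gt0// exprn_gt0.
have qr : q <= r by rewrite ler_pdivrMr ?exprn_gt0// ler_peMr ?(ltW r0)// exprn_ege1//; lra.
have -> : r / 2 ^+ k.+1 = q / 2 by rewrite exprSr invfM mulrA.
have hq : (wenergy d G x q <= J%:E)%E.
  apply: le_trans hJ; apply: ge0_subset_integral; try exact: measurable_cube.
  - apply/measurable_EFinP; apply: measurable_funTS; apply: measurable_funM.
      apply: (@measurableT_comp _ _ _ _ _ _ (fun y : R => powR y _)); first exact: measurable_powR.
      exact: measurable_enorm.
    apply: (@measurableT_comp _ _ _ _ _ _ (fun y : R => powR y _)); first exact: measurable_powR.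
    by case: wd.
  - by move=> z _; rewrite lee_fin mulr_ge0// powR_ge0.
  - by apply: cube_sub; rewrite subrr normr0 add0r.
have := @avg_step J x x x q (q / 2) q q0 (le_trans qr rr0).
rewrite !subrr normr0 !add0r => /(_ _ _ _ _ J0 hq) S.
have {}S : `|avg F x q - avg F x (q / 2)| <= C1 * q `^ kap * J `^ p^-1 by apply: S => //; lra.
rewrite -(subrK (avg F x q) (avg F x r)) -addrA (le_trans (ler_normD _ _))//.
rewrite (le_trans (lerD IH S))// le_eqVlt; apply/orP; left; apply/eqP.
have -> : (q / 2) `^ kap = q `^ kap * (1 - K^-1).
  rewrite /K invrK (_ : 1 - _ = 2 `^ (- kap)); last by ring.
  by rewrite powRM ?invr_ge0 ?(ltW q0)// powRN -powR_inv1// -powRrM mulN1r powRN.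
by field; rewrite gt_eqF.
Qed.

Lemma avg_limit (J : R) x r : 0 < r -> r <= rho0 -> 0 <= J -> (wenergy d G x r <= J%:E)%E ->
  `|avg F x r - cphi * F x| <= C1 * J `^ p^-1 * K * r `^ kap.
Proof.
move=> r0 rr0 J0 hJ; apply/ler_addgt0Pr => e e0.
have [r1 r10 hr1] := @avg_cvg R n D M m dD Dl Dr D01 D1_ge0 D1_le m0 D1_gt F x e cF e0.
pose k := Num.bound (r / r1).
have rk : r / 2 ^+ k <= r1.
  rewrite ler_pdivrMr ?exprn_gt0// mulrC -ler_pdivrMr//.
  apply: ltW; apply: (lt_le_trans (archi_boundP _)); first by rewrite divr_ge0// ltW.
  by rewrite -natrX ler_nat ltnW// ltn_expl.
have p2 : 0 < 2 ^+ k :> R by rewrite exprn_gt0.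
have := hr1 _ (divr_gt0 r0 p2) rk.
have := avg_telescope k r0 rr0 J0 hJ => h1 h2'.
rewrite -(subrK (avg F x (r / 2 ^+ k)) (avg F x r)) -addrA (le_trans (ler_normD _ _))//.
rewrite lerD// (le_trans h1)//; apply: ler_wpM2l; last by rewrite lerBlDr lerDl powR_ge0.
by rewrite !mulr_ge0 ?powR_ge0 ?(ltW K0)// exprn_ge0// mulr_ge0.
Qed.

Lemma measurable_wenergy : measurable_fun setT
  ((fun z => (enorm (G z) `^ p * d z `^ g)%:E) : borel_rV R n -> \bar R).
Proof.
apply/measurable_EFinP; apply: measurable_funM.
  apply: (@measurableT_comp _ _ _ _ _ _ (fun y : R => powR y _)); first exact: measurable_powR.
  exact: measurable_enorm.
apply: (@measurableT_comp _ _ _ _ _ _ (fun y : R => powR y _)); first exact: measurable_powR.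
by case: wd.
Qed.

Lemma wenergy_sub x y r s : `|x - y| + r <= s -> (wenergy d G x r <= wenergy d G y s)%E.
Proof.
move=> h; apply: ge0_subset_integral; try exact: measurable_cube.
- by apply: measurable_funTS; exact: measurable_wenergy.
- by move=> z _; rewrite lee_fin mulr_ge0// powR_ge0.
- exact: cube_sub.
Qed.

Definition morrey_cst : R := C1 * (2 `^ kap + 2 * K) / cphi.

Let cp0 : 0 < cphi.
Proof. by apply: (@cphi_gt0 R n D M m). Qed.

Lemma morrey_cst_ge0 : 0 <= morrey_cst.
Proof.
by rewrite divr_ge0 ?(ltW cp0)// mulr_ge0 ?C1_ge0// addr_ge0 ?powR_ge0// mulr_ge0// ltW.
Qed.

Lemma morrey_real (J : R) x y r : 0 < r -> 3 * r <= rho0 -> `|x - y| <= r ->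
  0 <= J -> (wenergy d G x (3 * r) <= J%:E)%E ->
  `|F x - F y| <= morrey_cst * r `^ kap * J `^ p^-1.
Proof.
move=> r0 rr0 xy J0 hJ.
have hx : (wenergy d G x r <= J%:E)%E.
  by apply: le_trans hJ; apply: wenergy_sub; rewrite subrr normr0; lra.
have hy : (wenergy d G y r <= J%:E)%E.
  by apply: le_trans hJ; apply: wenergy_sub; rewrite distrC; lra.
have hxy : (wenergy d G x (2 * r) <= J%:E)%E.
  by apply: le_trans hJ; apply: wenergy_sub; rewrite subrr normr0; lra.
have rr1 : r <= rho0 by lra.
have lx := avg_limit r0 rr1 J0 hx; have ly := avg_limit r0 rr1 J0 hy.
have := @avg_step J x y x r r (2 * r) _ _ _ _ _ _ J0 hxy.
rewrite subrr normr0 => st.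
have {}st : `|avg F x r - avg F y r| <= C1 * (2 * r) `^ kap * J `^ p^-1.
  by apply: st; rewrite ?(distrC y x); lra.
have -> : morrey_cst * r `^ kap * J `^ p^-1 =
    C1 * (2 `^ kap + 2 * K) * (r `^ kap * J `^ p^-1) / cphi by rewrite /morrey_cst; ring.
rewrite ler_pdivlMr// -{1}(gtr0_norm cp0) -normrM.
have -> : (F x - F y) * cphi = (avg F x r - avg F y r) - (avg F x r - cphi * F x) + (avg F y r - cphi * F y) by ring.
rewrite (le_trans (ler_normD _ _))// (le_trans (lerD (ler_normB _ _) ly))//.
rewrite (le_trans (lerD (lerD st lx) (lexx _)))// powRM ?(ltW r0)//.
by rewrite le_eqVlt; apply/orP; left; apply/eqP; ring.
Qed.

(** The added 1 keeps the constant positive, so that an infinite energy gives an infinite right-hand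
    side; in the extended reals 0 times +oo is 0. *)
Lemma morrey_pow x y r : 0 < r -> 3 * r <= rho0 -> `|x - y| <= r ->
  ((`|F x - F y| `^ p)%:E <=
   ((morrey_cst + 1) `^ p * r `^ (p - n%:R - g))%:E * wenergy d G x (3 * r))%E.
Proof.
move=> r0 rr0 xy.
have W0 : (0 <= wenergy d G x (3 * r))%E.
  by apply: integral_ge0 => z _; rewrite lee_fin mulr_ge0 ?powR_ge0.
have c0 := morrey_cst_ge0.
have C0 : 0 < (morrey_cst + 1) `^ p * r `^ (p - n%:R - g).
  by rewrite mulr_gt0 ?powR_gt0//; lra.
have [Woo|] := eqVneq (wenergy d G x (3 * r)) +oo%E.
  by rewrite Woo gt0_muley ?lte_fin// leey.
rewrite -ltey => Woo.
have J0 : 0 <= fine (wenergy d G x (3 * r)) by exact: fine_ge0.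
have E : wenergy d G x (3 * r) = (fine (wenergy d G x (3 * r)))%:E.
  by rewrite fineK// ge0_fin_numE.
rewrite E -EFinM lee_fin.
have {}E : (wenergy d G x (3 * r) <= (fine (wenergy d G x (3 * r)))%:E)%E by rewrite -E.
move: (fine _) J0 E => J J0 hJ.
apply: powR_root_le => //; first by rewrite mulr_ge0// ltW.
apply: le_trans (morrey_real r0 rr0 xy J0 hJ) _.
rewrite powRM ?(ltW C0)// powRM ?powR_ge0// -!powRrM mulfV ?gt_eqF// powRr1; last by lra.
by rewrite ler_wpM2r ?powR_ge0// ler_wpM2r ?powR_ge0//; lra.
Qed.

(** [avg_limit] compares [F x] with its average at radius [r], and Jensen's inequality turns the
    average of |F| into one of |F|^p. *)
Lemma sup_pow x r : 0 < r -> 3 * r <= rho0 ->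
  ((`|F x| `^ p)%:E <=
    (2 `^ p)%:E * (((M / r) ^+ n / cphi) `^ p * ((2 * r) ^+ n) `^ (p - 1))%:E *
      \int[leb]_(z in cube x r) (`|F z| `^ p)%:E +
    (2 `^ p * ((morrey_cst + 1) `^ p * r `^ (p - n%:R - g)))%:E * wenergy d G x (3 * r))%E.
Proof.
move=> r0 rr0.
have W0 : (0 <= wenergy d G x (3 * r))%E.
  by apply: integral_ge0 => z _; rewrite lee_fin mulr_ge0 ?powR_ge0.
have c0 := morrey_cst_ge0.
have C0 : 0 < (morrey_cst + 1) `^ p * r `^ (p - n%:R - g).
  by rewrite mulr_gt0 ?powR_gt0//; lra.
have X0 : (0 <= \int[leb]_(z in cube x r) (`|F z| `^ p)%:E)%E.
  by apply: integral_ge0 => z _; rewrite lee_fin powR_ge0.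
have M20 : 0 <= (2 * r) ^+ n by rewrite exprn_ge0// mulr_ge0// ltW.
have Mr0 : 0 <= (M / r) ^+ n by rewrite exprn_ge0// divr_ge0// ltW.
have [Woo|] := eqVneq (wenergy d G x (3 * r)) +oo%E.
  rewrite Woo gt0_muley ?lte_fin ?mulr_gt0 ?powR_gt0 ?addey ?leey//; last by lra.
  by rewrite gt_eqF// (lt_le_trans ltNy0)// !mule_ge0 ?lee_fin ?powR_ge0 ?mulr_ge0 ?powR_ge0.
rewrite -ltey => Woo.
have J0 : 0 <= fine (wenergy d G x (3 * r)) by exact: fine_ge0.
have E : wenergy d G x (3 * r) = (fine (wenergy d G x (3 * r)))%:E.
  by rewrite fineK// ge0_fin_numE.
rewrite E.
have {}E : (wenergy d G x (3 * r) <= (fine (wenergy d G x (3 * r)))%:E)%E by rewrite -E.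
move: (fine _) J0 E => J J0 hJ.
have hx : (wenergy d G x r <= J%:E)%E.
  by apply: le_trans hJ; apply: wenergy_sub; rewrite subrr normr0; lra.
have lx := avg_limit r0 (_ : r <= rho0) J0 hx; have {}lx := lx ltac:(lra).
have mF : measurable_fun setT ((fun z => `|F z|) : borel_rV R n -> R).
  by apply: continuous_measurable_rV => z; apply: continuous_comp; [exact: cF|exact: norm_continuous].
have [B B0 FB] := continuous_bounded_cube x r cF.
have Ioo : (\int[leb]_(z in cube x r) `|F z|%:E < +oo)%E.
  apply: (@le_lt_trans _ _ (\int[leb]_(z in cube x r) B%:E)%E).
    by apply: ge0_le_integral_nm => z cz; rewrite lee_fin// FB.
  rewrite integral_cst ?leb_cube ?(ltW r0)//; last exact: measurable_cube.
  by rewrite -EFinM ltry.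
have I0 : (0 <= \int[leb]_(z in cube x r) `|F z|%:E)%E by exact: integral_ge0.
have := @avg_le R n D M dD Dl Dr D1_ge0 D1_le F x r cF r0.
have := weighted_jensen (mu := leb) (D := cube x r) (g := fun z => `|F z|) (k := fun=> 1)
  p1 (@measurable_cube R n x r) (measurable_funTS mF) (@measurable_cst _ _ _ _ _ _)
  (fun z _ => normr_ge0 _) (fun _ _ => ler01) M20.
rewrite integral_cst ?leb_cube ?(ltW r0)// ?mul1e; last exact: measurable_cube.
move=> /(_ (lexx _)).
under eq_integral do rewrite mulr1.
under [X in (_ <= _ * X)%E]eq_integral do rewrite mulr1.
have : (\int[leb]_(z in cube x r) `|F z|%:E)%E = (fine (\int[leb]_(z in cube x r) `|F z|%:E))%:E.
  by rewrite fineK// ge0_fin_numE.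
have : 0 <= fine (\int[leb]_(z in cube x r) `|F z|%:E)%E by exact: fine_ge0.
move: (fine _) => I I_ge0 -> hI; rewrite -EFinM lee_fin => hA.
pose A := (M / r) ^+ n / cphi.
have A0 : 0 <= A by rewrite divr_ge0// ltW.
have FA : `|F x| <= A * I + (morrey_cst * r `^ kap * J `^ p^-1).
  rewrite -(ler_pM2l cp0).
  apply: (@le_trans _ _ (`|avg F x r| + `|avg F x r - cphi * F x|)).
    rewrite -{1}(gtr0_norm cp0) -normrM distrC.
    by rewrite -{1}(subrK (avg F x r) (cphi * F x)) addrC ler_normD.
  rewrite mulrDr lerD//.
    apply: le_trans hA _; rewrite /A; move: ((M / r) ^+ n) => Q.
    by rewrite (_ : cphi * (Q / cphi * I) = Q * I)//; field; rewrite gt_eqF.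
  apply: le_trans lx _; rewrite /morrey_cst.
  have -> : cphi * (C1 * (2 `^ kap + 2 * K) / cphi * r `^ kap * J `^ p^-1) =
     (C1 * J `^ p^-1 * r `^ kap) * (2 `^ kap + 2 * K) by field; rewrite gt_eqF.
  have -> : C1 * J `^ p^-1 * K * r `^ kap = (C1 * J `^ p^-1 * r `^ kap) * K by ring.
  apply: ler_wpM2l; first exact: (mulr_ge0 (mulr_ge0 C1_ge0 (powR_ge0 _ _)) (powR_ge0 _ _)).
  by have := powR_ge0 2 kap; have := K0; lra.
have T0 : 0 <= morrey_cst * r `^ kap * J `^ p^-1 by exact: (mulr_ge0 (mulr_ge0 c0 (powR_ge0 _ _)) (powR_ge0 _ _)).
have : `|F x| `^ p <= 2 `^ p * ((A * I) `^ p + (morrey_cst * r `^ kap * J `^ p^-1) `^ p).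
  apply: le_trans (powR_add_le p0 _ T0); last by rewrite mulr_ge0.
  apply: ge0_ler_powR; rewrite ?nnegrE ?(ltW p0)// addr_ge0//; exact: mulr_ge0.
rewrite -lee_fin => /le_trans; apply.
rewrite mulrDr EFinD; apply: leeD.
  rewrite powRM// -muleA EFinM EFinM; apply: lee_wpmul2l; first by rewrite lee_fin powR_ge0.
  rewrite [X in (_ <= X * _)%E]EFinM -muleA.
  by apply: lee_wpmul2l; [rewrite lee_fin powR_ge0|rewrite -poweR_EFin].
rewrite -EFinM lee_fin; move: morrey_cst c0 => mc mc0; rewrite -!mulrA; apply: ler_wpM2l; first exact: powR_ge0.
have -> : (mc * (r `^ kap * J `^ p^-1)) `^ p = mc `^ p * (r `^ (p - n%:R - g) * J).
  rewrite (powRM _ mc0) ?mulr_ge0 ?powR_ge0// (powRM _ (powR_ge0 _ _)) ?powR_ge0// -!powRrM.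
  rewrite mulVf ?gt_eqF// (powRr1 J0) (_ : kap * p = p - n%:R - g)//.
  by rewrite /kap; field; rewrite gt_eqF.
apply: ler_wpM2r; first by rewrite mulr_ge0 ?powR_ge0.
by rewrite ge0_ler_powR ?nnegrE ?(ltW p0)//; lra.
Qed.
End morrey_steps.

End weighted_morrey.

Section series_bounds.
Context {R : realType}.

Lemma nneseries_le_bound (f : nat -> \bar R) (B : \bar R) : (forall k, (0 <= f k)%E) ->
  (forall m, (\sum_(0 <= k < m) f k <= B)%E) -> (\sum_(k <oo) f k <= B)%E.
Proof.
move=> f0 fB; apply: lime_le; first by apply: is_cvg_nneseries => k _ _; exact: f0.
by apply: nearW => m; exact: fB.
Qed.

Lemma geometric_sum_le (q : R) m : 0 <= q -> q < 1 -> \sum_(0 <= k < m) q ^+ k <= (1 - q)^-1.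
Proof.
move=> q0 q1; have q2 : 0 < 1 - q by rewrite subr_gt0.
have : (1 - q) * \sum_(0 <= k < m) q ^+ k = 1 - q ^+ m.
  elim: m => [|m IH]; first by rewrite big_geq// mulr0 expr0 subrr.
  by rewrite big_nat_recr//= mulrDr IH exprSr; ring.
move=> E; rewrite -(ler_pM2l q2) E mulfV ?gt_eqF// gerBl exprn_ge0//.
Qed.

Lemma ge_nneseries_term (f : nat -> \bar R) k : (forall k, (0 <= f k)%E) ->
  (f k <= \sum_(j <oo) f j)%E.
Proof.
move=> f0; apply: le_trans (nneseries_lim_ge k.+1 _); last by move=> j _ _; exact: f0.
by rewrite big_nat_recr//= leeDr// sume_ge0.
Qed.
End series_bounds.

(** * Distance to a set and null sets *)

Section distance.
Context {R : realType} (n : nat) (S : set 'rV[R]_n).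
Implicit Types x y z : 'rV[R]_n.
Hypothesis S0 : S !=set0.

Definition dist z : R := inf [set `|z - y| | y in S].

Let has_lb z : has_lbound [set `|z - y| | y in S].
Proof. by exists 0 => _ [y _ <-]. Qed.
Let nonempty_im z : nonempty [set `|z - y| | y in S].
Proof. by have [y Sy] := S0; exists `|z - y|; exists y. Qed.

Lemma dist_le z y : S y -> dist z <= `|z - y|.
Proof. by move=> Sy; apply: ge_inf => //; exists y. Qed.

Lemma le_dist z r : (forall y, S y -> r <= `|z - y|) -> r <= dist z.
Proof. by move=> h; apply: lb_le_inf => // _ [y Sy <-]; exact: h. Qed.

Lemma dist_ge0 z : 0 <= dist z.
Proof. exact: le_dist. Qed.

Lemma dist_adh z r : dist z < r -> exists2 y, S y & `|z - y| < r.
Proof.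
move=> zr; apply: contrapT => h.
suff : r <= dist z by rewrite leNgt zr.
by apply: le_dist => y Sy; rewrite leNgt; apply/negP => zy; apply: h; exists y.
Qed.

Lemma dist_lip x y : dist x <= dist y + `|x - y|.
Proof.
rewrite -lerBlDr; apply: le_dist => z Sz; rewrite lerBlDr (le_trans (dist_le _ Sz))//.
have -> : x - z = (y - z) + (x - y) by rewrite [RHS]addrC addrA subrK.
exact: ler_normD.
Qed.

Lemma dist_continuous : continuous dist.
Proof.
apply: continuous_rV => x e e0; exists e => // y xy.
have := dist_lip x y; have := dist_lip y x; rewrite (distrC y) => h1 h2.
by rewrite ltr_norml; apply/andP; split; lra.
Qed.

Lemma dist_eq0 z : closed S -> dist z = 0 <-> S z.
Proof.
move=> cS; split => [z0|Sz]; last first.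
  by apply/eqP; rewrite eq_le dist_ge0 andbT (le_trans (dist_le z Sz))// subrr normr0.
have E := (closure_id S).1 cS; rewrite E => B /nbhs_ballP[e /= e0 eB].
have [y Sy zy] : exists2 y, S y & `|z - y| < e by apply: dist_adh; rewrite z0.
by exists y; split => //; apply: eB; rewrite mx_norm_ball.
Qed.

End distance.

Section null_sets.
Context {R : realType} (n : nat) (m : {measure set (borel_rV R n) -> \bar R}).

(** A Lindelöf argument: being null is a local property, because the rational cubes are countably
    many. *)
Lemma null_of_rat_cubes (A : set 'rV[R]_n) (J : set ('rV[rat]_n * nat)) :
  measurable (A : set (borel_rV R n)) ->
  (forall q, J q -> m.-negligible (A `&` rat_cube q)) -> A `<=` \bigcup_(q in J) rat_cube q ->
  m A = 0%E.
Proof.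
move=> mA hJ AJ; apply: measure_negligible => //.
pose F (k : nat) : set 'rV[R]_n := if unpickle k is Some q then
  (if q \in J then A `&` rat_cube q else set0) else set0.
apply: (@negligibleS _ _ _ m (\bigcup_k F k)).
  move=> x Ax; have [q Jq xq] := AJ _ Ax.
  by exists (pickle q) => //; rewrite /F pickleK mem_set.
apply: negligible_bigcup => k; rewrite /F; case: unpickle => [q|]; last exact: negligible_set0.
by case: ifPn => [/set_mem/hJ//|_]; exact: negligible_set0.
Qed.

Lemma msupport_null (S : set 'rV[R]_n) : closed S -> msupport m `<=` S -> m (~` S) = 0%E.
Proof.
move=> cS mS; have oS : open (~` S) by exact: closed_openC.
pose J := [set q | m (rat_cube q) = 0%E /\ True].
apply: (@null_of_rat_cubes _ J).
- exact: rV_borel_open.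
- move=> q [q0 _]; apply: (negligibleS (@subIsetr _ _ _)).
  by apply/negligibleP => //; exact: measurable_cube.
move=> x Sx; have : ~ msupport m x by move/mS.
move=> /existsNP[U /not_implyP[oU /not_implyP[Ux /negP]]].
rewrite -leNgt => U0.
have [q xq qU] := rat_cube_sub oU Ux.
exists q => //; split => //; apply/eqP; rewrite eq_le measure_ge0 andbT.
apply: le_trans U0; apply: le_measure; rewrite ?inE //; first exact: measurable_cube.
exact: rV_borel_open.
Qed.
End null_sets.

(** * Porosity and integrability of negative powers of the distance *)

Section porosity.
Context {R : realType} (n : nat).
Implicit Types (x y z c : 'rV[R]_n) (r s : R).
Hypothesis n0 : (0 < n)%N.
Local Notation leb := (lebesgue_rV n : {measure set (borel_rV R n) -> \bar R}).

Lemma enorm_le x : enorm x <= n%:R * `|x|.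
Proof.
rewrite -(@ger0_norm _ (n%:R * `|x|)) ?mulr_ge0// -sqrtr_sqr ler_sqrt ?sqr_ge0//.
apply: (@le_trans _ _ (\sum_(i < n) `|x| ^+ 2)).
  apply: ler_sum => i _; rewrite -(real_normK (num_real (x ord0 i))).
  by rewrite lerXn2r// ?nnegrE//; exact: rV_coord_le.
rewrite sumr_const card_ord exprMn -[_ *+ n]mulr_natl ler_wpM2r ?sqr_ge0//.
by rewrite expr2 ler_peMr// ler1n.
Qed.

Lemma norm_le_enorm x : `|x| <= enorm x.
Proof. by apply/(rV_norm_le _ (enorm_ge0 x)) => i; exact: coord_le_enorm. Qed.

Variables (beta : R) (N : nat).
Hypotheses (N6 : (6 <= N)%N) (Nb : 12 * beta * n%:R <= N%:R).
Variable S : set 'rV[R]_n.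
Hypotheses (cS : closed S) (S0 : S !=set0) (bS : ball_condition beta S).

Let beta0 : 0 < beta. Proof. by case: bS. Qed.
Let N0 : 0 < N%:R :> R. Proof. by rewrite ltr0n (leq_trans _ N6). Qed.
Let nr0 : 0 < n%:R :> R. Proof. by rewrite ltr0n. Qed.

(** A Euclidean ball of radius r' without points of S keeps S at maximum-norm distance at least r' /
    n from its centre, because [enorm] is at most n times the maximum norm. *)
Lemma hole_ball y s : S y -> 0 < s -> 2 * s <= 1 ->
  exists2 c', `|c' - y| <= s & s / (beta * n%:R) <= dist S c'.
Proof.
move=> Sy s0 s1; have [c' [r' [r'0 sub hb]]] := bS.2 y s Sy s0 s1.
have c'in : eball c' r' c' by rewrite /eball /= subrr /enorm big1 ?sqrtr0// => i _; rewrite mxE expr0n.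
have [yc' _] := sub _ c'in.
exists c'; first exact: le_trans (norm_le_enorm _) (ltW yc').
apply: le_dist => // w Sw; have : ~ eball c' r' w by move/sub => [_]; apply.
rewrite /eball /= => /negP; rewrite -leNgt => h.
have : r' <= n%:R * `|c' - w| by rewrite distrC (le_trans h)//; exact: enorm_le.
move=> h2; rewrite ler_pdivrMr ?mulr_gt0//.
have : beta * r' <= beta * (n%:R * `|c' - w|) by rewrite ler_pM2l.
lra.
Qed.

(** If S has a point y in the half cube, the ball condition at y with radius r / 4, allowed by r <=
    2, yields distance r / (4 beta n), and [12 * beta * n <= N] makes this 3 r / N. Otherwise the
    centre is at distance r / 2 and [6 <= N] suffices. *)
Lemma hole c r : 0 < r -> r <= 2 -> exists2 c', cube c r c' & 3 * r / N%:R <= dist S c'.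
Proof.
move=> r0 r2; have [[y [Sy yc]]|h] := pselect (exists y, S y /\ `|y - c| <= r / 2).
  have s0 : 0 < r / 4 by rewrite divr_gt0.
  have [|c' c'y dc'] := hole_ball Sy s0; first by lra.
  exists c'.
    rewrite /cube /= -(subrK y c') -addrA (le_trans (ler_normD _ _))// (le_trans (lerD c'y yc))//.
    by lra.
  apply: le_trans dc'; rewrite ler_pdivrMr// mulrAC ler_pdivlMr ?mulr_gt0//.
  have : r * (12 * beta * n%:R) <= r * N%:R by rewrite ler_pM2l.
  lra.
exists c; first by rewrite /cube /= subrr normr0 ltW.
apply: (@le_trans _ _ (r / 2)); last first.
  by apply: le_dist => // y Sy; rewrite distrC leNgt; apply/negP => /ltW yc; apply: h; exists y.
rewrite ler_pdivrMr//; have : 6%:R <= N%:R :> R by rewrite ler_nat.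
by move=> h6; have h7 : r * 6 <= r * N%:R; [rewrite ler_pM2l|lra].
Qed.

Definition subcenter c r (k : {ffun 'I_n -> 'I_N}) : 'rV[R]_n :=
  \row_j (c ord0 j + (r / N%:R) * (2 * (k j)%:R + 1 - N%:R)).

Lemma subcube_cover c r z : 0 < r -> cube c r z ->
  exists k, cube (subcenter c r k) (r / N%:R) z.
Proof.
move=> r0 /(rV_norm_le _ (ltW r0)) cz; have q0 : 0 < r / N%:R by rewrite divr_gt0.
have /choice[k hk] : forall j : 'I_n, exists k : 'I_N,
    `|z ord0 j - (c ord0 j + (r / N%:R) * (2 * k%:R + 1 - N%:R))| <= r / N%:R.
  move=> j; have := cz j; rewrite !mxE ler_norml => /andP[h1 h2].
  pose u := (z ord0 j - c ord0 j + r) / (2 * (r / N%:R)).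
  have u0 : 0 <= u by rewrite divr_ge0 ?mulr_ge0 ?(ltW q0)//; lra.
  have uE : z ord0 j - c ord0 j = 2 * (r / N%:R) * u - r.
    by rewrite /u; field; rewrite !gt_eqF.
  have uN : u <= N%:R.
    have E2 : N%:R * (2 * (r / N%:R)) = 2 * r by field; rewrite gt_eqF.
    rewrite /u ler_pdivrMr ?mulr_gt0 ?invr_gt0// E2; lra.
  have [k [kN ku uk]] : exists k : nat, [/\ (k < N)%N, k%:R <= u & u <= k%:R + 1].
    have [uN'|uN'] := ltP u N%:R.
      exists (Num.truncn u); have /andP[t1 t2] := truncn_itv u0.
      split => //; last by rewrite natr1 ltW.
      by rewrite -(ltr_nat R) (le_lt_trans t1).
    (* Here [u = N], the right face of the cube, which belongs to the last subcube. *)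
    exists N.-1; have N1 : N.-1.+1 = N by rewrite prednK// (leq_trans _ N6).
    rewrite N1 natr1 N1; split => //; apply: (le_trans _ uN'); rewrite ler_nat; exact: leq_pred.
  exists (Ordinal kN) => /=.
  have -> : z ord0 j - (c ord0 j + r / N%:R * (2 * k%:R + 1 - N%:R)) = (r / N%:R) * (2 * (u - k%:R) - 1).
    by rewrite opprD addrA uE; field; rewrite gt_eqF.
  rewrite normrM (gtr0_norm q0) -[leRHS]mulr1 ler_pM2l// ler_norml; apply/andP; split; lra.
exists [ffun j => k j]; apply/(rV_norm_le _ (ltW q0)) => j.
by rewrite !mxE ffunE; exact: hk.
Qed.

Let th : R := 1 - N%:R^-1 ^+ n.

Lemma measure_bigsetU_seq (I : eqType) (s : seq I) (P : pred I) (A : I -> set (borel_rV R n)) :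
  (forall i, measurable (A i)) ->
  (leb (\big[setU/set0]_(i <- s | P i) A i) <= \sum_(i <- s | P i) leb (A i))%E.
Proof.
move=> mA; suff [] : measurable (\big[setU/set0]_(i <- s | P i) A i) /\
  (leb (\big[setU/set0]_(i <- s | P i) A i) <= \sum_(i <- s | P i) leb (A i))%E by [].
elim/big_rec2 : _ => [|i y x Pi [mx h]]; first by rewrite measure0.
split; first exact: measurableU.
by apply: le_trans (measureU2 _ _ _) _ => //; rewrite leeD2l.
Qed.

Definition layer c r t : set (borel_rV R n) := cube c r `&` [set z | dist S z < t].

Lemma measurable_layer c r t : measurable (layer c r t).
Proof.
apply: measurableI; first exact: measurable_cube.
rewrite -[X in measurable X]setTI.
have := continuous_measurable_rV (dist_continuous S0) measurableT (measurable_itv `]-oo, t[).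
congr (measurable _); apply/seteqP; split => z /=; by rewrite in_itv.
Qed.

(** Cut the cube into N^n subcubes of radius r / N. All points of the one that contains the hole are
    within 2 r / N of it, hence at distance at least r / N from S, so this subcube misses the layer.
    The induction hypothesis on the N^n - 1 others gives the factor [th]; the 3 in [hole] is 2 +
    1. *)
Lemma layer_le (j : nat) c r : 0 < r -> r <= 2 ->
  (leb (layer c r (r / N%:R ^+ j)%R) <= (th ^+ j * (2 * r) ^+ n)%:E)%E.
Proof.
elim: j c r => [|j IH] c r r0 r2.
  rewrite expr0 mul1r -(leb_cube c (ltW r0)) divr1; apply: le_measure; rewrite ?inE.
  - exact: measurable_layer.
  - exact: measurable_cube.
  - exact: subIsetl.
have q0 : 0 < r / N%:R by rewrite divr_gt0.
have N1 : 1 <= N%:R :> R by rewrite ler1n (leq_trans _ N6).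
have qr : r / N%:R <= r by rewrite ler_pdivrMr// ler_peMr// ltW.
have [c' cc' dc'] := hole c r0 r2.
have [k0 hk0] := subcube_cover r0 cc'.
apply: (@le_trans _ _ (leb (\big[setU/set0]_(k in predC1 k0)
   layer (subcenter c r k) (r / N%:R)%R (r / N%:R / N%:R ^+ j)%R))).
  apply: le_measure; rewrite ?inE; first exact: measurable_layer.
    by apply: bigsetU_measurable => k _; exact: measurable_layer.
  move=> z [cz dz]; have [k hk] := subcube_cover r0 cz.
  have E : r / N%:R / N%:R ^+ j = r / N%:R ^+ j.+1 by rewrite exprS invfM mulrA.
  have kk0 : k != k0.
    apply/eqP => kk; subst k.
    have : dist S c' <= dist S z + `|c' - z| by exact: dist_lip.
    have : `|c' - z| <= r / N%:R + r / N%:R.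
      rewrite -(subrK (subcenter c r k0) c') -addrA (le_trans (ler_normD _ _))// lerD//.
      by rewrite distrC.
    move: dz => /= dz; have : r / N%:R ^+ j.+1 <= r / N%:R.
      by rewrite -E ler_pdivrMr ?exprn_gt0// ler_peMr ?(ltW q0)// exprn_ege1.
    by rewrite -mulrA in dc'; move: dz dc'; rewrite mulrA (mulrC 3) -mulrA; lra.
  rewrite -bigcup_pred; exists k; first by rewrite /= inE.
  by split => //; rewrite E.
apply: le_trans (measure_bigsetU_seq _ _ _) _; first by move=> k; exact: measurable_layer.
apply: (@le_trans _ _ (\sum_(k in predC1 k0) (th ^+ j * (2 * (r / N%:R)) ^+ n)%:E)%E).
  by apply: lee_sum => k _; apply: IH => //; exact: le_trans r2.
rewrite sumEFin lee_fin sumr_const cardC1 card_ffun !card_ord.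
have NN : 0 < N%:R ^+ n :> R by rewrite exprn_gt0.
have -> : (2 * (r / N%:R)) ^+ n = (2 * r) ^+ n * (N%:R ^+ n)^-1 by rewrite mulrA expr_div_n.
rewrite -[_ *+ _]mulr_natl -subn1 natrB ?expn_gt0 ?(leq_trans _ N6)// natrX exprSr.
rewrite le_eqVlt; apply/orP; left; apply/eqP; rewrite /th exprVn.
by move: (_ ^+ n) NN ((2 * r) ^+ n) (_ ^+ j) => A A0 B C; field; rewrite gt_eqF.
Qed.

Let th01 : 0 < th < 1.
Proof.
have N1 : 1 < N%:R :> R by rewrite ltr1n (leq_trans _ N6).
have V1 : N%:R^-1 ^+ n < 1 :> R by rewrite exprn_ilt1 ?invr_ge0 ?(ltW N0)// ?invf_lt1// -lt0n.
have V0 : 0 < N%:R^-1 ^+ n :> R by rewrite exprn_gt0// invr_gt0.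
by rewrite /th; apply/andP; split; lra.
Qed.

(** In every rational cube the zero set lies in all the layers, whose measures tend to 0. *)
Lemma dist_null : leb [set z | dist S z = 0] = 0%E.
Proof.
have md := continuous_measurable_rV (dist_continuous S0).
have mZ : measurable ([set z | dist S z = 0] : set (borel_rV R n)).
  by rewrite -[X in measurable X]setTI; have := md measurableT [set 0] (measurable_set1 _).
apply: (@null_of_rat_cubes _ _ _ _ setT) => //; last first.
  move=> x _; have [q xq _] := rat_cube_sub (@openT 'rV[R]_n) (I : setT x).
  by exists q.
move=> q _; have mI : measurable ([set z | dist S z = 0] `&` rat_cube q : set (borel_rV R n)).
  by apply: measurableI => //; exact: measurable_cube.
apply/negligibleP => //; apply/eqP; rewrite eq_le measure_ge0 andbT.
apply/lee_addgt0Pr => e e0; rewrite add0e.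
pose r : R := q.2.+1%:R^-1; have r0 : 0 < r by rewrite invr_gt0.
have r1 : r <= 2.
  apply: (@le_trans _ _ 1); last by lra.
  by rewrite invf_le1 ?ltr0n// ler1n.
have /andP[t0 t1] := th01.
have [j hj] : exists j, th ^+ j * (2 * r) ^+ n <= e.
  have cv : (fun j => th ^+ j * (2 * r) ^+ n) @ \oo --> 0 * (2 * r) ^+ n.
    by apply: cvgM; [apply: cvg_expr; rewrite gtr0_norm|exact: cvg_cst].
  rewrite mul0r in cv; have /cvgrPdist_le/(_ _ e0)[j _ /(_ j (leqnn j))] := cv.
  by rewrite /= sub0r normrN => h; exists j; apply: le_trans (ler_norm _) h.
rewrite -lee_fin in hj; apply: le_trans hj; apply: le_trans (layer_le j (map_mx ratr q.1) r0 r1).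
apply: le_measure; rewrite ?inE//; first exact: measurable_layer.
by move=> z [/= dz qz]; split => //=; rewrite dz divr_gt0// exprn_gt0.
Qed.

Lemma layer_index c r z : 0 < dist S z -> dist S z < r ->
  exists j, r / N%:R ^+ j.+1 <= dist S z < r / N%:R ^+ j.
Proof.
move=> d0 dr; have r0 := lt_trans d0 dr.
have N1 : 1 <= N%:R :> R by rewrite ler1n (leq_trans _ N6).
have ex : exists m, r / N%:R ^+ m <= dist S z.
  exists (Num.bound (r / dist S z)); rewrite ler_pdivrMr ?exprn_gt0// mulrC -ler_pdivrMr//.
  apply: ltW; apply: lt_le_trans (archi_boundP _) _; first by rewrite divr_ge0// ltW.
  by rewrite -natrX ler_nat ltnW// ltn_expl// (leq_trans _ N6).
case: (ex_minnP ex) => -[|j] hj hmin; first by move: hj; rewrite expr0 divr1 leNgt dr.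
exists j; rewrite hj /= ltNge; apply/negP => /hmin; by rewrite ltnn.
Qed.

Variable a : R.
Hypotheses (a0 : 0 < a) (aN : N%:R `^ a * th < 1).
Let q := N%:R `^ a * th.
Let q0 : 0 <= q. Proof. by rewrite mulr_ge0 ?powR_ge0//; have /andP[/ltW] := th01. Qed.

Lemma powRN_le (u v : R) : 0 < u -> u <= v -> v `^ (- a) <= u `^ (- a).
Proof.
move=> u0 uv; have v0 := lt_le_trans u0 uv.
by rewrite !powRN lef_pV2 ?posrE ?powR_gt0//; apply: ge0_ler_powR; rewrite ?nnegrE ?(ltW a0) ?(ltW u0) ?(ltW v0).
Qed.

(** Points at distance at least r from S are covered by the first term. Any other point off S has
    dist between r / N^(j+1) and r / N^j for some j, and the j-th summand alone suffices. *)
Lemma dist_weight_pointwise c r z : 0 < r -> cube c r z ->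
  ((dist S z `^ (- a))%:E <= (r `^ (- a))%:E +
   \sum_(j <oo) ((r / N%:R ^+ j.+1) `^ (- a))%:E * (\1_(layer c r (r / N%:R ^+ j)%R) z)%:E)%E.
Proof.
move=> r0 cz.
have T0 j : (0 <= ((r / N%:R ^+ j.+1) `^ (- a))%:E * (\1_(layer c r (r / N%:R ^+ j)%R) z)%:E)%E.
  by rewrite -EFinM lee_fin mulr_ge0// powR_ge0.
have [d0|d0] := ltP 0 (dist S z); last first.
  have -> : dist S z = 0 by apply/eqP; rewrite eq_le d0 dist_ge0.
  rewrite powR0 ?oppr_eq0 ?gt_eqF// adde_ge0 ?lee_fin ?powR_ge0//.
  by apply: nneseries_ge0 => j _ _; exact: T0.
have [rd|dr] := leP r (dist S z).
  apply: (@le_trans _ _ (r `^ (- a))%:E); first by rewrite lee_fin powRN_le.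
  by rewrite leeDl// nneseries_ge0// => j _ _; exact: T0.
have [j /andP[j1 j2]] := layer_index c d0 dr.
apply: le_trans (leeDr _ _); last by rewrite lee_fin powR_ge0.
apply: le_trans (ge_nneseries_term j T0).
rewrite indicE mem_set; last by split.
by rewrite mule1 lee_fin; apply: powRN_le => //; rewrite divr_gt0// exprn_gt0.
Qed.

Definition weight_cst : R := 2 ^+ n * (1 + N%:R `^ a / (1 - q)).

(** The j-th layer has measure at most th^j (2 r)^n and carries the weight (N^(j+1) / r)^a, so the
    sum is geometric of ratio [N%:R ^ a * th], below 1 by the choice of [a]. *)
Lemma weight_dist : weight_ok a weight_cst 2 (dist S).
Proof.
split.
- exact: continuous_measurable_rV (dist_continuous S0).
- exact: dist_ge0.
- exact: dist_null.
move=> c r r0 r2.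
pose f j (z : borel_rV R n) := (((r / N%:R ^+ j.+1) `^ (- a))%:E * (\1_(layer c r (r / N%:R ^+ j)%R) z)%:E)%E.
have f0 j z : (0 <= f j z)%E by rewrite /f -EFinM lee_fin mulr_ge0// powR_ge0.
have mf j : measurable_fun setT (f j).
  apply: measurable_funeM; apply/measurable_EFinP; apply: measurable_indic; exact: measurable_layer.
have mcube := @measurable_cube R n c r.
apply: (@le_trans _ _ (\int[leb]_(z in cube c r) ((r `^ (- a))%:E + \sum_(j <oo) f j z))%E).
  apply: ge0_le_integral_nm => z cz; first by rewrite lee_fin powR_ge0.
  exact: dist_weight_pointwise.
rewrite ge0_integralD//; last 3 first.
- by move=> z _; rewrite lee_fin powR_ge0.
- by move=> z _; apply: nneseries_ge0 => j _ _; exact: f0.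
- by apply: measurable_funTS; apply: ge0_emeasurable_sum => [j z _ _|j _]; [exact: f0|exact: mf].
rewrite integral_cst// leb_cube ?(ltW r0)// integral_nneseries//; last first.
  by move=> j; apply: measurable_funTS; exact: mf.
have r20 : 0 <= (2 * r) ^+ n by rewrite exprn_ge0// mulr_ge0// ltW.
have hsum : (\sum_(j <oo) \int[leb]_(z in cube c r) f j z <=
   (r `^ (- a) * (2 * r) ^+ n * N%:R `^ a / (1 - q))%:E)%E.
  apply: nneseries_le_bound => [j|k]; first by apply: integral_ge0 => z _; exact: f0.
  apply: (@le_trans _ _ (\sum_(0 <= j < k) ((r `^ (- a) * (2 * r) ^+ n * N%:R `^ a) * q ^+ j)%:E)%E).
    apply: lee_sum => j _; rewrite /f ge0_integralZl_EFin//; last 2 first.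
    - apply: measurable_funTS; apply/measurable_EFinP; apply: measurable_indic; exact: measurable_layer.
    - exact: powR_ge0.
    rewrite integral_indic//; last exact: measurable_layer.
    apply: (@le_trans _ _ (((r / N%:R ^+ j.+1) `^ (- a))%:E * (th ^+ j * (2 * r) ^+ n)%:E)%E).
      apply: lee_wpmul2l; first by rewrite lee_fin powR_ge0.
      apply: le_trans (layer_le j c r0 r2); apply: le_measure; rewrite ?inE.
      + by apply: measurableI => //; exact: measurable_layer.
      + exact: measurable_layer.
      + exact: subIsetl.
    rewrite -EFinM lee_fin le_eqVlt; apply/orP; left; apply/eqP.
    have -> : (r / N%:R ^+ j.+1) `^ (- a) = r `^ (- a) * (N%:R `^ a * (N%:R `^ a) ^+ j).
      rewrite powRM ?invr_ge0 ?exprn_ge0 ?(ltW r0)//; congr (_ * _).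
      rewrite -exprS -powR_invn ?(ltW N0)// -powRrM mulrNN -powR_mulrn ?powR_ge0// -powRrM.
      by rewrite mulrC.
    by rewrite /q; move: ((2 * r) ^+ n) => W; rewrite exprMn; ring.
  rewrite sumEFin lee_fin -mulr_sumr ler_wpM2l ?geometric_sum_le//.
  by rewrite !mulr_ge0 ?powR_ge0.
apply: le_trans (leeD2l _ hsum) _; rewrite -EFinM -EFinD lee_fin.
have -> : r `^ (n%:R - a) = r `^ (- a) * r ^+ n.
  rewrite -(powR_mulrn n (ltW r0)) -powRD; last by rewrite (gt_eqF r0) implybT.
  by rewrite addrC.
rewrite /weight_cst exprMn le_eqVlt; apply/orP; left; apply/eqP; ring.
Qed.

End porosity.

(** * Choice of the exponents and uniform Morrey inequalities *)

Section packages.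
Context {R : realType}.

Lemma weight_exists (n : nat) (p beta : R) : (0 < n)%N -> n%:R < p ->
  exists a Cd : R, [/\ 0 < a, a * (p - 1) < p - n%:R, 0 < Cd &
    forall S : set 'rV[R]_n, closed S -> S !=set0 -> ball_condition beta S ->
      weight_ok a Cd 2 (dist S)].
Proof.
move=> n0 np; have p1 : 1 < p by apply: le_lt_trans np; rewrite ler1n.
pose N := maxn 6 (Num.bound (12 * beta * n%:R)).
have N6 : (6 <= N)%N by rewrite leq_maxl.
have Nb : 12 * beta * n%:R <= N%:R.
  apply: (@le_trans _ _ (Num.bound (12 * beta * n%:R))%:R); last by rewrite ler_nat leq_maxr.
  by apply: le_trans (ler_norm _) _; apply: ltW; have := archi_boundP (normr_ge0 (12 * beta * n%:R)); rewrite /Num.bound /= normr_id.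
have N1 : 1 < N%:R :> R by rewrite ltr1n (leq_trans _ N6).
pose th : R := 1 - N%:R^-1 ^+ n.
have V1 : N%:R^-1 ^+ n < 1 :> R.
  by rewrite exprn_ilt1 ?invr_ge0 ?(ltW (lt_trans ltr01 N1))// ?invf_lt1// ?(lt_trans ltr01 N1)// -lt0n.
have V0 : 0 < N%:R^-1 ^+ n :> R by rewrite exprn_gt0// invr_gt0 (lt_trans ltr01 N1).
have t0 : 0 < th by rewrite /th; lra.
have t1 : th < 1 by rewrite /th; lra.
have lN : 0 < ln (N%:R : R) by rewrite ln_gt0.
have lt : ln th < 0 by rewrite ln_lt0// t0.
(* [a1] makes N^a1 th equal to the square root of [th], hence below 1; [a2] is half of the bound
   that keeps a (p - 1) below p - n. *)
pose a1 := - ln th / (2 * ln N%:R).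
pose a2 := (p - n%:R) / (2 * (p - 1)).
have a10 : 0 < a1 by rewrite divr_gt0 ?mulr_gt0// oppr_gt0.
have a20 : 0 < a2 by rewrite divr_gt0 ?mulr_gt0 ?subr_gt0.
pose a := Num.min a1 a2.
have a0 : 0 < a by rewrite lt_min a10.
have aN : N%:R `^ a * th < 1.
  apply: (@le_lt_trans _ _ (N%:R `^ a1 * th)).
    by rewrite ler_wpM2r ?(ltW t0)// ler_powR ?(ltW N1)// ge_min lexx.
  rewrite /powR gt_eqF ?(lt_trans ltr01 N1)// -[th]lnK ?posrE// -expRD expR_lt1.
  by rewrite (_ : a1 * ln N%:R = - ln th / 2); [lra|rewrite /a1; field; rewrite gt_eqF].
exists a, (weight_cst n N a); split => //.
- apply: (@le_lt_trans _ _ (a2 * (p - 1))).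
    by rewrite ler_wpM2r ?subr_ge0 ?(ltW p1)// ge_min lexx orbT.
  rewrite (_ : a2 * (p - 1) = (p - n%:R) / 2); last by rewrite /a2; field; rewrite gt_eqF// subr_gt0.
  by rewrite ltr_pdivrMr// ltr_pMr ?subr_gt0//; lra.
- rewrite /weight_cst mulr_gt0 ?exprn_gt0// ltr_pwDl// divr_ge0 ?powR_ge0//.
  by rewrite subr_ge0 ltW.
- by move=> S cS S0 bS; apply: (@weight_dist R n n0 beta N).
Qed.

Definition denergy (n : nat) (p g : R) (S : set 'rV[R]_n) (G : 'rV[R]_n -> 'rV[R]_n) c rho : \bar R :=
  (\int[lebesgue_rV n]_(z in cube c rho) (enorm (G z) `^ p * dist S z `^ g)%:E)%E.

Lemma morrey_package (n : nat) (p beta : R) : (0 < n)%N -> n%:R < p ->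
  exists g C : R, [/\ 0 < g, g < p - n%:R, 0 < C &
    forall S : set 'rV[R]_n, closed S -> S !=set0 -> ball_condition beta S ->
    forall (F : 'rV[R]_n -> R) (G : 'rV[R]_n -> 'rV[R]_n), continuous F ->
    (forall i, measurable_fun setT ((fun x => G x ord0 i) : borel_rV R n -> R)) ->
    weak_gradient F G ->
    (forall x y r, 0 < r -> 3 * r <= 2 -> `|x - y| <= r ->
      ((`|F x - F y| `^ p)%:E <= (C * r `^ (p - n%:R - g))%:E * denergy p g S G x (3 * r))%E) /\
    (forall x, ((`|F x| `^ p)%:E <= C%:E *
      (\int[lebesgue_rV n]_(z in cube x 8^-1) (`|F z| `^ p)%:E + denergy p g S G x (3 / 8)))%E)].
Proof.
move=> n0 np; have p1 : 1 < p by apply: le_lt_trans np; rewrite ler1n.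
have [a [Cd [a0 ap Cd0 wS]]] := weight_exists beta n0 np.
have [D [dD [Dl Dr] D01 [D1_ge0 [M D1_le]] [m m0 D1_gt]]] := @smooth_step_exists R.
pose g := a * (p - 1).
pose C1 := (morrey_cst n p a Cd D M + 1) `^ p.
(* With radius 1/8 the energy in the sup bound lives on a cube of radius 3/8; about a point of S the
   weight is at most 1 there and the mu-measure of such cubes is bounded. *)
pose r8 : R := 8^-1.
pose C2 := 2 `^ p * (((M / r8) ^+ n / cphi n D) `^ p * ((2 * r8) ^+ n) `^ (p - 1)).
pose C3 := 2 `^ p * (C1 * r8 `^ (p - n%:R - g)).
have C10 : 0 <= C1 by exact: powR_ge0.
have C20 : 0 <= C2 by rewrite !mulr_ge0 ?powR_ge0.
have C30 : 0 <= C3 by rewrite mulr_ge0 ?mulr_ge0 ?powR_ge0.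
exists g, (C1 + C2 + C3 + 1); split.
- by rewrite /g mulr_gt0// subr_gt0.
- exact: ap.
- by lra.
move=> S cS S0 bS F G cF mG wG; have wd := wS S cS S0 bS.
have W0 c r : (0 <= denergy p g S G c r)%E.
  by apply: integral_ge0 => z _; rewrite lee_fin mulr_ge0 ?powR_ge0.
split=> [x y r r0 r2 xy|x].
  have := @morrey_pow R n p a Cd 2 n0 np a0 Cd0 ap D M m dD Dl Dr D01 D1_ge0 D1_le m0 D1_gt (dist S) F G wd cF wG mG x y r r0 r2 xy.
  move=> /le_trans; apply; apply: lee_wpmul2r; first exact: W0.
  by rewrite lee_fin ler_wpM2r ?powR_ge0// -/C1; lra.
have r80 : 0 < r8 by rewrite invr_gt0.
have r82 : 3 * r8 <= 2 by rewrite /r8; lra.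
have := @sup_pow R n p a Cd 2 n0 np a0 Cd0 ap D M m dD Dl Dr D01 D1_ge0 D1_le m0 D1_gt (dist S) F G wd cF wG mG x r8 r80 r82.
move=> /le_trans; apply.
have X0 : (0 <= \int[lebesgue_rV n]_(z in cube x 8^-1) (`|F z| `^ p)%:E)%E.
  by apply: integral_ge0 => z _; rewrite lee_fin powR_ge0.
rewrite [leRHS](ge0_muleDr _ X0 (W0 _ _)).
apply: leeD.
  by rewrite -EFinM; apply: lee_wpmul2r => //; rewrite lee_fin -/C2; lra.
rewrite /denergy /wenergy; apply: lee_wpmul2r; first exact: W0.
by rewrite lee_fin -/C1 -/C3; lra.
Qed.
End packages.

(** * Measurability on products and Tonelli for cubes *)

Section product_measurability.
Context {R : realType} (n : nat).
Local Notation B := (borel_rV R n).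

Lemma measurable_norm_diff d (T : measurableType d) (f g : T -> B) :
  measurable_fun setT f -> measurable_fun setT g ->
  measurable_fun setT (fun t => `|(f t : 'rV[R]_n) - (g t : 'rV[R]_n)|).
Proof.
move=> mf mg.
have ms : measurable_fun setT (fun t => ((f t : 'rV[R]_n) - (g t : 'rV[R]_n)) : B).
  apply: measurable_fun_rV => j.
  apply: (eq_measurable_fun (fun t => (f t : 'rV[R]_n) ord0 j - (g t : 'rV[R]_n) ord0 j)).
    by move=> t _; rewrite !mxE.
  by apply: measurable_funB; apply: (measurableT_comp (@measurable_coord_rV R n j)).
have mn : measurable_fun setT ((fun x : 'rV[R]_n => `|x|) : B -> R).
  by apply: continuous_measurable_rV; exact: norm_continuous.
exact: (measurableT_comp mn ms).
Qed.

Lemma measurable_cube_indic (rho : R) :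
  measurable_fun setT (fun z : B * B => \1_(cube (z.2 : 'rV[R]_n) rho) z.1 : R).
Proof.
rewrite (_ : (fun=> _) = \1_[set z : B * B | `|(z.1 : 'rV[R]_n) - (z.2 : 'rV[R]_n)| <= rho]); last first.
  by apply/funext => z; rewrite !indicE; congr ((_ : bool)%:R); apply/idP/idP; rewrite !inE.
apply: measurable_indic.
have := measurable_norm_diff (@measurable_fst _ _ B B) (@measurable_snd _ _ B B).
move=> /(_ measurableT _ (measurable_itv `]-oo, rho])); rewrite setTI.
by congr (measurable _); apply/seteqP; split => z /=; rewrite in_itv.
Qed.

Lemma cube_sym (x y : 'rV[R]_n) r : cube x r y <-> cube y r x.
Proof. by rewrite /cube /= distrC. Qed.

Lemma indic_cube_sym (x y : 'rV[R]_n) r : \1_(cube x r) y = \1_(cube y r) x :> R.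
Proof.
by rewrite !indicE; congr ((_ : bool)%:R); apply/idP/idP; rewrite !inE => /cube_sym.
Qed.

Lemma integral_cube_indic (m : {measure set B -> \bar R}) c r (f : B -> \bar R) :
  (\int[m]_(z in cube c r) f z = \int[m]_z (f z * (\1_(cube c r : set B) z)%:E))%E.
Proof.
rewrite integral_mkcond; apply: eq_integral => z _.
by rewrite patchE indicE; case: ifP => _; rewrite ?mule1 ?mule0.
Qed.

(** The relation |x - z| <= rho is symmetric, so swapping the integrals only moves the centre of the
    cube from [x] to [z]. *)
Lemma tonelli_cube (m1 m2 : {measure set B -> \bar R}) (k h : B -> \bar R) rho :
  sigma_finite setT m1 -> sigma_finite setT m2 ->
  measurable_fun setT k -> measurable_fun setT h ->
  (forall x, (0 <= k x)%E) -> (forall x, (0 <= h x)%E) ->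
  (\int[m1]_x (k x * \int[m2]_(z in cube x rho) h z) =
   \int[m2]_z (h z * \int[m1]_(x in cube z rho) k x))%E.
Proof.
move=> s1 s2 mk mh k0 h0.
pose f (z : B * B) := (k z.1 * h z.2 * (\1_(cube (z.2 : 'rV[R]_n) rho) z.1)%:E)%E.
have f0 z : (0 <= f z)%E by rewrite /f !mule_ge0// lee_fin.
have mf : measurable_fun setT f.
  apply: emeasurable_funM.
    by apply: emeasurable_funM; apply: measurableT_comp.
  by apply/measurable_EFinP; exact: measurable_cube_indic.
have := tonelli_swap s1 s2 mf f0.
have mI (y : 'rV[R]_n) : measurable_fun setT (fun x : B => ((\1_(cube y rho : set B) x)%:E : \bar R)).
  by apply/measurable_EFinP; apply: measurable_indic; exact: measurable_cube.
have E1 x : (\int[m2]_y f (x, y) = k x * \int[m2]_(z in cube x rho) h z)%E.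
  rewrite integral_cube_indic -ge0_integralZl//.
  - by apply: eq_integral => y _; rewrite /f /= muleA indic_cube_sym.
  - by apply: emeasurable_funM.
  - by move=> y _; rewrite mule_ge0// lee_fin.
have E2 y : (\int[m1]_x f (x, y) = h y * \int[m1]_(x in cube y rho) k x)%E.
  rewrite integral_cube_indic -ge0_integralZl//.
  - by apply: eq_integral => x _; rewrite /f /= muleA (muleC (h y)).
  - by apply: emeasurable_funM.
  - by move=> x _; rewrite mule_ge0// lee_fin.
move=> E; rewrite (eq_integral (fun x => \int[m2]_y f (x, y))%E) => [|x _]; last by rewrite E1.
by rewrite E; apply: eq_integral => y _; rewrite E2.
Qed.

Lemma measurable_cube_integral (m : {measure set B -> \bar R}) (h : B -> \bar R) rho :
  sigma_finite setT m -> measurable_fun setT h -> (forall x, (0 <= h x)%E) ->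
  measurable_fun setT (fun x : B => \int[m]_(z in cube (x : 'rV[R]_n) rho) h z)%E.
Proof.
move=> s mh h0.
pose f (z : B * B) := (h z.2 * (\1_(cube (z.2 : 'rV[R]_n) rho) z.1)%:E)%E.
have f0 z : (0 <= f z)%E by rewrite /f !mule_ge0// lee_fin.
have mf : measurable_fun setT f.
  apply: emeasurable_funM; first by apply: measurableT_comp.
  by apply/measurable_EFinP; exact: measurable_cube_indic.
apply: eq_measurable_fun (measurable_integral_snd s mf f0) => x _.
by rewrite integral_cube_indic; apply: eq_integral => y _; rewrite /f /= indic_cube_sym.
Qed.
End product_measurability.

(** * Consequences of the doubling condition *)

Section mu_facts.
Context {R : realType} (n : nat) (S : set 'rV[R]_n).
Context (mu : {measure set (borel_rV R n) -> \bar R}) (Cmu C1 C2 : R).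
Local Notation B := (borel_rV R n).
Hypotheses (Cmu0 : 0 < Cmu) (C10 : 0 < C1) (C20 : 0 < C2).
Hypothesis cS : closed S.
Hypothesis muS : mu (~` S) = 0%E.
Hypothesis doubling : forall (x : 'rV[R]_n) (r k : R), S x -> 0 < r <= 1 -> 1 <= k <= r^-1 ->
  (mu (cube x (k * r)) <= (Cmu * k ^+ n)%:E * mu (cube x r))%E.
Hypothesis mu1 : forall x : 'rV[R]_n, S x -> (C1%:E <= mu (cube x 1) <= C2%:E)%E.
Implicit Types (x y z : 'rV[R]_n) (r s : R).

(** Real-valued for division and field arithmetic. It is faithful about points of S for radii up to
    1; an infinite measure would be read as 0. *)
Definition mcube x r : R := fine (mu (cube x r)).

Lemma mu_le (A A' : set 'rV[R]_n) : measurable (A : set B) -> measurable (A' : set B) ->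
  A `<=` A' -> (mu A <= mu A')%E.
Proof. by move=> mA mA' AA'; apply: le_measure => //; rewrite inE. Qed.

Lemma mu_cube_le x r : S x -> r <= 1 -> (mu (cube x r) <= C2%:E)%E.
Proof.
move=> Sx r1; have /andP[_] := mu1 Sx; apply: le_trans.
by apply: mu_le; [exact: measurable_cube|exact: measurable_cube|
  apply: cube_sub; rewrite subrr normr0 add0r].
Qed.

Lemma mu_cubeE x r : S x -> r <= 1 -> mu (cube x r) = (mcube x r)%:E.
Proof.
move=> Sx r1; rewrite /mcube fineK// ge0_fin_numE//.
by apply: le_lt_trans (mu_cube_le Sx r1) _; rewrite ltry.
Qed.

Lemma mcube_ge0 x r : 0 <= mcube x r. Proof. exact: fine_ge0. Qed.

Lemma mcube_le x r : S x -> r <= 1 -> mcube x r <= C2.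
Proof. by move=> Sx r1; rewrite -lee_fin -mu_cubeE// mu_cube_le. Qed.

Lemma mcube_doubling x r s : S x -> 0 < r -> r <= s -> s <= 1 ->
  mcube x s <= Cmu * (s / r) ^+ n * mcube x r.
Proof.
move=> Sx r0 rs s1; have r1 := le_trans rs s1.
have := @doubling x r (s / r) Sx; rewrite r0 r1 divfK ?gt_eqF// => /(_ isT).
rewrite ler_pdivlMr// mul1r rs /= -[leRHS]mul1r ler_pM2r ?invr_gt0// => /(_ s1).
by rewrite !mu_cubeE// -EFinM lee_fin.
Qed.

(** Doubling from radius r up to 1, where the measure is at least [C1]. *)
Lemma mcube_ge x r : S x -> 0 < r -> r <= 1 -> C1 / Cmu * r ^+ n <= mcube x r.
Proof.
move=> Sx r0 r1; have := mcube_doubling Sx r0 r1 (lexx 1).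
have : C1 <= mcube x 1 by rewrite -lee_fin -mu_cubeE//; have /andP[] := mu1 Sx.
move=> h1 h2; have rn : 0 < r ^+ n by rewrite exprn_gt0.
have h3 : C1 * r ^+ n <= Cmu * mcube x r.
  have -> : Cmu * mcube x r = (Cmu * (1 / r) ^+ n * mcube x r) * r ^+ n.
    rewrite expr_div_n expr1n; move: (r ^+ n) rn => A A0.
    by field; rewrite gt_eqF.
  by rewrite ler_pM2r// (le_trans h1).
by rewrite mulrAC ler_pdivrMr// (mulrC _ Cmu).
Qed.

Lemma mcube_gt0 x r : S x -> 0 < r -> r <= 1 -> 0 < mcube x r.
Proof.
move=> Sx r0 r1; apply: lt_le_trans (mcube_ge Sx r0 r1).
by rewrite mulr_gt0 ?divr_gt0// exprn_gt0.
Qed.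

Lemma mcube_mono x y r s : S y -> s <= 1 -> `|x - y| + r <= s -> mcube x r <= mcube y s.
Proof.
move=> Sy s1 h; rewrite /mcube fine_le//; last 2 first.
- by rewrite mu_cubeE.
- by apply: mu_le; [exact: measurable_cube|exact: measurable_cube|exact: cube_sub].
rewrite ge0_fin_numE//; apply: (@le_lt_trans _ _ (mu (cube y s))); last by rewrite mu_cubeE// ltry.
by apply: mu_le; [exact: measurable_cube|exact: measurable_cube|exact: cube_sub].
Qed.

Lemma mu_setIS (A : set 'rV[R]_n) : measurable (A : set B) -> mu (A `&` S) = mu A.
Proof.
move=> mA; have mS := rV_borel_closed cS.
rewrite -[in RHS](setIT A) -(setUv S) setIUr measureU//; last 3 first.
- exact: measurableI.
- by apply: measurableI => //; exact: measurableC.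
- by rewrite setIACA setICr setI0.
rewrite [X in (_ + X)%E](_ : _ = 0%E) ?adde0//.
apply/eqP; rewrite eq_le measure_ge0 andbT -muS; apply: mu_le.
- by apply: measurableI => //; exact: measurableC.
- exact: measurableC.
- exact: subIsetr.
Qed.

(** The centre need not be in S. As [mu] lives on S, the cube is null or meets S at some y, and then
    it lies in [cube y 1] because 2 r <= 1. *)
Lemma mu_cube_any_le z r : r <= 2^-1 -> (mu (cube z r) <= C2%:E)%E.
Proof.
move=> r2; have [[y [cy Sy]]|h] := pselect (exists y, cube z r y /\ S y).
  apply: (@le_trans _ _ (mu (cube y 1))); last by have /andP[] := mu1 Sy.
  apply: mu_le; [exact: measurable_cube|exact: measurable_cube|apply: cube_sub].
  by rewrite distrC; move: cy; rewrite /cube /=; lra.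
rewrite -mu_setIS; last exact: measurable_cube.
rewrite (_ : _ `&` _ = set0) ?measure0 ?lee_fin ?ltW//.
by apply/seteqP; split => // y [? ?]; apply: h; exists y.
Qed.

Lemma sigma_finite_mu : sigma_finite setT mu.
Proof.
pose F (k : nat) : set 'rV[R]_n := if unpickle k is Some q then
  (if (mu (rat_cube q) < +oo)%E then rat_cube q else set0) else set0.
exists F; last first.
  move=> k; rewrite /F; case: unpickle => [q|]; last by rewrite measure0 ltry; split.
  by case: ifPn => [h|_]; [split => //; exact: measurable_cube|rewrite measure0 ltry; split].
apply/seteqP; split => // x _.
pose U : set 'rV[R]_n := [set y | `|y - x| < 2^-1].
have oU : open U.
  rewrite (_ : U = (fun y => `|y - x|) @^-1` [set t | t < 2^-1])//.
  apply: open_comp; last exact: open_lt.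
  move=> y _; apply: continuous_comp; last exact: norm_continuous.
  by apply: continuousB; [exact: id|exact: cst_continuous].
have Ux : U x by rewrite /U /= subrr normr0 invr_gt0.
have [q xq qU] := rat_cube_sub oU Ux.
exists (pickle q) => //; rewrite /F pickleK ifT//.
apply: (@le_lt_trans _ _ C2%:E); last by rewrite ltry.
apply: le_trans (mu_cube_any_le x (lexx _)).
apply: mu_le; [exact: measurable_cube|exact: measurable_cube|].
by move=> y /qU; rewrite /U /cube /= => /ltW.
Qed.

(** The cubes are the sections of one measurable subset of the product, and measures of sections are
    measurable. *)
Lemma measurable_mu_cube d (T : measurableType d) (f : T -> B) (rho : T -> R) :
  measurable_fun setT f -> measurable_fun setT rho ->
  measurable_fun setT (fun t => mu (cube (f t : 'rV[R]_n) (rho t))).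
Proof.
move=> mf mrho.
pose A := [set z : T * B | `|(z.2 : 'rV[R]_n) - (f z.1 : 'rV[R]_n)| - rho z.1 <= 0].
have mA : measurable A.
  have : measurable_fun setT (fun z : T * B => `|(z.2 : 'rV[R]_n) - (f z.1 : 'rV[R]_n)| - rho z.1).
    apply: measurable_funB; last exact: measurableT_comp.
    apply: (measurable_norm_diff (f := snd) (g := f \o fst)) => //.
    exact: measurableT_comp.
  move=> /(_ measurableT _ (measurable_itv `]-oo, 0])); rewrite setTI.
  by congr (measurable _); apply/seteqP; split => z /=; rewrite in_itv.
apply: eq_measurable_fun (measurable_xsection_measure sigma_finite_mu mA) => t _.
congr (mu _); apply/seteqP; split => y; rewrite /xsection /A /cube /=.
  by rewrite inE /= subr_le0.
by move=> h; rewrite inE /= subr_le0.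
Qed.

Lemma measurable_mcube d (T : measurableType d) (f : T -> B) (rho : T -> R) :
  measurable_fun setT f -> measurable_fun setT rho ->
  measurable_fun setT (fun t => mcube (f t : 'rV[R]_n) (rho t)).
Proof.
move=> mf mrho; apply: (measurableT_comp (@fine_measurable R setT measurableT)).
exact: measurable_mu_cube.
Qed.

End mu_facts.

(** * Dyadic scales *)

Section dyadic.
Context {R : realType}.
Implicit Types (u g : R).

Lemma powR_invr (x q : R) : 0 <= x -> (x^-1) `^ q = (x `^ q)^-1.
Proof. by move=> x0; rewrite -powR_inv1// -powRrM mulN1r powRN. Qed.

Lemma powR_inv_le (x y q : R) : 0 < x -> 0 <= q -> x^-1 <= y -> (x `^ q)^-1 <= y `^ q.
Proof.
move=> x0 q0 xy; rewrite -powR_invr ?(ltW x0)//.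
by apply: ge0_ler_powR; rewrite ?nnegrE ?(le_trans _ xy)// invr_ge0 ltW.
Qed.

(** The terms grow geometrically and stop once u 2^k exceeds 3, so the sum is comparable with its
    last nonzero term, whatever [u]. *)
Lemma dyadic_sum_le u g m : 0 < g -> 0 <= u ->
  \sum_(0 <= k < m) (if u * 2 ^+ k <= 3 then (u * 2 ^+ k) `^ g else 0) <=
  (2 `^ g * 3 `^ g) / (2 `^ g - 1).
Proof.
move=> g0 u0; have q1 : 1 < 2 `^ g :> R.
  by have := @gt0_ltr_powR R g g0 1 2; rewrite !nnegrE powR1 => -> //; lra.
have K0 : 0 < 2 `^ g - 1 :> R by lra.
(* The second bound drives the induction: as long as u 2^m <= 3 it yields the uniform bound for the
   next sum, and after that nothing is added. *)
suff [] : \sum_(0 <= k < m) (if u * 2 ^+ k <= 3 then (u * 2 ^+ k) `^ g else 0) <=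
  (2 `^ g * 3 `^ g) / (2 `^ g - 1) /\
  \sum_(0 <= k < m) (if u * 2 ^+ k <= 3 then (u * 2 ^+ k) `^ g else 0) <=
   (u * 2 ^+ m) `^ g / (2 `^ g - 1) by [].
elim: m => [|m [IH1 IH2]].
  by rewrite big_geq//; split; rewrite divr_ge0 ?mulr_ge0 ?powR_ge0// ltW.
have E : (u * 2 ^+ m.+1) `^ g = 2 `^ g * (u * 2 ^+ m) `^ g.
  by rewrite -powRM// ?mulr_ge0 ?exprn_ge0// exprS mulrCA.
have S2 : (u * 2 ^+ m) `^ g / (2 `^ g - 1) + (u * 2 ^+ m) `^ g = (u * 2 ^+ m.+1) `^ g / (2 `^ g - 1).
  by rewrite E; field; rewrite gt_eqF.
rewrite big_nat_recr//=; case: ifPn => h; split.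
- rewrite (le_trans (lerD IH2 (lexx _)))// S2 E ler_pM2r ?invr_gt0// ler_pM2l ?powR_gt0//.
  by rewrite ge0_ler_powR ?nnegrE ?mulr_ge0 ?exprn_ge0// ltW.
- by rewrite -S2 lerD.
- by rewrite addr0.
- by rewrite addr0 (le_trans IH2)// -S2 lerDl powR_ge0.
Qed.

(** Starting at 1/8 ensures 3 [rk k] <= 1/2 and 6 [rk k] <= 1, so that all the enlarged cubes below
    obey the measure bounds. *)
Definition rk k : R := 8^-1 / 2 ^+ k.

Lemma rk_gt0 k : 0 < rk k.
Proof. by rewrite divr_gt0 ?invr_gt0// exprn_gt0. Qed.

Lemma rk_le k : rk k <= 8^-1.
Proof. by rewrite /rk ler_pdivrMr ?exprn_gt0// ler_peMr// exprn_ege1//; lra. Qed.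

Lemma rk_index u : 0 < u -> u <= 8^-1 -> exists k, rk k / 2 < u /\ u <= rk k.
Proof.
move=> u0 u8.
have ex : exists m, rk m < u.
  exists (Num.bound (8^-1 / u)); rewrite /rk ltr_pdivrMr ?exprn_gt0// mulrC -ltr_pdivrMr//.
  apply: lt_le_trans (archi_boundP _) _; first by rewrite divr_ge0// ltW.
  by rewrite -natrX ler_nat ltnW// ltn_expl.
case: (ex_minnP ex) => -[|k] hk hmin; first by move: hk; rewrite /rk expr0 divr1 ltNge u8.
exists k; split; first by move: hk; rewrite /rk exprSr invfM mulrA.
by rewrite leNgt; apply/negP => /hmin; rewrite ltnn.
Qed.
End dyadic.

(** * Restriction: the Besov norm is bounded by the Sobolev norm *)

Section trace_bound.
Context {R : realType} (n : nat) (S : set 'rV[R]_n).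
Context (mu : {measure set (borel_rV R n) -> \bar R}) (p Cmu C1 C2 : R).
Local Notation B := (borel_rV R n).
Local Notation leb := (lebesgue_rV n : {measure set (borel_rV R n) -> \bar R}).
Hypotheses (Cmu0 : 0 < Cmu) (C10 : 0 < C1) (C20 : 0 < C2).
Hypothesis cS : closed S.
Hypothesis S0 : S !=set0.
Hypothesis muS : mu (~` S) = 0%E.
Hypothesis doubling : forall (x : 'rV[R]_n) (r k : R), S x -> 0 < r <= 1 -> 1 <= k <= r^-1 ->
  (mu (cube x (k * r)) <= (Cmu * k ^+ n)%:E * mu (cube x r))%E.
Hypothesis mu1 : forall x : 'rV[R]_n, S x -> (C1%:E <= mu (cube x 1) <= C2%:E)%E.
Hypotheses (n0 : (0 < n)%N) (np : n%:R < p).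
Implicit Types (x y z : 'rV[R]_n) (r s : R) (F : 'rV[R]_n -> R).

Let p1 : 1 < p. Proof. by apply: le_lt_trans np; rewrite ler1n. Qed.
Let p0 : 0 < p. Proof. exact: lt_trans p1. Qed.
Local Notation m := (mcube mu).
Let smu : sigma_finite setT mu.
Proof. by apply: (@sigma_finite_mu R n S mu C1 C2). Qed.
Let mS : measurable (S : set B) := rV_borel_closed cS.
Let muE x r : S x -> r <= 1 -> mu (cube x r) = (m x r)%:E.
Proof. by move=> *; apply: (@mu_cubeE R n S mu C1 C2). Qed.
Let mgt0 x r : S x -> 0 < r -> r <= 1 -> 0 < m x r.
Proof. by move=> *; apply: (@mcube_gt0 R n S mu Cmu C1 C2). Qed.
Let mdbl x r s : S x -> 0 < r -> r <= s -> s <= 1 -> m x s <= Cmu * (s / r) ^+ n * m x r.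
Proof. by move=> *; apply: (@mcube_doubling R n S mu Cmu C1 C2). Qed.
Let mmono x y r s : S y -> s <= 1 -> `|x - y| + r <= s -> m x r <= m y s.
Proof. by move=> *; apply: (@mcube_mono R n S mu C1 C2). Qed.

Lemma besov_kernelE (f : 'rV[R]_n -> R) x y : S x -> 0 < `|x - y| -> `|x - y| < 1 ->
  besov_kernel p mu f x y =
  (`|f x - f y| `^ p / `|x - y| `^ (p - n%:R) / m x `|x - y| ^+ 2)%:E.
Proof.
move=> Sx xy0 xy1; rewrite /besov_kernel xy0 xy1 /= muE ?(ltW xy1)//.
have m0 := mgt0 Sx xy0 (ltW xy1).
by rewrite -EFinM -expr2 inver gt_eqF ?exprn_gt0// -EFinM.
Qed.

Lemma besov_kernel_ge0 f x y : (0 <= besov_kernel p mu f x y)%E.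
Proof.
rewrite /besov_kernel; case: ifP => // _.
rewrite mule_ge0// ?lee_fin ?divr_ge0 ?powR_ge0// inve_ge0 expe_ge0//.
Qed.

(** After the swap the inner integral is the mu-measure of a cube about an arbitrary point, at most
    [C2] by [mu_cube_any_le]. *)
Lemma tonelli_le (h : B -> \bar R) rho : rho <= 2^-1 -> measurable_fun setT h ->
  (forall x, (0 <= h x)%E) ->
  (\int[mu]_x \int[leb]_(z in cube (x : 'rV[R]_n) rho) h z <= C2%:E * \int[leb]_z h z)%E.
Proof.
move=> r2 mh h0.
have := tonelli_cube rho smu (@sigma_finite_leb R n) (@measurable_cst _ _ _ _ setT 1%E) mh (fun=> lee01) h0.
under eq_integral do rewrite mul1e.
move=> ->; rewrite -ge0_integralZl//; last by rewrite lee_fin ltW.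
apply: ge0_le_integral_nm => z _; first by rewrite mule_ge0// integral_ge0.
rewrite muleC; apply: lee_wpmul2r => //; rewrite integral_cst ?mul1e; last exact: measurable_cube.
by apply: (@mu_cube_any_le R n S mu C1 C2).
Qed.

Variables (g C : R).
Hypotheses (g0 : 0 < g) (gpn : g < p - n%:R) (C0 : 0 < C).
Variables (F : 'rV[R]_n -> R) (G : 'rV[R]_n -> 'rV[R]_n).
Hypotheses (cF : continuous F).
Hypothesis mG : forall i, measurable_fun setT ((fun x => G x ord0 i) : B -> R).
Hypothesis morrey1 : forall x y r, 0 < r -> 3 * r <= 2 -> `|x - y| <= r ->
  ((`|F x - F y| `^ p)%:E <= (C * r `^ (p - n%:R - g))%:E * denergy p g S G x (3 * r))%E.
Hypothesis morrey2 : forall x, ((`|F x| `^ p)%:E <= C%:E *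
  (\int[leb]_(z in cube x 8^-1) (`|F z| `^ p)%:E + denergy p g S G x (3 / 8)))%E.

Let hF (z : B) : \bar R := (`|F z| `^ p)%:E.
Let hG (z : B) : \bar R := (enorm (G z) `^ p)%:E.
Let hD (z : B) : \bar R := (enorm (G z) `^ p * dist S z `^ g)%:E.
Let mpow (f : B -> R) (q : R) : measurable_fun setT f -> measurable_fun setT (fun z : B => f z `^ q).
Proof.
by move=> mf; apply: (@measurableT_comp _ _ _ _ _ _ (fun y : R => powR y _)); first exact: measurable_powR.
Qed.
Let mhF : measurable_fun setT hF.
Proof.
apply/measurable_EFinP; apply: mpow; apply: continuous_measurable_rV => z.
by apply: continuous_comp; [exact: cF|exact: norm_continuous].
Qed.
Let mhG : measurable_fun setT hG.
Proof. by apply/measurable_EFinP; apply: mpow; exact: measurable_enorm. Qed.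
Let mhD : measurable_fun setT hD.
Proof.
apply/measurable_EFinP; apply: measurable_funM; first by apply: mpow; exact: measurable_enorm.
by apply: mpow; apply: continuous_measurable_rV; exact: dist_continuous.
Qed.
Let hF0 z : (0 <= hF z)%E. Proof. by rewrite lee_fin powR_ge0. Qed.
Let hG0 z : (0 <= hG z)%E. Proof. by rewrite lee_fin powR_ge0. Qed.
Let hD0 z : (0 <= hD z)%E. Proof. by rewrite lee_fin mulr_ge0// powR_ge0. Qed.
Let X : \bar R := (\int[leb]_z hF z)%E.
Let Y : \bar R := (\int[leb]_z hG z)%E.
Let X0 : (0 <= X)%E. Proof. by apply: integral_ge0. Qed.
Let Y0 : (0 <= Y)%E. Proof. by apply: integral_ge0. Qed.

Lemma denergy_le x rho : S x -> rho <= 1 ->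
  (denergy p g S G x rho <= \int[leb]_(z in cube x rho) hG z)%E.
Proof.
move=> Sx r1; apply: ge0_le_integral_nm => z cz; first exact: hD0.
rewrite lee_fin ler_piMr ?powR_ge0//.
have d1 : dist S z <= 1.
  by apply: le_trans (dist_le z Sx) _; apply: le_trans r1.
apply: (@le_trans _ _ (1 `^ g)); last by rewrite powR1.
by apply: ge0_ler_powR; rewrite ?nnegrE ?(ltW g0)// dist_ge0.
Qed.

Lemma trace_Lp_le : (\int[mu]_(x in S) hF x <= (C * C2)%:E * (X + Y))%E.
Proof.
have T1 : (0 <= \int[mu]_x \int[leb]_(z in cube (x : 'rV[R]_n) 8^-1) hF z)%E.
  by apply: integral_ge0 => x _; exact: integral_ge0.
rewrite integral_mkcond.
apply: (@le_trans _ _ (\int[mu]_x (C%:E * (\int[leb]_(z in cube (x : 'rV[R]_n) 8^-1) hF z +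
   \int[leb]_(z in cube (x : 'rV[R]_n) (3 / 8)%R) hG z)))%E).
  apply: ge0_le_integral_nm => x _; rewrite patchE; case: ifPn => // [/set_mem Sx|_].
    apply: le_trans (morrey2 x) _; apply: lee_wpmul2l; first by rewrite lee_fin ltW.
    by apply: leeD2l; apply: denergy_le => //; lra.
  by apply: mule_ge0; [rewrite lee_fin ltW|apply: adde_ge0; apply: integral_ge0].
have m1 : measurable_fun setT (fun x : B => \int[leb]_(z in cube (x : 'rV[R]_n) 8^-1) hF z)%E.
  by apply: measurable_cube_integral => //; exact: sigma_finite_leb.
have m2 : measurable_fun setT (fun x : B => \int[leb]_(z in cube (x : 'rV[R]_n) (3 / 8)%R) hG z)%E.
  by apply: measurable_cube_integral => //; exact: sigma_finite_leb.
rewrite ge0_integralZl//; last 3 first.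
- exact: emeasurable_funD.
- by move=> x _; rewrite adde_ge0// integral_ge0.
- by rewrite lee_fin ltW.
rewrite EFinM -muleA; apply: lee_wpmul2l; first by rewrite lee_fin ltW.
rewrite ge0_integralD//; last 2 first.
- by move=> x _; exact: integral_ge0.
- by move=> x _; exact: integral_ge0.
by rewrite ge0_muleDr//; apply: leeD; apply: tonelli_le => //; lra.
Qed.

Let K2 := C * 2 `^ (p - n%:R) * (Cmu * 4 ^+ n) ^+ 2.
Let c0 := C1 / Cmu * 8^-1 ^+ n.
Let K1 := 2 `^ p * 8 `^ (p - n%:R) / c0 ^+ 2.

(** In the shell |x - y| is comparable with r and, by doubling, the cube about [x] has at least a
    multiple of the measure of [cube y r]. The bound thus depends on [y] and [r] only, after
    Morrey's inequality for the numerator. *)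
Lemma kernel_near x y r : S x -> S y -> 0 < r -> r <= 8^-1 -> r / 2 < `|x - y| -> `|x - y| <= r ->
  (besov_kernel p mu F x y <= (K2 * r `^ (- g) / m y r ^+ 2)%:E * denergy p g S G y (3 * r))%E.
Proof.
move=> Sx Sy r0 r8 xyr xyr'.
have xy0 : 0 < `|x - y| by apply: lt_trans xyr; rewrite divr_gt0.
rewrite besov_kernelE//; last by rewrite (le_lt_trans xyr')//; lra.
have mx := mgt0 Sx xy0; have my := mgt0 Sy r0.
have {}mx : 0 < m x `|x - y| by apply: mx; lra.
have {}my : 0 < m y r by apply: my; lra.
(* As r < 2 |x - y|, [cube y r] lies in the cube about x of radius 4 |x - y|, which is at most
   1/2. *)
have hm : m y r <= Cmu * 4 ^+ n * m x `|x - y|.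
  apply: (@le_trans _ _ (m x (4 * `|x - y|))).
    by apply: mmono => //; rewrite ?(distrC y x); lra.
  have := @mdbl x `|x - y| (4 * `|x - y|) Sx xy0.
  by rewrite mulfK ?gt_eqF//; apply; lra.
have hA : (`|x - y| `^ (p - n%:R))^-1 / m x `|x - y| ^+ 2 <=
    (2 / r) `^ (p - n%:R) * ((Cmu * 4 ^+ n) ^+ 2 / m y r ^+ 2).
  apply: ler_pM.
  - by rewrite invr_ge0 powR_ge0.
  - by rewrite invr_ge0 sqr_ge0.
  - apply: powR_inv_le => //; first by rewrite subr_ge0 ltW.
    by rewrite -(invrK (2 / r)) lef_pV2 ?posrE ?invr_gt0 ?divr_gt0// invf_div ltW.
  - rewrite ler_pdivlMr ?exprn_gt0// mulrC ler_pdivrMr ?exprn_gt0//.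
    by rewrite -exprMn lerXn2r// nnegrE ltW// mulr_gt0// mulr_gt0// exprn_gt0.
rewrite -mulrA EFinM.
apply: (@le_trans _ _ ((C * r `^ (p - n%:R - g))%:E * denergy p g S G y (3 * r) *
   ((2 / r) `^ (p - n%:R) * ((Cmu * 4 ^+ n) ^+ 2 / m y r ^+ 2))%:E)%E).
  apply: lee_pmul.
  - by rewrite lee_fin powR_ge0.
  - by rewrite lee_fin divr_ge0 ?sqr_ge0// invr_ge0 powR_ge0.
  - by rewrite distrC; apply: morrey1 => //; [lra|rewrite distrC].
  - by rewrite lee_fin.
rewrite muleAC -EFinM le_eqVlt; apply/orP; left; apply/eqP; congr (_%:E * _)%E.
rewrite powRM ?invr_ge0 ?(ltW r0)// -(powR_inv1 (ltW r0)) -powRrM mulN1r.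
have -> : r `^ (- g) = r `^ (p - n%:R - g) * r `^ (- (p - n%:R)).
  by rewrite -powRD ?(gt_eqF r0) ?implybT//; congr (_ `^ _); ring.
by rewrite /K2; ring.
Qed.

(** Both denominators are bounded below, so no cancellation in F x - F y has to be exploited. *)
Lemma kernel_far x y : S x -> S y -> 8^-1 <= `|x - y| -> `|x - y| < 1 ->
  (besov_kernel p mu F x y <= (K1 * (`|F x| `^ p + `|F y| `^ p))%:E)%E.
Proof.
move=> Sx Sy xy8 xy1; have xy0 : 0 < `|x - y| by apply: lt_le_trans xy8; rewrite invr_gt0.
rewrite besov_kernelE// lee_fin.
have c00 : 0 < c0 by rewrite mulr_gt0 ?divr_gt0 ?exprn_gt0// invr_gt0.
have mx := mgt0 Sx xy0 (ltW xy1).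
have hm : c0 <= m x `|x - y|.
  apply: (@le_trans _ _ (m x 8^-1)); last first.
    by apply: mmono => //; [exact: ltW|rewrite subrr normr0 add0r].
  by apply: (@mcube_ge R n S mu Cmu C1 C2) => //; rewrite ?invr_gt0//; lra.
have -> : K1 * (`|F x| `^ p + `|F y| `^ p) =
  (2 `^ p * (`|F x| `^ p + `|F y| `^ p)) * 8 `^ (p - n%:R) * (c0 ^+ 2)^-1 by rewrite /K1; ring.
apply: ler_pM.
- by rewrite mulr_ge0 ?powR_ge0// invr_ge0 powR_ge0.
- by rewrite invr_ge0 sqr_ge0.
- apply: ler_pM; rewrite ?powR_ge0 ?invr_ge0 ?powR_ge0//.
    apply: le_trans (powR_add_le p0 (normr_ge0 _) (normr_ge0 _)).
    by rewrite ge0_ler_powR ?nnegrE ?(ltW p0) ?addr_ge0// ler_normB.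
  apply: powR_inv_le => //; first by rewrite subr_ge0 ltW.
  by rewrite -(invrK 8) lef_pV2 ?posrE ?invr_gt0.
- by rewrite lef_pV2 ?posrE ?exprn_gt0// lerXn2r// nnegrE ltW.
Qed.

(** Integrating in x over the shell at scale [rk k] cancels one of the two measures in the Besov
    denominator; this is the one that survives. *)
Let w (k : nat) (y : B) : R := \1_S y / m y (rk k).

Let w_ge0 k y : 0 <= w k y.
Proof. by rewrite divr_ge0// mcube_ge0. Qed.

Let mw k : measurable_fun setT (fun y : B => (w k y)%:E).
Proof.
apply/measurable_EFinP; apply: measurable_funM; first exact: measurable_indic.
rewrite (_ : (fun=> _) = (fun y : B => m y (rk k) `^ (-1))); last first.
  by apply/funext => y; rewrite powR_inv1// mcube_ge0.
by apply: mpow; apply: (@measurable_mcube R n S mu C1 C2).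
Qed.

Let K3 := Cmu * 6 ^+ n.

(** For y in S and in the cube Q about z of radius 3 [rk k], Q lies in the cube about y of radius 6
    [rk k]; doubling gives [w k y] <= [K3] / mu(Q), and integration over Q cancels mu(Q). If dist(z,
    S) > 3 [rk k], then Q misses S. *)
Lemma inner_weight_le k z :
  (\int[mu]_(y in cube z (3 * rk k)) (w k y)%:E <=
   (if (dist S z <= 3 * rk k)%R then K3 else 0)%:E)%E.
Proof.
have r0 := @rk_gt0 R k; have r8 := @rk_le R k.
have K30 : 0 <= K3 by rewrite /K3 mulr_ge0 ?exprn_ge0 ?(ltW Cmu0).
have [[y0 [cy0 Sy0]]|h] := pselect (exists y, cube z (3 * rk k) y /\ S y); last first.
  apply: (@le_trans _ _ 0%E); last by case: ifP => _; rewrite lee_fin.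
  rewrite integral0_eq// => y cy; rewrite /w indicE memNset ?mul0r// => Sy.
  by apply: h; exists y.
have -> : dist S z <= 3 * rk k.
  by apply: le_trans (dist_le z Sy0) _; move/cube_sym : cy0.
pose mz := m z (3 * rk k).
have hm y : S y -> cube z (3 * rk k) y -> mz <= K3 * m y (rk k).
  move=> Sy cy; apply: (@le_trans _ _ (m y (6 * rk k))).
    by apply: mmono => //; [lra|rewrite distrC; move: cy; rewrite /cube /=; lra].
  have := @mdbl y (rk k) (6 * rk k) Sy r0; rewrite mulfK ?gt_eqF//; apply; lra.
have muz : mu (cube z (3 * rk k)) = mz%:E.
  rewrite /mz /mcube fineK// ge0_fin_numE//; apply: (@le_lt_trans _ _ C2%:E); last by rewrite ltry.
  by apply: (@mu_cube_any_le R n S mu C1 C2) => //; lra.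
have mcz := @measurable_cube R n z (3 * rk k).
have mz0 : 0 <= mz by exact: mcube_ge0.
(* A null cube makes the bound [K3 / mz] meaningless, but then the integral vanishes. *)
have [mz00|mzn] := eqVneq mz 0.
  rewrite (_ : \int[mu]_(y in _) _ = 0)%E ?lee_fin//.
  apply: null_set_integral => //; last by rewrite muz mz00.
  by apply: measurable_funTS; exact: mw.
have mzp : 0 < mz by rewrite lt_neqAle eq_sym mzn.
apply: (@le_trans _ _ (\int[mu]_(y in cube z (3 * rk k)) (K3 / mz)%:E)%E).
  apply: ge0_le_integral_nm => y cy; rewrite lee_fin ?w_ge0// /w indicE.
  have [/set_mem Sy|_] := boolP (y \in S); last by rewrite mul0r divr_ge0.
  have my := mgt0 Sy r0; have {}my : 0 < m y (rk k) by apply: my; lra.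
  by rewrite mul1r -[leLHS]mul1r ler_pdivrMr// mulrAC ler_pdivlMr// mul1r hm.
by rewrite integral_cst// muz -EFinM divfK.
Qed.

(** The points x are sorted by |x - y|: the series collects the dyadic shells below 1/8, the last
    term the range from 1/8 to 1. On the diagonal the kernel is 0. *)
Lemma besov_inner_le y : S y ->
  (\int[mu]_(x in S) besov_kernel p mu F x y <=
   \sum_(k <oo) ((K2 * rk k `^ (- g))%:E * ((w k y)%:E * denergy p g S G y (3 * rk k))) +
   K1%:E * (C2%:E * hF y + \int[mu]_(x in cube y 1) (hF x * (\1_(S : set B) x)%:E)))%E.
Proof.
move=> Sy.
have K20 : 0 <= K2 by rewrite (mulr_ge0 _ (sqr_ge0 _))// mulr_ge0 ?powR_ge0// ltW.
have K10 : 0 <= K1 by rewrite /K1 divr_ge0 ?sqr_ge0// mulr_ge0 ?powR_ge0.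
have E0 k : (0 <= denergy p g S G y (3 * rk k))%E by apply: integral_ge0 => z _; exact: hD0.
pose t k (x : B) : \bar R := ((K2 * rk k `^ (- g) / m y (rk k) ^+ 2)%:E * denergy p g S G y (3 * rk k) *
   (\1_(cube y (rk k) : set B) x)%:E)%E.
pose q (x : B) : \bar R := (K1%:E * ((hF x * (\1_(S : set B) x)%:E + hF y) * (\1_(cube y 1 : set B) x)%:E))%E.
have c0k k : 0 <= K2 * rk k `^ (- g) / m y (rk k) ^+ 2.
  by rewrite divr_ge0 ?sqr_ge0// mulr_ge0 ?powR_ge0.
have t0 k x : (0 <= t k x)%E by rewrite /t !mule_ge0// ?lee_fin.
have q0 x : (0 <= q x)%E by rewrite /q !mule_ge0 ?adde_ge0 ?mule_ge0// lee_fin.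
have mind r : measurable_fun setT (fun x : B => ((\1_(cube y r : set B) x)%:E : \bar R)).
  by apply/measurable_EFinP; apply: measurable_indic; exact: measurable_cube.
have mindS : measurable_fun setT (fun x : B => ((\1_(S : set B) x)%:E : \bar R)).
  by apply/measurable_EFinP; apply: measurable_indic.
have mt k : measurable_fun setT (t k) by apply: measurable_funeM.
have mq1 : measurable_fun setT (fun x : B => hF x * (\1_(S : set B) x)%:E)%E by exact: emeasurable_funM.
have mq : measurable_fun setT q.
  by apply: measurable_funeM; apply: emeasurable_funM => //; apply: emeasurable_funD.
apply: (@le_trans _ _ (\int[mu]_x (\sum_(k <oo) t k x + q x))%E).
  rewrite integral_mkcond; apply: ge0_le_integral_nm => x _; rewrite patchE.
    by case: ifPn => // _; exact: besov_kernel_ge0.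
  have st0 : (0 <= \sum_(k <oo) t k x)%E by apply: nneseries_ge0 => k _ _; exact: t0.
  case: ifPn => [/set_mem Sx|_]; last by rewrite adde_ge0.
  have [xy0|xy0] := leP `|x - y| 0.
    by rewrite /besov_kernel ltNge xy0 /= adde_ge0.
  have [xy1|xy1] := leP 1 `|x - y|.
    by rewrite /besov_kernel (ltNge _ 1) xy1 andbF adde_ge0.
  have [xy8|xy8] := leP `|x - y| 8^-1.
    have [k [k1 k2]] := rk_index xy0 xy8.
    apply: (@le_trans _ _ (t k x)).
      rewrite /t indicE mem_set// mule1; apply: kernel_near => //; [exact: rk_gt0|exact: rk_le].
    by apply: le_trans (leeDl _ (q0 x)); exact: ge_nneseries_term.
  apply: (@le_trans _ _ (q x)); last exact: leeDr.
  rewrite /q !indicE (mem_set Sx) (mem_set (_ : cube y 1 x)) ?mule1; last exact: ltW.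
  by rewrite /hF -EFinD -EFinM; apply: kernel_far => //; exact: ltW.
rewrite ge0_integralD//; last 2 first.
- by move=> x _; apply: nneseries_ge0 => k _ _; exact: t0.
- by apply: ge0_emeasurable_sum => // k x _ _; exact: t0.
apply: leeD.
  rewrite integral_nneseries// le_eqVlt; apply/orP; left; apply/eqP.
  apply: eq_eseriesr => k _; rewrite /t ge0_integralZl//; last by rewrite mule_ge0// lee_fin.
  rewrite integral_indic ?setIT//; last exact: measurable_cube.
  have r1 : rk k <= 1 :> R by apply: le_trans (@rk_le R k) _; lra.
  have my := mgt0 Sy (@rk_gt0 R k) r1.
  rewrite muE// /w indicE mem_set// muleAC [RHS]muleA -!EFinM; congr (_%:E * _)%E.
  by rewrite /= mul1r; field; rewrite gt_eqF.
rewrite /q ge0_integralZl//; last by move=> x _; rewrite mule_ge0 ?adde_ge0 ?mule_ge0// lee_fin.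
apply: lee_wpmul2l; first by rewrite lee_fin.
rewrite [X in (X <= _)%E](_ : _ = (\int[mu]_x ((hF x * (\1_(S : set B) x)%:E) * (\1_(cube y 1 : set B) x)%:E) +
   \int[mu]_x (hF y * (\1_(cube y 1 : set B) x)%:E))%E); last first.
  rewrite -ge0_integralD//.
  - by apply: eq_integral => x _; rewrite ge0_muleDl// mule_ge0// lee_fin.
  - by move=> x _; rewrite !mule_ge0// lee_fin.
  - exact: emeasurable_funM.
  - by move=> x _; rewrite mule_ge0// lee_fin.
  - exact: measurable_funeM.
rewrite addeC; apply: leeD.
  rewrite ge0_integralZl// muleC; apply: lee_wpmul2r => //.
  rewrite integral_indic ?setIT//; last exact: measurable_cube.
  by have /andP[_] := mu1 Sy.
by rewrite integral_cube_indic.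
by apply: emeasurable_funM => //; apply: emeasurable_funD.
Qed.

Let Kg := (2 `^ g * 3 `^ g) / (2 `^ g - 1) : R.
Let Kg0 : 0 <= Kg.
Proof.
have q1 : 1 < 2 `^ g :> R.
  by have := @gt0_ltr_powR R g g0 1 2; rewrite !nnegrE powR1 => -> //; lra.
by rewrite /Kg divr_ge0 ?mulr_ge0 ?powR_ge0// subr_ge0 ltW.
Qed.

Definition trace_cst : R := K2 * K3 * Kg + K1 * (C2 * (C * C2) * 2).

(** Tonelli turns the near part into an integral in z of |G z|^p times the sum of (dist(z, S) /
    [rk k])^g over the scales with dist(z, S) <= 3 [rk k], which [dyadic_sum_le] bounds uniformly.
    The far part is twice the L_p(mu) bound, mu being at most [C2] on unit cubes about S. *)
Lemma besov_trace_le :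
  (\int[mu]_(y in S) \int[mu]_(x in S) besov_kernel p mu F x y <= trace_cst%:E * (X + Y))%E.
Proof.
have K20 : 0 <= K2 by rewrite (mulr_ge0 _ (sqr_ge0 _))// mulr_ge0 ?powR_ge0// ltW.
have K10 : 0 <= K1 by rewrite /K1 divr_ge0 ?sqr_ge0// mulr_ge0 ?powR_ge0.
have K30 : 0 <= K3 by rewrite /K3 mulr_ge0 ?exprn_ge0 ?(ltW Cmu0).
have E0 k y : (0 <= denergy p g S G y (3 * rk k))%E by apply: integral_ge0 => z _; exact: hD0.
have rg0 k : 0 <= K2 * rk k `^ (- g) by rewrite mulr_ge0 ?powR_ge0.
have c1 : 0 <= K2 * K3 * Kg := mulr_ge0 (mulr_ge0 K20 K30) Kg0.
have c2 : 0 <= K1 * (C2 * (C * C2) * 2).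
  by apply: (mulr_ge0 K10); rewrite !mulr_ge0// ltW.
pose hS (x : B) : \bar R := (hF x * (\1_(S : set B) x)%:E)%E.
have hS0 x : (0 <= hS x)%E by rewrite mule_ge0// lee_fin.
have mindS : measurable_fun setT (fun x : B => ((\1_(S : set B) x)%:E : \bar R)).
  by apply/measurable_EFinP; apply: measurable_indic.
have mhS : measurable_fun setT hS by exact: emeasurable_funM.
pose T1 k (y : B) : \bar R := ((K2 * rk k `^ (- g))%:E * ((w k y)%:E * denergy p g S G y (3 * rk k)))%E.
have T10 k y : (0 <= T1 k y)%E by rewrite /T1 !mule_ge0// lee_fin.
have mden k : measurable_fun setT (fun y : B => denergy p g S G (y : 'rV[R]_n) (3 * rk k)%R).
  by apply: measurable_cube_integral => //; exact: sigma_finite_leb.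
have mT1 k : measurable_fun setT (T1 k).
  by apply: measurable_funeM; apply: emeasurable_funM.
pose I1 (y : B) : \bar R := (\int[mu]_(x in cube (y : 'rV[R]_n) 1) hS x)%E.
have I10 y : (0 <= I1 y)%E by apply: integral_ge0.
have mI1 : measurable_fun setT I1 by apply: measurable_cube_integral.
pose T2 (y : B) : \bar R := (K1%:E * (C2%:E * hS y + (\1_(S : set B) y)%:E * I1 y))%E.
have T20 y : (0 <= T2 y)%E.
  by rewrite /T2 mule_ge0 ?adde_ge0 ?mule_ge0// lee_fin// ltW.
have mT2 : measurable_fun setT T2.
  apply: measurable_funeM; apply: emeasurable_funD; first exact: measurable_funeM.
  exact: emeasurable_funM.
have A1 : (\int[mu]_x hS x <= (C * C2)%:E * (X + Y))%E.
  rewrite (_ : \int[mu]_x hS x = \int[mu]_(x in S) hF x)%E; first exact: trace_Lp_le.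
  rewrite [RHS]integral_mkcond; apply: eq_integral => x _.
  by rewrite /hS patchE indicE; case: ifP => _; rewrite ?mule1 ?mule0.
apply: (@le_trans _ _ (\int[mu]_y (\sum_(k <oo) T1 k y + T2 y))%E).
  rewrite integral_mkcond; apply: ge0_le_integral_nm => y _; rewrite patchE.
    by case: ifPn => // _; apply: integral_ge0 => x _; exact: besov_kernel_ge0.
  case: ifPn => [/set_mem Sy|_]; last by rewrite adde_ge0// nneseries_ge0.
  apply: le_trans (besov_inner_le Sy) _; apply: leeD2l.
  by rewrite /T2 /hS indicE mem_set// mule1 mul1e.
rewrite ge0_integralD//; last 2 first.
- by move=> y _; apply: nneseries_ge0.
- by apply: ge0_emeasurable_sum.
rewrite /trace_cst EFinD ge0_muleDl ?lee_fin//.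
apply: leeD.
  rewrite integral_nneseries//.
  apply: (@le_trans _ _ (\sum_(k <oo) \int[leb]_z ((K2 * rk k `^ (- g) * K3)%:E *
     (hD z * (if (dist S z <= 3 * rk k)%R then 1 else 0)%:E)))%E).
    apply: lee_nneseries => [k _ _|k _]; first by apply: integral_ge0.
    rewrite /T1 ge0_integralZl//; last 3 first.
    - by apply: emeasurable_funM.
    - by move=> y _; rewrite mule_ge0// lee_fin.
    - by rewrite lee_fin.
    rewrite (tonelli_cube (3 * rk k) smu (@sigma_finite_leb R n) (mw k) mhD _ hD0); last first.
      by move=> x; rewrite lee_fin.
    have mif : measurable_fun setT (fun z : B => ((if (dist S z <= 3 * rk k)%R then 1 else 0)%:E : \bar R)).
      apply/measurable_EFinP.
      rewrite (_ : (fun=> _) = \1_[set z : B | dist S z <= 3 * rk k]); last first.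
        by apply/funext => z; rewrite indicE; case: ifPn => h; [rewrite mem_set|rewrite memNset//; apply/negP].
      apply: measurable_indic.
      have := continuous_measurable_rV (dist_continuous S0) measurableT (measurable_itv `]-oo, (3 * rk k)]).
      by rewrite setTI; congr (measurable _); apply/seteqP; split => z /=; rewrite in_itv.
    have if0 z : (0 <= (if (dist S z <= 3 * rk k)%R then 1 else 0)%:E :> \bar R)%E.
      by case: ifP => _; rewrite lee_fin.
    rewrite ge0_integralZl//; last 3 first.
    - exact: emeasurable_funM.
    - by move=> z _; rewrite mule_ge0.
    - by rewrite lee_fin (mulr_ge0 (rg0 k) K30).
    rewrite [X in (_ <= X * _)%E]EFinM -muleA; apply: lee_wpmul2l; first by rewrite lee_fin.
    rewrite -ge0_integralZl//; last 2 first.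
    - exact: emeasurable_funM.
    - by move=> z _; rewrite mule_ge0.
    apply: ge0_le_integral_nm => z _; first by apply: mule_ge0 => //; apply: integral_ge0 => y _; rewrite lee_fin w_ge0.
    rewrite muleCA; apply: lee_wpmul2l => //.
    apply: le_trans (inner_weight_le k z) _.
    by case: ifP => _; rewrite ?mule1 ?mule0.
  have mif k : measurable_fun setT (fun z : B => ((K2 * rk k `^ (- g) * K3)%:E *
     (hD z * (if (dist S z <= 3 * rk k)%R then 1 else 0)%:E))%E).
    apply: measurable_funeM; apply: emeasurable_funM => //.
    apply/measurable_EFinP.
    rewrite (_ : (fun=> _) = \1_[set z : B | dist S z <= 3 * rk k]); last first.
      by apply/funext => z; rewrite indicE; case: ifPn => h; [rewrite mem_set|rewrite memNset//; apply/negP].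
    apply: measurable_indic.
    have := continuous_measurable_rV (dist_continuous S0) measurableT (measurable_itv `]-oo, (3 * rk k)]).
    by rewrite setTI; congr (measurable _); apply/seteqP; split => z /=; rewrite in_itv.
  have if0 k z : (0 <= (K2 * rk k `^ (- g) * K3)%:E *
     (hD z * (if (dist S z <= 3 * rk k)%R then 1 else 0)%:E))%E.
    apply: mule_ge0; first by rewrite lee_fin (mulr_ge0 (rg0 k) K30).
    by apply: mule_ge0 => //; case: ifP => _; rewrite lee_fin.
  rewrite -integral_nneseries//.
  apply: (@le_trans _ _ ((K2 * K3 * Kg)%:E * Y)%E); last first.
    by apply: lee_wpmul2l; [rewrite lee_fin|exact: leeDr].
  rewrite /Y -ge0_integralZl ?lee_fin//.
  apply: ge0_le_integral_nm => z _; first by apply: nneseries_ge0.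
  apply: nneseries_le_bound => // l.
  have d0 := dist_ge0 S0 z.
  have u0 : 0 <= 8 * dist S z by rewrite mulr_ge0.
  have hd := dyadic_sum_le l g0 u0.
  (* Since [rk k] is 2^(-k) / 8, the quotient dist(z, S) / [rk k] is u 2^k with u = 8 dist(z, S),
     the form that [dyadic_sum_le] expects. *)
  rewrite (eq_bigr (fun k => ((K2 * K3 * enorm (G z) `^ p) *
     (if 8 * dist S z * 2 ^+ k <= 3 then (8 * dist S z * 2 ^+ k) `^ g else 0))%:E)); last first.
    move=> k _; have E : 8 * dist S z * 2 ^+ k = dist S z / rk k.
      by rewrite /rk invf_div invrK; ring.
    have -> : (8 * dist S z * 2 ^+ k <= 3) = (dist S z <= 3 * rk k).
      by rewrite E ler_pdivrMr// rk_gt0.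
    rewrite E; case: ifP => _; last by rewrite mule0 mule0 mulr0.
    rewrite mule1 -EFinM powRM ?invr_ge0 ?(ltW (@rk_gt0 R k))// powR_invr ?(ltW (@rk_gt0 R k))// -powRN.
    by congr (_%:E); ring.
  rewrite sumEFin -mulr_sumr -EFinM lee_fin.
  have -> : K2 * K3 * Kg * enorm (G z) `^ p = K2 * K3 * enorm (G z) `^ p * Kg by ring.
  by apply: ler_wpM2l => //; exact: (mulr_ge0 (mulr_ge0 K20 K30) (powR_ge0 _ _)).
rewrite /T2 ge0_integralZl//; last 2 first.
- apply: emeasurable_funD; first exact: measurable_funeM.
  exact: emeasurable_funM.
- by move=> y _; apply: adde_ge0; apply: mule_ge0; rewrite ?lee_fin// ltW.
rewrite [X in (_ <= X * _)%E]EFinM -muleA; apply: lee_wpmul2l; first by rewrite lee_fin.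
rewrite ge0_integralD//; last 4 first.
- by move=> y _; rewrite mule_ge0// lee_fin ltW.
- exact: measurable_funeM.
- by move=> y _; rewrite mule_ge0// lee_fin.
- exact: emeasurable_funM.
rewrite ge0_integralZl//; last by rewrite lee_fin ltW.
rewrite (tonelli_cube 1 smu smu mindS mhS _ hS0); last by move=> x; rewrite lee_fin.
have C200 : 0 <= C2 by exact: ltW.
have A2 : (\int[mu]_x (hS x * \int[mu]_(y in cube (x : 'rV[R]_n) 1) (\1_(S : set B) y)%:E) <= C2%:E * \int[mu]_x hS x)%E.
  rewrite -ge0_integralZl//.
  apply: ge0_le_integral_nm => x _; first by rewrite mule_ge0// integral_ge0// => y _; rewrite lee_fin.
  rewrite muleC /hS indicE; have [/set_mem Sx|_] := boolP (x \in S); last by rewrite !mule0.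
  apply: lee_wpmul2r; first by rewrite mule1.
  rewrite integral_indic//; last exact: measurable_cube.
  apply: (@le_trans _ _ (mu (cube x 1))); last by have /andP[_] := mu1 Sx.
  apply: le_measure; rewrite ?inE; [|exact: measurable_cube|exact: subIsetr].
  by apply: measurableI => //; exact: measurable_cube.
apply: (@le_trans _ _ (C2%:E * ((C * C2)%:E * (X + Y)) + C2%:E * ((C * C2)%:E * (X + Y)))%E).
  apply: leeD; first by apply: lee_wpmul2l; [rewrite lee_fin|].
  by apply: le_trans A2 _; apply: lee_wpmul2l; [rewrite lee_fin|].
have XY0 : (0 <= X + Y)%E by exact: adde_ge0.
rewrite muleA -ge0_muleDl ?lee_fin ?mulr_ge0 ?(ltW C0)// -EFinM -EFinD.
by apply: lee_wpmul2r => //; rewrite lee_fin le_eqVlt; apply/orP; left; apply/eqP; ring.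
Qed.
End trace_bound.

(** * The smoothed kernel of the extension *)

Section kernel.
Context {R : realType} (n : nat).
Implicit Types (x y z : 'rV[R]_n) (e : R).
Variables (D : nat -> R -> R) (M K : R) (N : nat).
Hypothesis dD : forall k (u : R), is_derive u (1 : R) (D k) (D k.+1 u).
Hypothesis Dl : forall u : R, u <= -1 -> D 0 u = 0.
Hypothesis Dr : forall u : R, 1 <= u -> D 0 u = 1.
Hypothesis D01 : forall u : R, 0 <= D 0 u <= 1.
Hypothesis D1_ge0 : forall u : R, 0 <= D 1%N u.
Hypothesis D1_le : forall u : R, D 1%N u <= M.
Hypotheses (K0 : 0 < K) (N0 : (0 < N)%N).

Let M0 : 0 <= M. Proof. exact: le_trans (D1_le 0). Qed.

(** The argument falls from 1 to -1 as t runs from 1/(2K) to 1/K: a cutoff equal to 1 before and to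
    0 after that interval. *)
Definition chi t : R := D 0 (3 - 4 * K * t).
Definition dchi t : R := - (4 * K) * D 1%N (3 - 4 * K * t).
(** The squared Euclidean distance is used instead of the maximum norm because it is a polynomial,
    hence differentiable. *)
Definition qf x y : R := \sum_i (x ord0 i - y ord0 i) ^+ 2.
Definition vf e x y : R := (e + qf x y)^-1.
Definition wf e x y : R := vf e x y ^+ N * chi (qf x y).
Definition dwf i e x y : R := (2 * (x ord0 i - y ord0 i)) *
  (- N%:R * vf e x y ^+ N.+1 * chi (qf x y) + vf e x y ^+ N * dchi (qf x y)).
(** [wf] with a sharp cutoff. The derivative of [wf] is controlled by [wt] and not by [wf] itself,
    because [chi] may be small where [dchi] is not. *)
Definition wt e x y : R := vf e x y ^+ N * (qf x y <= K^-1)%R%:R.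

Lemma qf_ge0 x y : 0 <= qf x y.
Proof. by apply: sumr_ge0 => i _; exact: sqr_ge0. Qed.

Lemma norm_le_qf x y : `|x - y| ^+ 2 <= qf x y.
Proof.
have -> : qf x y = enorm (x - y) ^+ 2.
  rewrite /enorm sqr_sqrtr; last by apply: sumr_ge0 => i _; exact: sqr_ge0.
  by apply: eq_bigr => i _; rewrite !mxE.
by rewrite lerXn2r ?nnegrE ?enorm_ge0//; exact: norm_le_enorm.
Qed.

Lemma qf_le x y : qf x y <= n%:R * `|x - y| ^+ 2.
Proof.
rewrite (_ : n%:R * _ = \sum_(i < n) `|x - y| ^+ 2); last by rewrite sumr_const card_ord mulr_natl.
apply: ler_sum => i _.
rewrite -(real_normK (num_real (_ - _))) lerXn2r ?nnegrE//.
by have := rV_coord_le (x - y) i; rewrite !mxE.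
Qed.

Lemma vf_ge0 e x y : 0 <= e -> 0 <= vf e x y.
Proof. by move=> e0; rewrite invr_ge0 addr_ge0// qf_ge0. Qed.

Lemma chi_ge0 t : 0 <= chi t. Proof. by have /andP[] := D01 (3 - 4 * K * t). Qed.
Lemma chi_le1 t : chi t <= 1. Proof. by have /andP[] := D01 (3 - 4 * K * t). Qed.

Lemma chi_small t : t <= (2 * K)^-1 -> chi t = 1.
Proof.
move=> h; apply: Dr; have : 4 * K * t <= 4 * K * (2 * K)^-1 by rewrite ler_pM2l// mulr_gt0.
by rewrite (_ : 4 * K * (2 * K)^-1 = 2); [lra|field; rewrite gt_eqF].
Qed.

Lemma KK1 t : K^-1 <= t -> 4 <= 4 * K * t.
Proof.
move=> h; have : 4 * K * K^-1 <= 4 * K * t by rewrite ler_pM2l// mulr_gt0.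
by rewrite (_ : 4 * K * K^-1 = 4)//; field; rewrite gt_eqF.
Qed.

Lemma chi_large t : K^-1 <= t -> chi t = 0.
Proof. by move=> /KK1 h; apply: Dl; lra. Qed.

Lemma dchi_large t : K^-1 < t -> dchi t = 0.
Proof.
move=> h; rewrite /dchi (@D1_out R D dD Dl Dr) ?mulr0//.
have : 4 * K * K^-1 < 4 * K * t by rewrite ltr_pM2l// mulr_gt0.
rewrite (_ : 4 * K * K^-1 = 4); last by field; rewrite gt_eqF.
by move=> h4; rewrite ltr0_norm; lra.
Qed.

Lemma dchi_le t : `|dchi t| <= 4 * K * M.
Proof.
rewrite /dchi normrM normrN (gtr0_norm (mulr_gt0 _ K0))// ler_pM2l ?mulr_gt0//.
by rewrite ger0_norm.
Qed.

Lemma wf_ge0 e x y : 0 <= e -> 0 <= wf e x y.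
Proof. by move=> e0; rewrite mulr_ge0 ?exprn_ge0 ?vf_ge0 ?chi_ge0. Qed.

Lemma wt_ge0 e x y : 0 <= e -> 0 <= wt e x y.
Proof. by move=> e0; rewrite mulr_ge0 ?exprn_ge0 ?vf_ge0. Qed.

Lemma wf_le_wt e x y : 0 <= e -> wf e x y <= wt e x y.
Proof.
move=> e0; rewrite /wf /wt; case: (leP (qf x y) K^-1) => h.
  by apply: ler_wpM2l; rewrite ?exprn_ge0 ?vf_ge0 ?chi_le1.
by rewrite chi_large ?(ltW h)// mulr0 mulr0.
Qed.

(** The two kernels can differ only where [qf] exceeds 1/(2K), and there [vf] is at most 2 K. *)
Lemma wt_le_wf e x y : 0 <= e -> wt e x y <= wf e x y + (2 * K) ^+ N * (qf x y <= K^-1)%R%:R.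
Proof.
move=> e0; have [h|h] := leP (qf x y) (2 * K)^-1.
  rewrite /wf chi_small// mulr1; apply: ler_wpDr.
    by apply: mulr_ge0 => //; apply: exprn_ge0; apply: mulr_ge0 => //; exact: ltW.
  by rewrite /wt ler_piMr ?exprn_ge0 ?vf_ge0//; case: (leP (qf x y)).
rewrite /wt; apply: ler_wpDl; first exact: wf_ge0.
apply: ler_wpM2r => //.
rewrite lerXn2r ?nnegrE ?vf_ge0 ?mulr_ge0 ?(ltW K0)//.
have k2 : 0 < (2 * K)^-1 by rewrite invr_gt0 mulr_gt0.
by rewrite -[leRHS]invrK lef_pV2 ?posrE//; lra.
Qed.

(** With T the square root in the bound, the coordinate difference is at most T and [vf] is T^(-2).
    Differentiating the power costs a factor [N * vf]. Where the kernel lives, [e] and [qf] are at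
    most 1/K, so [K <= 2 * vf] and [dchi], at most 4 K M, costs no more than [8 * M * vf]. *)
Lemma dwf_bound i e x y : 0 <= e -> 0 < e + qf x y -> e <= K^-1 ->
  `|dwf i e x y| <= 2 * (N%:R + 8 * M) / Num.sqrt (e + qf x y) * wt e x y.
Proof.
move=> e0 eq0 eK; have v0 : 0 < vf e x y by rewrite invr_gt0.
set T := Num.sqrt _; have T0 : 0 < T by rewrite sqrtr_gt0.
have T2 : T ^+ 2 = e + qf x y by rewrite sqr_sqrtr// ltW.
have NM0 : 0 <= N%:R + 8 * M by rewrite addr_ge0// mulr_ge0.
have [h|h] := leP (qf x y) K^-1; last first.
  rewrite /dwf chi_large ?(ltW h)// dchi_large// !mulr0 addr0 mulr0 normr0.
  by rewrite mulr_ge0 ?wt_ge0// divr_ge0 ?(ltW T0)// mulr_ge0.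
rewrite /wt h mulr1 /dwf normrM.
have xT : `|x ord0 i - y ord0 i| <= T.
  rewrite -(@ler_pXn2r _ 2) ?nnegrE ?(ltW T0)// T2 real_normK ?num_real//.
  by rewrite /qf (bigD1 i)//= addrCA lerDl addr_ge0// sumr_ge0// => j _; exact: sqr_ge0.
have Kv : K <= 2 * vf e x y.
  rewrite /vf -ler_pdivrMl// mulrC -(invrK K) -invfM lef_pV2 ?posrE ?mulr_gt0 ?invr_gt0//; lra.
apply: (@le_trans _ _ ((2 * T) * ((N%:R + 8 * M) * vf e x y ^+ N.+1))).
  apply: ler_pM => //; first by rewrite normrM ger0_norm// ler_wpM2l.
  apply: le_trans (ler_normD _ _) _; rewrite mulrDl; apply: lerD.
    rewrite -!mulrA normrM normrN normr_nat ler_wpM2l// normrM !ger0_norm ?exprn_ge0 ?(ltW v0) ?chi_ge0//.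
    by rewrite ler_piMr ?exprn_ge0 ?(ltW v0)// chi_le1.
  rewrite normrM [X in X * _]ger0_norm ?exprn_ge0 ?(ltW v0)// exprS.
  have h8 : `|dchi (qf x y)| <= 8 * M * vf e x y.
    by apply: le_trans (dchi_le _) _; have := ler_wpM2r M0 Kv; lra.
  by have := ler_wpM2l (exprn_ge0 N (ltW v0)) h8; lra.
rewrite exprS (_ : vf e x y = T^-1 * T^-1); last by rewrite -invfM -expr2 T2.
by rewrite le_eqVlt; apply/orP; left; apply/eqP; field; rewrite gt_eqF.
Qed.

Lemma qf_line x y i s : qf (x + s *: delta_mx ord0 i) y =
  qf x y + (2 * (x ord0 i - y ord0 i)) * s + s * s.
Proof.
rewrite /qf (bigD1 i)//= [in RHS](bigD1 i)//= !mxE !eqxx mulr1.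
rewrite (eq_bigr (fun j => (x ord0 j - y ord0 j) ^+ 2)); first by ring.
by move=> j /negbTE ji; rewrite !mxE ji andbF mulr0 addr0.
Qed.

Lemma qf_derive x y i : is_derive x (delta_mx ord0 i) (fun x => qf x y) (2 * (x ord0 i - y ord0 i)).
Proof.
apply/is_derive_line0; under eq_fun do rewrite qf_line.
have id := is_derive_id (0 : R) (1 : R).
have := isd_add (isd_add (is_derive_cst (qf x y) (0 : R) (1 : R))
  (isd_mul (is_derive_cst (2 * (x ord0 i - y ord0 i)) (0 : R) (1 : R)) id)) (isd_mul id id).
by move=> h; apply: is_derive_eq h _; rewrite /cst /=; ring.
Qed.

Lemma chi_derive (t : R) : is_derive t (1 : R) chi (dchi t).
Proof.
have d1 : is_derive t 1 (fun t : R => 3 - 4 * K * t) (- (4 * K)).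
  have := isd_add (is_derive_cst (3 : R) t (1 : R)) (isd_opp (isd_mul (is_derive_cst (4 * K) t (1 : R)) (is_derive_id t (1 : R)))).
  by move=> h; apply: is_derive_eq h _; rewrite /cst /=; ring.
by have := isd_comp (dD 0 _) d1; move=> h; apply: is_derive_eq h _; rewrite /dchi mulrC.
Qed.

Lemma wf_derive i e x y : e + qf x y != 0 ->
  is_derive x (delta_mx ord0 i) (fun x => wf e x y) (dwf i e x y).
Proof.
move=> h; have dq := qf_derive x y i.
have de := isd_add (is_derive_cst e x (delta_mx ord0 i : 'rV[R]_n)) dq.
have dv := isd_exp N (isd_inv (f := fun x => e + qf x y) h de).
have dc := isd_comp (g := fun x => qf x y) (chi_derive (qf x y)) dq.
have := isd_mul dv dc.
move=> H; apply: is_derive_eq H _; rewrite /dwf /vf /cst /=.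
have E : (e + qf x y)^-1 ^+ N = (e + qf x y)^-1 * (e + qf x y)^-1 ^+ N.-1 by rewrite -exprS prednK.
rewrite [_ ^+ N.+1]exprS E; move: (_ ^+ N.-1) N%:R => Q k; field.
by [].
Qed.

Lemma qf_continuous y : continuous (fun x => qf x y).
Proof.
rewrite /qf; elim: (index_enum _) => [|j s IH].
  by rewrite (_ : (fun=> _) = cst 0); [exact: cst_continuous|apply/funext => x; rewrite big_nil].
rewrite (_ : (fun=> _) = (fun x => (x ord0 j - y ord0 j) ^+ 2 + \sum_(j <- s) (x ord0 j - y ord0 j) ^+ 2)); last first.
  by apply/funext => x; rewrite big_cons.
move=> x; suff h : {for x, continuous (fun x => (x ord0 j - y ord0 j) ^+ 2)} by exact: (continuousD h (IH x)).
rewrite (_ : (fun=> _) = (fun x => (x ord0 j - y ord0 j) * (x ord0 j - y ord0 j))); last first.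
  by apply/funext => z; rewrite expr2.
have c : {for x, continuous (fun x => x ord0 j - y ord0 j)}.
  by apply: continuousB; [exact: coord_continuous|exact: cst_continuous].
exact: continuousM.
Qed.

Lemma qf_sym x y : qf x y = qf y x.
Proof. by apply: eq_bigr => i _; rewrite -sqrrN opprB. Qed.

Lemma qf_continuous2 x : continuous (fun y => qf x y).
Proof. by under eq_fun do rewrite qf_sym; exact: qf_continuous. Qed.

Lemma D_continuous k : continuous (D k).
Proof. by apply: is_derive_continuous; exact: dD. Qed.

Lemma measurable_vf e x : 0 <= e -> measurable_fun setT ((fun y => vf e x y) : borel_rV R n -> R).
Proof.
move=> e0; rewrite (_ : (fun=> _) = (fun y => (e + qf x y) `^ (-1))); last first.
  by apply/funext => y; rewrite powR_inv1// addr_ge0// qf_ge0.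
apply: (@measurableT_comp _ _ _ _ _ _ (fun y : R => powR y _)); first exact: measurable_powR.
apply: measurable_funD => //; apply: continuous_measurable_rV; exact: qf_continuous2.
Qed.

Lemma measurable_Dq k x : measurable_fun setT ((fun y => D k (3 - 4 * K * qf x y)) : borel_rV R n -> R).
Proof.
apply: (@measurableT_comp _ _ _ _ _ _ (D k)).
  by apply: continuous_measurable_fun; exact: D_continuous.
apply: measurable_funB => //; apply: measurable_funM => //.
by apply: continuous_measurable_rV; exact: qf_continuous2.
Qed.

Lemma measurable_wf e x : 0 <= e -> measurable_fun setT ((fun y => wf e x y) : borel_rV R n -> R).
Proof.
move=> e0; apply: measurable_funM; last exact: measurable_Dq.
by apply: measurable_funX; exact: measurable_vf.
Qed.

Lemma measurable_dwf i e x : 0 <= e -> measurable_fun setT ((fun y => dwf i e x y) : borel_rV R n -> R).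
Proof.
move=> e0; have mv := measurable_vf x e0.
have mx : measurable_fun setT ((fun y => x ord0 i - y ord0 i) : borel_rV R n -> R).
  by apply: measurable_funB => //; exact: measurable_coord_rV.
apply: measurable_funM; first exact: measurable_funM.
apply: measurable_funD; apply: measurable_funM.
- by apply: measurable_funM => //; exact: measurable_funX.
- exact: measurable_Dq.
- exact: measurable_funX.
- by apply: measurable_funM => //; exact: measurable_Dq.
Qed.

Lemma measurable_wt e x : 0 <= e -> measurable_fun setT ((fun y => wt e x y) : borel_rV R n -> R).
Proof.
move=> e0; apply: measurable_funM; first by apply: measurable_funX; exact: measurable_vf.
rewrite (_ : (fun=> _) = \1_[set y : borel_rV R n | qf x y <= K^-1]); last first.
  by apply/funext => y; rewrite indicE; case: leP => h; [rewrite mem_set|rewrite memNset//; apply/negP; rewrite -ltNge].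
apply: measurable_indic.
have := continuous_measurable_rV (@qf_continuous2 x) measurableT (measurable_itv `]-oo, K^-1]).
by rewrite setTI; congr (measurable _); apply/seteqP; split => y /=; rewrite in_itv.
Qed.

Section sequences.
Variables (xs : nat -> 'rV[R]_n) (es : nat -> R) (x : 'rV[R]_n) (e : R) (y : 'rV[R]_n).
Hypotheses (xcv : xs k @[k --> \oo] --> x) (ecv : es k @[k --> \oo] --> e).
Hypothesis eq0 : e + qf x y != 0.

Let qcv : qf (xs k) y @[k --> \oo] --> qf x y.
Proof. exact: (cvg_comp _ _ xcv (@qf_continuous y x)). Qed.

Let vcv : vf (es k) (xs k) y @[k --> \oo] --> vf e x y.
Proof. by apply: cvgV => //; exact: cvgD. Qed.

Let vncv m : vf (es k) (xs k) y ^+ m @[k --> \oo] --> vf e x y ^+ m.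
Proof.
elim: m => [|m IH]; first by under eq_fun do rewrite expr0; rewrite expr0; exact: cvg_cst.
by under eq_fun do rewrite exprS; rewrite exprS; exact: cvgM.
Qed.

Let Dcv m : D m (3 - 4 * K * qf (xs k) y) @[k --> \oo] --> D m (3 - 4 * K * qf x y).
Proof.
have h : (3 - 4 * K * qf (xs k) y) @[k --> \oo] --> 3 - 4 * K * qf x y.
  by apply: cvgB; [exact: cvg_cst|apply: cvgM; [exact: cvg_cst|exact: qcv]].
exact: (cvg_comp _ _ h (@D_continuous m _)).
Qed.

Lemma wf_cvg : wf (es k) (xs k) y @[k --> \oo] --> wf e x y.
Proof. by apply: cvgM; [exact: vncv|exact: Dcv]. Qed.

Lemma dwf_cvg i : dwf i (es k) (xs k) y @[k --> \oo] --> dwf i e x y.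
Proof.
apply: cvgM.
  apply: cvgM; first exact: cvg_cst.
  apply: cvgB; last exact: cvg_cst.
  exact: (cvg_comp _ _ xcv (@coord_continuous _ _ _ ord0 i x)).
apply: cvgD; apply: cvgM.
- by apply: cvgM; [exact: cvg_cst|exact: vncv].
- exact: Dcv.
- exact: vncv.
- by apply: cvgM; [exact: cvg_cst|exact: Dcv].
Qed.
End sequences.

End kernel.

(** * Integrals against kernels supported in small cubes *)

Section local_integrals.
Context {R : realType} (n : nat) (S : set (borel_rV R n)).
Context (mu : {measure set (borel_rV R n) -> \bar R}) (C2 : R).
Local Notation B := (borel_rV R n).
Hypothesis mS : measurable (S : set B).
Hypothesis mu_half : forall x, (mu (cube x 2^-1) <= C2%:E)%E.

Lemma integrable_cube_bound (h : B -> R) c A : measurable_fun S h ->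
  (forall y, S y -> `|h y| <= A * \1_(cube c 2^-1) (y : 'rV[R]_n)) ->
  mu.-integrable S (EFin \o h).
Proof.
move=> mh hA.
have iI : mu.-integrable S (fun y : B => (A * \1_(cube c 2^-1) (y : 'rV[R]_n))%:E).
  apply: (@integrableS _ _ _ mu setT) => //.
  rewrite (_ : (fun=> _) = (fun y : B => A%:E * (\1_(cube c 2^-1 : set B) y)%:E)%E); last first.
    by apply/funext => y; rewrite EFinM.
  apply: integrableZl => //; apply: integrable_indic_lty; first exact: measurable_cube.
  by apply: le_lt_trans (mu_half c) _; rewrite ltry.
apply: (le_integrable mS _ _ iI) => [|y Sy]; first exact/measurable_EFinP.
by rewrite /= lee_fin; apply: le_trans (hA y Sy) _; exact: ler_norm.
Qed.

Definition loc_bounded (h : B -> R) := forall r : R, exists A, forall y : 'rV[R]_n,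
  S y -> `|y| <= r -> `|h y| <= A.

Lemma loc_bounded_cube h c : loc_bounded h ->
  exists2 A, 0 <= A & forall y, S y -> cube c 2^-1 y -> `|h y| <= A.
Proof.
move=> /(_ (`|c| + 2^-1))[A hA]; exists (Num.max A 0); first by rewrite le_max lexx orbT.
move=> y Sy cy; rewrite le_max hA//.
rewrite -[y](subrK c) addrC; apply: le_trans (ler_normD _ _) _.
by rewrite lerD2l.
Qed.

Lemma integrable_mul_kernel (h k : B -> R) c A : measurable_fun S h -> loc_bounded h ->
  measurable_fun setT k -> (forall y, S y -> `|k y| <= A * \1_(cube c 2^-1) (y : 'rV[R]_n)) ->
  mu.-integrable S (EFin \o (fun y => h y * k y)).
Proof.
move=> mh hb mk kA; have [H H0 hH] := loc_bounded_cube c hb.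
apply: (@integrable_cube_bound _ c (H * A)).
  by apply: measurable_funM => //; exact: measurable_funTS.
move=> y Sy; rewrite normrM -mulrA; have := kA y Sy; rewrite indicE.
have [cy|cy] := boolP (y \in cube c 2^-1); last first.
  rewrite mulr0 => k0; rewrite (_ : `|k y| = 0) ?mulr0//.
  by apply/eqP; rewrite eq_le k0 normr_ge0.
by rewrite mulr1 => kA'; apply: ler_pM => //; apply: hH => //; rewrite inE in cy.
Qed.

Lemma Rintegral_kernel_cvg (h : B -> R) (ks : nat -> B -> R) (k : B -> R) c A :
  measurable_fun S h -> loc_bounded h ->
  (forall j, measurable_fun setT (ks j)) -> measurable_fun setT k ->
  (forall j y, S y -> `|ks j y| <= A * \1_(cube c 2^-1) (y : 'rV[R]_n)) ->
  (forall y, S y -> `|k y| <= A * \1_(cube c 2^-1) (y : 'rV[R]_n)) ->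
  (forall y, S y -> ks j y @[j --> \oo] --> k y) ->
  \int[mu]_(y in S) (h y * ks j y) @[j --> \oo] --> \int[mu]_(y in S) (h y * k y).
Proof.
move=> mh hb mks mk ksA kA kcv; have [H H0 hH] := loc_bounded_cube c hb.
have ik := integrable_mul_kernel mh hb mk kA.
have [] := @dominated_convergence _ _ _ mu S mS (fun j y => (h y * ks j y)%:E)
  (fun y => (h y * k y)%:E) (fun y : B => (H * A)%:E * (\1_(cube c 2^-1 : set B) y)%:E)%E.
- by move=> j; apply/measurable_EFinP; apply: measurable_funM => //; exact: measurable_funTS.
- by apply/measurable_EFinP; apply: measurable_funM => //; exact: measurable_funTS.
- apply: aeW => y Sy; apply: cvg_EFin; first exact: nearW.
  by apply: cvgM; [exact: cvg_cst|exact: kcv].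
- apply: (@integrableS _ _ _ mu setT) => //; apply: integrableZl => //.
  apply: integrable_indic_lty; first exact: measurable_cube.
  by apply: le_lt_trans (mu_half c) _; rewrite ltry.
- apply: aeW => y j Sy; rewrite -EFinM lee_fin normrM -mulrA; have := ksA j y Sy; rewrite indicE.
  have [cy|cy] := boolP (y \in cube c 2^-1); last first.
    rewrite mulr0 => k0; rewrite (_ : `|ks j y| = 0) ?mulr0//.
    by apply/eqP; rewrite eq_le k0 normr_ge0.
  by rewrite mulr1 => kA'; apply: ler_pM => //; apply: hH => //; rewrite inE in cy.
move=> _ _ h3; apply: fine_cvg; rewrite /Rintegral fineK//.
exact: (integrable_fin_num mS ik).
Qed.

End local_integrals.

Lemma seq_continuous_rV {R : realType} n (F : 'rV[R]_n -> R) (x : 'rV[R]_n) (d : R) : 0 < d ->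
  (forall xs : nat -> 'rV[R]_n, (forall k, `|xs k - x| <= d) -> xs k @[k --> \oo] --> x ->
     F (xs k) @[k --> \oo] --> F x) ->
  forall e : R, 0 < e -> exists2 r : R, 0 < r & forall y : 'rV[R]_n, `|x - y| < r -> `|F x - F y| < e.
Proof.
move=> d0 h e e0; apply: contrapT => H.
pose u (k : nat) : R := Num.min d k.+1%:R^-1.
have u0 k : 0 < u k by rewrite lt_min d0 invr_gt0 ltr0n.
have /choice[xs xsP] : forall k : nat, exists y, `|x - y| < u k /\ e <= `|F x - F y|.
  move=> k; apply: contrapT => Hk; apply: H; exists (u k) => // y xy.
  by rewrite ltNge; apply/negP => le; apply: Hk; exists y.
have cv : xs k @[k --> \oo] --> x.
  apply/cvgrPdist_lt => /= r r0; near=> k; apply: lt_trans ((xsP k).1) _.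
  rewrite gt_min; apply/orP; right; near: k; exact: near_infty_natSinv_lt (PosNum r0).
have xd k : `|xs k - x| <= d.
  by rewrite distrC; apply: ltW; apply: lt_le_trans (xsP k).1 _; rewrite ge_min lexx.
have /cvgrPdist_lt/(_ _ e0)[k _ /(_ k (leqnn k))] /= := h xs xd cv.
by rewrite ltNge (xsP k).2.
Unshelve. all: by end_near. Qed.

(** * Convergence and differentiation under the integral *)

Section extension.
Context {R : realType} (n : nat) (S : set (borel_rV R n)).
Context (mu : {measure set (borel_rV R n) -> \bar R}) (C2 : R).
Local Notation B := (borel_rV R n).
Hypothesis mS : measurable (S : set B).
Hypothesis mu_half : forall x, (mu (cube x 2^-1) <= C2%:E)%E.
Variables (D : nat -> R -> R) (M K : R) (N : nat).
Hypothesis dD : forall k (u : R), is_derive u (1 : R) (D k) (D k.+1 u).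
Hypothesis Dl : forall u : R, u <= -1 -> D 0 u = 0.
Hypothesis Dr : forall u : R, 1 <= u -> D 0 u = 1.
Hypothesis D01 : forall u : R, 0 <= D 0 u <= 1.
Hypothesis D1_ge0 : forall u : R, 0 <= D 1%N u.
Hypothesis D1_le : forall u : R, D 1%N u <= M.
Hypotheses (K128 : 128 <= K) (N0 : (0 < N)%N).
Implicit Types (x z : 'rV[R]_n) (e d : R).

Let M0 : 0 <= M. Proof. exact: le_trans (D1_le 0). Qed.
Let K0 : 0 < K. Proof. exact: lt_le_trans K128. Qed.
Local Notation wf := (wf D K N).
Local Notation dwf := (dwf D K N).
Local Notation wt := (wt K N).

Lemma qf_support x (y : 'rV[R]_n) : qf x y <= K^-1 -> `|x - y| <= 8^-1.
Proof.
move=> h; rewrite -(@ler_pXn2r _ 2) ?nnegrE//; apply: le_trans (norm_le_qf x y) _.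
apply: le_trans h _; rewrite exprVn lef_pV2 ?posrE ?exprn_gt0//.
by apply: le_trans K128; rewrite -natrX ler_nat.
Qed.

(** The gap [d] covers both uses of the kernel: [d = e] for the smoothed one at any x, and a bound
    from the distance to S when e = 0 and x is off S. *)
Lemma wt_le_gap e d x y : 0 <= e -> 0 < d -> d <= e + qf x y ->
  wt e x y <= d^-1 ^+ N * \1_(cube x 8^-1) y.
Proof.
move=> e0 d0 dq; rewrite /wt /vf; have q0 : 0 < e + qf x y by exact: lt_le_trans dq.
apply: ler_pM => //; first by rewrite exprn_ge0// invr_ge0 ltW.
  by rewrite lerXn2r ?nnegrE ?invr_ge0 ?(ltW d0) ?(ltW q0)// lef_pV2.
rewrite indicE; case: (leP (qf x y)) => // /qf_support h.
by rewrite mem_set// /cube /= distrC.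
Qed.

Lemma wf_le_gap e d x y : 0 <= e -> 0 < d -> d <= e + qf x y ->
  `|wf e x y| <= d^-1 ^+ N * \1_(cube x 8^-1) y.
Proof.
move=> e0 d0 dq; rewrite ger0_norm; last exact: wf_ge0.
by apply: le_trans (wt_le_gap e0 d0 dq); exact: wf_le_wt.
Qed.

Definition dwf_cst d : R := 2 * (N%:R + 8 * M) / Num.sqrt d * d^-1 ^+ N.

Lemma dwf_cst_ge0 d : 0 < d -> 0 <= dwf_cst d.
Proof.
move=> d0; apply: mulr_ge0; last by rewrite exprn_ge0// invr_ge0 ltW.
apply: divr_ge0; last exact: sqrtr_ge0.
by apply: mulr_ge0 => //; apply: addr_ge0 => //; apply: mulr_ge0.
Qed.

Lemma dwf_le_gap i e d x y : 0 <= e -> e <= K^-1 -> 0 < d -> d <= e + qf x y ->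
  `|dwf i e x y| <= dwf_cst d * \1_(cube x 8^-1) y.
Proof.
move=> e0 eK d0 dq; have q0 : 0 < e + qf x y by exact: lt_le_trans dq.
apply: (le_trans (@dwf_bound R n D M K N dD Dl Dr D01 D1_ge0 D1_le K0 i e x y e0 q0 eK)).
have NM0 : 0 <= 2 * (N%:R + 8 * M) by apply: mulr_ge0 => //; apply: addr_ge0 => //; apply: mulr_ge0.
rewrite /dwf_cst -[leRHS]mulrA; apply: ler_pM => //.
- by apply: divr_ge0 => //; exact: sqrtr_ge0.
- exact: wt_ge0.
- by apply: ler_wpM2l => //; rewrite lef_pV2 ?posrE ?sqrtr_gt0// ler_sqrt// ltW.
- exact: wt_le_gap.
Qed.

Lemma indic_cube_shift x x' (y : 'rV[R]_n) : `|x' - x| <= 8^-1 ->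
  \1_(cube x' 8^-1) y <= \1_(cube x 2^-1) y :> R.
Proof.
move=> h; rewrite !indicE; case: (boolP (y \in cube x' 8^-1)) => //= /set_mem hy.
rewrite mem_set// /cube /= -(subrK x' y) -addrA; apply: le_trans (ler_normD _ _) _.
by have := lerD hy h; move/le_trans; apply; lra.
Qed.

Definition Ik (h : B -> R) e x := \int[mu]_(y in S) (h y * wf e x y).
Definition Jk i (h : B -> R) e x := \int[mu]_(y in S) (h y * dwf i e x y).

Section one_function.
Variable h : B -> R.
Hypotheses (mh : measurable_fun S h) (hb : loc_bounded S h).

Lemma integrable_wf e d x : 0 <= e -> 0 < d -> (forall y, S y -> d <= e + qf x y) ->
  mu.-integrable S (EFin \o (fun y : B => h y * wf e x y)).
Proof.
move=> e0 d0 dq; apply: (@integrable_mul_kernel _ _ _ _ _ mS mu_half h (wf e x) x (d^-1 ^+ N)) => //.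
  exact: measurable_wf.
move=> y Sy; apply: le_trans (wf_le_gap e0 d0 (dq y Sy)) _.
apply: ler_wpM2l; first by rewrite exprn_ge0// invr_ge0 ltW.
by apply: indic_cube_shift; rewrite subrr normr0.
Qed.

Lemma integrable_dwf i e d x : 0 <= e -> e <= K^-1 -> 0 < d -> (forall y, S y -> d <= e + qf x y) ->
  mu.-integrable S (EFin \o (fun y : B => h y * dwf i e x y)).
Proof.
move=> e0 eK d0 dq; apply: (@integrable_mul_kernel _ _ _ _ _ mS mu_half h (dwf i e x) x (dwf_cst d)) => //.
  exact: measurable_dwf.
move=> y Sy; apply: le_trans (dwf_le_gap i e0 eK d0 (dq y Sy)) _.
apply: ler_wpM2l; last by apply: indic_cube_shift; rewrite subrr normr0.
exact: dwf_cst_ge0.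
Qed.

Section sequences.
Variables (xs : nat -> 'rV[R]_n) (es : nat -> R) (x : 'rV[R]_n) (e d : R).
Hypotheses (xcv : xs k @[k --> \oo] --> x) (ecv : es k @[k --> \oo] --> e).
Hypotheses (es0 : forall k, 0 <= es k) (esK : forall k, es k <= K^-1).
Hypotheses (e0 : 0 <= e) (eK : e <= K^-1).
Hypotheses (d0 : 0 < d) (xd : forall y, S y -> d <= e + qf x y).
Hypothesis xsd : forall k y, S y -> d <= es k + qf (xs k) y.
Hypothesis xs8 : forall k, `|xs k - x| <= 8^-1.

Let d1 : 0 <= d^-1 ^+ N. Proof. by rewrite exprn_ge0// invr_ge0 ltW. Qed.
Let d2 : 0 <= dwf_cst d. Proof. exact: dwf_cst_ge0. Qed.
Let neq0 y : S y -> e + qf x y != 0.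
Proof. by move=> Sy; rewrite gt_eqF//; apply: lt_le_trans (xd Sy). Qed.

Lemma Ik_cvg : Ik h (es k) (xs k) @[k --> \oo] --> Ik h e x.
Proof.
apply: (@Rintegral_kernel_cvg _ _ _ _ _ mS mu_half h (fun k => wf (es k) (xs k)) (wf e x) x (d^-1 ^+ N)) => //.
- by move=> j; exact: measurable_wf.
- exact: measurable_wf.
- move=> j y Sy; apply: le_trans (wf_le_gap (es0 j) d0 (xsd j Sy)) _.
  by apply: ler_wpM2l => //; exact: indic_cube_shift.
- move=> y Sy; apply: le_trans (wf_le_gap e0 d0 (xd Sy)) _.
  by apply: ler_wpM2l => //; apply: indic_cube_shift; rewrite subrr normr0.
- by move=> y Sy; apply: wf_cvg => //; exact: neq0.
Qed.

Lemma Jk_cvg i : Jk i h (es k) (xs k) @[k --> \oo] --> Jk i h e x.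
Proof.
apply: (@Rintegral_kernel_cvg _ _ _ _ _ mS mu_half h (fun k => dwf i (es k) (xs k)) (dwf i e x) x (dwf_cst d)) => //.
- by move=> j; exact: measurable_dwf.
- exact: measurable_dwf.
- move=> j y Sy; apply: le_trans (dwf_le_gap i (es0 j) (esK j) d0 (xsd j Sy)) _.
  by apply: ler_wpM2l => //; exact: indic_cube_shift.
- move=> y Sy; apply: le_trans (dwf_le_gap i e0 eK d0 (xd Sy)) _.
  by apply: ler_wpM2l => //; apply: indic_cube_shift; rewrite subrr normr0.
- by move=> y Sy; apply: dwf_cvg => //; exact: neq0.
Qed.
End sequences.

(** Differentiation under the integral along the line x + s v. For |s| < 1/8 all the moved kernels
    stay supported in the cube of radius 1/2 about x, which has finite measure, and [dwf_cst e]
    bounds their derivatives. *)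
Lemma Ik_derive i e x : 0 < e -> e <= K^-1 ->
  is_derive x (delta_mx ord0 i) (Ik h e) (Jk i h e x).
Proof.
move=> e0 eK; apply/is_derive_line0; pose v : 'rV[R]_n := delta_mx ord0 i.
have v1 : `|v| <= 1.
  apply/(rV_norm_le _ ler01) => j; rewrite mxE eqxx /=.
  by case: (j == i); rewrite ?normr1 ?normr0.
have eq z y : e <= e + qf z y by rewrite lerDl qf_ge0.
have der (s : R) (y : B) : is_derive s (1 : R) (fun s => h y * wf e (x + s *: v) y) (h y * dwf i e (x + s *: v) y).
  have := @is_derive_line R n (fun x => wf e x y) x v s (dwf i e (x + s *: v) y).
  move=> H.
  have h1 : e + qf (x + s *: v) y != 0 by rewrite gt_eqF//; apply: lt_le_trans (eq _ _).
  have := isd_mul (is_derive_cst (h y) s (1 : R)) (H (@wf_derive R n D K N dD N0 i e _ y h1)).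
  by move=> h2; apply: is_derive_eq h2 _; rewrite /cst /=; ring.
have [H H0 hH] := loc_bounded_cube x hb.
have in8 : (0 : R) \in `]- 8^-1, 8^-1[ by rewrite in_itv/=; apply/andP; split; lra.
have de0 := dwf_cst_ge0 e0.
have C0 : 0 <= H * dwf_cst e by apply: mulr_ge0.
have sv (s : R) : `]- 8^-1, 8^-1[%classic s -> `|x + s *: v - x| <= 8^-1.
  rewrite /= in_itv /= => /andP[s1 s2]; rewrite addrAC subrr add0r normrZ.
  have s8 : `|s| <= 8^-1 by rewrite ler_norml; apply/andP; split; exact: ltW.
  by apply: le_trans (ler_pM _ _ s8 v1) _ => //; rewrite mulr1.
have := @cvg_differentiation_under_integral R _ B mu (fun s y => h y * wf e (x + s *: v) y) S mS 0 (- 8^-1) (8^-1).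
move=> /(_ _ _ _ (fun y : B => (H * dwf_cst e) * \1_(cube x 2^-1 : set B) y)) HH.
have cv := HH _ _ _ _ _ _.
have E : \int[mu]_(y in S) partial1of2 (fun (s : R) (y : B) => h y * wf e (x + s *: v) y) 0 y = Jk i h e x.
  apply: eq_Rintegral => y _; rewrite partial1of2E; have [_ ->] := der 0 y.
  by rewrite scale0r addr0.
have : (fun t : R => t^-1 *: (((fun s : R => Ik h e (x + s *: v)) \o shift 0) (t *: (1 : R)) - Ik h e (x + (0 : R) *: v))) @ 0^' --> Jk i h e x.
  rewrite -E; under eq_fun => t do rewrite /= [t *: 1]mulr1; apply: cv.
  - exact: in8.
  - by move=> s _; apply: (@integrable_wf _ e); rewrite ?(ltW e0).
  - by move=> s y _ _; have [] := der s y.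
  - by move=> y; apply: mulr_ge0.
  - apply: (@integrable_cube_bound _ _ _ _ _ mS mu_half _ x (H * dwf_cst e)).
      by apply: measurable_funM => //; apply: measurable_indic; exact: measurable_cube.
    by move=> y Sy; rewrite ger0_norm//; apply: mulr_ge0.
  - move=> s y Is Sy; rewrite partial1of2E; have [_ ->] := der s y.
    rewrite normrM -mulrA; have := dwf_le_gap i (ltW e0) eK e0 (eq (x + s *: v) y).
    have := indic_cube_shift y (sv s Is); rewrite !indicE.
    have [cy _ hd|_] := boolP (y \in cube x 2^-1).
      apply: ler_pM => //; first by apply: hH => //; rewrite inE in cy.
      by apply: le_trans hd _; apply: ler_wpM2l => //; case: (_ \in _).
    case: (y \in _) => //= [|_]; first by rewrite ler10.
    rewrite mulr0 => k0; rewrite (_ : `|dwf _ _ _ _| = 0) ?mulr0//.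
    by apply/eqP; rewrite eq_le k0 normr_ge0.
move=> cvJ; apply: DeriveDef; first by apply/cvg_ex; exists (Jk i h e x).
exact: cvg_lim cvJ.
Qed.

End one_function.
End extension.

(** * The smoothed extension and its gradient *)

Section extension_calculus.
Context {R : realType} (n : nat) (S : set (borel_rV R n)).
Context (mu : {measure set (borel_rV R n) -> \bar R}) (C2 : R).
Local Notation B := (borel_rV R n).
Local Notation leb := (lebesgue_rV n : {measure set (borel_rV R n) -> \bar R}).
Hypothesis mS : measurable (S : set B).
Hypothesis mu_half : forall x, (mu (cube x 2^-1) <= C2%:E)%E.
Variables (D : nat -> R -> R) (M K : R) (N : nat).
Hypothesis dD : forall k (u : R), is_derive u (1 : R) (D k) (D k.+1 u).
Hypothesis Dl : forall u : R, u <= -1 -> D 0 u = 0.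
Hypothesis Dr : forall u : R, 1 <= u -> D 0 u = 1.
Hypothesis D01 : forall u : R, 0 <= D 0 u <= 1.
Hypothesis D1_ge0 : forall u : R, 0 <= D 1%N u.
Hypothesis D1_le : forall u : R, D 1%N u <= M.
Hypotheses (K128 : 128 <= K) (N0 : (0 < N)%N).
Variable f : B -> R.
Hypotheses (mf : measurable_fun S f) (fb : loc_bounded S f).
Implicit Types (x z : 'rV[R]_n) (e d : R).

Let K0 : 0 < K. Proof. exact: lt_le_trans K128. Qed.
Local Notation wf := (wf D K N).
Local Notation dwf := (dwf D K N).
Local Notation wt := (wt K N).
Local Notation Ix := (Ik S mu D K N).
Local Notation Jx := (Jk S mu D K N).

Lemma loc_bounded_cst (c : R) : loc_bounded S (fun=> c).
Proof. by move=> r; exists `|c|. Qed.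

Lemma loc_bounded_sub (h1 h2 : B -> R) : loc_bounded S h1 -> loc_bounded S h2 ->
  loc_bounded S (fun y => h1 y - h2 y).
Proof.
move=> b1 b2 r; have [A1 h1A] := b1 r; have [A2 h2A] := b2 r; exists (A1 + A2) => y Sy yr.
by apply: le_trans (ler_normB _ _) _; apply: lerD; [exact: h1A|exact: h2A].
Qed.

Definition Wk e x := Ix (fun=> 1) e x.
(** A weighted mean of the values of f and of one additional value 0 of weight 1; it is bounded by f
    nearby and fades out with the kernel. [Gk] is the quotient rule. *)
Definition Fk e x := Ix f e x / (1 + Wk e x).
Definition Gk i e x := (Jx i f e x * (1 + Wk e x) - Ix f e x * Jx i (fun=> 1) e x) / (1 + Wk e x) ^+ 2.

Lemma Wk_ge0 e x : 0 <= e -> 0 <= Wk e x.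
Proof. by move=> e0; apply: Rintegral_ge0 => y _; rewrite mul1r; exact: wf_ge0. Qed.

Lemma Wk1_gt0 e x : 0 <= e -> 0 < 1 + Wk e x.
Proof. by move=> e0; rewrite ltr_pwDl// Wk_ge0. Qed.

Let m1 : measurable_fun S (fun _ : B => 1 : R). Proof. exact: measurable_cst. Qed.

Lemma Fk_cvg (xs : nat -> 'rV[R]_n) (es : nat -> R) x e d :
  xs k @[k --> \oo] --> x -> es k @[k --> \oo] --> e ->
  (forall k, 0 <= es k) -> 0 <= e -> 0 < d ->
  (forall y, S y -> d <= e + qf x y) -> (forall k y, S y -> d <= es k + qf (xs k) y) ->
  (forall k, `|xs k - x| <= 8^-1) ->
  Fk (es k) (xs k) @[k --> \oo] --> Fk e x.
Proof.
move=> xcv ecv es0 e0 d0 xd xsd xs8.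
apply: cvgM; first exact: (Ik_cvg mS mu_half dD Dl D01 K128 mf fb xcv ecv es0 e0 d0).
apply: cvgV; first by rewrite gt_eqF// Wk1_gt0.
apply: cvgD; first exact: cvg_cst.
exact: (Ik_cvg mS mu_half dD Dl D01 K128 m1 (loc_bounded_cst 1) xcv ecv es0 e0 d0).
Qed.

Lemma Gk_cvg i (xs : nat -> 'rV[R]_n) (es : nat -> R) x e d :
  xs k @[k --> \oo] --> x -> es k @[k --> \oo] --> e ->
  (forall k, 0 <= es k) -> (forall k, es k <= K^-1) -> 0 <= e -> e <= K^-1 -> 0 < d ->
  (forall y, S y -> d <= e + qf x y) -> (forall k y, S y -> d <= es k + qf (xs k) y) ->
  (forall k, `|xs k - x| <= 8^-1) ->
  Gk i (es k) (xs k) @[k --> \oo] --> Gk i e x.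
Proof.
move=> xcv ecv es0 esK e0 eK d0 xd xsd xs8.
have If := Ik_cvg mS mu_half dD Dl D01 K128 mf fb xcv ecv es0 e0 d0 xd xsd xs8.
have Jf := Jk_cvg mS mu_half dD Dl Dr D01 D1_ge0 D1_le K128 mf fb xcv ecv es0 esK e0 eK d0 xd xsd xs8.
have I1 := Ik_cvg mS mu_half dD Dl D01 K128 m1 (loc_bounded_cst 1) xcv ecv es0 e0 d0 xd xsd xs8.
have J1 := Jk_cvg mS mu_half dD Dl Dr D01 D1_ge0 D1_le K128 m1 (loc_bounded_cst 1) xcv ecv es0 esK e0 eK d0 xd xsd xs8.
have A1 : 1 + Wk (es k) (xs k) @[k --> \oo] --> 1 + Wk e x by apply: cvgD; [exact: cvg_cst|exact: I1].
apply: cvgM; first by apply: cvgB; [apply: cvgM; [exact: Jf|exact: A1]|apply: cvgM; [exact: If|exact: J1]].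
apply: cvgV; first by rewrite gt_eqF// exprn_gt0// Wk1_gt0.
by rewrite expr2; under eq_fun do rewrite expr2; exact: cvgM.
Qed.

Lemma Fk_derive i e x : 0 < e -> e <= K^-1 -> is_derive x (delta_mx ord0 i) (Fk e) (Gk i e x).
Proof.
move=> e0 eK.
have df := Ik_derive mS mu_half dD Dl Dr D01 D1_ge0 D1_le K128 N0 mf fb i x e0 eK.
have d1 := Ik_derive mS mu_half dD Dl Dr D01 D1_ge0 D1_le K128 N0 m1 (loc_bounded_cst 1) i x e0 eK.
have dA := isd_add (is_derive_cst (1 : R) x (delta_mx ord0 i : 'rV[R]_n)) d1.
have A0 : 1 + Wk e x != 0 by rewrite gt_eqF// Wk1_gt0// ltW.
have := isd_mul df (isd_inv (f := fun x => 1 + Wk e x) A0 dA).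
by move=> H; apply: is_derive_eq H _; rewrite /Gk /cst /=; field.
Qed.

Lemma Fk_continuous e : 0 < e -> continuous (Fk e).
Proof.
move=> e0; apply: continuous_rV => x; apply: (@seq_continuous_rV _ _ _ _ (8^-1)) => // xs xs8 xcv.
by apply: (@Fk_cvg xs (fun=> e) x e e) => //; rewrite ?(ltW e0)//;
  [exact: cvg_cst|move=> *; rewrite lerDl qf_ge0..].
Qed.

Lemma Gk_continuous i e : 0 < e -> e <= K^-1 -> continuous (Gk i e).
Proof.
move=> e0 eK; apply: continuous_rV => x; apply: (@seq_continuous_rV _ _ _ _ (8^-1)) => // xs xs8 xcv.
by apply: (@Gk_cvg i xs (fun=> e) x e e) => //; rewrite ?(ltW e0)//;
  [exact: cvg_cst|move=> *; rewrite lerDl qf_ge0..].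
Qed.

Lemma Fk_weak_gradient i e phi : 0 < e -> e <= K^-1 -> test_function phi ->
  (\int[leb]_x (Fk e x * partial i phi x)%:E = - \int[leb]_x (Gk i e x * phi x)%:E)%E.
Proof.
move=> e0 eK tphi; apply: classical_weak_gradient => //; first exact: Fk_continuous.
  by move=> x; exact: Fk_derive.
move=> r; have [A A0 hA] := continuous_bounded_cube 0 r (@Gk_continuous i _ e0 eK).
by exists A => x xr; apply: hA; rewrite /cube /= subr0.
Qed.

Lemma Ik_le (h : B -> R) (A : R) e x d : measurable_fun S h -> loc_bounded S h -> 0 <= e -> 0 < d ->
  (forall y, S y -> d <= e + qf x y) ->
  (forall y : 'rV[R]_n, S y -> `|x - y| <= 8^-1 -> `|h y| <= A) -> `|Ix h e x| <= A * Wk e x.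
Proof.
move=> mh hb e0 d0 xd hA.
have ih := integrable_wf mS mu_half N dD Dl D01 K128 mh hb e0 d0 xd.
have i1 := integrable_wf mS mu_half N dD Dl D01 K128 m1 (loc_bounded_cst 1) e0 d0 xd.
apply: le_trans (le_normr_Rintegral mS ih) _.
rewrite /Wk /Ik -RintegralZl//; apply: le_Rintegral => //.
- by have := integrable_norm ih.
- by have := integrableZl mS A i1.
move=> y Sy; have w0 : 0 <= wf e x y by exact: wf_ge0.
rewrite mul1r normrM (ger0_norm w0).
have [q|q] := leP (qf x y) K^-1.
  by apply: ler_wpM2r; [exact: w0|apply: hA => //; apply: (qf_support K128)].
have -> : wf e x y = 0 by rewrite /wf chi_large ?mulr0// ltW.
by rewrite !mulr0.
Qed.

Lemma Fk_le A e x d : 0 <= e -> 0 < d -> (forall y, S y -> d <= e + qf x y) -> 0 <= A ->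
  (forall y : 'rV[R]_n, S y -> `|x - y| <= 8^-1 -> `|f y| <= A) -> `|Fk e x| <= A.
Proof.
move=> e0 d0 xd A0 hA; have A1 := Wk1_gt0 x e0.
rewrite /Fk normrM normfV (gtr0_norm A1) ler_pdivrMr//.
apply: le_trans (Ik_le mf fb e0 d0 xd hA) _; apply: ler_wpM2l => //; lra.
Qed.

Lemma Fk_out e x : (forall y, S y -> K^-1 <= qf x y) -> Fk e x = 0.
Proof.
move=> h; rewrite /Fk /Ik (@eq_Rintegral _ _ _ mu S (fun=> 0)).
  by rewrite Rintegral_cst// mul0r mul0r.
by move=> y; rewrite inE => Sy; rewrite /wf chi_large ?mulr0//; exact: h.
Qed.

Lemma Gk_out i e x : (forall y, S y -> K^-1 < qf x y) -> Gk i e x = 0.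
Proof.
move=> h; have J0 g : Jx i g e x = 0.
  rewrite /Jk (@eq_Rintegral _ _ _ mu S (fun=> 0)); first by rewrite Rintegral_cst// mul0r.
  move=> y; rewrite inE => Sy; rewrite /dwf chi_large ?(ltW (h _ Sy))// dchi_large ?h//.
  by rewrite !mulr0 addr0 !mulr0.
by rewrite /Gk !J0 mul0r mulr0 subrr mul0r.
Qed.

End extension_calculus.

(** Half the radius of a ball about x that avoids S still bounds the distance from every z near x to
    S. The cap 1/8 is the shift allowed in [indic_cube_shift]. *)
Lemma closed_gap {R : realType} n (S : set 'rV[R]_n) x : closed S -> ~ S x ->
  exists2 d : R, 0 < d <= 8^-1 & forall (e : R) z, 0 <= e -> `|z - x| <= d ->
    forall y, S y -> d ^+ 2 <= e + qf z y.
Proof.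
move=> cS nSx; have /nbhs_ballP[r /= r0 rS] : nbhs x (~` S).
  by apply: open_nbhs_nbhs; split => //; exact: closed_openC.
pose d := Num.min (r / 2) 8^-1.
have d0 : 0 < d by rewrite lt_min divr_gt0//=.
have dr : d <= r / 2 by rewrite ge_min lexx.
exists d; first by rewrite d0 /= ge_min lexx orbT.
move=> e z e0 zx y Sy; apply: le_trans (_ : qf z y <= _); last by rewrite lerDr.
apply: le_trans (norm_le_qf z y); rewrite lerXn2r ?nnegrE ?(ltW d0)// leNgt; apply/negP => zy.
have := rS y; rewrite -ball_normE /ball_ /=; apply => //.
rewrite (_ : x - y = (z - y) - (z - x)); last by rewrite opprB [RHS]addrC addrA subrK.
by apply: le_lt_trans (ler_normB _ _) _; lra.
Qed.

(** * The inequalities behind the choice of N *)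

Section kernel_algebra.
Context {R : realType}.
Implicit Types (s t w A c : R) (n N P : nat).

(** Here [s] is about the distance from x to S and [A] is 1 plus the total weight, which is at least
    s^(n-2N) up to [c]. Using this twice, s^(-2N) <= c^2 A^2 s^(2N-2n), and 2N - 2n >= P >= p with s
    <= 1 leaves s^p; finally A <= A^p. *)
Lemma kernel_bound1 n N P (p s A c w : R) : (2 * n + P <= 2 * N)%N -> 1 < p -> p <= P%:R ->
  0 < s -> s <= 1 -> 1 <= A -> 0 <= c -> s ^+ n <= c * (s ^+ 2) ^+ N * A ->
  w <= 4 ^+ N * ((s ^+ 2) ^+ N)^-1 -> w <= 4 ^+ N * c ^+ 2 * (A * (A `^ p * s `^ p)).
Proof.
move=> nPN p1 pP s0 s1 A1 c0 hA hw; have A0 : 0 < A by exact: lt_le_trans A1.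
have S0 : 0 < (s ^+ 2) ^+ N by rewrite !exprn_gt0.
have hAp : A <= A `^ p by rewrite -[leLHS]powRr1 ?(ltW A0)// ler_powR// ltW.
have hsp : s ^+ P <= s `^ p by rewrite -powR_mulrn ?(ltW s0)// ger_powR// s0.
apply: le_trans hw _; rewrite -[4 ^+ N * _ * _]mulrA; apply: ler_wpM2l; first exact: exprn_ge0.
apply: (@le_trans _ _ (c ^+ 2 * (A * (A * s ^+ P)))); last first.
  apply: ler_wpM2l; first exact: sqr_ge0.
  apply: ler_wpM2l; first exact: ltW.
  by apply: ler_pM => //; rewrite ?exprn_ge0 ?(ltW A0) ?(ltW s0).
have h1 : (s ^+ 2) ^+ N <= (s ^+ n) ^+ 2 * s ^+ P.
  by rewrite -!exprM -exprD ler_wiXn2l ?(ltW s0)// mulnC.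
have h2 : (s ^+ n) ^+ 2 <= (c * (s ^+ 2) ^+ N * A) ^+ 2.
  by rewrite lerXn2r// nnegrE ?exprn_ge0 ?(ltW s0)// !mulr_ge0// ?exprn_ge0 ?sqr_ge0// ltW.
have h3 := le_trans h1 (ler_wpM2r (exprn_ge0 P (ltW s0)) h2).
rewrite -(@ler_pM2l _ ((s ^+ 2) ^+ N * (s ^+ 2) ^+ N)); last exact: mulr_gt0.
rewrite mulfK ?gt_eqF//; apply: le_trans h3 _.
by rewrite le_eqVlt; apply/orP; left; apply/eqP; ring.
Qed.

(** [t] is the larger of the two distances from x to the points of a pair and u = 2 t / s >= 1.
    Relative to the nearest point, mz^2 grows at most like u^(2n) and mx^p like u^P, while the
    weight has decayed like u^(-2N). *)
Lemma kernel_bound2 n N P (p s t mt A c Cmu w mz mx : R) : (2 * n + P <= 2 * N)%N -> 1 < p -> p <= P%:R ->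
  0 < s -> 0 < t -> s <= 2 * t -> 0 < mt -> 0 < A -> 0 <= c -> 0 <= Cmu ->
  mt <= c * (s ^+ 2) ^+ N * A -> 0 <= w -> w <= 4 ^+ N * (((t ^+ 2) ^+ N)^-1 * ((s ^+ 2) ^+ N)^-1) ->
  0 <= mz -> mz <= Cmu * (5 * t / s) ^+ n * mt -> 0 <= mx -> mx <= t ->
  w * (mz ^+ 2 * mx `^ p) <= 16 ^+ N * 25 ^+ n * Cmu ^+ 2 * c ^+ 2 * (A ^+ 2 * s `^ p).
Proof.
move=> nPN p1 pP s0 t0 st mt0 A0 c0 Cmu0 hmt w0 hw mz0 hmz mx0 hmx.
pose u := 2 * t / s; have u1 : 1 <= u by rewrite ler_pdivlMr// mul1r.
have u0 : 0 < u by exact: lt_le_trans u1.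
have p0 : 0 <= p by exact: ltW (lt_trans ltr01 p1).
have sp0 : 0 <= s `^ p by exact: powR_ge0.
have hx : mx `^ p <= u ^+ P * s `^ p.
  apply: (@le_trans _ _ (t `^ p)); first by rewrite ge0_ler_powR ?nnegrE ?(ltW t0).
  apply: (@le_trans _ _ ((u * s) `^ p)).
    have tu : t <= u * s by rewrite /u mulfVK ?gt_eqF//; lra.
    by apply: ge0_ler_powR => //; rewrite nnegrE ?(ltW t0)// (le_trans (ltW t0)).
  rewrite powRM ?(ltW u0) ?(ltW s0)//; apply: ler_wpM2r => //.
  by rewrite -powR_mulrn ?(ltW u0)// ler_powR.
pose v := (t / s) ^+ 2; have v0 : 0 < v by rewrite exprn_gt0// divr_gt0.
have hz : mz ^+ 2 <= Cmu ^+ 2 * 25 ^+ n * v ^+ n * mt ^+ 2.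
  apply: (@le_trans _ _ ((Cmu * (5 * t / s) ^+ n * mt) ^+ 2)).
    by rewrite lerXn2r// nnegrE// (le_trans mz0).
  rewrite le_eqVlt; apply/orP; left; apply/eqP.
  rewrite (_ : 25 = 5 ^+ 2); last by ring.
  by rewrite /v -[5 * t / s]mulrA [(5 * _) ^+ n]exprMn [(5 ^+ 2) ^+ n]exprAC [((t / s) ^+ 2) ^+ n]exprAC; ring.
have hm : mt ^+ 2 <= (c * (s ^+ 2) ^+ N * A) ^+ 2.
  by rewrite lerXn2r// nnegrE ?(ltW mt0)// (le_trans (ltW mt0)).
have hv : u ^+ P * v ^+ n <= 4 ^+ N * v ^+ N.
  have u2 : u ^+ 2 = 4 * v by rewrite /u /v; field; rewrite gt_eqF.
  have h : u ^+ P * (u ^+ 2) ^+ n <= (u ^+ 2) ^+ N by rewrite -!exprM -exprD ler_weXn2l// addnC.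
  have h' : u ^+ P * (4 ^+ n * v ^+ n) <= 4 ^+ N * v ^+ N by rewrite -!exprMn -u2.
  apply: (le_trans _ h').
  apply: ler_wpM2l; first by rewrite exprn_ge0// ltW.
  rewrite -[leLHS]mul1r; apply: ler_wpM2r; first by rewrite exprn_ge0// ltW.
  by apply: exprn_ege1; lra.
have mz2 : 0 <= mz ^+ 2 by exact: sqr_ge0.
apply: (@le_trans _ _ ((4 ^+ N * (((t ^+ 2) ^+ N)^-1 * ((s ^+ 2) ^+ N)^-1)) *
   ((Cmu ^+ 2 * 25 ^+ n * v ^+ n * (c * (s ^+ 2) ^+ N * A) ^+ 2) * (u ^+ P * s `^ p)))).
  apply: ler_pM => //; first by rewrite mulr_ge0// powR_ge0.
  apply: ler_pM => //; first exact: powR_ge0.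
  by apply: le_trans hz _; rewrite ler_wpM2l// !mulr_ge0// ?sqr_ge0// exprn_ge0// ltW.
rewrite (_ : 16 = 4 * 4); last by ring.
rewrite [(4 * 4) ^+ N]exprMn; have Tn : (t ^+ 2) ^+ N != 0 by rewrite gt_eqF// !exprn_gt0.
have Sn : (s ^+ 2) ^+ N != 0 by rewrite gt_eqF// !exprn_gt0.
have vE : v ^+ N = (t ^+ 2) ^+ N / (s ^+ 2) ^+ N by rewrite /v expr_div_n expr_div_n.
rewrite vE in hv.
rewrite [leLHS](_ : _ = (4 ^+ N * (Cmu ^+ 2 * 25 ^+ n * c ^+ 2 * (A ^+ 2 * s `^ p)) *
  ((s ^+ 2) ^+ N / (t ^+ 2) ^+ N)) * (u ^+ P * v ^+ n)); last first.
  move: Tn Sn; move: ((t ^+ 2) ^+ N) ((s ^+ 2) ^+ N) (v ^+ n) (u ^+ P) (s `^ p) (25 ^+ n) (4 ^+ N).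
  by move=> a b q1 q2 q3 q4 q5 a0 b0; field; rewrite a0 b0.
rewrite [leRHS](_ : _ = (4 ^+ N * (Cmu ^+ 2 * 25 ^+ n * c ^+ 2 * (A ^+ 2 * s `^ p)) *
  ((s ^+ 2) ^+ N / (t ^+ 2) ^+ N)) * (4 ^+ N * ((t ^+ 2) ^+ N / (s ^+ 2) ^+ N))); last first.
  move: Tn Sn; move: ((t ^+ 2) ^+ N) ((s ^+ 2) ^+ N) (v ^+ n) (u ^+ P) (s `^ p) (25 ^+ n) (4 ^+ N).
  by move=> a b q1 q2 q3 q4 q5 a0 b0; field; rewrite a0 b0.
apply: ler_wpM2l => //.
apply: mulr_ge0; last by apply: divr_ge0; apply: exprn_ge0; exact: sqr_ge0.
apply: mulr_ge0; first exact: exprn_ge0.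
have h1 := sqr_ge0 Cmu; have h2 := sqr_ge0 c; have h3 := sqr_ge0 A.
by apply: mulr_ge0; [apply: mulr_ge0 => //; apply: mulr_ge0 => //; exact: exprn_ge0|exact: mulr_ge0].
Qed.
End kernel_algebra.

(** * Kernel bounds at a fixed point *)

Section pointwise_bound.
Context {R : realType} (n : nat) (S : set (borel_rV R n)).
Context (mu : {measure set (borel_rV R n) -> \bar R}) (C2 : R).
Local Notation B := (borel_rV R n).
Local Notation leb := (lebesgue_rV n : {measure set (borel_rV R n) -> \bar R}).
Hypothesis mS : measurable (S : set B).
Hypothesis mu_half : forall x, (mu (cube x 2^-1) <= C2%:E)%E.
Variables (D : nat -> R -> R) (M K : R) (N : nat).
Hypothesis dD : forall k (u : R), is_derive u (1 : R) (D k) (D k.+1 u).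
Hypothesis Dl : forall u : R, u <= -1 -> D 0 u = 0.
Hypothesis Dr : forall u : R, 1 <= u -> D 0 u = 1.
Hypothesis D01 : forall u : R, 0 <= D 0 u <= 1.
Hypothesis D1_ge0 : forall u : R, 0 <= D 1%N u.
Hypothesis D1_le : forall u : R, D 1%N u <= M.
Hypotheses (K128 : 128 <= K) (N0 : (0 < N)%N).
Variable f : B -> R.
Hypotheses (mf : measurable_fun S f) (fb : loc_bounded S f).
Implicit Types (x z : 'rV[R]_n) (e d : R).

Let K0 : 0 < K. Proof. exact: lt_le_trans K128. Qed.
Local Notation wf := (wf D K N).
Local Notation dwf := (dwf D K N).
Local Notation wt := (wt K N).
Local Notation Ix := (Ik S mu D K N).
Local Notation Jx := (Jk S mu D K N).
Variables (Cmu C1 p : R) (P : nat).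
Hypotheses (Cmu0 : 0 < Cmu) (C10 : 0 < C1) (C20 : 0 < C2).
Hypothesis cS : closed (S : set 'rV[R]_n).
Hypothesis muS : mu (~` S) = 0%E.
Hypothesis doubling : forall (x : 'rV[R]_n) (r k : R), S x -> 0 < r <= 1 -> 1 <= k <= r^-1 ->
  (mu (cube x (k * r)) <= (Cmu * k ^+ n)%:E * mu (cube x r))%E.
Hypothesis mu1 : forall x : 'rV[R]_n, S x -> (C1%:E <= mu (cube x 1) <= C2%:E)%E.
Hypotheses (n0 : (0 < n)%N) (p1 : 1 < p) (pP : p <= P%:R) (nPN : (2 * n + P <= 2 * N)%N).

Local Notation m := (mcube mu).
Let p0 : 0 < p. Proof. exact: lt_trans p1. Qed.
Let muE x r : S x -> r <= 1 -> mu (cube x r) = (m x r)%:E.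
Proof. by move=> *; apply: (@mu_cubeE R n S mu C1 C2). Qed.
Let mgt0 x r : S x -> 0 < r -> r <= 1 -> 0 < m x r.
Proof. by move=> *; apply: (@mcube_gt0 R n S mu Cmu C1 C2). Qed.
Let mdbl x r s : S x -> 0 < r -> r <= s -> s <= 1 -> m x s <= Cmu * (s / r) ^+ n * m x r.
Proof. by move=> *; apply: (@mcube_doubling R n S mu Cmu C1 C2). Qed.
Let mmono x y r s : S y -> s <= 1 -> `|x - y| + r <= s -> m x r <= m y s.
Proof. by move=> *; apply: (@mcube_mono R n S mu C1 C2). Qed.
Let mge x r : S x -> 0 < r -> r <= 1 -> C1 / Cmu * r ^+ n <= m x r.
Proof. by move=> *; apply: (@mcube_ge R n S mu Cmu C1 C2). Qed.
Let mle x r : S x -> r <= 1 -> m x r <= C2.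
Proof. by move=> *; apply: (@mcube_le R n S mu C1 C2). Qed.

Section fixed_point.
Variables (e d : R) (x : 'rV[R]_n).
Hypotheses (e0 : 0 <= e) (eK : e <= K^-1) (d0 : 0 < d).
Hypothesis xd : forall y, S y -> d <= e + qf x y.
Local Notation T y := (Num.sqrt (e + qf x y)).
Local Notation A := (1 + Wk S mu D K N e x).

Lemma T_gt0 (y : B) : S y -> 0 < T y.
Proof. by move=> Sy; rewrite sqrtr_gt0; apply: lt_le_trans (xd Sy). Qed.

Lemma T_sqr (y : B) : (T y) ^+ 2 = e + qf x y.
Proof. by rewrite sqr_sqrtr// addr_ge0// qf_ge0. Qed.

Lemma norm_le_T (y : 'rV[R]_n) : `|x - y| <= T y.
Proof.
rewrite -(@ler_pXn2r _ 2) ?nnegrE ?sqrtr_ge0// T_sqr.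
by apply: le_trans (norm_le_qf x y) _; rewrite lerDr.
Qed.

(** A near-minimiser suffices: if none existed, every value [e + qf x y] would be at least 4 times
    their infimum, which is positive because of the gap [d]. *)
Lemma near_point y0 : S y0 -> exists2 xt : 'rV[R]_n, S xt & forall y, S y -> T xt <= 2 * T y.
Proof.
move=> Sy0; apply: contrapT => H.
pose I := inf [set e + qf x y | y in S].
have dI : d <= I by apply: lb_le_inf => [|_ [y Sy <-]]; [exists (e + qf x y0), y0|exact: xd].
have I0 : 0 < I by exact: lt_le_trans dI.
suff : 4 * I <= I by lra.
apply: lb_le_inf => [|_ [y Sy <-]]; first by exists (e + qf x y0), y0.
rewrite leNgt; apply/negP => yI; apply: H; exists y => // z Sz.
rewrite -(@ler_pXn2r _ 2) ?nnegrE ?mulr_ge0 ?sqrtr_ge0//.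
rewrite exprMn !T_sqr; apply: le_trans (ltW yI) _.
rewrite (_ : 2 ^+ 2 = 4 :> R); last by ring.
rewrite ler_pM2l//; apply: ge_inf; last by exists z.
by exists 0 => _ [w _ <-]; rewrite addr_ge0// qf_ge0.
Qed.

Variable xt : 'rV[R]_n.
Hypotheses (Sxt : S xt) (xtP : forall y, S y -> T xt <= 2 * T y).
Local Notation s := (T xt).
Let s0 : 0 < s. Proof. exact: T_gt0. Qed.

(** This is where [128 <= K] comes from: e + qf <= 2 / K <= 1/64. *)
Lemma T_small (y : B) : qf x y <= K^-1 -> T y <= 8^-1.
Proof.
move=> q; rewrite -(@ler_pXn2r _ 2) ?nnegrE ?sqrtr_ge0// T_sqr.
have K1 : K^-1 <= 128^-1 by rewrite lef_pV2 ?posrE.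
rewrite exprVn (_ : 8 ^+ 2 = 64 :> R); last by ring.
by move: q eK K1; move: (qf x y) K^-1 => u v q eK' K1; lra.
Qed.

Definition A_cst : R := (8 * n%:R * K) ^+ N * (1 + C2).

Lemma A_cst_ge0 : 0 <= A_cst.
Proof. by rewrite mulr_ge0 ?addr_ge0 ?(ltW C20)// exprn_ge0// !mulr_ge0// ltW. Qed.

Lemma qf_double (y : 'rV[R]_n) : qf x y <= 2 * qf x xt + 2 * qf xt y.
Proof.
rewrite /qf !mulr_sumr -big_split /=; apply: ler_sum => i _.
have := sqr_ge0 ((x ord0 i - xt ord0 i) - (xt ord0 i - y ord0 i)); lra.
Qed.

(** On [cube xt s] one has e + qf <= 4 n s^2, so this cube alone contributes its measure times (4 n
    s^2)^(-N) to the total weight. When 4 n s^2 is too large for [chi] to be known to equal 1, [s]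
    is bounded below and the bound [C2] on the measure is enough. *)
Lemma A_lower : s <= 2^-1 -> m xt s <= A_cst * (s ^+ 2) ^+ N * A.
Proof.
move=> s2; have s1 : s <= 1 by lra.
have W0 := @Wk_ge0 R n S mu D K N D01 e x e0.
have n1 : 1 <= n%:R :> R by rewrite ler1n.
have nn : 0 < n%:R :> R by rewrite ltr0n.
have [h|h] := leP (4 * n%:R * s ^+ 2) (2 * K)^-1; last first.
  apply: le_trans (mle Sxt s1) _.
  have h1 : 1 <= (8 * n%:R * K) ^+ N * (s ^+ 2) ^+ N.
    rewrite -exprMn exprn_ege1//; move: h; rewrite -(@ltr_pM2l _ (2 * K)) ?mulr_gt0// mulfV ?gt_eqF ?mulr_gt0//.
    by move=> h; apply: ltW; apply: lt_le_trans h _; lra.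
  have -> : A_cst * (s ^+ 2) ^+ N * A = ((1 + C2) * A) * ((8 * n%:R * K) ^+ N * (s ^+ 2) ^+ N) by rewrite /A_cst; ring.
  apply: (@le_trans _ _ ((1 + C2) * A)); last by rewrite ler_peMr// mulr_ge0// addr_ge0// ltW.
  by have := mulr_ge0 (ltW C20) W0; lra.
pose c := ((4 * n%:R * s ^+ 2)^-1) ^+ N.
have ns0 : 0 < 4 * n%:R * s ^+ 2 by rewrite !mulr_gt0// exprn_gt0.
have c0 : 0 < c by rewrite exprn_gt0// invr_gt0.
have cW : c * m xt s <= Wk S mu D K N e x.
  have m1 : measurable_fun S (fun _ : B => 1 : R) by exact: measurable_cst.
  have i1 := integrable_wf mS mu_half N dD Dl D01 K128 m1 (loc_bounded_cst S 1) e0 d0 xd.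
  rewrite -lee_fin EFinM -muE// [X in (_ <= X)%E](fineK (integrable_fin_num mS i1)).
  rewrite -(@mu_setIS R n S mu cS muS); last exact: measurable_cube.
  rewrite -(integral_indic _ mS); last exact: measurable_cube.
  rewrite -ge0_integralZl_EFin//; last 2 first.
    - by apply/measurable_EFinP; apply: measurable_indic; exact: measurable_cube.
    - exact: ltW.
  apply: ge0_le_integral_nm => y Sy; first by rewrite mule_ge0// lee_fin ltW.
  rewrite /= mul1r -EFinM lee_fin indicE; have [/set_mem cy|_] := boolP (y \in _); last by rewrite mulr0; exact: wf_ge0.
  have q4 : e + qf x y <= 4 * n%:R * s ^+ 2.
    have q2 : qf xt y <= n%:R * s ^+ 2.
      apply: le_trans (qf_le xt y) _; rewrite ler_wpM2l ?ler0n// lerXn2r ?nnegrE ?(ltW s0)//.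
      by rewrite distrC; exact: cy.
    have ss : s ^+ 2 <= n%:R * s ^+ 2 by rewrite ler_peMl// sqr_ge0.
    move: q2 ss (qf_double y) (T_sqr xt) e0.
    by move: (s ^+ 2) n%:R (qf x xt) (qf x y) (qf xt y) => u v a b c'; lra.
  rewrite mulr1 /wf chi_small//; last by apply: le_trans h; apply: le_trans q4; rewrite lerDr.
  rewrite mulr1 /c lerXn2r ?nnegrE ?invr_ge0 ?addr_ge0 ?qf_ge0 ?(ltW ns0)//.
  by rewrite lef_pV2 ?posrE//; apply: lt_le_trans (xd Sy).
have cE : c * (4 * n%:R * s ^+ 2) ^+ N = 1.
  by rewrite /c -exprMn mulVf ?gt_eqF// expr1n.
apply: (@le_trans _ _ ((4 * n%:R * s ^+ 2) ^+ N * Wk S mu D K N e x)).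
  have := ler_wpM2l (exprn_ge0 N (ltW ns0)) cW.
  by rewrite mulrA (mulrC (_ ^+ N) c) cE mul1r.
have h8 : (4 * n%:R * s ^+ 2) ^+ N <= (8 * n%:R * K) ^+ N * (s ^+ 2) ^+ N.
  rewrite -exprMn lerXn2r ?nnegrE ?(ltW ns0) ?mulr_ge0 ?sqr_ge0 ?(ltW K0)//.
  rewrite ler_wpM2r ?sqr_ge0//; have : n%:R * 1 <= n%:R * K by rewrite ler_pM2l//; apply: le_trans K128; rewrite ler1n.
  lra.
rewrite /A_cst; have k0 : 0 <= (8 * n%:R * K) ^+ N * (s ^+ 2) ^+ N by apply: le_trans h8; rewrite exprn_ge0// ltW.
have -> : (8 * n%:R * K) ^+ N * (1 + C2) * (s ^+ 2) ^+ N * A = ((8 * n%:R * K) ^+ N * (s ^+ 2) ^+ N) * ((1 + C2) * A) by ring.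
apply: ler_pM => //; rewrite mulrDr mulr1 -[leLHS]mul1r; apply: ler_wpDl; first by rewrite addr_ge0// ltW.
by apply: ler_wpM2r => //; rewrite lerDl ltW.
Qed.

Lemma vf_le_near (y : B) : S y -> vf e x y <= 4 / s ^+ 2.
Proof.
move=> Sy; rewrite /vf -T_sqr; have T0 := T_gt0 Sy.
rewrite ler_pdivlMr ?exprn_gt0// mulrC ler_pdivrMr ?exprn_gt0//.
have := xtP Sy; rewrite -(@ler_pXn2r _ 2) ?nnegrE ?mulr_ge0 ?sqrtr_ge0//.
by rewrite exprMn; lra.
Qed.

Lemma wt_near_le (y : B) : S y -> wt e x y <= 4 ^+ N * ((s ^+ 2) ^+ N)^-1.
Proof.
move=> Sy; rewrite /wt -exprVn -exprMn; apply: le_trans (_ : vf e x y ^+ N <= _).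
  by rewrite ler_piMr ?exprn_ge0 ?vf_ge0//; case: (leP (qf x y)).
by rewrite lerXn2r ?nnegrE ?vf_ge0 ?divr_ge0 ?sqr_ge0//; exact: vf_le_near.
Qed.

Lemma wt0 (y : B) : K^-1 < qf x y -> wt e x y = 0.
Proof. by move=> h; rewrite /wt leNgt h mulr0. Qed.

Definition B1_cst : R := 4 ^+ N * (A_cst * Cmu / C1) ^+ 2.
Definition B2_cst : R := 16 ^+ N * 25 ^+ n * Cmu ^+ 2 * A_cst ^+ 2.

Lemma B1_cst_ge0 : 0 <= B1_cst.
Proof. by apply: mulr_ge0; [rewrite exprn_ge0|exact: sqr_ge0]. Qed.

Lemma B2_cst_ge0 : 0 <= B2_cst.
Proof.
by apply: mulr_ge0; [apply: mulr_ge0; [rewrite mulr_ge0// exprn_ge0|exact: sqr_ge0]|exact: sqr_ge0].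
Qed.

(** Serves the term in which f is compared with the additional value 0. A nonzero kernel at y forces
    s <= 1/4; then [A_lower] and [mcube_ge] give the hypothesis of [kernel_bound1]. *)
Lemma point_bound1 (y : B) : S y ->
  wt e x y <= B1_cst * (A * (A `^ p * s `^ p)) * \1_(cube x 8^-1) (y : 'rV[R]_n).
Proof.
move=> Sy; have A1 : 1 <= A by rewrite lerDl Wk_ge0.
have A0 : 0 < A by exact: lt_le_trans A1.
have [q|q] := leP (qf x y) K^-1; last first.
  rewrite wt0//; apply: mulr_ge0 => //; apply: mulr_ge0; first exact: B1_cst_ge0.
  by rewrite !mulr_ge0 ?powR_ge0 ?(ltW A0).
rewrite indicE mem_set ?mulr1; last by rewrite /cube /= distrC; exact: (qf_support K128).
have s4 : s <= 4^-1 by have := T_small q; have := xtP Sy; lra.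
apply: (@kernel_bound1 _ n N P) => //; [lra| |  |exact: wt_near_le].
  apply: divr_ge0; last exact: ltW.
  by apply: mulr_ge0; [exact: A_cst_ge0|exact: ltW].
have h : C1 / Cmu * s ^+ n <= A_cst * (s ^+ 2) ^+ N * A.
  by apply: le_trans (mge Sxt s0 _) (A_lower _); lra.
have hc : 0 <= Cmu / C1 by rewrite divr_ge0 ?ltW.
have := ler_wpM2l hc h; rewrite [X in X <= _ -> _](_ : _ = s ^+ n); last by field; rewrite !gt_eqF.
by move=> h'; apply: le_trans h' _; rewrite le_eqVlt; apply/orP; left; apply/eqP; ring.
Qed.

(** Serves the pairs of points of S. The squared measure and the power of the maximum are the
    denominators of [D2k], multiplied out. *)
Lemma point_bound2 (y z : B) : S y -> S z -> 0 < `|(y : 'rV[R]_n) - z| ->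
  wt e x y * wf e x z * (m z `|(y : 'rV[R]_n) - z| ^+ 2 * (maxr `|x - y| (`|(y : 'rV[R]_n) - z| / 2)) `^ p) <=
  B2_cst * (A ^+ 2 * s `^ p) * (`|(y : 'rV[R]_n) - z| < 1)%R%:R.
Proof.
move=> Sy Sz yz; have A0 : 0 < A by rewrite Wk1_gt0.
have A2 : 0 <= A ^+ 2 by rewrite exprn_ge0// ltW.
have R0 : 0 <= B2_cst * (A ^+ 2 * s `^ p) * (`|(y : 'rV[R]_n) - z| < 1)%R%:R.
  apply: mulr_ge0 => //; apply: mulr_ge0; last by rewrite mulr_ge0// powR_ge0.
  exact: B2_cst_ge0.
have [qy|qy] := leP (qf x y) K^-1; last by rewrite wt0// !mul0r.
have [qz|qz] := leP (qf x z) K^-1; last first.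
  rewrite (_ : wf e x z = 0) ?mulr0 ?mul0r//; apply/eqP; rewrite eq_le wf_ge0// andbT.
  by apply: le_trans (wf_le_wt _ Dl D01 K0 _ _ e0) _; rewrite wt0.
pose t := Num.max (T y) (T z).
have t0 : 0 < t by rewrite lt_max T_gt0.
have ty : T y <= t by rewrite le_max lexx.
have tz : T z <= t by rewrite le_max lexx orbT.
have t8 : t <= 8^-1 by rewrite ge_max !T_small.
have xy := norm_le_T y; have xz := norm_le_T z.
have yzt : `|(y : 'rV[R]_n) - z| <= 2 * t.
  have -> : (y : 'rV[R]_n) - z = (x - z) - (x - y) by rewrite opprB [RHS]addrC addrA subrK.
  by apply: le_trans (ler_normB _ _) _; lra.
have -> : (`|(y : 'rV[R]_n) - z| < 1) by lra.
rewrite mulr1; have s4 : s <= 4^-1 by have := T_small qy; have := xtP Sy; lra.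
apply: (@kernel_bound2 _ n N P p s t (m xt s)) => //.
- by have := xtP Sy; lra.
- by apply: mgt0 => //; lra.
- exact: A_cst_ge0.
- exact: ltW.
- by apply: A_lower; lra.
- by rewrite mulr_ge0 ?wt_ge0 ?wf_ge0.
- have wz : wf e x z <= vf e x z ^+ N.
    by rewrite /wf ler_piMr ?exprn_ge0 ?vf_ge0// chi_le1.
  have wy : wt e x y <= vf e x y ^+ N.
    by rewrite /wt ler_piMr ?exprn_ge0 ?vf_ge0//; case: (leP (qf x y)).
  apply: le_trans (ler_pM _ _ wy wz) _; [exact: wt_ge0|exact: wf_ge0|].
  rewrite -[((t ^+ 2) ^+ N)^-1]exprVn -[((s ^+ 2) ^+ N)^-1]exprVn -!exprMn lerXn2r ?nnegrE ?mulr_ge0 ?vf_ge0 ?invr_ge0 ?sqr_ge0//.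
  (* The farther of the two points contributes t^(-2), the other at most 4 s^(-2) since xt is a
     near-minimiser. *)
  have [tE|tE] : t = T y \/ t = T z by rewrite /t; case: (leP (T y) (T z)); [right|left].
    rewrite [in leRHS]tE T_sqr mulrCA -/(vf e x y) ler_wpM2l ?vf_ge0//; exact: vf_le_near.
  rewrite [in leRHS]tE T_sqr mulrCA mulrC -/(vf e x z) ler_wpM2l ?vf_ge0//; exact: vf_le_near.
- exact: mcube_ge0.
(* |xt - z| <= s + T z <= 3 t because s <= 2 T z, and |y - z| <= 2 t; t <= 1/8 keeps the radius 5 t
   below 1. *)
- apply: (@le_trans _ _ (m xt (5 * t))).
    apply: mmono => //; first lra.
    rewrite distrC; have -> : xt - z = (x - z) - (x - xt) by rewrite opprB [RHS]addrC addrA subrK.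
    by have := ler_normB (x - z) (x - xt); have := norm_le_T xt; have := xtP Sz; lra.
  by apply: mdbl => //; [have := xtP Sy; lra|lra].
- by rewrite ge_max; apply/andP; split; lra.
Qed.

End fixed_point.
End pointwise_bound.

(** * Pointwise bound for the gradient *)

Section gradient_bound.
Context {R : realType} (n : nat) (S : set (borel_rV R n)).
Context (mu : {measure set (borel_rV R n) -> \bar R}) (C2 : R).
Local Notation B := (borel_rV R n).
Local Notation leb := (lebesgue_rV n : {measure set (borel_rV R n) -> \bar R}).
Hypothesis mS : measurable (S : set B).
Hypothesis mu_half : forall x, (mu (cube x 2^-1) <= C2%:E)%E.
Variables (D : nat -> R -> R) (M K : R) (N : nat).
Hypothesis dD : forall k (u : R), is_derive u (1 : R) (D k) (D k.+1 u).
Hypothesis Dl : forall u : R, u <= -1 -> D 0 u = 0.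
Hypothesis Dr : forall u : R, 1 <= u -> D 0 u = 1.
Hypothesis D01 : forall u : R, 0 <= D 0 u <= 1.
Hypothesis D1_ge0 : forall u : R, 0 <= D 1%N u.
Hypothesis D1_le : forall u : R, D 1%N u <= M.
Hypotheses (K128 : 128 <= K) (N0 : (0 < N)%N).
Variable f : B -> R.
Hypotheses (mf : measurable_fun S f) (fb : loc_bounded S f).
Implicit Types (x : 'rV[R]_n) (y z : B) (e d : R).

Let K0 : 0 < K. Proof. exact: lt_le_trans K128. Qed.
Local Notation wf := (wf D K N).
Local Notation dwf := (dwf D K N).
Local Notation wt := (wt K N).
Local Notation Ix := (Ik S mu D K N).
Local Notation Jx := (Jk S mu D K N).
Variables (Cmu C1 p : R) (P : nat).
Hypotheses (Cmu0 : 0 < Cmu) (C10 : 0 < C1) (C20 : 0 < C2).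
Hypothesis cS : closed (S : set 'rV[R]_n).
Hypothesis muS : mu (~` S) = 0%E.
Hypothesis doubling : forall (x : 'rV[R]_n) (r k : R), S x -> 0 < r <= 1 -> 1 <= k <= r^-1 ->
  (mu (cube x (k * r)) <= (Cmu * k ^+ n)%:E * mu (cube x r))%E.
Hypothesis mu1 : forall x : 'rV[R]_n, S x -> (C1%:E <= mu (cube x 1) <= C2%:E)%E.
Hypotheses (n0 : (0 < n)%N) (p1 : 1 < p) (pP : p <= P%:R) (nPN : (2 * n + P <= 2 * N)%N).

Local Notation m := (mcube mu).
Let p0 : 0 < p. Proof. exact: lt_trans p1. Qed.
Let muE x r : S x -> r <= 1 -> mu (cube x r) = (m x r)%:E.
Proof. by move=> *; apply: (@mu_cubeE R n S mu C1 C2). Qed.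
Let mgt0 x r : S x -> 0 < r -> r <= 1 -> 0 < m x r.
Proof. by move=> *; apply: (@mcube_gt0 R n S mu Cmu C1 C2). Qed.
Let mdbl x r s : S x -> 0 < r -> r <= s -> s <= 1 -> m x s <= Cmu * (s / r) ^+ n * m x r.
Proof. by move=> *; apply: (@mcube_doubling R n S mu Cmu C1 C2). Qed.
Let mmono x y r s : S y -> s <= 1 -> `|x - y| + r <= s -> m x r <= m y s.
Proof. by move=> *; apply: (@mcube_mono R n S mu C1 C2). Qed.
Let mge x r : S x -> 0 < r -> r <= 1 -> C1 / Cmu * r ^+ n <= m x r.
Proof. by move=> *; apply: (@mcube_ge R n S mu Cmu C1 C2). Qed.
Let mle x r : S x -> r <= 1 -> m x r <= C2.
Proof. by move=> *; apply: (@mcube_le R n S mu C1 C2). Qed.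

Let smu : sigma_finite setT mu.
Proof. by apply: (@sigma_finite_mu R n S mu C1 C2). Qed.
(** Extending f by 0 makes it measurable on the whole space, as needed for functions on products. *)
Let fS : B -> R := f \_ S.
Let mfS : measurable_fun setT fS.
Proof. by rewrite -(measurable_restrictT f mS). Qed.
Let fSE y : S y -> fS y = f y. Proof. by move=> Sy; rewrite /fS patchE mem_set. Qed.

Lemma measurable_invr_ge0 (d' : measure_display) (T' : measurableType d') (g : T' -> R) : measurable_fun setT g ->
  (forall t, 0 <= g t) -> measurable_fun setT (fun t => (g t)^-1).
Proof.
move=> mg g0; rewrite (_ : (fun=> _) = (fun t => g t `^ (-1))); last first.
  by apply/funext => t; rewrite powR_inv1.
by apply: (@measurableT_comp _ _ _ _ _ _ (fun y : R => powR y _)) => //; exact: measurable_powR.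
Qed.

(** Together with [E0k] and [D2k] this builds [Dk], a majorant of the p-th power of the gradient
    that does not involve e. In [D2k] the power of max(|x - y|, |y - z| / 2) keeps enough decay in x
    for its integral to be of order |y - z|^(n-p), the factor missing from the Besov kernel. *)
Definition D1k x (y : B) : R := `|fS y| `^ p * \1_(cube x 8^-1) (y : 'rV[R]_n).
Definition E0k (y z : B) : R := \1_S y * \1_S z * `|fS y - fS z| `^ p *
  (m z `|(y : 'rV[R]_n) - z| ^+ 2)^-1 * \1_(`]-oo, 1[%classic : set R) `|(y : 'rV[R]_n) - z|.
Definition D2k x (y z : B) : R := E0k y z * ((maxr `|x - y| (`|(y : 'rV[R]_n) - z| / 2)) `^ p)^-1.
Definition Dk x : \bar R := (\int[mu]_y (D1k x y)%:E + \int[mu]_y \int[mu]_z (D2k x y z)%:E)%E.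

Lemma D1k_ge0 x y : 0 <= D1k x y. Proof. by rewrite mulr_ge0// powR_ge0. Qed.
Lemma E0k_ge0 y z : 0 <= E0k y z.
Proof.
have h1 : 0 <= (m z `|(y : 'rV[R]_n) - z| ^+ 2)^-1 by rewrite invr_ge0; exact: sqr_ge0.
have h3 : 0 <= `|fS y - fS z| `^ p by exact: powR_ge0.
apply: mulr_ge0 => //; apply: mulr_ge0 h1; apply: mulr_ge0 h3.
exact: mulr_ge0.
Qed.
Lemma D2k_ge0 x y z : 0 <= D2k x y z.
Proof. by apply: mulr_ge0; [exact: E0k_ge0|rewrite invr_ge0 powR_ge0]. Qed.

Let mpw (d' : measure_display) (T' : measurableType d') (g : T' -> R) q :
  measurable_fun setT g -> measurable_fun setT (fun t => g t `^ q).
Proof.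
by move=> mg; apply: (@measurableT_comp _ _ _ _ _ _ (fun y : R => powR y q)) => //; exact: measurable_powR.
Qed.

Lemma measurable_D1k : measurable_fun setT (fun t : B * B => D1k t.1 t.2).
Proof.
apply: measurable_funM.
  apply: mpw; apply: measurableT_comp => //.
  by apply: (measurableT_comp mfS); exact: measurable_snd.
rewrite (_ : (fun=> _) = (fun t : B * B => \1_(cube (t.2 : 'rV[R]_n) 8^-1) t.1 : R)).
  exact: measurable_cube_indic.
by apply/funext => t; rewrite indic_cube_sym.
Qed.

Lemma measurable_E0k : measurable_fun setT (fun t : B * B => E0k t.1 t.2).
Proof.
have my : measurable_fun setT (fun t : B * B => t.1) by exact: measurable_fst.
have mz : measurable_fun setT (fun t : B * B => t.2) by exact: measurable_snd.
have myz := measurable_norm_diff my mz.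
have mS1 : measurable_fun setT (\1_S : B -> R) by exact: measurable_indic.
apply: measurable_funM; last first.
  apply: (measurableT_comp _ myz); apply: measurable_indic; exact: measurable_itv.
apply: measurable_funM; last first.
  apply: measurable_invr_ge0; last by move=> t; exact: sqr_ge0.
  by apply: measurable_funX; apply: (measurable_mcube C20 cS muS mu1).
apply: measurable_funM; last first.
  apply: mpw; apply: measurableT_comp => //.
  by apply: measurable_funB; exact: (measurableT_comp mfS).
by apply: measurable_funM; exact: (measurableT_comp mS1).
Qed.

Lemma measurable_D2k : measurable_fun setT (fun t : (B * B) * B => D2k t.1.1 t.1.2 t.2).
Proof.
have mx : measurable_fun setT (fun t : (B * B) * B => t.1.1) by apply: measurableT_comp => //; exact: measurable_fst.
have my : measurable_fun setT (fun t : (B * B) * B => t.1.2) by apply: (measurableT_comp measurable_snd); exact: measurable_fst.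
have mz : measurable_fun setT (fun t : (B * B) * B => t.2) by exact: measurable_snd.
have myz := measurable_norm_diff my mz; have mxy := measurable_norm_diff mx my.
apply: measurable_funM; last first.
  apply: measurable_invr_ge0; last by move=> t; exact: powR_ge0.
  by apply: mpw; apply: measurable_maxr => //; exact: measurable_funM.
rewrite (_ : (fun=> _) = (fun t : B * B => E0k t.1 t.2) \o (fun t : (B * B) * B => (t.1.2, t.2)))//.
apply: measurableT_comp; first exact: measurable_E0k.
exact: measurable_fun_pair.
Qed.

Lemma measurable_D2k_snd x : measurable_fun setT (fun t : B * B => D2k x t.1 t.2).
Proof.
rewrite (_ : (fun=> _) = (fun t : (B * B) * B => D2k t.1.1 t.1.2 t.2) \o (fun t : B * B => ((x : B, t.1), t.2)))//.
apply: measurableT_comp; first exact: measurable_D2k.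
apply: measurable_fun_pair; last exact: measurable_snd.
by apply: measurable_fun_pair => //; exact: measurable_fst.
Qed.

Definition G_cst : R := (4 * (N%:R + 8 * M)) `^ p * ((1 + (2 * K) ^+ N * C2) `^ (p - 1) *
  (2 `^ p * (B1_cst n C2 K N Cmu C1 + B2_cst n C2 K N Cmu))).

(** The quotient rule reads Gk = J(f - F) / A with F the value of the extension at x, so only
    oscillation counts. The derivative kernel costs 1/s. Jensen's inequality is used for [wt / A]
    outside and for [wf / A] on the mean inside F; then [q1] and [q2] supply the factor s^p that
    cancels s^(-p). *)
Lemma Gk_pointwise i e d x : 0 <= e -> e <= K^-1 -> 0 < d -> (forall y, S y -> d <= e + qf x y) ->
  ((`|Gk S mu D K N f i e x| `^ p)%:E <= G_cst%:E * Dk x)%E.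
Proof.
move=> e0 eK d0 xd.
have M0 : 0 <= M by exact: le_trans (D1_le 0).
have D0 : (0 <= Dk x)%E.
  apply: adde_ge0; apply: integral_ge0 => y _; first by rewrite lee_fin D1k_ge0.
  by apply: integral_ge0 => z _; rewrite lee_fin D2k_ge0.
have B10 := @B1_cst_ge0 R n C2 K N Cmu C1; have B20 := @B2_cst_ge0 R n C2 K N Cmu.
have G0 : 0 <= G_cst.
  apply: mulr_ge0; first exact: powR_ge0.
  by apply: mulr_ge0; [exact: powR_ge0|apply: mulr_ge0; [exact: powR_ge0|exact: addr_ge0]].
have [[y0 [Sy0 qy0]]|H] := pselect (exists y0, S y0 /\ qf x y0 <= K^-1); last first.
  rewrite Gk_out//; last by move=> y Sy; rewrite ltNge; apply/negP => q; apply: H; exists y.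
  by rewrite normr0 powR0 ?gt_eqF// mule_ge0.
have [xt Sxt xtP] := near_point e0 d0 xd Sy0.
set s := Num.sqrt (e + qf x xt) in xtP.
have s0 : 0 < s by exact: (T_gt0 d0 xd).
set A := 1 + Wk S mu D K N e x; have A0 : 0 < A by exact: Wk1_gt0.
have iw (h : B -> R) (mh : measurable_fun S h) hb := integrable_wf mS mu_half N dD Dl D01 K128 mh hb e0 d0 xd.
have idw (h : B -> R) (mh : measurable_fun S h) hb := integrable_dwf mS mu_half N dD Dl Dr D01 D1_ge0 D1_le K128 mh hb i e0 eK d0 xd.
have m1 : measurable_fun S (fun _ : B => 1 : R) by exact: measurable_cst.
have b1 := loc_bounded_cst S (1 : R).
pose F := Fk S mu D K N f e x.
have mfF c : measurable_fun S (fun y => f y - c) by exact: measurable_funB.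
have bfF c : loc_bounded S (fun y => f y - c) by apply: loc_bounded_sub => //; exact: loc_bounded_cst.
have mab y : measurable_fun S (fun z => `|f y - f z|).
  by apply: measurableT_comp => //; exact: measurable_funB.
have bab y : loc_bounded S (fun z => `|f y - f z|).
  move=> r; have [Q hQ] := loc_bounded_sub (loc_bounded_cst S (f y)) fb r.
  by exists Q => z Sz zr; rewrite normr_id; exact: hQ.
pose I2 y := Ix (fun z => `|f y - f z|) e x / A.
have I20 y : 0 <= I2 y.
  by apply: divr_ge0; [apply: Rintegral_ge0 => z _; apply: mulr_ge0 => //; exact: wf_ge0|exact: ltW].
pose g1 y := `|f y| / A + I2 y; pose k1 y := wt e x y / A.
have g10 y : 0 <= g1 y by apply: addr_ge0 => //; apply: divr_ge0 => //; exact: ltW.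
have k10 y : 0 <= k1 y by apply: divr_ge0; [exact: wt_ge0|exact: ltW].
(* As A = 1 + W, the difference f y - F is f y plus the integral of (f y - f z) w, all over A. The
   additional value 0 is the source of |f y| / A. *)
have Fg y : `|f y - F| <= g1 y.
  have E : Ix (fun z => f y - f z) e x = f y * Wk S mu D K N e x - Ix f e x.
    rewrite /Wk /Ik -RintegralZl//; last exact: (iw _ m1 b1).
    rewrite -RintegralB//; last 2 first.
    - by have := integrableZl mS (f y) (iw _ m1 b1).
    - exact: iw.
    by apply: eq_Rintegral => z _; ring.
  have E2 : f y - F = (f y + Ix (fun z => f y - f z) e x) / A.
    by rewrite E /F /Fk -/A (_ : Wk S mu D K N e x = A - 1); [field; rewrite gt_eqF|rewrite /A addrAC subrr add0r].
  rewrite E2 normrM normfV (gtr0_norm A0) /g1 /I2 -mulrDl ler_wpM2r ?invr_ge0 ?(ltW A0)//.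
  apply: le_trans (ler_normD _ _) _; apply: lerD => //.
  have ms : measurable_fun S (fun z => f y - f z) by exact: measurable_funB.
  have bs := loc_bounded_sub (loc_bounded_cst S (f y)) fb.
  apply: le_trans (le_normr_Rintegral mS (iw _ ms bs)) _.
  rewrite le_eqVlt; apply/orP; left; apply/eqP; apply: eq_Rintegral => z _.
  by rewrite normrM (ger0_norm (wf_ge0 K N D01 x z e0)).
pose C0 := 2 * (N%:R + 8 * M); have C00 : 0 <= C0 by rewrite mulr_ge0// addr_ge0// mulr_ge0.
(* Near-minimality replaces the factor 1 / T y of [dwf_bound] by 2 / s, which no longer depends on
   y. *)
have dwb y : S y -> `|dwf i e x y| <= 2 * C0 / s * wt e x y.
  move=> Sy; have q0 : 0 < e + qf x y by exact: lt_le_trans (xd y Sy).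
  apply: (le_trans (@dwf_bound R n D M K N dD Dl Dr D01 D1_ge0 D1_le K0 i e x y e0 q0 eK)).
  apply: ler_wpM2r; first exact: wt_ge0.
  rewrite -/C0 ler_pdivrMr ?sqrtr_gt0// mulrAC ler_pdivlMr//.
  by have := ler_wpM2l C00 (xtP y Sy); lra.
have mI2 : measurable_fun S I2.
  pose u (t : B * B) := (`|fS t.1 - fS t.2| * wf e x t.2 * \1_S t.2)%:E.
  have mu' : measurable_fun setT u.
    apply/measurable_EFinP; apply: measurable_funM; last first.
      by apply: measurableT_comp; [exact: measurable_indic|exact: measurable_snd].
    apply: measurable_funM; last by apply: measurableT_comp; [exact: measurable_wf|exact: measurable_snd].
    apply: measurableT_comp => //; apply: measurable_funB.
      by apply: (measurableT_comp mfS); exact: measurable_fst.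
    by apply: (measurableT_comp mfS); exact: measurable_snd.
  have u0 t : (0 <= u t)%E by rewrite lee_fin; apply: mulr_ge0 => //; apply: mulr_ge0 => //; exact: wf_ge0.
  have mI := measurable_integral_snd smu mu' u0.
  apply: (eq_measurable_fun (fun y => fine (\int[mu]_z u (y, z))%E / A)); last first.
    apply: measurable_funM => //; apply: measurable_funTS.
    by apply: measurableT_comp mI; exact: fine_measurable.
  move=> y; rewrite inE => Sy; rewrite /I2 /Ik /Rintegral [in RHS]integral_mkcond.
  congr (fine _ / _); apply: eq_integral => z _; rewrite patchE /u /= indicE.
  by case: ifPn => [/set_mem Sz|_]; rewrite ?mulr1 ?mulr0// !fSE.
have mg : measurable_fun S g1.
  apply: measurable_funD => //; apply: measurable_funM => //.
  by apply: measurableT_comp => //.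
have mk : measurable_fun S k1.
  by apply: measurable_funM => //; apply: measurable_funTS; exact: measurable_wt.
have step1 : ((`|Gk S mu D K N f i e x|)%:E <= (2 * C0 / s)%:E * \int[mu]_(y in S) (g1 y * k1 y)%:E)%E.
  pose h (y : B) := f y - F.
  have JE : Gk S mu D K N f i e x = Jx i h e x / A.
    have -> : Jx i h e x = Jx i f e x - F * Jx i (fun=> 1) e x.
      rewrite /Jk -RintegralZl//; last exact: (idw _ m1 b1).
      rewrite -RintegralB//; last 2 first.
      - exact: idw.
      - by have := integrableZl mS F (idw _ m1 b1).
      by apply: eq_Rintegral => z _; rewrite /h; ring.
    by rewrite /Gk /F /Fk -/A; field; rewrite gt_eqF.
  have ih := idw _ (mfF F) (bfF F).
  rewrite JE normrM normfV (gtr0_norm A0) mulrC EFinM.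
  have le1 : ((`|Jx i h e x|)%:E <= \int[mu]_(y in S) (`|h y * dwf i e x y|)%:E)%E.
    apply: (@le_trans _ _ (\int[mu]_(y in S) `|h y * dwf i e x y|)%:E).
      by rewrite lee_fin; exact: (le_normr_Rintegral mS ih).
    by rewrite /Rintegral fineK//; have := integrable_fin_num mS (integrable_norm ih).
  have mk1 : measurable_fun S (fun y => (g1 y * k1 y)%:E).
    by apply/measurable_EFinP; exact: measurable_funM.
  rewrite -ge0_integralZl_EFin//; last 2 first.
  - by move=> y Sy; rewrite lee_fin mulr_ge0.
  - by apply: divr_ge0; [rewrite mulr_ge0|exact: ltW].
  have Ai0 : 0 <= A^-1 by rewrite invr_ge0 ltW.
  apply: (le_trans (lee_wpmul2l _ le1)); first by rewrite lee_fin.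
  rewrite -ge0_integralZl_EFin//; last first.
    by have /integrableP[/measurable_EFinP mm _] := ih; apply/measurable_EFinP; exact: measurableT_comp.
  apply: ge0_le_integral_nm => y Sy; first by rewrite mule_ge0// lee_fin.
  rewrite -!EFinM lee_fin normrM.
  have := ler_pM (normr_ge0 _) (normr_ge0 _) (Fg y) (dwb y Sy); rewrite -/(h y) => hh.
  apply: le_trans (ler_wpM2l Ai0 hh) _; rewrite /k1 le_eqVlt; apply/orP; left; apply/eqP; ring.
pose L : R := 1 + (2 * K) ^+ N * C2.
have K2 : 0 <= (2 * K) ^+ N by rewrite exprn_ge0// mulr_ge0// ltW.
have L0 : 0 <= L by rewrite addr_ge0// mulr_ge0// ltW.
have A1 : 1 <= A by rewrite lerDl; exact: Wk_ge0.
have Ai0 : 0 <= A^-1 by rewrite invr_ge0 ltW.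
have Ai1 : A^-1 <= 1 by rewrite invf_le1.
have iW : (\int[mu]_(y in S) (wf e x y)%:E = (A - 1)%:E)%E.
  rewrite /A addrAC subrr add0r /Wk /Ik /Rintegral fineK.
    by apply: eq_integral => y _; rewrite mul1r.
  exact: (integrable_fin_num mS (iw _ m1 b1)).
have mwf : measurable_fun S (fun y => (wf e x y)%:E).
  by apply/measurable_EFinP; apply: measurable_funTS; exact: measurable_wf.
have mcub : measurable_fun S (fun y : B => (\1_(cube x 2^-1 : set B) y : R)%:E).
  by apply/measurable_EFinP; apply: measurable_indic; exact: measurable_cube.
(* [wf / A] has mass below 1, and [wt] exceeds [wf] by at most (2K)^N on a cube of measure at most
   [C2]. *)
have kL : (\int[mu]_(y in S) (k1 y)%:E <= L%:E)%E.
  have h1 y : S y -> ((k1 y)%:E <= A^-1%:E * (wf e x y)%:E + ((2 * K) ^+ N)%:E * (\1_(cube x 2^-1 : set B) y)%:E)%E.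
    move=> Sy; rewrite -!EFinM -EFinD lee_fin /k1 mulrC.
    have := ler_wpM2l Ai0 (wt_le_wf N Dr D01 K0 x y e0); rewrite mulrDr => h.
    apply: le_trans h _; apply: lerD => //; rewrite mulrCA; apply: ler_wpM2l => //.
    rewrite -[leRHS]mul1r; apply: ler_pM => //.
    rewrite indicE; case: (leP (qf x y)) => // /(qf_support K128) q.
    by rewrite mem_set// /cube /= distrC; apply: le_trans q _; lra.
  have hh : (\int[mu]_(y in S) (k1 y)%:E <= \int[mu]_(y in S)
     (A^-1%:E * (wf e x y)%:E + ((2 * K) ^+ N)%:E * (\1_(cube x 2^-1 : set B) y)%:E))%E.
    by apply: ge0_le_integral_nm => // y Sy; rewrite lee_fin.
  apply: le_trans hh _.
  rewrite ge0_integralD//; last 4 first.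
  - by move=> y Sy; rewrite -EFinM lee_fin mulr_ge0//; exact: wf_ge0.
  - exact: measurable_funeM.
  - by move=> y Sy; rewrite -EFinM lee_fin mulr_ge0.
  - exact: measurable_funeM.
  rewrite !ge0_integralZl_EFin//; last first.
    by move=> y Sy; rewrite lee_fin; exact: wf_ge0.
  rewrite iW [L%:E]EFinD; apply: leeD.
    by rewrite -EFinM lee_fin -ler_pdivlMl ?invr_gt0// invrK; lra.
  rewrite EFinM; apply: lee_wpmul2l; first by rewrite lee_fin.
  rewrite integral_indic//; last exact: measurable_cube.
  apply: le_trans (mu_half x); apply: le_measure; rewrite ?inE; [|exact: measurable_cube|by move=> y []].
  by apply: measurableI => //; exact: measurable_cube.
have jen := weighted_jensen p1 mS mg mk (fun y _ => g10 y) (fun y _ => k10 y) L0 kL.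
have I2p y : S y -> ((I2 y `^ p)%:E <= \int[mu]_(z in S) (`|f y - f z| `^ p * (wf e x z / A))%:E)%E.
  move=> Sy.
  have iwA : (\int[mu]_(z in S) (wf e x z / A)%:E <= 1%:E)%E.
    under eq_integral do rewrite mulrC EFinM.
    rewrite ge0_integralZl_EFin//; last by move=> z Sz; rewrite lee_fin; exact: wf_ge0.
    by rewrite iW -EFinM lee_fin mulrC ler_pdivrMr// mul1r; lra.
  have E : ((I2 y)%:E = \int[mu]_(z in S) (`|f y - f z| * (wf e x z / A))%:E)%E.
    under eq_integral do rewrite mulrA mulrC EFinM.
    have ii := iw _ (mab y) (bab y).
    have mm : measurable_fun S (fun z => (`|f y - f z| * wf e x z)%:E).
      apply/measurable_EFinP; apply: measurable_funM; first exact: mab.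
      by apply: measurable_funTS; exact: measurable_wf.
    have pos z : S z -> (0 <= (`|f y - f z| * wf e x z)%:E)%E.
      by move=> Sz; rewrite lee_fin mulr_ge0//; exact: wf_ge0.
    rewrite (ge0_integralZl_EFin _ _ pos mm)//.
    by rewrite /I2 mulrC EFinM /Ik /Rintegral fineK//; exact: (integrable_fin_num mS ii).
  rewrite -poweR_EFin E.
  have mwA : measurable_fun S (fun z => wf e x z / A).
    by apply: measurable_funM => //; apply: measurable_funTS; exact: measurable_wf.
  have := weighted_jensen p1 mS (mab y) mwA (fun z _ => normr_ge0 _) _ ler01 iwA.
  rewrite powR1 mul1e; apply => z _; apply: mulr_ge0 => //; exact: wf_ge0.
pose Q (y : B) : \bar R := ((D1k x y)%:E + \int[mu]_z (D2k x y z)%:E)%E.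
have mD2 : measurable_fun setT (fun y : B => \int[mu]_z (D2k x y z)%:E)%E.
  apply: (measurable_integral_snd smu (f := fun t : B * B => (D2k x t.1 t.2)%:E)).
    by apply/measurable_EFinP; exact: measurable_D2k_snd.
  by move=> t; rewrite lee_fin D2k_ge0.
have mD1 : measurable_fun setT (fun y : B => (D1k x y)%:E).
  apply/measurable_EFinP; apply: measurable_funM.
    by apply: mpw; exact: measurableT_comp.
  by apply: measurable_indic; exact: measurable_cube.
have D20 y : (0 <= \int[mu]_z (D2k x y z)%:E)%E by apply: integral_ge0 => z _; rewrite lee_fin D2k_ge0.
have Q0 y : (0 <= Q y)%E by apply: adde_ge0 => //; rewrite lee_fin D1k_ge0.
pose B1 := B1_cst n C2 K N Cmu C1; pose B2 := B2_cst n C2 K N Cmu.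
have sp0 : 0 < s `^ p by exact: powR_gt0.
have Ap0 : 0 < A `^ p by exact: powR_gt0.
have p2 : 0 <= 2 `^ p by exact: powR_ge0.
have q1 y : S y -> (`|f y| / A) `^ p * k1 y <= B1 * s `^ p * D1k x y.
  move=> Sy; have := point_bound1 mS mu_half dD Dl Dr D01 K128 Cmu0 C10 C20 cS muS doubling mu1 n0 p1 pP nPN e0 eK d0 xd Sxt xtP Sy.
  rewrite -/s -/A -/B1 => h.
  rewrite powRM// powR_invr ?(ltW A0)// /k1 /D1k fSE//.
  have c0 : 0 <= `|f y| `^ p * (A `^ p)^-1 * A^-1.
    by apply: mulr_ge0 => //; apply: mulr_ge0; [exact: powR_ge0|rewrite invr_ge0 ltW].
  have := ler_wpM2l c0 h; rewrite [X in X <= _ -> _](_ : _ = `|f y| `^ p / A `^ p * (wt e x y / A)); last by ring.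
  by move/le_trans; apply; rewrite le_eqVlt; apply/orP; left; apply/eqP; field; rewrite !gt_eqF.
have q2 y z : S y -> S z -> `|f y - f z| `^ p * (wf e x z / A) * k1 y <= B2 * s `^ p * D2k x y z.
  move=> Sy Sz; have [->|yz] := eqVneq y z.
    rewrite subrr normr0 powR0 ?gt_eqF// !mul0r; apply: mulr_ge0; last exact: D2k_ge0.
    by apply: mulr_ge0; [exact: B20|exact: ltW].
  have nyz : 0 < `|(y : 'rV[R]_n) - z| by rewrite normr_gt0 subr_eq0.
  have h := point_bound2 mS mu_half dD Dl Dr D01 K128 Cmu0 C10 C20 cS muS doubling mu1 n0 p1 pP nPN e0 eK d0 xd Sxt xtP Sy Sz nyz.
  rewrite -/s -/A -/B2 in h.
  have fp0 : 0 <= `|f y - f z| `^ p by exact: powR_ge0.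
  have [r1|r1] := ltP `|(y : 'rV[R]_n) - z| 1; last first.
    have w00 : wt e x y * wf e x z = 0.
      have [qy|qy] := leP (qf x y) K^-1; last by rewrite wt0// mul0r.
      have [qz|qz] := leP (qf x z) K^-1; last by rewrite /wf chi_large ?mulr0// ltW.
      have xy := qf_support K128 qy; have xz := qf_support K128 qz.
      have : `|(y : 'rV[R]_n) - z| <= 4^-1.
        have -> : (y : 'rV[R]_n) - z = (x - z) - (x - y) by rewrite opprB [RHS]addrC addrA subrK.
        by apply: le_trans (ler_normB _ _) _; lra.
      by move=> /(le_trans r1); lra.
    have -> : `|f y - f z| `^ p * (wf e x z / A) * k1 y = `|f y - f z| `^ p / A / A * (wt e x y * wf e x z).
      by rewrite /k1; ring.
    rewrite w00 mulr0; apply: mulr_ge0; last exact: D2k_ge0.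
    by apply: mulr_ge0; [exact: B20|exact: ltW].
  rewrite r1 mulr1 in h.
  have mz0 : 0 < m z `|(y : 'rV[R]_n) - z| by apply: mgt0 => //; exact: ltW.
  have rin : (`|(y : 'rV[R]_n) - z| \in (`]-oo, 1[%classic : set R)) = true.
    by apply: mem_set; rewrite /= in_itv.
  rewrite /D2k /E0k !fSE// !indicE (mem_set Sy) (mem_set Sz) rin !mul1r mulr1.
  set X := (maxr _ _) `^ p in h *; have X0 : 0 < X.
    by apply: powR_gt0; rewrite lt_max divr_gt0 ?orbT.
  set mm := m z _ ^+ 2 in h *; have mm0 : 0 < mm by rewrite exprn_gt0.
  have c0 : 0 <= `|f y - f z| `^ p / (A ^+ 2 * (mm * X)).
    by apply: divr_ge0 => //; apply: mulr_ge0; [rewrite exprn_ge0// ltW|rewrite mulr_ge0// ltW].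
  have := ler_wpM2l c0 h.
  rewrite [X in X <= _ -> _](_ : _ = `|f y - f z| `^ p * (wf e x z / A) * k1 y); last first.
    by rewrite /k1; field; rewrite !gt_eqF.
  by move/le_trans; apply; rewrite le_eqVlt; apply/orP; left; apply/eqP; field; rewrite !gt_eqF.
have gQ y : S y -> ((g1 y `^ p * k1 y)%:E <= (2 `^ p * ((B1 + B2) * s `^ p))%:E * Q y)%E.
  move=> Sy.
  have u0 : 0 <= `|f y| / A by apply: divr_ge0 => //; exact: ltW.
  have I2k : ((I2 y `^ p * k1 y)%:E <= (B2 * s `^ p)%:E * \int[mu]_z (D2k x y z)%:E)%E.
    rewrite mulrC EFinM; apply: (le_trans (lee_wpmul2l _ (I2p y Sy))); first by rewrite lee_fin.
    rewrite -ge0_integralZl_EFin//; last 2 first.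
    - by move=> z Sz; rewrite lee_fin mulr_ge0 ?powR_ge0// divr_ge0 ?(ltW A0)//; exact: wf_ge0.
    - apply/measurable_EFinP; apply: measurable_funM.
        apply: (@measurableT_comp _ _ _ _ _ _ (fun y : R => powR y p)); [exact: measurable_powR|exact: mab].
      by apply: measurable_funM => //; apply: measurable_funTS; exact: measurable_wf.
    apply: (@le_trans _ _ (\int[mu]_(z in S) ((B2 * s `^ p)%:E * (D2k x y z)%:E))%E).
      apply: ge0_le_integral_nm => z Sz.
        rewrite -EFinM lee_fin; apply: mulr_ge0 => //; apply: mulr_ge0; first exact: powR_ge0.
        by apply: divr_ge0; [exact: wf_ge0|exact: ltW].
      by rewrite -!EFinM lee_fin mulrC; exact: q2.
    have mD : measurable_fun setT (fun z => (D2k x y z)%:E).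
      apply/measurable_EFinP.
      by have := measurableT_comp (measurable_D2k_snd x) (measurable_pair1 y).
    rewrite ge0_integralZl_EFin//; last 3 first.
    - by move=> z _; rewrite lee_fin D2k_ge0.
    - exact: measurable_funTS.
    - by apply: mulr_ge0; [exact: B20|exact: ltW].
    apply: lee_wpmul2l; first by rewrite lee_fin; apply: mulr_ge0; [exact: B20|exact: ltW].
    by apply: ge0_subset_integral => // z _; rewrite lee_fin D2k_ge0.
  apply: (@le_trans _ _ ((2 `^ p)%:E * ((B1 * s `^ p * D1k x y)%:E + (B2 * s `^ p)%:E * \int[mu]_z (D2k x y z)%:E))%E).
    apply: (@le_trans _ _ ((2 `^ p)%:E * (((`|f y| / A) `^ p * k1 y)%:E + (I2 y `^ p * k1 y)%:E))%E).
      rewrite -EFinD -EFinM lee_fin -mulrDl mulrA; apply: ler_wpM2r => //.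
      exact: powR_add_le.
    apply: lee_wpmul2l; first by rewrite lee_fin.
    by apply: leeD => //; rewrite lee_fin; exact: q1.
  rewrite [X in (_ <= X * _)%E]EFinM -muleA; apply: lee_wpmul2l; first by rewrite lee_fin.
  have d10 : (0 <= (D1k x y)%:E)%E by rewrite lee_fin D1k_ge0.
  rewrite /Q (ge0_muleDr _ d10 (D20 y)); apply: leeD.
    rewrite -EFinM lee_fin; apply: ler_wpM2r; first exact: D1k_ge0.
    by apply: ler_wpM2r; [exact: ltW|rewrite lerDl; exact: B20].
  apply: lee_wpmul2r => //; rewrite lee_fin; apply: ler_wpM2r; first exact: ltW.
  by rewrite lerDr; exact: B10.
have intQ : (\int[mu]_(y in S) (g1 y `^ p * k1 y)%:E <= (2 `^ p * ((B1 + B2) * s `^ p))%:E * Dk x)%E.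
  have c0 : 0 <= 2 `^ p * ((B1 + B2) * s `^ p).
    by apply: mulr_ge0 => //; apply: mulr_ge0; [exact: addr_ge0|exact: ltW].
  apply: (@le_trans _ _ (\int[mu]_(y in S) ((2 `^ p * ((B1 + B2) * s `^ p))%:E * Q y))%E).
    by apply: ge0_le_integral_nm => y Sy; [rewrite lee_fin mulr_ge0// powR_ge0|exact: gQ].
  have mQ : measurable_fun setT Q by exact: emeasurable_funD.
  rewrite ge0_integralZl_EFin//; last exact: measurable_funTS.
  apply: lee_wpmul2l; first by rewrite lee_fin.
  apply: (@le_trans _ _ (\int[mu]_y Q y)%E).
    by apply: ge0_subset_integral.
  by rewrite /Q ge0_integralD// => y _; rewrite lee_fin D1k_ge0.
have Is0 : (0 <= \int[mu]_(y in S) (g1 y * k1 y)%:E)%E.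
  by apply: integral_ge0 => y _; rewrite lee_fin mulr_ge0.
have C0s : 0 <= 2 * C0 / s by apply: divr_ge0; [exact: mulr_ge0|exact: ltW].
apply: (@le_trans _ _ (((2 * C0 / s)%:E * \int[mu]_(y in S) (g1 y * k1 y)%:E) `^ p)%E).
  rewrite -poweR_EFin; apply: gt0_ler_poweR; rewrite ?(ltW p0)// in_itv /= leey andbT ?lee_fin//.
  by rewrite mule_ge0.
rewrite poweRM// poweR_EFin.
apply: (@le_trans _ _ (((2 * C0 / s) `^ p)%:E * ((L `^ (p - 1))%:E * ((2 `^ p * ((B1 + B2) * s `^ p))%:E * Dk x)))%E).
  apply: lee_wpmul2l; first by rewrite lee_fin powR_ge0.
  by apply: le_trans jen _; apply: lee_wpmul2l; [rewrite lee_fin powR_ge0|exact: intQ].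
rewrite !muleA -!EFinM; apply: lee_wpmul2r => //; rewrite lee_fin /G_cst -/B1 -/B2 -/L.
rewrite (_ : 4 * (N%:R + 8 * M) = 2 * C0); last by rewrite /C0; ring.
have c20 : 0 <= 2 * C0 by exact: mulr_ge0.
have si0 : 0 <= s^-1 by rewrite invr_ge0 ltW.
rewrite (powRM p c20 si0) (powR_invr _ (ltW s0)).
by rewrite le_eqVlt; apply/orP; left; apply/eqP; field; rewrite gt_eqF.
Qed.

End gradient_bound.

(** * Integral of a truncated negative power *)

Section max_integral.
Context {R : realType} (n : nat) (p : R).
Hypotheses (p0 : 0 < p) (np : n%:R < p).
Local Notation B := (borel_rV R n).
Local Notation leb := (lebesgue_rV n : {measure set (borel_rV R n) -> \bar R}).

Definition ratio : R := 2 ^+ n / 2 `^ p.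

Lemma ratio_lt1 : ratio < 1.
Proof.
rewrite /ratio ltr_pdivrMr ?powR_gt0// mul1r -powR_mulrn//.
have -> : 2 `^ p = 2 `^ n%:R * 2 `^ (p - n%:R) :> R by rewrite -powRD; [congr powR; ring|apply/implyP].
rewrite ltr_pMr ?powR_gt0//.
by have := @gt0_ltr_powR R (p - n%:R) _ 1 2; rewrite !nnegrE powR1 subr_gt0 => -> //; rewrite ltr1n.
Qed.

Lemma ratio_ge0 : 0 <= ratio. Proof. by apply: divr_ge0; [exact: exprn_ge0|exact: powR_ge0]. Qed.

Definition max_cst : R := 2 `^ p * 2 ^+ n / (1 - ratio).

Lemma max_cst_ge0 : 0 <= max_cst.
Proof.
apply: divr_ge0; last by rewrite subr_ge0 ltW// ratio_lt1.
by apply: mulr_ge0; [exact: powR_ge0|exact: exprn_ge0].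
Qed.

Lemma dyadic_index (r u : R) : 0 < r -> exists k, u <= 2 ^+ k * r /\ 2 ^+ k * r / 2 <= maxr u r.
Proof.
move=> r0; have ex : exists k, u <= 2 ^+ k * r.
  have [u0|u0] := leP u 0; first by exists 0%N; rewrite expr0 mul1r; apply: le_trans u0 _; exact: ltW.
  exists (Num.bound (u / r)); rewrite -ler_pdivrMr//; apply: ltW.
  apply: lt_le_trans (archi_boundP _) _; first by rewrite divr_ge0 ?ltW.
  by rewrite -natrX ler_nat ltnW// ltn_expl.
case: (ex_minnP ex) => k hk kmin; exists k; split => //.
rewrite le_max; case: k hk kmin => [|k] hk kmin.
  by apply/orP; right; rewrite expr0 mul1r; lra.
apply/orP; left; have /negP : ~ u <= 2 ^+ k * r by move=> /kmin; rewrite ltnn.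
by rewrite -ltNge exprS => h; lra.
Qed.

(** At every x some k satisfies |x - y| <= 2^k r while the maximum is at least 2^(k-1) r. Summing
    (2^(k-1) r)^(-p) over the cubes of radius 2^k r gives a series of ratio 2^(n-p), convergent
    because p > n. *)
Lemma max_integral (y : 'rV[R]_n) r : 0 < r ->
  (\int[leb]_x ((maxr `|(x : 'rV[R]_n) - y| r `^ p)^-1)%:E <= (max_cst * (r ^+ n / r `^ p))%:E)%E.
Proof.
move=> r0; pose u k : R := 2 ^+ k * r; have u0 k : 0 < u k by rewrite mulr_gt0// exprn_gt0.
pose c k : R := 2 `^ p * (u k `^ p)^-1.
have c0 k : 0 <= c k by apply: mulr_ge0; rewrite ?invr_ge0 powR_ge0.
pose g (k : nat) (x : B) : \bar R := ((c k)%:E * (\1_(cube y (u k) : set B) x)%:E)%E.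
have g0 k x : (0 <= g k x)%E by rewrite /g -EFinM lee_fin mulr_ge0.
have mind k : measurable_fun setT (fun x : B => (\1_(cube y (u k) : set B) x : R)%:E).
  by apply/measurable_EFinP; apply: measurable_indic; exact: measurable_cube.
apply: (@le_trans _ _ (\int[leb]_x \sum_(k <oo) g k x)%E).
  apply: ge0_le_integral_nm => x _; first by rewrite lee_fin invr_ge0 powR_ge0.
  have [k [xk km]] := dyadic_index `|(x : 'rV[R]_n) - y| r0.
  apply: le_trans (ge_nneseries_term k (fun k => g0 k x)).
  rewrite /g -EFinM lee_fin indicE mem_set// mulr1 /c.
  have -> : 2 `^ p * (u k `^ p)^-1 = ((u k / 2) `^ p)^-1.
    have h2 : 0 <= 2^-1 :> R by rewrite invr_ge0.
    rewrite (powRM p (ltW (u0 k)) h2) powR_invr// invfM invrK mulrC//.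
  have hm : 0 < u k / 2 by rewrite divr_gt0.
  rewrite lef_pV2 ?posrE ?powR_gt0//; last by apply: lt_le_trans km.
  by apply: ge0_ler_powR; rewrite ?nnegrE ?(ltW p0) ?(ltW hm)// (le_trans (ltW hm)).
rewrite integral_nneseries//; last by move=> k; apply: measurable_funeM; exact: mind.
apply: nneseries_le_bound => [k|N]; first by apply: integral_ge0 => x _.
have E k : (\int[leb]_x g k x = (2 `^ p * 2 ^+ n * (r ^+ n / r `^ p) * ratio ^+ k)%:E)%E.
  rewrite /g ge0_integralZl_EFin// integral_indic//; last exact: measurable_cube.
  rewrite setIT leb_cube ?(ltW (u0 k))// -EFinM; congr EFin; rewrite /c /u /ratio.
  have h2 : 0 <= 2 ^+ k :> R by exact: exprn_ge0.
  rewrite (powRM p h2 (ltW r0)).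
  have -> : (2 ^+ k) `^ p = (2 `^ p) ^+ k :> R.
    by rewrite -powR_mulrn// -powRrM mulrC powRrM powR_mulrn// powR_ge0.
  rewrite !exprMn exprVn [(2 ^+ k) ^+ n]exprAC.
  by field; rewrite !gt_eqF ?exprn_gt0 ?powR_gt0.
under eq_bigr do rewrite E.
rewrite sumEFin lee_fin -mulr_sumr.
have pos : 0 <= 2 `^ p * 2 ^+ n * (r ^+ n / r `^ p).
  apply: mulr_ge0; first by apply: mulr_ge0; [exact: powR_ge0|exact: exprn_ge0].
  by apply: divr_ge0; [rewrite exprn_ge0// ltW|exact: powR_ge0].
apply: le_trans (ler_wpM2l pos (geometric_sum_le N ratio_ge0 ratio_lt1)) _.
rewrite /max_cst le_eqVlt; apply/orP; left; apply/eqP.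
by rewrite -!mulrA; congr (_ * (_ * _)); ring.
Qed.

End max_integral.

(** * Integration of the majorant *)

Section integral_bound.
Context {R : realType} (n : nat) (S : set (borel_rV R n)).
Context (mu : {measure set (borel_rV R n) -> \bar R}) (C2 : R).
Local Notation B := (borel_rV R n).
Local Notation leb := (lebesgue_rV n : {measure set (borel_rV R n) -> \bar R}).
Hypothesis mS : measurable (S : set B).
Hypothesis mu_half : forall x, (mu (cube x 2^-1) <= C2%:E)%E.
Variables (D : nat -> R -> R) (M K : R) (N : nat).
Hypothesis dD : forall k (u : R), is_derive u (1 : R) (D k) (D k.+1 u).
Hypothesis Dl : forall u : R, u <= -1 -> D 0 u = 0.
Hypothesis Dr : forall u : R, 1 <= u -> D 0 u = 1.
Hypothesis D01 : forall u : R, 0 <= D 0 u <= 1.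
Hypothesis D1_ge0 : forall u : R, 0 <= D 1%N u.
Hypothesis D1_le : forall u : R, D 1%N u <= M.
Hypotheses (K128 : 128 <= K) (N0 : (0 < N)%N).
Variable f : B -> R.
Hypotheses (mf : measurable_fun S f) (fb : loc_bounded S f).
Implicit Types (x : 'rV[R]_n) (y z : B) (e d : R).

Let K0 : 0 < K. Proof. exact: lt_le_trans K128. Qed.
Local Notation wf := (wf D K N).
Local Notation dwf := (dwf D K N).
Local Notation wt := (wt K N).
Local Notation Ix := (Ik S mu D K N).
Local Notation Jx := (Jk S mu D K N).
Variables (Cmu C1 p : R) (P : nat).
Hypotheses (Cmu0 : 0 < Cmu) (C10 : 0 < C1) (C20 : 0 < C2).
Hypothesis cS : closed (S : set 'rV[R]_n).
Hypothesis muS : mu (~` S) = 0%E.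
Hypothesis doubling : forall (x : 'rV[R]_n) (r k : R), S x -> 0 < r <= 1 -> 1 <= k <= r^-1 ->
  (mu (cube x (k * r)) <= (Cmu * k ^+ n)%:E * mu (cube x r))%E.
Hypothesis mu1 : forall x : 'rV[R]_n, S x -> (C1%:E <= mu (cube x 1) <= C2%:E)%E.
Hypotheses (n0 : (0 < n)%N) (p1 : 1 < p) (pP : p <= P%:R) (nPN : (2 * n + P <= 2 * N)%N).

Local Notation m := (mcube mu).
Let p0 : 0 < p. Proof. exact: lt_trans p1. Qed.
Let muE x r : S x -> r <= 1 -> mu (cube x r) = (m x r)%:E.
Proof. by move=> *; apply: (@mu_cubeE R n S mu C1 C2). Qed.
Let mgt0 x r : S x -> 0 < r -> r <= 1 -> 0 < m x r.
Proof. by move=> *; apply: (@mcube_gt0 R n S mu Cmu C1 C2). Qed.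
Let mdbl x r s : S x -> 0 < r -> r <= s -> s <= 1 -> m x s <= Cmu * (s / r) ^+ n * m x r.
Proof. by move=> *; apply: (@mcube_doubling R n S mu Cmu C1 C2). Qed.
Let mmono x y r s : S y -> s <= 1 -> `|x - y| + r <= s -> m x r <= m y s.
Proof. by move=> *; apply: (@mcube_mono R n S mu C1 C2). Qed.
Let mge x r : S x -> 0 < r -> r <= 1 -> C1 / Cmu * r ^+ n <= m x r.
Proof. by move=> *; apply: (@mcube_ge R n S mu Cmu C1 C2). Qed.
Let mle x r : S x -> r <= 1 -> m x r <= C2.
Proof. by move=> *; apply: (@mcube_le R n S mu C1 C2). Qed.
Hypothesis np : n%:R < p.
Let smu : sigma_finite setT mu.
Proof. by apply: (@sigma_finite_mu R n S mu C1 C2). Qed.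
Let sleb : sigma_finite setT leb := @sigma_finite_leb R n.
Local Notation D1k := (D1k S f p).
Local Notation D2k := (D2k S mu f p).
Local Notation E0k := (E0k S mu f p).
Local Notation Dk := (Dk S mu f p).

Lemma E0k_diag y : E0k y y = 0.
Proof. by rewrite /E0k subrr normr0 powR0 ?gt_eqF// mulr0 !mul0r. Qed.

(** A real-valued form of the Besov kernel with the cube centred at [z], so that measurability and
    constants are handled in [R]. *)
Definition E1k (y z : B) : R := E0k y z * (`|(y : 'rV[R]_n) - z| ^+ n / `|(y : 'rV[R]_n) - z| `^ p).

Lemma E1k_ge0 y z : 0 <= E1k y z.
Proof.
apply: mulr_ge0; first exact: E0k_ge0.
by apply: divr_ge0; [exact: exprn_ge0|exact: powR_ge0].
Qed.

Let mE0 : measurable_fun setT (fun t : B * B => E0k t.1 t.2).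
Proof. exact: (measurable_E0k mS mf p C20 cS muS mu1). Qed.
Let mD2 : measurable_fun setT (fun t : (B * B) * B => D2k t.1.1 t.1.2 t.2).
Proof.
exact: (measurable_D2k mS mf p C20 cS muS mu1).
Qed.

Lemma measurable_E1k : measurable_fun setT (fun t : B * B => (E1k t.1 t.2)%:E).
Proof.
have m1 : measurable_fun setT (fun t : B * B => t.1) by exact: measurable_fst.
have m2 : measurable_fun setT (fun t : B * B => t.2) by exact: measurable_snd.
have myz := measurable_norm_diff m1 m2.
apply/measurable_EFinP; apply: measurable_funM; first exact: mE0.
apply: measurable_funM; first exact: measurable_funX.
apply: measurable_invr_ge0; last by move=> t; exact: powR_ge0.
by apply: (@measurableT_comp _ _ _ _ _ _ (fun y : R => powR y p)) => //; exact: measurable_powR.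
Qed.

Lemma E1k_le y z : S y -> S z -> ((E1k y z)%:E <= besov_kernel p mu f z y)%E.
Proof.
move=> Sy Sz; have [->|yz] := eqVneq y z.
  rewrite /E1k E0k_diag mul0r; exact: besov_kernel_ge0.
have r0 : 0 < `|(y : 'rV[R]_n) - z| by rewrite normr_gt0 subr_eq0.
have [r1|r1] := ltP `|(y : 'rV[R]_n) - z| 1; last first.
  have rin : (`|(y : 'rV[R]_n) - z| \in (`]-oo, 1[%classic : set R)) = false.
    by apply: memNset; rewrite /= in_itv /= => /(le_lt_trans r1); rewrite ltxx.
  rewrite /E1k (_ : E0k y z = 0) ?mul0r; first exact: besov_kernel_ge0.
  by rewrite /E0k [\1_(`]-oo, 1[%classic : set R) _]indicE rin mulr0.
have kE : besov_kernel p mu f z y =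
  (`|f z - f y| `^ p / `|(y : 'rV[R]_n) - z| `^ (p - n%:R) / m z `|(y : 'rV[R]_n) - z| ^+ 2)%:E.
  by rewrite -(distrC (z : 'rV[R]_n)); apply: (@besov_kernelE R n S mu p Cmu C1 C2) => //; rewrite distrC.
rewrite kE lee_fin.
have rin : (`|(y : 'rV[R]_n) - z| \in (`]-oo, 1[%classic : set R)) = true.
  by apply: mem_set; rewrite /= in_itv.
rewrite /E1k /E0k !patchE (mem_set Sy) (mem_set Sz) !indicE (mem_set Sy) (mem_set Sz) rin !mul1r mulr1.
rewrite (distrC (f z)); have -> : `|(y : 'rV[R]_n) - z| `^ p = `|(y : 'rV[R]_n) - z| `^ (p - n%:R) * `|(y : 'rV[R]_n) - z| ^+ n.
  rewrite -powR_mulrn// -powRD; first by congr powR; ring.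
  by apply/implyP => _; rewrite gt_eqF.
have mz0 : 0 < m z `|(y : 'rV[R]_n) - z| by apply: mgt0 => //; exact: ltW.
rewrite le_eqVlt; apply/orP; left; apply/eqP; field.
by rewrite !gt_eqF ?powR_gt0 ?exprn_gt0.
Qed.

Lemma integral_D2k_le y z : (\int[leb]_x (D2k x y z)%:E <= (max_cst n p * 2 `^ p * E1k y z)%:E)%E.
Proof.
have [->|yz] := eqVneq y z.
  rewrite (_ : (fun x => _) = cst 0%E); last by apply/funext => x; rewrite /D2k E0k_diag mul0r.
  by rewrite integral0 lee_fin /E1k E0k_diag mul0r mulr0.
have r0 : 0 < `|(y : 'rV[R]_n) - z| by rewrite normr_gt0 subr_eq0.
have r2 : 0 < `|(y : 'rV[R]_n) - z| / 2 by rewrite divr_gt0.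
under eq_integral do rewrite EFinM.
have e00 := E0k_ge0 S mu f p y z.
have pos (x : B) : setT x -> (0 <= ((maxr `|(x : 'rV[R]_n) - y| (`|(y : 'rV[R]_n) - z| / 2) `^ p)^-1)%:E)%E.
  by move=> _; rewrite lee_fin invr_ge0 powR_ge0.
have mm : measurable_fun setT (fun x : B => ((maxr `|(x : 'rV[R]_n) - y| (`|(y : 'rV[R]_n) - z| / 2) `^ p)^-1)%:E).
  apply/measurable_EFinP; apply: measurable_invr_ge0; last by move=> t; exact: powR_ge0.
  apply: (@measurableT_comp _ _ _ _ _ _ (fun y : R => powR y p)); first exact: measurable_powR.
  apply: measurable_maxr => //.
  by apply: (measurable_norm_diff (f := fun x : B => x) (g := fun=> y)) => //; exact: measurable_cst.
rewrite (ge0_integralZl_EFin _ measurableT pos mm e00).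
have p0' : 0 < p := p0.
apply: (le_trans (lee_wpmul2l _ (@max_integral R n p p0' np y _ r2))); first by rewrite lee_fin E0k_ge0.
rewrite -EFinM lee_fin /E1k.
have -> : (`|(y : 'rV[R]_n) - z| / 2) `^ p = `|(y : 'rV[R]_n) - z| `^ p / 2 `^ p.
  have h2 : 0 <= 2^-1 :> R by rewrite invr_ge0.
  by rewrite (powRM p (ltW r0) h2) powR_invr.
have -> : max_cst n p * 2 `^ p * (E0k y z * (`|(y : 'rV[R]_n) - z| ^+ n / `|(y : 'rV[R]_n) - z| `^ p)) =
  E0k y z * (max_cst n p * (`|(y : 'rV[R]_n) - z| ^+ n / (`|(y : 'rV[R]_n) - z| `^ p / 2 `^ p))).
  by field; rewrite !gt_eqF ?powR_gt0.
apply: ler_wpM2l; first exact: E0k_ge0.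
apply: ler_wpM2l; first exact: max_cst_ge0.
apply: ler_wpM2r; first by rewrite invr_ge0 divr_ge0 ?powR_ge0.
by rewrite exprMn ler_piMr ?exprn_ge0// exprn_ile1//; lra.
Qed.

Definition D_cst : R := 1 + max_cst n p * 2 `^ p.

(** Tonelli moves the x-integral innermost: in [D1k] it is the volume of a cube of side 1/4, at most
    1, and in [D2k] it produces the Besov kernel through [max_integral]. *)
Lemma integral_Dk : (\int[leb]_x Dk x <= D_cst%:E * (\int[mu]_(y in S) (`|f y| `^ p)%:E +
  \int[mu]_(y in S) \int[mu]_(x in S) besov_kernel p mu f x y))%E.
Proof.
have mD1 : measurable_fun setT (fun t : B * B => (D1k t.1 t.2)%:E).
  by apply/measurable_EFinP; exact: measurable_D1k.
have D10 (t : B * B) : (0 <= (D1k t.1 t.2)%:E)%E by rewrite lee_fin D1k_ge0.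
have D20 (t : (B * B) * B) : (0 <= (D2k t.1.1 t.1.2 t.2)%:E)%E by rewrite lee_fin D2k_ge0.
have mD2' : measurable_fun setT (fun t : (B * B) * B => (D2k t.1.1 t.1.2 t.2)%:E).
  exact/measurable_EFinP.
have mI2 := measurable_integral_snd smu mD2' D20.
have I20 (t : B * B) : (0 <= \int[mu]_z (D2k t.1 t.2 z)%:E)%E by apply: integral_ge0 => z _; rewrite lee_fin D2k_ge0.
have c0 : 0 <= max_cst n p * 2 `^ p by apply: mulr_ge0; [exact: max_cst_ge0|exact: powR_ge0].
rewrite /Dk ge0_integralD//; last 4 first.
- by move=> x _; apply: integral_ge0 => y _; exact: (D10 (x, y)).
- exact: (measurable_integral_snd smu mD1 D10).
- by move=> x _; apply: integral_ge0 => y _; exact: (I20 (x, y)).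
- exact: (measurable_integral_snd smu mI2 I20).
set X := (\int[mu]_(y in S) (`|f y| `^ p)%:E)%E.
set Z := (\int[mu]_(y in S) \int[mu]_(x in S) _)%E.
have X0 : (0 <= X)%E by apply: integral_ge0 => y _; rewrite lee_fin powR_ge0.
have Z0 : (0 <= Z)%E.
  by apply: integral_ge0 => y _; apply: integral_ge0 => x _; exact: besov_kernel_ge0.
have h1 : (\int[leb]_x \int[mu]_y (D1k x y)%:E <= X)%E.
  rewrite (tonelli_swap sleb smu mD1 D10) /X [leRHS]integral_mkcond.
  apply: ge0_le_integral_nm => y _; first by apply: integral_ge0 => x _; rewrite lee_fin D1k_ge0.
  rewrite patchE /D1k /= patchE; case: ifPn => [_|_]; last first.
    rewrite integral0_eq// => x _; rewrite normr0 powR0 ?gt_eqF// mul0r//.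
  under eq_integral do rewrite EFinM indic_cube_sym.
  rewrite ge0_integralZl_EFin ?powR_ge0//; last first.
    by apply/measurable_EFinP; apply: measurable_indic; exact: measurable_cube.
  rewrite integral_indic//; last exact: measurable_cube.
  rewrite setIT leb_cube// -EFinM lee_fin ler_piMr ?powR_ge0// exprn_ile1//; lra.
have h2 : (\int[leb]_x \int[mu]_y \int[mu]_z (D2k x y z)%:E <= (max_cst n p * 2 `^ p)%:E * Z)%E.
  rewrite (tonelli_swap sleb smu mI2 I20).
  have mE1 := measurable_integral_snd smu measurable_E1k.
  have E10 (t : B * B) : (0 <= (E1k t.1 t.2)%:E)%E by rewrite lee_fin E1k_ge0.
  apply: (@le_trans _ _ (\int[mu]_y ((max_cst n p * 2 `^ p)%:E * \int[mu]_z (E1k y z)%:E))%E).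
    apply: ge0_le_integral_nm => y _; first by apply: integral_ge0 => x _; exact: (I20 (x, y)).
    have mxz : measurable_fun setT (fun t : B * B => (D2k t.1 y t.2)%:E).
      rewrite (_ : (fun=> _) = (fun t : (B * B) * B => (D2k t.1.1 t.1.2 t.2)%:E) \o (fun t : B * B => ((t.1, y), t.2)))//.
      apply: measurableT_comp => //; apply: measurable_fun_pair; last exact: measurable_snd.
      by apply: measurable_fun_pair => //; exact: measurable_fst.
    have pxz (t : B * B) : (0 <= (D2k t.1 y t.2)%:E)%E by rewrite lee_fin D2k_ge0.
    rewrite (tonelli_swap sleb smu mxz pxz) -ge0_integralZl_EFin//; last 2 first.
    - by move=> z _; rewrite lee_fin E1k_ge0.
    - by have := measurableT_comp measurable_E1k (measurable_pair1 y).
    apply: ge0_le_integral_nm => z _; first by apply: integral_ge0 => x _; rewrite lee_fin D2k_ge0.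
    by rewrite -EFinM; exact: integral_D2k_le.
  rewrite ge0_integralZl_EFin//; last 2 first.
  - by move=> y _; apply: integral_ge0 => z _; rewrite lee_fin E1k_ge0.
  - exact: mE1.
  apply: lee_wpmul2l; first by rewrite lee_fin.
  rewrite /Z [leRHS]integral_mkcond; apply: ge0_le_integral_nm => y _.
    by apply: integral_ge0 => z _; rewrite lee_fin E1k_ge0.
  rewrite patchE; case: ifPn => [/set_mem Sy|Sy]; last first.
    by rewrite integral0_eq// => z _; rewrite /E1k /E0k [X in X * _ * _ * _ * _ * _]indicE (negbTE Sy) !mul0r.
  rewrite [leRHS]integral_mkcond; apply: ge0_le_integral_nm => z _; first by rewrite lee_fin E1k_ge0.
  rewrite patchE; case: ifPn => [/set_mem Sz|Sz]; first exact: E1k_le.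
  by rewrite /E1k /E0k [X in _ * X * _ * _ * _ * _]indicE (negbTE Sz) mulr0 !mul0r.
apply: le_trans (leeD h1 h2) _.
rewrite /D_cst EFinD ge0_muleDl ?lee_fin//; apply: leeD.
  by rewrite mul1e leeDl.
by apply: lee_wpmul2l; [rewrite lee_fin|rewrite leeDr].
Qed.

End integral_bound.

(** * The extension and its continuity *)

Section assembly.
Context {R : realType} (n : nat) (S : set (borel_rV R n)).
Context (mu : {measure set (borel_rV R n) -> \bar R}) (C2 : R).
Local Notation B := (borel_rV R n).
Local Notation leb := (lebesgue_rV n : {measure set (borel_rV R n) -> \bar R}).
Hypothesis mS : measurable (S : set B).
Hypothesis mu_half : forall x, (mu (cube x 2^-1) <= C2%:E)%E.
Variables (D : nat -> R -> R) (M K : R) (N : nat).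
Hypothesis dD : forall k (u : R), is_derive u (1 : R) (D k) (D k.+1 u).
Hypothesis Dl : forall u : R, u <= -1 -> D 0 u = 0.
Hypothesis Dr : forall u : R, 1 <= u -> D 0 u = 1.
Hypothesis D01 : forall u : R, 0 <= D 0 u <= 1.
Hypothesis D1_ge0 : forall u : R, 0 <= D 1%N u.
Hypothesis D1_le : forall u : R, D 1%N u <= M.
Hypotheses (K128 : 128 <= K) (N0 : (0 < N)%N).
Variable f : B -> R.
Hypotheses (mf : measurable_fun S f) (fb : loc_bounded S f).
Implicit Types (x : 'rV[R]_n) (y z : B) (e d : R).

Let K0 : 0 < K. Proof. exact: lt_le_trans K128. Qed.
Local Notation wf := (wf D K N).
Local Notation dwf := (dwf D K N).
Local Notation wt := (wt K N).
Local Notation Ix := (Ik S mu D K N).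
Local Notation Jx := (Jk S mu D K N).
Variables (Cmu C1 p : R) (P : nat).
Hypotheses (Cmu0 : 0 < Cmu) (C10 : 0 < C1) (C20 : 0 < C2).
Hypothesis cS : closed (S : set 'rV[R]_n).
Hypothesis muS : mu (~` S) = 0%E.
Hypothesis doubling : forall (x : 'rV[R]_n) (r k : R), S x -> 0 < r <= 1 -> 1 <= k <= r^-1 ->
  (mu (cube x (k * r)) <= (Cmu * k ^+ n)%:E * mu (cube x r))%E.
Hypothesis mu1 : forall x : 'rV[R]_n, S x -> (C1%:E <= mu (cube x 1) <= C2%:E)%E.
Hypotheses (n0 : (0 < n)%N) (p1 : 1 < p) (pP : p <= P%:R) (nPN : (2 * n + P <= 2 * N)%N).

Local Notation m := (mcube mu).
Let p0 : 0 < p. Proof. exact: lt_trans p1. Qed.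
Let muE x r : S x -> r <= 1 -> mu (cube x r) = (m x r)%:E.
Proof. by move=> *; apply: (@mu_cubeE R n S mu C1 C2). Qed.
Let mgt0 x r : S x -> 0 < r -> r <= 1 -> 0 < m x r.
Proof. by move=> *; apply: (@mcube_gt0 R n S mu Cmu C1 C2). Qed.
Let mdbl x r s : S x -> 0 < r -> r <= s -> s <= 1 -> m x s <= Cmu * (s / r) ^+ n * m x r.
Proof. by move=> *; apply: (@mcube_doubling R n S mu Cmu C1 C2). Qed.
Let mmono x y r s : S y -> s <= 1 -> `|x - y| + r <= s -> m x r <= m y s.
Proof. by move=> *; apply: (@mcube_mono R n S mu C1 C2). Qed.
Let mge x r : S x -> 0 < r -> r <= 1 -> C1 / Cmu * r ^+ n <= m x r.
Proof. by move=> *; apply: (@mcube_ge R n S mu Cmu C1 C2). Qed.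
Let mle x r : S x -> r <= 1 -> m x r <= C2.
Proof. by move=> *; apply: (@mcube_le R n S mu C1 C2). Qed.
Hypothesis np : n%:R < p.
Hypothesis lebS : leb S = 0%E.
Hypothesis fc : forall x0 (eta : R), S x0 -> 0 < eta ->
  exists2 d, 0 < d & forall x, S x -> `|x - x0| < d -> `|f x - f x0| < eta.
Local Notation Fx := (Fk S mu D K N f).
Local Notation Gk := (Gk S mu D K N f).
Local Notation Wx := (Wk S mu D K N).
Local Notation Dk := (Dk S mu f p).
Local Notation Gc := (G_cst n C2 M K N Cmu C1 p).

Definition extF x : R := if x \in (S : set 'rV[R]_n) then f x else Fx 0 x.
(** The value 0 on S is arbitrary, S being a null set. *)
Definition extG x : 'rV[R]_n := \row_i (if x \in (S : set 'rV[R]_n) then 0 else Gk i 0 x).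

Lemma extF_in x : S x -> extF x = f x.
Proof. by move=> Sx; rewrite /extF mem_set. Qed.
Lemma extF_out x : ~ S x -> extF x = Fx 0 x.
Proof. by move=> Sx; rewrite /extF memNset. Qed.

Lemma ball_out x d : 0 < d -> (forall e (z : 'rV[R]_n), 0 <= e -> `|z - x| <= d -> forall y : 'rV[R]_n, S y -> d ^+ 2 <= e + qf z y) ->
  forall z : 'rV[R]_n, `|z - x| <= d -> ~ S z.
Proof.
move=> d0 h z zx Sz; have := h 0 z (lexx 0) zx z Sz.
rewrite add0r /qf big1 => [|i _]; last by rewrite subrr expr0n.
by rewrite leNgt exprn_gt0.
Qed.

Lemma extF_cont_out x : ~ S x -> forall eta : R, 0 < eta ->
  exists2 r : R, 0 < r & forall y : 'rV[R]_n, `|x - y| < r -> `|extF x - extF y| < eta.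
Proof.
move=> Sx; have [d /andP[d0 d8] hd] := closed_gap cS Sx.
apply: (@seq_continuous_rV _ _ _ _ d) => // xs xsd xcv.
have out := ball_out d0 hd.
have E : (fun k => extF (xs k)) = (fun k => Fx 0 (xs k)).
  by apply/funext => k; rewrite extF_out//; exact: out.
rewrite extF_out// E.
apply: (Fk_cvg mS mu_half dD Dl D01 K128 mf fb (es := fun=> 0) (d := d ^+ 2) xcv) => //.
- exact: cvg_cst.
- by rewrite exprn_gt0.
- by move=> y Sy; apply: hd => //; rewrite subrr normr0 ltW.
- by move=> k y Sy; exact: hd.
- by move=> k; apply: le_trans (xsd k) _.
Qed.

Lemma P2 : (1 <= P)%N.
Proof. by rewrite -(ler1n R); apply: ltW; apply: lt_le_trans pP. Qed.

Definition inv_cst : R := A_cst n C2 K N * Cmu / C1 * (2 * n%:R).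

(** The total weight blows up at S: [A_lower] and [mcube_ge] bound s^n by a multiple of s^(2N) A,
    and 2N >= n + 1 leaves one factor s, at most 2 n |x - x0|. The smallness of |x - x0| makes s <=
    1/4. *)
Lemma A_inv_le x d x0 : 0 < d -> (forall y, S y -> d <= 0 + qf x y) -> S x0 ->
  (8 * n%:R) * `|x - x0| <= 1 -> (1 + Wx 0 x)^-1 <= inv_cst * `|x - x0|.
Proof.
move=> d0 xd Sx0 hx; have [xt Sxt xtP] := near_point (lexx 0) d0 xd Sx0.
set s := Num.sqrt (0 + qf x xt) in xtP.
have s0 : 0 < s by exact: (T_gt0 d0 xd).
have sx : s <= (2 * n%:R) * `|x - x0|.
  apply: le_trans (xtP x0 Sx0) _; rewrite -mulrA ler_wpM2l// add0r.
  apply: le_trans (enorm_le n0 (x - x0)); rewrite /enorm /qf le_eqVlt; apply/orP; left; apply/eqP.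
  by congr Num.sqrt; apply: eq_bigr => i _; rewrite !mxE.
have s4 : s <= 4^-1.
  have : 4 * (2 * n%:R * `|x - x0|) <= 1 by rewrite !mulrA (_ : 4 * 2 = 8 :> R)//; ring.
  by move=> h; lra.
have low := A_lower mS mu_half N dD Dl Dr D01 K128 C20 cS muS mu1 n0 (lexx 0) d0 xd Sxt.
rewrite -/s in low; have s2 : s <= 2^-1 by lra.
have h1 := le_trans (mge Sxt s0 (le_trans s2 _)) (low s2).
have A0 : 0 < 1 + Wx 0 x by exact: Wk1_gt0.
have Ac0 : 0 <= A_cst n C2 K N by exact: A_cst_ge0.
have s1 : s <= 1 by lra.
have h2 : (s ^+ 2) ^+ N <= s ^+ n * s.
  rewrite -exprM -exprSr ler_wiXn2l ?(ltW s0)//; apply: leq_trans nPN.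
  by rewrite -addn1 leq_add ?P2// mul2n -addnn leq_addr.
have h3 : C1 / Cmu * s ^+ n <= A_cst n C2 K N * (s ^+ n * s) * (1 + Wx 0 x).
  apply: le_trans (h1 _) _; first by lra.
  by apply: ler_wpM2r; [exact: ltW|exact: ler_wpM2l].
have sn0 : 0 < s ^+ n by rewrite exprn_gt0.
have h4 : C1 / Cmu <= A_cst n C2 K N * s * (1 + Wx 0 x).
  rewrite -(ler_pM2r sn0); apply: le_trans h3 _.
  by rewrite le_eqVlt; apply/orP; left; apply/eqP; ring.
have c1 : 0 <= Cmu / C1 by apply: divr_ge0; exact: ltW.
have h5 : 1 <= A_cst n C2 K N * Cmu / C1 * s * (1 + Wx 0 x).
  have := ler_wpM2l c1 h4; rewrite (_ : Cmu / C1 * (C1 / Cmu) = 1); last by field; rewrite !gt_eqF.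
  by move/le_trans; apply; rewrite le_eqVlt; apply/orP; left; apply/eqP; ring.
have h6 : (1 + Wx 0 x)^-1 <= A_cst n C2 K N * Cmu / C1 * s.
  by rewrite -(ler_pM2r A0) mulVf ?gt_eqF.
apply: le_trans h6 _; rewrite /inv_cst -[leRHS]mulrA; apply: ler_wpM2l => //.
by rewrite -mulrA; apply: mulr_ge0.
Qed.

Lemma Ik_far_le (h : B -> R) x d (eta c : R) : measurable_fun S h -> loc_bounded S h ->
  0 < d -> (forall y, S y -> d <= 0 + qf x y) -> 0 <= eta -> 0 <= c ->
  (forall y, S y -> `|h y * wf 0 x y| <= eta * wf 0 x y + c * \1_(cube x 2^-1) (y : 'rV[R]_n)) ->
  `|Ix h 0 x| <= eta * Wx 0 x + c * C2.
Proof.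
move=> mh hb d0 xd eta0 c0 hw.
have m1 : measurable_fun S (fun _ : B => 1 : R) by exact: measurable_cst.
have ih := integrable_wf mS mu_half N dD Dl D01 K128 mh hb (lexx 0) d0 xd.
have i1 := integrable_wf mS mu_half N dD Dl D01 K128 m1 (loc_bounded_cst S 1) (lexx 0) d0 xd.
have iW : (\int[mu]_(y in S) (wf 0 x y)%:E = (Wx 0 x)%:E)%E.
  rewrite /Wk /Ik /Rintegral fineK; last exact: (integrable_fin_num mS i1).
  by apply: eq_integral => y _; rewrite mul1r.
have mwf : measurable_fun S (fun y => (wf 0 x y)%:E).
  by apply/measurable_EFinP; apply: measurable_funTS; exact: measurable_wf.
have mcub : measurable_fun S (fun y : B => (\1_(cube x 2^-1 : set B) y : R)%:E).
  by apply/measurable_EFinP; apply: measurable_indic; exact: measurable_cube.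
rewrite -lee_fin; apply: (@le_trans _ _ (\int[mu]_(y in S) (`|h y * wf 0 x y|)%:E)%E).
  apply: (@le_trans _ _ (\int[mu]_(y in S) `|h y * wf 0 x y|)%:E).
    by rewrite lee_fin; exact: (le_normr_Rintegral mS ih).
  by rewrite /Rintegral fineK//; have := integrable_fin_num mS (integrable_norm ih).
have hh : (\int[mu]_(y in S) (`|h y * wf 0 x y|)%:E <= \int[mu]_(y in S)
   (eta%:E * (wf 0 x y)%:E + c%:E * (\1_(cube x 2^-1 : set B) y)%:E))%E.
  by apply: ge0_le_integral_nm => // y Sy; rewrite -!EFinM -EFinD lee_fin; exact: hw.
apply: le_trans hh _.
rewrite ge0_integralD//; last 4 first.
- by move=> y Sy; rewrite -EFinM lee_fin mulr_ge0//; exact: wf_ge0.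
- exact: measurable_funeM.
- by move=> y Sy; rewrite -EFinM lee_fin mulr_ge0.
- exact: measurable_funeM.
rewrite !ge0_integralZl_EFin//; last by move=> y Sy; rewrite lee_fin; exact: wf_ge0.
rewrite iW [leRHS]EFinD; apply: leeD; first by rewrite -EFinM.
rewrite EFinM; apply: lee_wpmul2l; first by rewrite lee_fin.
rewrite integral_indic//; last exact: measurable_cube.
apply: le_trans (mu_half x); apply: le_measure; rewrite ?inE; [|exact: measurable_cube|by move=> y []].
by apply: measurableI => //; exact: measurable_cube.
Qed.

(** F x - f x0 is the integral of (f - f x0) w minus f x0, all over 1 + W. Points y near x0
    contribute at most eta/2 times W; for the others the kernel is bounded, so their contribution
    and f x0 form a bounded quantity [E], which 1 / (1 + W) sends to 0 by [A_inv_le]. *)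
Lemma extF_cont_in x0 : S x0 -> forall eta : R, 0 < eta ->
  exists2 r : R, 0 < r & forall x, `|x0 - x| < r -> `|extF x0 - extF x| < eta.
Proof.
move=> Sx0 eta eta0; have e2 : 0 < eta / 2 by rewrite divr_gt0.
have [d1 d10 hd1] := fc Sx0 e2.
pose h (y : B) := f y - f x0.
have mh : measurable_fun S h by exact: measurable_funB.
have hb : loc_bounded S h by apply: loc_bounded_sub => //; exact: loc_bounded_cst.
have [H hH] := hb (`|x0| + 1); pose H' := maxr H 0.
have H0 : 0 <= H' by rewrite le_max lexx orbT.
pose c := H' * ((d1 / 2) ^+ 2)^-1 ^+ N.
have c0 : 0 <= c by apply: mulr_ge0 => //; rewrite exprn_ge0// invr_ge0; exact: sqr_ge0.
pose E := c * C2 + `|f x0|.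
have E0 : 0 <= E by rewrite addr_ge0// mulr_ge0// ltW.
have ic0 : 0 <= inv_cst.
  apply: mulr_ge0; last exact: mulr_ge0.
  by apply: divr_ge0; [apply: mulr_ge0; [exact: A_cst_ge0|exact: ltW]|exact: ltW].
(* d1/2 keeps x at distance d1/2 from the far points y; 1/4 keeps the y that matter within 1 of x0,
   where [H] bounds h; 1/(8n) is the condition of [A_inv_le]; the last entry makes the bounded part
   at most eta/4. *)
pose r := minr (minr (d1 / 2) (4^-1)) (minr ((8 * n%:R)^-1) (eta / (4 * (E * inv_cst + 1)))).
have n8 : 0 < 8 * n%:R :> R by rewrite mulr_gt0// ltr0n.
have EI : 0 < E * inv_cst + 1 by rewrite ltr_wpDl// mulr_ge0.
have r0 : 0 < r.
  rewrite /r !lt_min; apply/andP; split; apply/andP; split; [exact: divr_gt0|by []|by rewrite invr_gt0|].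
  by apply: divr_gt0 => //; exact: mulr_gt0.
have [r1 r2] : r <= d1 / 2 /\ r <= 4^-1 by split; rewrite !ge_min lexx ?orbT.
have [r3 r4] : r <= (8 * n%:R)^-1 /\ r <= eta / (4 * (E * inv_cst + 1)) by split; rewrite !ge_min lexx ?orbT.
exists r => // x xr; have xr' : `|x - x0| < r by rewrite distrC.
have [Sx|Sx] := pselect (S x).
  by rewrite !extF_in// distrC; apply: lt_trans (hd1 x Sx _) _; [apply: lt_le_trans xr' _|]; lra.
rewrite extF_in// extF_out// distrC.
have [d /andP[d0 d8] hd] := closed_gap cS Sx.
have xd y : S y -> d ^+ 2 <= 0 + qf x y by move=> Sy; apply: hd => //; rewrite subrr normr0 ltW.
have dd0 : 0 < d ^+ 2 by rewrite exprn_gt0.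
have A0 : 0 < 1 + Wx 0 x by exact: Wk1_gt0.
have m1 : measurable_fun S (fun _ : B => 1 : R) by exact: measurable_cst.
have iw (h' : B -> R) (mh' : measurable_fun S h') hb' := integrable_wf mS mu_half N dD Dl D01 K128 mh' hb' (lexx 0) dd0 xd.
have IE : Ix h 0 x = Ix f 0 x - f x0 * Wx 0 x.
  rewrite /Wk /Ik -RintegralZl//; last exact: (iw _ m1 (loc_bounded_cst S 1)).
  rewrite -RintegralB//; last 2 first.
  - exact: iw.
  - by have := integrableZl mS (f x0) (iw _ m1 (loc_bounded_cst S 1)).
  by apply: eq_Rintegral => z _; rewrite /h; ring.
have FE : Fx 0 x - f x0 = (Ix h 0 x - f x0) / (1 + Wx 0 x).
  by rewrite IE /Fk; field; rewrite gt_eqF.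
have hI : `|Ix h 0 x| <= eta / 2 * Wx 0 x + c * C2.
  apply: (Ik_far_le mh hb dd0 xd (ltW e2) c0) => y Sy.
  have w0 : 0 <= wf 0 x y by exact: wf_ge0.
  rewrite normrM (ger0_norm w0).
  have [q|q] := leP (qf x y) K^-1; last first.
    have -> : wf 0 x y = 0 by rewrite /wf chi_large ?mulr0// ltW.
    by rewrite !mulr0 add0r mulr_ge0.
  have xy8 := qf_support K128 q.
  have [yx|yx] := ltP `|(y : 'rV[R]_n) - x0| d1.
    apply: ler_wpDr; first exact: mulr_ge0.
    by apply: ler_wpM2r => //; apply: ltW; exact: hd1.
  apply: ler_wpDl; first by rewrite mulr_ge0// ltW.
  rewrite indicE mem_set ?mulr1; last by rewrite /cube /= distrC; apply: le_trans xy8 _; lra.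
  apply: ler_pM => //.
    rewrite le_max; apply/orP; left; apply: hH => //.
    have -> : (y : 'rV[R]_n) = x0 + ((x - x0) - (x - y)) by rewrite opprB addrCA addrA subrK addrC addrNK.
    apply: le_trans (ler_normD _ _) _; rewrite lerD2l; apply: le_trans (ler_normB _ _) _; lra.
  apply: (@le_trans _ _ (vf 0 x y ^+ N)).
    by rewrite /wf ler_piMr ?exprn_ge0 ?vf_ge0 ?chi_le1.
  rewrite lerXn2r ?nnegrE ?vf_ge0 ?invr_ge0 ?sqr_ge0//.
  have xyd : d1 / 2 <= `|x - y|.
    have : `|(y : 'rV[R]_n) - x0| <= `|x - x0| + `|x - y|.
      have -> : (y : 'rV[R]_n) - x0 = (x - x0) - (x - y) by rewrite opprB [RHS]addrC addrA subrK.
      exact: ler_normB.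
    by move=> h'; lra.
  have q1 : (d1 / 2) ^+ 2 <= qf x y.
    apply: le_trans (norm_le_qf x y); rewrite lerXn2r// nnegrE//; first by rewrite divr_ge0 ?ltW.
  rewrite /vf add0r lef_pV2// posrE; first by apply: lt_le_trans q1; rewrite exprn_gt0// divr_gt0.
  by rewrite exprn_gt0// divr_gt0.
rewrite FE normrM normfV (gtr0_norm A0).
have inv := A_inv_le dd0 xd Sx0.
have hx : 8 * n%:R * `|x - x0| <= 1.
  by rewrite -ler_pdivlMl// mulr1; apply: le_trans (ltW xr') r3.
have W0 : 0 <= Wx 0 x by exact: Wk_ge0.
have b1 : `|Ix h 0 x - f x0| <= eta / 2 * (1 + Wx 0 x) + E.
  apply: le_trans (ler_normB _ _) _; rewrite /E; lra.
have Ai0 : 0 <= (1 + Wx 0 x)^-1 by rewrite invr_ge0 ltW.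
apply: (@le_lt_trans _ _ (eta / 2 + E * (inv_cst * r))).
  apply: le_trans (ler_wpM2r Ai0 b1) _; rewrite mulrDl mulfK ?gt_eqF//.
  rewrite lerD2l; apply: ler_wpM2l => //; apply: le_trans (inv hx) _.
  by apply: ler_wpM2l => //; exact: ltW.
have : (E * inv_cst + 1) * r <= eta / 4.
  have := ler_wpM2l (ltW EI) r4.
  by rewrite [X in _ <= X -> _](_ : _ = eta / 4)//; field; rewrite gt_eqF.
lra.
Qed.

Lemma extF_continuous : continuous extF.
Proof.
apply: continuous_rV => x eta eta0; have [Sx|Sx] := pselect (S x).
  exact: extF_cont_in.
exact: extF_cont_out.
Qed.

End assembly.

(** * Weak gradient and L_p bound of the extension *)

Section sobolev_extension.
Context {R : realType} (n : nat) (S : set (borel_rV R n)).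
Context (mu : {measure set (borel_rV R n) -> \bar R}) (C2 : R).
Local Notation B := (borel_rV R n).
Local Notation leb := (lebesgue_rV n : {measure set (borel_rV R n) -> \bar R}).
Hypothesis mS : measurable (S : set B).
Hypothesis mu_half : forall x, (mu (cube x 2^-1) <= C2%:E)%E.
Variables (D : nat -> R -> R) (M K : R) (N : nat).
Hypothesis dD : forall k (u : R), is_derive u (1 : R) (D k) (D k.+1 u).
Hypothesis Dl : forall u : R, u <= -1 -> D 0 u = 0.
Hypothesis Dr : forall u : R, 1 <= u -> D 0 u = 1.
Hypothesis D01 : forall u : R, 0 <= D 0 u <= 1.
Hypothesis D1_ge0 : forall u : R, 0 <= D 1%N u.
Hypothesis D1_le : forall u : R, D 1%N u <= M.
Hypotheses (K128 : 128 <= K) (N0 : (0 < N)%N).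
Variable f : B -> R.
Hypotheses (mf : measurable_fun S f) (fb : loc_bounded S f).
Implicit Types (x : 'rV[R]_n) (y z : B) (e d : R).

Let K0 : 0 < K. Proof. exact: lt_le_trans K128. Qed.
Local Notation wf := (wf D K N).
Local Notation dwf := (dwf D K N).
Local Notation wt := (wt K N).
Local Notation Ix := (Ik S mu D K N).
Local Notation Jx := (Jk S mu D K N).
Variables (Cmu C1 p : R) (P : nat).
Hypotheses (Cmu0 : 0 < Cmu) (C10 : 0 < C1) (C20 : 0 < C2).
Hypothesis cS : closed (S : set 'rV[R]_n).
Hypothesis muS : mu (~` S) = 0%E.
Hypothesis doubling : forall (x : 'rV[R]_n) (r k : R), S x -> 0 < r <= 1 -> 1 <= k <= r^-1 ->
  (mu (cube x (k * r)) <= (Cmu * k ^+ n)%:E * mu (cube x r))%E.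
Hypothesis mu1 : forall x : 'rV[R]_n, S x -> (C1%:E <= mu (cube x 1) <= C2%:E)%E.
Hypotheses (n0 : (0 < n)%N) (p1 : 1 < p) (pP : p <= P%:R) (nPN : (2 * n + P <= 2 * N)%N).

Local Notation m := (mcube mu).
Let p0 : 0 < p. Proof. exact: lt_trans p1. Qed.
Let muE x r : S x -> r <= 1 -> mu (cube x r) = (m x r)%:E.
Proof. by move=> *; apply: (@mu_cubeE R n S mu C1 C2). Qed.
Let mgt0 x r : S x -> 0 < r -> r <= 1 -> 0 < m x r.
Proof. by move=> *; apply: (@mcube_gt0 R n S mu Cmu C1 C2). Qed.
Let mdbl x r s : S x -> 0 < r -> r <= s -> s <= 1 -> m x s <= Cmu * (s / r) ^+ n * m x r.
Proof. by move=> *; apply: (@mcube_doubling R n S mu Cmu C1 C2). Qed.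
Let mmono x y r s : S y -> s <= 1 -> `|x - y| + r <= s -> m x r <= m y s.
Proof. by move=> *; apply: (@mcube_mono R n S mu C1 C2). Qed.
Let mge x r : S x -> 0 < r -> r <= 1 -> C1 / Cmu * r ^+ n <= m x r.
Proof. by move=> *; apply: (@mcube_ge R n S mu Cmu C1 C2). Qed.
Let mle x r : S x -> r <= 1 -> m x r <= C2.
Proof. by move=> *; apply: (@mcube_le R n S mu C1 C2). Qed.
Hypothesis np : n%:R < p.
Hypothesis lebS : leb S = 0%E.
Local Notation Fk := (Fk S mu D K N f).
Local Notation Gk := (Gk S mu D K N f).
Local Notation Dk := (Dk S mu f p).
Local Notation Gc := (G_cst n C2 M K N Cmu C1 p).
Local Notation extF := (extF S mu D K N f).
Local Notation extG := (extG S mu D K N f).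
Hypothesis cextF : continuous extF.
Let smu : sigma_finite setT mu.
Proof. by apply: (@sigma_finite_mu R n S mu C1 C2). Qed.
Let sleb : sigma_finite setT leb := @sigma_finite_leb R n.

(** Smoothing parameters that tend to 0 and stay below 1/K, the range in which the kernel bounds
    hold. *)
Let es (k : nat) : R := K^-1 * k.+1%:R^-1.
Let es0 k : 0 < es k. Proof. by rewrite mulr_gt0 ?invr_gt0. Qed.
Let esK k : es k <= K^-1.
Proof. by rewrite /es ler_piMr ?invr_ge0 ?(ltW K0)// invf_le1 ?ltr0n// ler1n. Qed.
Let escv : es k @[k --> \oo] --> (0 : R).
Proof. by rewrite -(mulr0 K^-1); apply: cvgM; [exact: cvg_cst|exact: cvg_harmonic]. Qed.

Lemma Fk_lim x : ~ S x -> Fk (es k) x @[k --> \oo] --> Fk 0 x.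
Proof.
move=> Sx; have [d /andP[d0 d8] hd] := closed_gap cS Sx.
have xx : `|x - x| <= d by rewrite subrr normr0 ltW.
apply: (Fk_cvg mS mu_half dD Dl D01 K128 mf fb (xs := fun=> x) (d := d ^+ 2) _ escv) => //.
- exact: cvg_cst.
- by move=> k; exact: ltW.
- by rewrite exprn_gt0.
- by move=> y Sy; exact: hd.
- by move=> k y Sy; apply: hd => //; exact: ltW.
- by move=> _; rewrite subrr normr0.
Qed.

Lemma Gk_lim i x : ~ S x -> Gk i (es k) x @[k --> \oo] --> Gk i 0 x.
Proof.
move=> Sx; have [d /andP[d0 d8] hd] := closed_gap cS Sx.
have xx : `|x - x| <= d by rewrite subrr normr0 ltW.
apply: (Gk_cvg mS mu_half dD Dl Dr D01 D1_ge0 D1_le K128 mf fb (xs := fun=> x) (d := d ^+ 2) _ escv) => //.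
- exact: cvg_cst.
- by move=> k; exact: ltW.
- by rewrite invr_ge0 ltW.
- by rewrite exprn_gt0.
- by move=> y Sy; exact: hd.
- by move=> k y Sy; apply: hd => //; exact: ltW.
- by move=> _; rewrite subrr normr0.
Qed.

Let cFk k : continuous (Fk (es k)).
Proof. exact: (Fk_continuous mS mu_half dD Dl D01 K128 mf fb (es0 k)). Qed.
Let cGk i k : continuous (Gk i (es k)).
Proof. exact: (Gk_continuous mS mu_half dD Dl Dr D01 D1_ge0 D1_le K128 mf fb (es0 k) (esK k)). Qed.

Lemma measurable_extG i : measurable_fun setT ((fun x => extG x ord0 i) : B -> R).
Proof.
pose g k (x : B) : R := Gk i (es k) x * \1_(~` S) x.
apply/measurable_EFinP.
apply: (emeasurable_fun_cvg (fun k (x : B) => (g k x)%:E) (fun x : B => (extG x ord0 i)%:E)).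
  move=> k; apply/measurable_EFinP; apply: measurable_funM.
    by apply: continuous_measurable_rV; exact: cGk.
  by apply: measurable_indic; exact: measurableC.
move=> x _; apply: cvg_EFin; first exact: nearW.
rewrite /extG mxE; have [Sx|Sx] := pselect (S x).
  rewrite mem_set// /g (_ : (fun k => _) = cst 0); first exact: cvg_cst.
  by apply/funext => k; rewrite indicE memNset ?mulr0//; apply.
suff h : g k x @[k --> \oo] --> Gk i 0 x by rewrite memNset.
have -> : (fun k => g k x) = (fun k => Gk i (es k) x); last exact: Gk_lim.
by apply/funext => k; rewrite /g indicE mem_set ?mulr1.
Qed.

Lemma measurable_Dk : measurable_fun setT (Dk : B -> \bar R).
Proof.
have mD1 : measurable_fun setT (fun t : B * B => (D1k S f p t.1 t.2)%:E).
  by apply/measurable_EFinP; exact: measurable_D1k.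
have D10 (t : B * B) : (0 <= (D1k S f p t.1 t.2)%:E)%E by rewrite lee_fin D1k_ge0.
have D20 (t : (B * B) * B) : (0 <= (D2k S mu f p t.1.1 t.1.2 t.2)%:E)%E by rewrite lee_fin D2k_ge0.
have mD2' : measurable_fun setT (fun t : (B * B) * B => (D2k S mu f p t.1.1 t.1.2 t.2)%:E).
  by apply/measurable_EFinP; exact: (measurable_D2k mS mf p C20 cS muS mu1).
have mI2 := measurable_integral_snd smu mD2' D20.
have I20 (t : B * B) : (0 <= \int[mu]_z (D2k S mu f p t.1 t.2 z)%:E)%E by apply: integral_ge0 => z _; rewrite lee_fin D2k_ge0.
apply: emeasurable_funD; first exact: (measurable_integral_snd smu mD1 D10).
exact: (measurable_integral_snd smu mI2 I20).
Qed.

Lemma Dk_ge0 x : (0 <= Dk x)%E.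
Proof.
apply: adde_ge0; apply: integral_ge0 => y _; first by rewrite lee_fin D1k_ge0.
by apply: integral_ge0 => z _; rewrite lee_fin D2k_ge0.
Qed.

Lemma G_cst_ge0 : 0 <= Gc.
Proof.
apply: mulr_ge0; first exact: powR_ge0.
apply: mulr_ge0; [exact: powR_ge0|apply: mulr_ge0; [exact: powR_ge0|apply: addr_ge0]].
  exact: B1_cst_ge0.
exact: B2_cst_ge0.
Qed.

Lemma Gk_bound i e x : 0 <= e -> e <= K^-1 -> ~ S x -> ((`|Gk i e x| `^ p)%:E <= Gc%:E * Dk x)%E.
Proof.
move=> e0 eK Sx; have [d /andP[d0 d8] hd] := closed_gap cS Sx.
apply: (Gk_pointwise mS mu_half dD Dl Dr D01 D1_ge0 D1_le K128 mf fb Cmu0 C10 C20 cS muS doubling mu1 n0 p1 pP nPN i e0 eK (d := d ^+ 2)).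
  by rewrite exprn_gt0.
by move=> y Sy; apply: hd => //; rewrite subrr normr0 ltW.
Qed.

Lemma enorm_extG_le x : ((enorm (extG x) `^ p)%:E <= (n%:R `^ p * Gc)%:E * Dk x)%E.
Proof.
have GD : (0 <= Gc%:E * Dk x)%E by rewrite mule_ge0 ?lee_fin ?G_cst_ge0// Dk_ge0.
have [i hi] : exists i : 'I_n, `|extG x| <= `|extG x ord0 i|.
  have i0 : 'I_n := Ordinal n0.
  case: (@Order.TotalTheory.arg_maxP _ _ _ i0 predT (fun i => `|extG x ord0 i|) isT) => i _ h.
  by exists i; apply/(rV_norm_le _ (normr_ge0 _)) => j; exact: h.
have np0 : 0 <= n%:R * `|extG x ord0 i| by apply: mulr_ge0.
apply: (@le_trans _ _ ((n%:R * `|extG x ord0 i|) `^ p)%:E).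
  rewrite lee_fin; apply: ge0_ler_powR; rewrite ?nnegrE ?enorm_ge0 ?(ltW p0)//.
  by apply: le_trans (enorm_le n0 _) _; rewrite ler_wpM2l.
rewrite powRM// EFinM [X in (_ <= X * _)%E]EFinM -muleA; apply: lee_wpmul2l; first by rewrite lee_fin powR_ge0.
rewrite /extG mxE; have [Sx|Sx] := pselect (S x).
  by rewrite mem_set// normr0 powR0// gt_eqF.
by rewrite memNset//; apply: Gk_bound => //; rewrite invr_ge0 ltW.
Qed.

Let aeS (P' : B -> Prop) : (forall x : B, ~ S x -> P' x) -> {ae leb, forall x, P' x}.
Proof. by move=> h; exists S; split => // x /= nP; apply: contrapT => /h. Qed.

(** Passage to the limit in [Fk_weak_gradient], pointwise off the null set S. On the support of phi
    the functions [Fk] are bounded by a local bound of f, and the gradients by 1 plus the integrable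
    majorant, uniformly in the smoothing parameter. *)
Lemma ext_weak_gradient : (\int[leb]_x Dk x < +oo)%E -> weak_gradient extF extG.
Proof.
move=> Dfin i phi tphi.
have [r r0 hr] := test_function_out tphi.
have cphi := test_function_continuous tphi.
have cdphi := test_function_partial_continuous (i:=i) tphi.
have mphi : measurable_fun setT (phi : B -> R) by exact: continuous_measurable_rV.
have mdphi : measurable_fun setT (partial i phi : B -> R) by exact: continuous_measurable_rV.
have [Bp Bp0 hBp] := continuous_bounded_cube 0 r cphi.
have phiB x : `|phi x| <= Bp.
  have [xr|xr] := leP `|x| r; first by apply: hBp; rewrite /cube /= subr0.
  by rewrite (hr x xr).1 normr0.
have [A hA] := fb (r + 1); pose A' := maxr A 0.
have A0 : 0 <= A' by rewrite le_max lexx orbT.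
have FA k x : `|x| <= r -> `|Fk (es k) x| <= A'.
  move=> xr; apply: (Fk_le mS mu_half N dD Dl D01 K128 mf fb (ltW (es0 k)) (es0 k)) => //.
    by move=> y Sy; rewrite lerDl qf_ge0.
  move=> y Sy xy; rewrite le_max; apply/orP; left; apply: hA => //.
  have -> : y = x - (x - y) by rewrite opprB addrC subrK.
  apply: le_trans (ler_normB _ _) _; lra.
have lim1 : (\int[leb]_x (Fk (es k) x * partial i phi x)%:E)%E @[k --> \oo] -->
            (\int[leb]_x (extF x * partial i phi x)%:E)%E.
  have [] := @dominated_convergence _ _ _ leb setT measurableT
    (fun k (x : B) => (Fk (es k) x * partial i phi x)%:E) (fun x : B => (extF x * partial i phi x)%:E)
    (fun x : B => (A' * `|partial i phi x|)%:E).
  - move=> k; apply/measurable_EFinP; apply: measurable_funM => //.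
    by apply: continuous_measurable_rV; exact: cFk.
  - apply/measurable_EFinP; apply: measurable_funM => //.
    exact: continuous_measurable_rV.
  - apply: aeS => x Sx _; apply: cvg_EFin; first exact: nearW.
    apply: cvgM; last exact: cvg_cst.
    by rewrite extF_out//; exact: Fk_lim.
  - rewrite (_ : (fun x => _) = (fun x => A'%:E * (`|partial i phi x|)%:E)%E); last first.
      by apply/funext => x; rewrite EFinM.
    apply: integrableZl => //.
    have ip : leb.-integrable setT (EFin \o (partial i phi : B -> R)).
      by apply: (@integrable_compact_support R n (partial i phi) r) => // x xr; exact: ((hr x xr).2 i).
    by have := integrable_norm ip.
  - apply: aeS => x _ k _; rewrite lee_fin normrM.
    have [xr|xr] := leP `|(x : 'rV[R]_n)| r; first by apply: ler_wpM2r => //; exact: FA.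
    by rewrite (hr x xr).2 normr0 !mulr0.
  by move=> _ _; exact.
have lim2 : (\int[leb]_x (Gk i (es k) x * phi x)%:E)%E @[k --> \oo] -->
            (\int[leb]_x (extG x ord0 i * phi x)%:E)%E.
  have mcub : measurable_fun setT (fun x : B => (\1_(cube 0 r : set B) x : R)%:E).
    by apply/measurable_EFinP; apply: measurable_indic; exact: measurable_cube.
  have [] := @dominated_convergence _ _ _ leb setT measurableT
    (fun k (x : B) => (Gk i (es k) x * phi x)%:E) (fun x : B => (extG x ord0 i * phi x)%:E)
    (fun x : B => Bp%:E * ((\1_(cube 0 r : set B) x)%:E + Gc%:E * Dk x))%E.
  - move=> k; apply/measurable_EFinP; apply: measurable_funM => //.
    by apply: continuous_measurable_rV; exact: cGk.
  - by apply/measurable_EFinP; apply: measurable_funM => //; exact: measurable_extG.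
  - apply: aeS => x Sx _; apply: cvg_EFin; first exact: nearW.
    apply: cvgM; last exact: cvg_cst.
    by rewrite /extG mxE memNset//; exact: Gk_lim.
  - apply: integrableZl => //; apply: integrableD => //.
      by apply: integrable_indic_lty; [exact: measurable_cube|exact: leb_cube_lty].
    apply: integrableZl => //; apply/integrableP; split; first exact: measurable_Dk.
    by rewrite (eq_integral (Dk : B -> \bar R))// => x _; rewrite gee0_abs// Dk_ge0.
  - apply: aeS => x Sx k _.
    have GD : (0 <= Gc%:E * Dk x)%E by rewrite mule_ge0 ?lee_fin ?G_cst_ge0// Dk_ge0.
    have [xr|xr] := leP `|(x : 'rV[R]_n)| r; last first.
      by rewrite (hr x xr).1 mulr0 abse0 mule_ge0 ?lee_fin// adde_ge0// lee_fin.
    rewrite indicE mem_set; last by rewrite /cube /= subr0.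
    apply: (@le_trans _ _ (Bp%:E * (`|Gk i (es k) x|)%:E)%E).
      by rewrite -EFinM lee_fin normrM mulrC; apply: ler_wpM2r.
    apply: lee_wpmul2l; first by rewrite lee_fin.
    (* The majorant controls the p-th power; a <= 1 + a^p transfers this to the gradient itself. *)
    apply: (@le_trans _ _ (1%:E + (`|Gk i (es k) x| `^ p)%:E)%E); last first.
      by apply: leeD => //; apply: Gk_bound => //; exact: ltW.
    rewrite -EFinD lee_fin; set a := `|_|; have a0 : 0 <= a by exact: normr_ge0.
    have [a1|a1] := leP a 1; first by apply: ler_wpDr => //; exact: powR_ge0.
    by apply: ler_wpDl => //; rewrite -[leLHS](powRr1 a0) ler_powR// ltW.
  by move=> _ _; exact.
have E k : (\int[leb]_x (Fk (es k) x * partial i phi x)%:E = - \int[leb]_x (Gk i (es k) x * phi x)%:E)%E.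
  exact: (Fk_weak_gradient mS mu_half dD Dl Dr D01 D1_ge0 D1_le K128 N0 mf fb i (es0 k) (esK k) tphi).
have lim3 : (\int[leb]_x (Fk (es k) x * partial i phi x)%:E)%E @[k --> \oo] -->
            (- \int[leb]_x (extG x ord0 i * phi x)%:E)%E.
  by rewrite (eq_cvg _ _ E); exact: (cvgeN lim2).
have h1 := cvg_lim (@ereal_hausdorff R) lim1.
have h3 := cvg_lim (@ereal_hausdorff R) lim3.
exact: (etrans (esym (h1 _)) (h3 _)).
Qed.

Section Lp_bound.
Variables (beta g Cm : R).
Hypotheses (S0 : S !=set0) (bS : ball_condition beta (S : set 'rV[R]_n)).
Hypothesis Kbeta : (16 * (beta * n%:R)) ^+ 2 <= K.
Hypotheses (g0 : 0 < g) (Cm0 : 0 < Cm).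
Hypothesis morrey1 : forall x (y : 'rV[R]_n) r, 0 < r -> 3 * r <= 2 -> `|x - y| <= r ->
  ((`|extF x - extF y| `^ p)%:E <= (Cm * r `^ (p - n%:R - g))%:E * denergy p g S extG x (3 * r))%E.

Definition Lp_cst : R := Cm * 2^-1 `^ (p - n%:R - g) * 2 `^ g.

Let hG (z : B) : \bar R := (enorm (extG z) `^ p)%:E.
Let mhG : measurable_fun setT hG.
Proof.
apply/measurable_EFinP; apply: (@measurableT_comp _ _ _ _ _ _ (fun y : R => powR y p)) => //.
by apply: measurable_enorm; exact: measurable_extG.
Qed.
Let hG0 z : (0 <= hG z)%E. Proof. by rewrite lee_fin powR_ge0. Qed.

(** If F x is nonzero, some y in S is within 1/8 of x. The ball condition at y with radius 1/16
    gives c' at distance at least 1/(16 beta n) from S, and [Kbeta] makes the kernel vanish there,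
    so F c' = 0. Morrey's inequality between x and c', at distance at most 1/2, bounds F x; the
    weight is at most 2^g on the cube. *)
Lemma extF_pointwise x : ((`|extF x| `^ p)%:E <= Lp_cst%:E * \int[leb]_(z in cube x (3 * 2^-1)) hG z)%E.
Proof.
have L0 : 0 <= Lp_cst.
  by apply: mulr_ge0; [apply: mulr_ge0; [exact: ltW|exact: powR_ge0]|exact: powR_ge0].
have beta0 := bS.1; have bn0 : 0 < beta * n%:R by rewrite mulr_gt0// ltr0n.
have [F0|F0] := eqVneq (extF x) 0.
  by rewrite F0 normr0 powR0 ?gt_eqF// mule_ge0 ?lee_fin// integral_ge0.
have [y Sy xy] : exists2 y : 'rV[R]_n, S y & `|x - y| <= 8^-1.
  have [Sx|Sx] := pselect (S x); first by exists x; rewrite // subrr normr0.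
  apply: contrapT => H; move/eqP: F0; apply; rewrite extF_out//.
  apply: (Fk_out mu mS N Dl K128) => y Sy; rewrite leNgt; apply/negP => q.
  by apply: H; exists y => //; apply: (qf_support K128); exact: ltW.
have [c' c1 c2] : exists2 c' : 'rV[R]_n, `|c' - y| <= 16^-1 & 16^-1 / (beta * n%:R) <= dist S c'.
  by apply: hole_ball => //; lra.
have dc : 0 < dist S c' by apply: lt_le_trans c2; rewrite divr_gt0.
have Sc : ~ S c'.
  by move=> Sc; have := dist_le c' Sc; rewrite subrr normr0 leNgt dc.
have Fc : extF c' = 0.
  rewrite extF_out//; apply: (Fk_out mu mS N Dl K128) => z Sz.
  apply: le_trans (norm_le_qf c' z).
  have h : (16 * (beta * n%:R))^-1 <= `|c' - z| by rewrite invfM; apply: le_trans c2 (dist_le c' Sz).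
  apply: (@le_trans _ _ ((16 * (beta * n%:R))^-1 ^+ 2)).
    by rewrite exprVn lef_pV2 ?posrE// exprn_gt0// mulr_gt0.
  by rewrite lerXn2r// nnegrE// invr_ge0 mulr_ge0// ltW.
have xc : `|x - c'| <= 2^-1.
  have -> : x - c' = (x - y) - (c' - y) by rewrite opprB addrA subrK.
  by apply: le_trans (ler_normB _ _) _; lra.
have := morrey1 (_ : 0 < 2^-1) _ xc; rewrite Fc subr0 => h.
apply: le_trans (h _ _) _; [by []|lra|].
suff den : (denergy p g S extG x (3 * 2^-1) <= (2 `^ g)%:E * \int[leb]_(z in cube x (3 * 2^-1)) hG z)%E.
  apply: (le_trans (lee_wpmul2l _ den)); first by rewrite lee_fin; apply: mulr_ge0; [exact: ltW|exact: powR_ge0].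
  by rewrite muleA -EFinM.
have mh' : measurable_fun (cube x (3 * 2^-1) : set B) hG by exact: measurable_funTS.
rewrite -(ge0_integralZl_EFin _ (@measurable_cube R n x _) (fun z _ => hG0 z) mh' (powR_ge0 2 g)).
apply: ge0_le_integral_nm => z cz; first by rewrite lee_fin mulr_ge0 ?powR_ge0.
rewrite /hG -EFinM lee_fin mulrC; apply: ler_wpM2r; first exact: powR_ge0.
have d0 := dist_ge0 S0 (z : 'rV[R]_n).
apply: ge0_ler_powR; rewrite ?nnegrE ?(ltW g0)//.
apply: le_trans (dist_le z Sy) _.
have -> : (z : 'rV[R]_n) - y = (z - x) + (x - y) by rewrite addrA subrK.
apply: le_trans (ler_normD _ _) _; move: cz; rewrite /cube /=; lra.
Qed.

Lemma extF_Lp : (\int[leb]_x (`|extF x| `^ p)%:E <= (Lp_cst * 3 ^+ n)%:E * \int[leb]_x hG x)%E.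
Proof.
have L0 : 0 <= Lp_cst.
  by apply: mulr_ge0; [apply: mulr_ge0; [exact: ltW|exact: powR_ge0]|exact: powR_ge0].
apply: (@le_trans _ _ (\int[leb]_x (Lp_cst%:E * \int[leb]_(z in cube (x : 'rV[R]_n) (3 * 2^-1)) hG z))%E).
  by apply: ge0_le_integral_nm => x _; [rewrite lee_fin powR_ge0|exact: extF_pointwise].
have T := @tonelli_cube R n leb leb (fun=> Lp_cst%:E) hG (3 * 2^-1) sleb sleb.
have k0 (x : B) : (0 <= Lp_cst%:E)%E by rewrite lee_fin.
rewrite (T (measurable_cst _) mhG k0 hG0).
apply: (@le_trans _ _ (\int[leb]_z ((Lp_cst * 3 ^+ n)%:E * hG z))%E).
  apply: ge0_le_integral_nm => z _.
    by apply: mule_ge0 => //; apply: integral_ge0 => x _; rewrite lee_fin.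
  rewrite integral_cst//; last exact: measurable_cube.
  rewrite leb_cube// (_ : 2 * (3 * 2^-1) = 3 :> R); last by field.
  by rewrite -EFinM muleC.
by rewrite ge0_integralZl_EFin// mulr_ge0// exprn_ge0.
Qed.

End Lp_bound.
End sobolev_extension.

(** * Continuous functions on a closed set *)

Section within_continuity.
Context {R : realType} (n : nat) (S : set 'rV[R]_n) (f : 'rV[R]_n -> R).
Hypotheses (cS : closed S) (cf : {within S, continuous f}).

Lemma within_continuous_dist x0 (eta : R) : S x0 -> 0 < eta ->
  exists2 d : R, 0 < d & forall x, S x -> `|x - x0| < d -> `|f x - f x0| < eta.
Proof.
move=> Sx0 eta0; have /subspace_continuousP/(_ x0 Sx0) h := cf.
have /h : nbhs (f x0) [set t | `|t - f x0| < eta].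
  by apply/nbhs_ballP; exists eta => //= t; rewrite /ball /= distrC.
rewrite /within /= => /nbhs_ballP[d /= d0 hd]; exists d => // x Sx xd.
by apply: (hd x) => //; rewrite -ball_normE /ball_ /= distrC.
Qed.

Lemma within_continuous_loc_bounded : loc_bounded (S : set (borel_rV R n)) f.
Proof.
move=> r; have cK : compact (S `&` cube 0 r).
  by rewrite setIC; apply: compact_closedI => //; exact: cube_compact.
have cfK : {within S `&` cube 0 r, continuous f}.
  by apply: continuous_subspaceW cf => x [].
have [A [_ hA]] := compact_bounded (continuous_compact cfK cK).
exists (`|A| + 1) => y Sy yr; apply: (hA (`|A| + 1)); first by rewrite (le_lt_trans (ler_norm _))// ltrDl.
by exists y => //; split => //; rewrite /cube /= subr0.
Qed.

Lemma within_continuous_measurable :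
  measurable_fun (S : set (borel_rV R n)) (f : borel_rV R n -> R).
Proof.
have mS : measurable (S : set (borel_rV R n)) by exact: rV_borel_closed.
apply: (@measurability _ _ _ _ (S : set (borel_rV R n)) _ _ (RGenOpens.measurableE R)) => _ [_ [a [b ->]] <-].
have oI : open (`]a, b[%classic : set R) by exact: interval_open.
have /open_subspaceP[U oU US] := iffLR (continuousP _) cf _ oI.
have E : f @^-1` `]a, b[%classic `&` S = U `&` S := esym US.
by rewrite setIC E; apply: measurableI => //; exact: rV_borel_open.
Qed.
End within_continuity.

(** * Powers of extended reals *)

Section powers.
Context {R : realType}.
Local Open Scope ereal_scope.

Lemma poweR_add_le (x y : \bar R) (q : R) : (0 < q)%R -> 0 <= x -> 0 <= y ->
  (x + y) `^ q <= (2 `^ q)%:E * (x `^ q + y `^ q).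
Proof.
move=> q0; have qn : (q != 0)%R by rewrite gt_eqF.
have p2 : (0 < 2 `^ q :> R)%R by exact: powR_gt0.
case: x => [x| |]// x0; case: y => [y| |]// y0.
- by have := powR_add_le q0 x0 y0; rewrite -lee_fin EFinM EFinD.
- by rewrite addey// (poweRyr qn) addey// gt0_muley ?lte_fin.
- by rewrite addye// (poweRyr qn) addye// gt0_muley ?lte_fin.
- by rewrite addye// (poweRyr qn) addye// gt0_muley ?lte_fin.
Qed.

Lemma poweR_mul_le (x y : \bar R) (c q : R) : (0 < q)%R -> (0 <= c)%R -> 0 <= x -> 0 <= y ->
  x <= c%:E * y -> x `^ q <= (c `^ q)%:E * y `^ q.
Proof.
move=> q0 c0 x0 y0 xy; have cy0 : 0 <= c%:E * y by rewrite mule_ge0 ?lee_fin.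
rewrite -poweR_EFin -poweRM ?lee_fin//; apply: gt0_ler_poweR => //; first exact: ltW.
  by rewrite in_itv /= x0 leey.
by rewrite in_itv /= cy0 leey.
Qed.
End powers.

(** * Both inequalities with constants independent of S, mu and f *)

Section extension_exists.
Context {R : realType}.

Lemma extension_exists (n : nat) (p Cmu C1 C2 beta : R) :
  (0 < n)%N -> n%:R < p -> 0 < Cmu -> 0 < C1 -> 0 < C2 ->
  exists2 C : R, 0 <= C & forall (S : set 'rV[R]_n) (mu : {measure set (borel_rV R n) -> \bar R}),
    closed S -> S !=set0 -> mu (~` S) = 0%E ->
    (forall (x : 'rV[R]_n) (r k : R), S x -> 0 < r <= 1 -> 1 <= k <= r^-1 ->
      (mu (cube x (k * r)) <= (Cmu * k ^+ n)%:E * mu (cube x r))%E) ->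
    (forall x : 'rV[R]_n, S x -> (C1%:E <= mu (cube x 1) <= C2%:E)%E) ->
    ball_condition beta S ->
    forall f : 'rV[R]_n -> R, {within S, continuous f} ->
    let T := (\int[mu]_(y in S) (`|f y| `^ p)%:E +
      \int[mu]_(y in S) \int[mu]_(x in S) besov_kernel p mu f x y)%E in (T < +oo)%E ->
    exists (F : 'rV[R]_n -> R) (G : 'rV[R]_n -> 'rV[R]_n), [/\ continuous F,
      forall i, measurable_fun [set: borel_rV R n] (fun x => G x ord0 i),
      weak_gradient F G, forall x, S x -> F x = f x &
      (\int[lebesgue_rV n]_x (`|F x| `^ p)%:E <= C%:E * T)%E /\
      (\int[lebesgue_rV n]_x (enorm (G x) `^ p)%:E <= C%:E * T)%E].
Proof.
move=> n0 np Cmu0 C10 C20; have p1 : 1 < p by apply: le_lt_trans np; rewrite ler1n.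
have p0 : 0 < p by exact: lt_trans p1.
have [g [Cm [g0 gpn Cm0 MP]]] := morrey_package beta n0 np.
have [a [Cd [_ _ _ wS]]] := weight_exists beta n0 np.
have [D [dD [Dl Dr] D01 [D1_ge0 [M D1_le]] _]] := @smooth_step_exists R.
(* An integer above p, because the kernel algebra works with natural exponents; [N = n + P] then
   satisfies 2 n + P <= 2 N. *)
pose P := Num.bound p; have pP : p <= P%:R by apply: ltW; apply: archi_boundP; exact: ltW.
pose N := (n + P)%N.
have nPN : (2 * n + P <= 2 * N)%N by rewrite /N mulnDr leq_add2l leq_pmull.
have N0 : (0 < N)%N by rewrite addn_gt0 n0.
(* 128 confines the kernel to distance 1/8; the square makes it vanish in the holes of S. *)
pose K : R := 128 + (16 * (beta * n%:R)) ^+ 2.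
have K128 : 128 <= K by rewrite lerDl; exact: sqr_ge0.
have Kbeta : (16 * (beta * n%:R)) ^+ 2 <= K by rewrite lerDr.
pose cY := (n%:R `^ p * G_cst n C2 M K N Cmu C1 p) * D_cst n p.
pose cX := (Lp_cst n p g Cm * 3 ^+ n) * cY.
have D0 : 0 <= D_cst n p by apply: addr_ge0 => //; apply: mulr_ge0; [exact: max_cst_ge0|exact: powR_ge0].
have nG0 : 0 <= n%:R `^ p * G_cst n C2 M K N Cmu C1 p by apply: mulr_ge0; [exact: powR_ge0|exact: G_cst_ge0].
have cY0 : 0 <= cY by exact: mulr_ge0.
have L0 : 0 <= Lp_cst n p g Cm * 3 ^+ n.
  apply: mulr_ge0; last exact: exprn_ge0.
  by apply: mulr_ge0; [apply: mulr_ge0; [exact: ltW|exact: powR_ge0]|exact: powR_ge0].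
have cX0 : 0 <= cX by exact: mulr_ge0.
exists (cX + cY); first exact: addr_ge0.
move=> S mu cS S0 muS doubling mu1 bS f cf T Tfin.
have mS : measurable (S : set (borel_rV R n)) by exact: rV_borel_closed.
have mu_half x : (mu (cube x 2^-1) <= C2%:E)%E by apply: (mu_cube_any_le C20 cS muS mu1).
have mf := within_continuous_measurable cS cf.
have fb := within_continuous_loc_bounded cS cf.
have fc := within_continuous_dist cf.
have lebS : lebesgue_rV n S = 0%E.
  have [_ _ h _] := wS S cS S0 bS; rewrite -h; congr (lebesgue_rV n _).
  by apply/seteqP; split => x; rewrite /= dist_eq0.
pose F := extF (S : set (borel_rV R n)) mu D K N f; pose G := extG (S : set (borel_rV R n)) mu D K N f.
have cF : continuous F := extF_continuous mS mu_half dD Dl Dr D01 K128 mf fb Cmu0 C10 C20 cS muS doubling mu1 n0 p1 pP nPN fc.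
have mG i : measurable_fun [set: borel_rV R n] (fun x => G x ord0 i).
  exact: (measurable_extG mS mu_half N dD Dl Dr D01 D1_ge0 D1_le K128 mf fb cS i).
have T0 : (0 <= T)%E.
  apply: adde_ge0; apply: integral_ge0 => y _; first by rewrite lee_fin powR_ge0.
  by apply: integral_ge0 => x _; exact: besov_kernel_ge0.
have ID := integral_Dk mS mf Cmu0 C10 C20 cS muS doubling mu1 p1 np.
have Dfin : (\int[lebesgue_rV n]_x Dk (S : set (borel_rV R n)) mu f p x < +oo)%E.
  by apply: le_lt_trans ID _; rewrite lte_mul_pinfty.
have wG : weak_gradient F G.
  exact: (ext_weak_gradient mS mu_half dD Dl Dr D01 D1_ge0 D1_le K128 N0 mf fb Cmu0 C10 C20 cS muS doubling mu1 n0 p1 pP nPN lebS cF Dfin).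
have [m1 _] := MP S cS S0 bS F G cF mG wG.
have hY : (\int[lebesgue_rV n]_x (enorm (G x) `^ p)%:E <= cY%:E * T)%E.
  apply: (@le_trans _ _ (\int[lebesgue_rV n]_x ((n%:R `^ p * G_cst n C2 M K N Cmu C1 p)%:E * Dk (S : set (borel_rV R n)) mu f p x))%E).
    apply: ge0_le_integral_nm => x _; first by rewrite lee_fin powR_ge0.
    exact: (enorm_extG_le mS mu_half dD Dl Dr D01 D1_ge0 D1_le K128 mf fb Cmu0 C10 C20 cS muS doubling mu1 n0 p1 pP nPN).
  have mD : measurable_fun setT (Dk (S : set (borel_rV R n)) mu f p : borel_rV R n -> \bar R).
    exact: (measurable_Dk mS mf p C20 cS muS mu1).
  have DP (x : borel_rV R n) : setT x -> (0 <= Dk (S : set (borel_rV R n)) mu f p x)%E.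
    by move=> _; exact: Dk_ge0.
  rewrite (ge0_integralZl_EFin _ measurableT DP mD nG0).
  rewrite /cY [X in (_ <= X * _)%E]EFinM -muleA; apply: lee_wpmul2l; first by rewrite lee_fin.
  exact: ID.
have hX : (\int[lebesgue_rV n]_x (`|F x| `^ p)%:E <= cX%:E * T)%E.
  apply: (le_trans (extF_Lp mS mu_half dD Dl Dr D01 D1_ge0 D1_le K128 mf fb cS n0 p1 S0 bS Kbeta g0 Cm0 m1)).
  rewrite /cX [X in (_ <= X * _)%E]EFinM -muleA; apply: lee_wpmul2l; first by rewrite lee_fin.
  exact: hY.
exists F, G; split => //; first by move=> x Sx; exact: extF_in.
split; [apply: (le_trans hX)|apply: (le_trans hY)]; apply: lee_wpmul2r => //; rewrite lee_fin.
  by rewrite lerDl.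
by rewrite lerDr.
Qed.

Lemma besov_le_sobolev (n : nat) (p Cmu C1 C2 beta : R) :
  (0 < n)%N -> n%:R < p -> 0 < Cmu -> 0 < C1 -> 0 < C2 ->
  exists2 C : R, 0 <= C & forall (S : set 'rV[R]_n) (mu : {measure set (borel_rV R n) -> \bar R}),
    closed S -> S !=set0 -> mu (~` S) = 0%E ->
    (forall (x : 'rV[R]_n) (r k : R), S x -> 0 < r <= 1 -> 1 <= k <= r^-1 ->
      (mu (cube x (k * r)) <= (Cmu * k ^+ n)%:E * mu (cube x r))%E) ->
    (forall x : 'rV[R]_n, S x -> (C1%:E <= mu (cube x 1) <= C2%:E)%E) ->
    ball_condition beta S ->
    forall (F : 'rV[R]_n -> R) (G : 'rV[R]_n -> 'rV[R]_n), continuous F ->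
      (forall i, measurable_fun [set: borel_rV R n] (fun x => G x ord0 i)) ->
      weak_gradient F G ->
      (\int[mu]_(y in S) (`|F y| `^ p)%:E <= C%:E *
        (\int[lebesgue_rV n]_x (`|F x| `^ p)%:E + \int[lebesgue_rV n]_x (enorm (G x) `^ p)%:E))%E /\
      (\int[mu]_(y in S) \int[mu]_(x in S) besov_kernel p mu F x y <= C%:E *
        (\int[lebesgue_rV n]_x (`|F x| `^ p)%:E + \int[lebesgue_rV n]_x (enorm (G x) `^ p)%:E))%E.
Proof.
move=> n0 np Cmu0 C10 C20.
have [g [Cm [g0 gpn Cm0 MP]]] := morrey_package beta n0 np.
have CC0 : 0 <= Cm * C2 by rewrite mulr_ge0// ltW.
(* The absolute value makes the constant nonnegative without an inspection of [trace_cst]. *)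
exists (Cm * C2 + `|trace_cst n p Cmu C1 C2 g Cm|); first exact: addr_ge0.
move=> S mu cS S0 muS doubling mu1 bS F G cF mG wG.
have [m1 m2] := MP S cS S0 bS F G cF mG wG.
have X0 : (0 <= \int[lebesgue_rV n]_x (`|F x| `^ p)%:E + \int[lebesgue_rV n]_x (enorm (G x) `^ p)%:E)%E.
  by apply: adde_ge0; apply: integral_ge0 => x _; rewrite lee_fin powR_ge0.
split.
  apply: (le_trans (trace_Lp_le C20 cS S0 muS mu1 g0 Cm0 cF mG m2)).
  by apply: lee_wpmul2r => //; rewrite lee_fin lerDl.
apply: (le_trans (besov_trace_le Cmu0 C10 C20 cS S0 muS doubling mu1 n0 np g0 Cm0 cF mG m1 m2)).
by apply: lee_wpmul2r => //; rewrite lee_fin; apply: le_trans (ler_norm _) _; rewrite lerDr.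
Qed.

Lemma LnormE (n : nat) (m : {measure set (borel_rV R n) -> \bar R}) (p : R) (h : borel_rV R n -> R) :
  ('N[m]_p%:E [EFin \o h] = (\int[m]_x (`|h x| `^ p)%:E) `^ p^-1)%E.
Proof. by rewrite unlock. Qed.

End extension_exists.

(** With [q = 1/p] this passes from bounds between sums of p-th powers to bounds between sums of
    norms; both directions of the equivalence end with it. *)
Lemma poweR_pair_le (R : realType) (x y a b : \bar R) (c q C : R) : 0 < q -> 0 <= c ->
  (c `^ q + c `^ q) * 2 `^ q <= C ->
  (0 <= x)%E -> (0 <= y)%E -> (0 <= a)%E -> (0 <= b)%E ->
  (x <= c%:E * (a + b))%E -> (y <= c%:E * (a + b))%E ->
  (x `^ q + y `^ q <= C%:E * (a `^ q + b `^ q))%E.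
Proof.
move=> q0 c0 cC x0 y0 a0 b0 xc yc; have ab0 : (0 <= a + b)%E by exact: adde_ge0.
have hx := poweR_mul_le q0 c0 x0 ab0 xc; have hy := poweR_mul_le q0 c0 y0 ab0 yc.
have s0 : (0 <= a `^ q + b `^ q)%E by apply: adde_ge0; exact: poweR_ge0.
apply: le_trans (leeD hx hy) _.
apply: (@le_trans _ _ (((c `^ q + c `^ q) * 2 `^ q)%:E * (a `^ q + b `^ q))%E).
  rewrite -ge0_muleDl ?lee_fin ?powR_ge0// EFinM -muleA EFinD.
  apply: lee_wpmul2l; first by rewrite -EFinD lee_fin addr_ge0 ?powR_ge0.
  exact: poweR_add_le.
by apply: lee_wpmul2r.
Qed.

Theorem theorem1p11 (R : realType) (n : nat) (p Cmu C1 C2 beta : R) :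
  (0 < n)%N -> n%:R < p -> 0 < Cmu -> 0 < C1 -> 0 < C2 ->
  exists2 C : R, 1 <= C &
  forall (S : set 'rV[R]_n) (mu : {measure set (borel_rV R n) -> \bar R}),
    closed S ->
    regular_measure mu ->
    msupport mu = boundary S ->
    (forall (x : 'rV[R]_n) (r k : R), S x -> 0 < r <= 1 -> 1 <= k <= r^-1 ->
      (mu (cube x (k * r)) <= (Cmu * k ^+ n)%:E * mu (cube x r))%E) ->
    (forall x : 'rV[R]_n, S x -> (C1%:E <= mu (cube x 1) <= C2%:E)%E) ->
    S° = set0 ->
    ball_condition beta S ->
    forall f : 'rV[R]_n -> R, {within S, continuous f} ->
      ((C^-1)%:E * trace_norm p S f <= besov_norm p mu S f
         <= C%:E * trace_norm p S f)%E.
Proof.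
move=> n0 np Cmu0 C10 C20.
have p1 : 1 < p by apply: le_lt_trans np; rewrite ler1n.
have p0 : 0 < p by exact: lt_trans p1.
have q0 : 0 < p^-1 by rewrite invr_gt0.
have [Cx Cx0 ext] := extension_exists beta n0 np Cmu0 C10 C20.
have [Cb Cb0 bes] := besov_le_sobolev beta n0 np Cmu0 C10 C20.
pose q := p^-1.
pose k (c : R) := (c `^ q + c `^ q) * 2 `^ q.
have k0 c : 0 <= k c by apply: mulr_ge0; rewrite ?addr_ge0 ?powR_ge0.
pose C := 1 + k Cx + k Cb.
have C1' : 1 <= C by have := k0 Cx; have := k0 Cb; rewrite /C; lra.
have Cpos : 0 < C by exact: lt_le_trans C1'.
have CxC : (Cx `^ q + Cx `^ q) * 2 `^ q <= C by have := k0 Cb; rewrite /C /k; lra.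
have CbC : (Cb `^ q + Cb `^ q) * 2 `^ q <= C by have := k0 Cx; rewrite /C /k; lra.
exists C => // S mu cS _ suppS doubling mu1 intS bS f cf.
(* Closed with empty interior, S is its own boundary, so [mu] is carried by S. *)
have bdS : boundary S = S by rewrite /boundary intS setD0 -(closure_id S).1.
have muS : mu (~` S) = 0%E by apply: msupport_null => //; rewrite suppS bdS.
pose a := (\int[mu]_(y in S) (`|f y| `^ p)%:E)%E.
pose Z := (\int[mu]_(y in S) \int[mu]_(x in S) besov_kernel p mu f x y)%E.
have a0 : (0 <= a)%E by apply: integral_ge0 => y _; rewrite lee_fin powR_ge0.
have Z0 : (0 <= Z)%E.
  by apply: integral_ge0 => y _; apply: integral_ge0 => x _; exact: besov_kernel_ge0.
have besE : besov_norm p mu S f = (a `^ q + Z `^ q)%E.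
  rewrite /besov_norm LnormE; congr (_ `^ _ + _)%E.
  rewrite /a [in RHS]integral_mkcond; apply: eq_integral => y _.
  by rewrite !patchE; case: ifPn => // _; rewrite normr0 powR0 ?gt_eqF.
have bes0 : (0 <= besov_norm p mu S f)%E by rewrite besE adde_ge0// poweR_ge0.
have nE (F : 'rV[R]_n -> R) : norm_Lp p F = ((\int[lebesgue_rV n]_x (`|F x| `^ p)%:E) `^ q)%E.
  by rewrite /norm_Lp LnormE.
have nGE (G : 'rV[R]_n -> 'rV[R]_n) :
    norm_Lp p (@enorm R n \o G) = ((\int[lebesgue_rV n]_x (enorm (G x) `^ p)%:E) `^ q)%E.
  rewrite nE; congr (_ `^ _)%E; apply: eq_integral => x _ /=.
  by rewrite ger0_norm// enorm_ge0.
have I0 (h : borel_rV R n -> R) : (0 <= \int[lebesgue_rV n]_x (h x `^ p)%:E)%E.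
  by apply: integral_ge0 => x _; rewrite lee_fin powR_ge0.
have tr0 : (0 <= trace_norm p S f)%E.
  by apply: le_ereal_inf_tmp => _ [F [G [_ _ ->]]]; rewrite adde_ge0// nE ?nGE poweR_ge0.
(* The estimates rest on the distance to S and hence on S being nonempty. For empty S both norms are
   0, the zero function being an extension. *)
have [S0|S0] := pselect (S !=set0); last first.
  have SE : S = set0 by apply/seteqP; split => // x Sx; case: S0; exists x.
  have bes00 : besov_norm p mu S f = 0%E.
    by rewrite besE /a /Z SE !integral_set0 !poweR0r ?gt_eqF// adde0.
  rewrite bes00; apply/andP; split; last by rewrite mule_ge0// lee_fin ltW.
  suff -> : trace_norm p S f = 0%E by rewrite mule0.
  apply/eqP; rewrite eq_le tr0 andbT; apply: ereal_inf_lbound.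
  have N0 (h : borel_rV R n -> R) : (forall x, h x = 0) -> (\int[lebesgue_rV n]_x (h x `^ p)%:E = 0)%E.
    by move=> h0; rewrite integral0_eq// => x _; rewrite h0 powR0// gt_eqF.
  have e0 : norm_Lp p (fun _ : 'rV[R]_n => 0 : R) = 0%E.
    by rewrite nE N0 ?poweR0r ?gt_eqF// => x; rewrite normr0.
  have e1 : norm_Lp p (@enorm R n \o (fun _ : 'rV[R]_n => 0 : 'rV[R]_n)) = 0%E.
    rewrite (nGE (fun=> 0)) N0 ?poweR0r ?gt_eqF// => x.
    by rewrite /enorm big1 ?sqrtr0// => i _; rewrite mxE expr0n.
  exists (fun=> 0), (fun _ : 'rV[R]_n => 0 : 'rV[R]_n); split; last 1 first.
  - by rewrite e0 e1 adde0.
  - split; [by move=> x; exact: cst_continuous|by rewrite e0 ltry| | |by rewrite e1 ltry].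
      by move=> i; exact: measurable_cst.
    by move=> i phi _; rewrite !integral0_eq ?oppe0// => x _; rewrite ?mxE mul0r.
  - by move=> x; rewrite SE.
apply/andP; split.
  rewrite lee_pdivrMl//.
  (* An infinite Besov norm makes the bound trivial because C > 0; a finite one makes the majorant
     integrable, as the construction of the extension requires. *)
  have [/eqP boo|bfin] := boolP (besov_norm p mu S f == +oo%E).
    by rewrite boo gt0_muley ?lte_fin// leey.
  have Tfin : (a + Z < +oo)%E.
    have qn : q != 0 by rewrite gt_eqF.
    have nNy (x : \bar R) : (x `^ q != -oo)%E by rewrite gt_eqF// (lt_le_trans _ (poweR_ge0 x q)).
    move: bfin; rewrite besE; have [->|an] := eqVneq a +oo%E.
      by rewrite (poweRyr qn) (addye (nNy Z)).
    have [->|Zn] := eqVneq Z +oo%E.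
      by rewrite (poweRyr qn) (addey (nNy a)).
    by move=> _; rewrite lte_add_pinfty// ltey.
  have [F [G [cF mG wG FS [hX hY]]]] := ext S mu cS S0 muS doubling mu1 bS f cf Tfin.
  have le1 : (norm_Lp p F + norm_Lp p (@enorm R n \o G) <= C%:E * besov_norm p mu S f)%E.
    have X0 : (0 <= \int[lebesgue_rV n]_x (`|F x| `^ p)%:E)%E by exact: I0.
    have Y0 : (0 <= \int[lebesgue_rV n]_x (enorm (G x) `^ p)%:E)%E by exact: I0.
    rewrite nE nGE besE; exact: (poweR_pair_le q0 Cx0 CxC X0 Y0 a0 Z0 hX hY).
  apply: le_trans le1; apply: ereal_inf_lbound; exists F, G; split => //; split => //.
    rewrite nE; apply: poweR_lty; apply: le_lt_trans hX _.
    by rewrite lte_mul_pinfty// ?lee_fin.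
  rewrite nGE; apply: poweR_lty; apply: le_lt_trans hY _.
  by rewrite lte_mul_pinfty// ?lee_fin.
(* The Besov norm only sees values on S, so it is the same for f and for every extension F; the
   infimum over F is taken last. *)
rewrite -lee_pdivrMl//; apply: le_ereal_inf_tmp => _ [F [G [[cF _ mG wG _] FS ->]]].
rewrite lee_pdivrMl// besE nE nGE.
have [h1 h2] := bes S mu cS S0 muS doubling mu1 bS F G cF mG wG.
have aE : a = (\int[mu]_(y in S) (`|F y| `^ p)%:E)%E.
  by apply: eq_integral => y; rewrite inE => Sy; rewrite FS.
have ZE : Z = (\int[mu]_(y in S) \int[mu]_(x in S) besov_kernel p mu F x y)%E.
  apply: eq_integral => y; rewrite inE => Sy; apply: eq_integral => x; rewrite inE => Sx.
  by rewrite /besov_kernel !FS.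
rewrite -aE in h1; rewrite -ZE in h2.
have X0 : (0 <= \int[lebesgue_rV n]_x (`|F x| `^ p)%:E)%E by exact: I0.
have Y0 : (0 <= \int[lebesgue_rV n]_x (enorm (G x) `^ p)%:E)%E by exact: I0.
exact: (poweR_pair_le q0 Cb0 CbC a0 Z0 X0 Y0 h1 h2).
Qed.
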